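(* Suppose $p\nmid a_p$ and that $E(\mathbb{Q}(\mu_{mp^\infty})\otimes\mathbb{Q}_p)$ is $p$-torsion free, where $m$ is the conductor of $K$. Then the Coleman map $\mathrm{Col}$ gives an isomorphism of $\mathcal{R}$-modules $(E(k_\infty)\otimes\mathbb{Q}_p/\mathbb{Z}_p)^\vee\xrightarrow{\sim}\mathcal{R}$.
   Context: $p$ odd prime, $E/\mathbb{Q}$ elliptic curve with good reduction at $p$, $a_p=1+p-\#\widetilde E(\mathbb{F}_p)$; $\alpha,\beta\in\mathbb{Z}_p$ roots of $t^2-a_pt+p$ with $p\nmid\alpha$, $p\mid\beta$. $K$ finite abelian over $\mathbb{Q}$, unramified at $p$; $S$ finite set of primes $\ne p$ containing those ramified in $K$. $K_n=K(\mu_{p^{n+1}})$, $G_n=\mathrm{Gal}(K_n/\mathbb{Q})$, $R_n=\mathbb{Z}_p[G_n]$, $\mathcal{R}=\varprojlim R_n=\mathbb{Z}_p[[G_\infty]]$; $k_n=K_n\otimes\mathbb{Q}_p$, $\mathfrak{m}_n$ the Jacobson radical of its ring of integers, $k_\infty=\bigcup k_n$, $E(k_\infty)=\bigoplus_{v\mid p}E(K_{\infty,v})$; $\hat E$ formal group of a minimal model, $\log_{\hat E}$ its logarithm; $\mathrm{Tr}^n_{n'}$ trace maps; $\varphi\in G_{-1}$ Frobenius at $p$. Let $(d_n)_{n\ge-1}$, $d_n\in\hat E(\mathfrak{m}_n)$, be the unique system such that $\mathrm{Tr}^n_{n-1}(d_n)=\alpha d_{n-1}$ ($n\ge1$), $\mathrm{Tr}^0_{-1}(d_0)=(\alpha-\varphi^{-1})d_{-1}$,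 $\hat E(\mathfrak{m}_n)=R_nd_n$ for all $n\ge-1$, and for each finite-order character $\psi$ of $G_\infty$ (conductor $m_\psi p^{n_\psi+1}$, $p\nmid m_\psi$) $\sum_{\sigma\in G_{n_\psi}}\iota(\sigma\log_{\hat E}d_{n_\psi})\psi(\sigma)$ equals $\tau_S(\psi)$ if $n_\psi\ge0$ and $(1-\beta^{-1}\psi(p)^{-1})^{-1}\tau_S(\psi)$ if $n_\psi=-1$ (here $\iota:k_n\to\overline{\mathbb{Q}}_p$ is induced by a fixed embedding, and $\tau_S(\psi)=\sum_{\sigma\in\mathrm{Gal}(\mathbb{Q}(\mu_{M'})/\mathbb{Q})}\psi(\sigma)\zeta_{M'}^\sigma$ with $M'=m'p^{n_\psi+1}$, $m'$ least multiple of $m_\psi$ with prime divisors exactly $S$). Put $d'_n=\alpha^{-(n+1)}d_n$ and define $\mathrm{Col}_n:\hat E(\mathfrak{m}_n)^*\to R_n$ by $\mathrm{Col}_n(f)=\sum_{\sigma\in G_n}f(\sigma(d'_n))\sigma$, where $X^*=\mathrm{Hom}_{\mathbb{Z}_p}(X,\mathbb{Z}_p)$ with $G_n$ acting by $(gf)(x)=f(g^{-1}x)$. These are compatible with the natural projections, and $\mathrm{Col}=\varprojlim\mathrm{Col}_n:\varprojlim_n\hat E(\mathfrak{m}_n)^*\to\mathcal{R}$. The source is identified with $(E(k_\infty)\otimes\mathbb{Q}_p/\mathbb{Z}_p)^\vee$ via the natural isomorphism (coming from $\hat E(\mathfrak{m}_n)$ being the $p$-part of $E(k_n)$ and $X^*\simeq(X\otimes\mathbb{Q}_p/\mathbb{Z}_p)^\vee$).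 *)

(* Defs.v *)
From HB Require Import structures.
From mathcomp Require Import all_boot all_order all_algebra all_fingroup.
From mathcomp Require Import all_solvable all_field.
From mathcomp Require Import generic_quotient ring_quotient.
From mathcomp Require Import boolp classical_sets functions cardinality fsbigop.

Set Implicit Arguments.
Unset Strict Implicit.
Unset Printing Implicit Defensive.

Import Order.TTheory GRing.Theory Num.Theory.

Local Open Scope classical_set_scope.
Local Open Scope quotient_scope.
Local Open Scope ring_scope.

Record primeNat := PrimeNat { prime_val :> nat; prime_valP : prime prime_val }.

(* An element of Z_p = lim Z/p^n is the sequence of its residues [zres x n] in
   [0, p^n): the condition below forces both the range and the coherence. *)
Record padic_int (p : primeNat) := MkZp {
  zres : nat -> int;
  zresP : forall n, zres n = (zres n.+1 %% (p%:Z ^+ n))%Z }.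

Section PadicIntegers.
Variable p : primeNat.
Local Notation padic_int := (padic_int p).

HB.instance Definition _ := gen_eqMixin padic_int.
HB.instance Definition _ := gen_choiceMixin padic_int.

Lemma Zp_ext (x y : padic_int) : (forall n, zres x n = zres y n) -> x = y.
Proof.
case: x y => x xP [y yP] /= /funext exy; rewrite -exy in yP *.
by congr MkZp; apply: Prop_irrelevance.
Qed.

Definition pexp (n : nat) : int := p%:Z ^+ n.

Lemma modz_dvdm (a d e : int) : (d %| e)%Z ->
  ((a %% e)%Z %% d)%Z = (a %% d)%Z.
Proof.
move=> de; apply/eqP; rewrite eqz_mod_dvd.
by rewrite /modz addrAC subrr sub0r -mulNr dvdz_mull.
Qed.

Lemma modz_pexpS (a : int) n :
  ((a %% pexp n.+1)%Z %% pexp n)%Z = (a %% pexp n)%Z.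
Proof. by rewrite modz_dvdm // /pexp exprS dvdz_mull. Qed.

Lemma zres_mod (x : padic_int) n : (zres x n %% pexp n)%Z = zres x n.
Proof. by rewrite zresP modz_mod. Qed.

Lemma zresS (x : padic_int) n : (zres x n.+1 %% pexp n)%Z = zres x n.
Proof. by rewrite -zresP. Qed.

Lemma Zp_seqP (u : nat -> int) :
    (forall n, u n.+1 = u n %[mod pexp n])%Z ->
  forall n, (u n %% pexp n)%Z = ((u n.+1 %% pexp n.+1)%Z %% (p%:Z ^+ n))%Z.
Proof. by move=> uP n; rewrite -/(pexp n) modz_pexpS uP. Qed.

Definition Zp_of_seq (u : nat -> int)
  (uP : forall n, (u n.+1 = u n %[mod pexp n])%Z) : padic_int := MkZp (Zp_seqP uP).

Fact Zp_int_subproof (a : int) (n : nat) : (a = a %[mod pexp n])%Z.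
Proof. by []. Qed.

Fact Zp_add_subproof (x y : padic_int) n :
  (zres x n.+1 + zres y n.+1 = zres x n + zres y n %[mod pexp n])%Z.
Proof. by rewrite -modzDm !zresS. Qed.

Fact Zp_opp_subproof (x : padic_int) n :
  (- zres x n.+1 = - zres x n %[mod pexp n])%Z.
Proof. by rewrite -modzNm zresS. Qed.

Fact Zp_mul_subproof (x y : padic_int) n :
  (zres x n.+1 * zres y n.+1 = zres x n * zres y n %[mod pexp n])%Z.
Proof. by rewrite -modzMm !zresS. Qed.

Definition Zp_int a : padic_int := Zp_of_seq (Zp_int_subproof a).
Definition Zp_add x y : padic_int := Zp_of_seq (Zp_add_subproof x y).
Definition Zp_opp x : padic_int := Zp_of_seq (Zp_opp_subproof x).
Definition Zp_mul x y : padic_int := Zp_of_seq (Zp_mul_subproof x y).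

Lemma Zp_addA : associative Zp_add.
Proof. by move=> x y z; apply: Zp_ext => n /=; rewrite modzDmr modzDml addrA. Qed.

Lemma Zp_addC : commutative Zp_add.
Proof. by move=> x y; apply: Zp_ext => n /=; rewrite addrC. Qed.

Lemma Zp_add0 : left_id (Zp_int 0) Zp_add.
Proof. by move=> x; apply: Zp_ext => n /=; rewrite modzDml add0r zres_mod. Qed.

Lemma Zp_addN : left_inverse (Zp_int 0) Zp_opp Zp_add.
Proof. by move=> x; apply: Zp_ext => n /=; rewrite modzDml addNr. Qed.

HB.instance Definition _ :=
  GRing.isZmodule.Build padic_int Zp_addA Zp_addC Zp_add0 Zp_addN.

Lemma Zp_mulA : associative Zp_mul.
Proof. by move=> x y z; apply: Zp_ext => n /=; rewrite modzMmr modzMml mulrA. Qed.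

Lemma Zp_mulC : commutative Zp_mul.
Proof. by move=> x y; apply: Zp_ext => n /=; rewrite mulrC. Qed.

Lemma Zp_mul1 : left_id (Zp_int 1) Zp_mul.
Proof. by move=> x; apply: Zp_ext => n /=; rewrite modzMml mul1r zres_mod. Qed.

Lemma Zp_mulD : left_distributive Zp_mul (+%R : padic_int -> padic_int -> padic_int).
Proof.
by move=> x y z; apply: Zp_ext => n /=; rewrite modzMml mulrDl modzDm.
Qed.

Lemma pexp_gt1 n : 1 < pexp n.+1.
Proof. by rewrite /pexp exprn_egt1 // ltz_nat prime_gt1 // prime_valP. Qed.

Lemma Zp_1_neq0 : Zp_int 1 != 0.
Proof.
apply/eqP => /(congr1 (fun x => zres x 1)) /=.
by rewrite mod0z modz_small // pexp_gt1.
Qed.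

HB.instance Definition _ := GRing.Zmodule_isComNzRing.Build padic_int
  Zp_mulA Zp_mulC Zp_mul1 Zp_mulD Zp_1_neq0.

Definition Zp_unit : {pred padic_int} := fun x => `[< exists y : padic_int, y * x = 1 >].
Definition Zp_inv (x : padic_int) : padic_int := xget x [set y | y * x = 1].

Lemma Zp_mulV : {in Zp_unit, left_inverse 1 Zp_inv *%R}.
Proof.
by move=> x /asboolP[y yx]; rewrite /Zp_inv; case: xgetP => // /(_ y).
Qed.

Lemma Zp_unitP (x y : padic_int) : y * x = 1 -> Zp_unit x.
Proof. by move=> yx; apply/asboolP; exists y. Qed.

Lemma Zp_inv_out : {in [predC Zp_unit], Zp_inv =1 id}.
Proof.
move=> x /negP xN; rewrite /Zp_inv; case: xgetP => // y _ /= yx.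
by case: xN; apply: Zp_unitP yx.
Qed.

HB.instance Definition _ := GRing.ComNzRing_hasMulInverse.Build padic_int
  Zp_mulV Zp_unitP Zp_inv_out.

Lemma zres_mod_le (x : padic_int) n k : (zres x (n + k) %% pexp n)%Z = zres x n.
Proof.
elim: k => [|k IHk]; first by rewrite addn0 zres_mod.
rewrite addnS -IHk -(zresS x (n + k)) modz_dvdm //.
by rewrite /pexp exprD dvdz_mulr.
Qed.

Lemma Zp_neq0 (x : padic_int) : x != 0 -> exists n, ~~ (pexp n %| zres x n)%Z.
Proof.
move=> x0; apply: contrapT => xN; case/eqP: x0; apply: Zp_ext => n /=.
rewrite mod0z -zres_mod; apply/dvdz_mod0P.
by apply: contrapT => /negP xn; apply: xN; exists n.
Qed.

Lemma pexp_dvdM (a b : int) n m : ~~ (pexp n %| a)%Z -> ~~ (pexp m %| b)%Z ->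
  ~~ (pexp (n + m) %| a * b)%Z.
Proof.
have pp := prime_valP p.
have dvdE (c : int) k : (pexp k %| c)%Z = (p ^ k %| `|c|)%N.
  by rewrite dvdzE /pexp abszX.
rewrite !dvdE abszM; case: (posnP `|a|%N) => [->|a0]; first by rewrite dvdn0.
case: (posnP `|b|%N) => [->|b0]; first by rewrite dvdn0.
rewrite !pfactor_dvdn ?muln_gt0 ?a0 ?b0 // lognM // -!ltnNge => la lb.
exact: (leq_trans _ (leq_add la (ltnW lb))).
Qed.

Lemma Zp_mulf_eq0 (x y : padic_int) : x * y = 0 -> (x == 0) || (y == 0).
Proof.
move=> xy0; apply/negP => /negP; rewrite negb_or => /andP[].
move=> /Zp_neq0[n xn] /Zp_neq0[m ym].
have /(congr1 (fun z => zres z (n + m))) /= := xy0.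
rewrite mod0z => /dvdz_mod0P.
have [a ->] : exists a, zres x (n + m) = zres x n + a * pexp n.
  exists (zres x (n + m) %/ pexp n)%Z.
  by rewrite -(zres_mod_le x n m) addrC -divz_eq.
have [b ->] : exists b, zres y (n + m) = zres y m + b * pexp m.
  exists (zres y (n + m) %/ pexp m)%Z.
  by rewrite -(zres_mod_le y m n) addnC addrC -divz_eq.
apply/negP; apply: pexp_dvdM.
  by rewrite rpredDr ?xn // dvdz_mull.
by rewrite rpredDr ?ym // dvdz_mull.
Qed.

HB.instance Definition _ := GRing.ComUnitRing_isIntegral.Build padic_int Zp_mulf_eq0.

End PadicIntegers.

Definition padic_num (p : primeNat) : Type := {fraction (padic_int p)}.
HB.instance Definition _ (p : primeNat) := GRing.Field.on (padic_num p).

Definition Zp_Qp (p : primeNat) (a : padic_int p) : padic_num p := tofrac a.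

Section QpModZp.
Variable p : primeNat.

Definition Zp_in : {pred padic_num p} := fun q => `[< exists a : padic_int p, q = Zp_Qp a >].

Fact Zp_in_closed : zmod_closed Zp_in.
Proof.
split; first by apply/asboolP; exists 0; rewrite /Zp_Qp rmorph0.
move=> _ _ /asboolP[a ->] /asboolP[b ->]; apply/asboolP; exists (a - b).
by rewrite /Zp_Qp rmorphB.
Qed.

HB.instance Definition _ := GRing.isZmodClosed.Build (padic_num p) Zp_in Zp_in_closed.

Definition QpZp : Type := Quotient.quot Zp_in.
HB.instance Definition _ := GRing.Zmodule.on QpZp.

Definition QpZp_scale (a : padic_int p) (t : QpZp) : QpZp :=
  \pi_(Quotient.quot Zp_in) (Zp_Qp a * repr (t : Quotient.quot Zp_in)).

End QpModZp.

Definition fps (R : comNzRingType) : Type := nat -> R.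
HB.instance Definition _ (R : comNzRingType) :=
  GRing.Zmodule.copy (fps R) (nat -> R).

Section PowerSeries.
Variable R : comNzRingType.
Implicit Types f g h : fps R.

Definition fpsC (c : R) : fps R := fun n => if n == 0%N then c else 0.
Definition fpsX : fps R := fun n => (n == 1%N)%:R.
Definition fps_mul f g : fps R := fun n => \sum_(i < n.+1) f i * g (n - i)%N.

Definition fps_trunc n f : {poly R} := \poly_(i < n) f i.

Lemma fps_mulE n k f g : (k < n)%N ->
  fps_mul f g k = (fps_trunc n f * fps_trunc n g)`_k.
Proof.
move=> kn; rewrite coefM; apply: eq_bigr => i _; rewrite !coef_poly.
have ik : (i < n)%N by apply: leq_ltn_trans kn; rewrite -ltnS ltn_ord.
by rewrite ik (leq_ltn_trans (leq_subr _ _) kn).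
Qed.

Lemma fps_mulC : commutative fps_mul.
Proof.
by move=> f g; apply/funext => n; rewrite !(fps_mulE _ _ (ltnSn n)) mulrC.
Qed.

Lemma fps_mulA : associative fps_mul.
Proof.
move=> f g h; apply/funext => n; rewrite !(fps_mulE _ _ (ltnSn n)).
have tr u v k : (k < n.+1)%N ->
    (fps_trunc n.+1 (fps_mul u v))`_k = (fps_trunc n.+1 u * fps_trunc n.+1 v)`_k.
  by move=> kn; rewrite coef_poly kn (fps_mulE _ _ kn).
transitivity (fps_trunc n.+1 f * (fps_trunc n.+1 g * fps_trunc n.+1 h))`_n.
  rewrite 2!coefM; apply: eq_bigr => i _; rewrite tr //.
  by rewrite ltnS leq_subr.
rewrite mulrA 2!(coefM _ (fps_trunc n.+1 h)).
by apply: eq_bigr => i _; rewrite tr.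
Qed.

Lemma fps_mul1 : left_id (fpsC 1) fps_mul.
Proof.
move=> f; apply/funext => n; rewrite /fps_mul big_ord_recl /= mul1r subn0.
by rewrite big1 ?addr0 // => i _; rewrite mul0r.
Qed.

Lemma fps_mulD : left_distributive fps_mul (+%R : fps R -> fps R -> fps R).
Proof.
move=> f g h; apply/funext => n.
transitivity (fps_mul f h n + fps_mul g h n) => //; rewrite /fps_mul.
by rewrite -big_split; apply: eq_bigr => i _ /=; exact: mulrDl.
Qed.

Lemma fps_1_neq0 : fpsC 1 != 0.
Proof. by apply/eqP => /(congr1 (@^~ 0%N)); apply/eqP/oner_neq0. Qed.

HB.instance Definition _ := GRing.Zmodule_isComNzRing.Build (fps R)
  fps_mulA fps_mulC fps_mul1 fps_mulD fps_1_neq0.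

(* Inverse of a series with constant term 1, as a geometric series. *)
Definition fps_inv f : fps R := fun n => \sum_(k < n.+1) ((1 - f) ^+ k) n.

End PowerSeries.

Definition fps2 : Type := fps (fps int).
HB.instance Definition _ := GRing.ComNzRing.on fps2.

(* [fps2_inv u] requires constant term 1 and [fps2_comp a u] = a(u) requires
   constant term 0: then u ^+ k has no term of total degree < k. *)
Definition fps2_inv (u : fps2) : fps2 :=
  fun m n => \sum_(k < (m + n).+1) ((1 - u) ^+ k) m n.
Definition fps2_comp (a : fps int) (u : fps2) : fps2 :=
  fun m n => \sum_(k < (m + n).+1) a k * (u ^+ k) m n.

Record weierstrass := Weierstrass {
  wa1 : int; wa2 : int; wa3 : int; wa4 : int; wa6 : int }.

Section WeierstrassInvariants.
Variable W : weierstrass.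
Let a1 := wa1 W. Let a2 := wa2 W. Let a3 := wa3 W.
Let a4 := wa4 W. Let a6 := wa6 W.

Definition wdisc : int :=
  let b2 := a1 ^+ 2 + 4 * a2 in
  let b4 := 2 * a4 + a1 * a3 in
  let b6 := a3 ^+ 2 + 4 * a6 in
  let b8 := a1 ^+ 2 * a6 + 4 * a2 * a6 - a1 * a3 * a4 + a2 * a3 ^+ 2 - a4 ^+ 2 in
  - b2 ^+ 2 * b8 - 8 * b4 ^+ 3 - 27 * b6 ^+ 2 + 9 * b2 * b4 * b6.

Definition on_wcurve (F : fieldType) (x y : F) : bool :=
  y ^+ 2 + a1%:~R * x * y + a3%:~R * y ==
  x ^+ 3 + a2%:~R * x ^+ 2 + a4%:~R * x + a6%:~R.

(* Points of the projective curve; [None] is the point at infinity. *)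
Definition wpoint (F : fieldType) : Type := option (F * F).
HB.instance Definition _ (F : fieldType) := Choice.on (wpoint F).

Definition in_wcurve (F : fieldType) (P : wpoint F) : bool :=
  if P is Some (x, y) then on_wcurve x y else true.

Definition wadd (F : fieldType) (P Q : wpoint F) : wpoint F :=
  match P, Q with
  | None, _ => Q
  | _, None => P
  | Some (x1, y1), Some (x2, y2) =>
    if (x1 == x2) && (y1 + y2 + a1%:~R * x2 + a3%:~R == 0) then None else
    let l := if x1 == x2
      then (3 * x1 ^+ 2 + 2 * a2%:~R * x1 + a4%:~R - a1%:~R * y1) /
           (2 * y1 + a1%:~R * x1 + a3%:~R)
      else (y2 - y1) / (x2 - x1) in
    let x3 := l ^+ 2 + a1%:~R * l - a2%:~R - x1 - x2 in
    Some (x3, - (l + a1%:~R) * x3 - (y1 - l * x1) - a3%:~R)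
  end.

Definition wcount (p : nat) : nat :=
  (#|[pred xy : 'F_p * 'F_p | on_wcurve xy.1 xy.2]|).+1.
Definition wtrace (p : nat) : int := 1 + p%:Z - (wcount p)%:Z.

(* The formal group in the parameter z = - x / y, w = - 1 / y, for which the
   equation reads w = f(z, w). The power series w(z) is the limit of
   0, f(z, 0), f(z, f(z, 0)), ..., whose n-th coefficient is constant from the
   (n + 1)-st iteration on. *)
Definition wser_step (w : {poly int}) : {poly int} :=
  'X^3 + a1 *: ('X * w) + a2 *: ('X^2 * w) + a3 *: w ^+ 2
  + a4 *: ('X * w ^+ 2) + a6 *: w ^+ 3.
Definition wser : fps int := fun n => (iter n.+1 wser_step 0)`_n.

(* z1, z2, z3 are the z-coordinates of the intersections with the curve of the
   chord w = l * z + nu, l = (w(z2) - w(z1)) / (z2 - z1), and the inversion is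
   z |-> - z / (1 - a1 * z - a3 * w(z)). *)
Definition fgl : fps2 :=
  let z1 : fps2 := fpsX _ in
  let z2 : fps2 := fpsC (fpsX _) in
  let w1 : fps2 := fun i => fpsC (wser i) in
  let l : fps2 := fun i j => wser (i + j).+1 in
  let nu : fps2 := w1 - l * z1 in
  let num : fps2 := a1%:~R * l + a2%:~R * nu + a3%:~R * l ^+ 2
    + 2 * a4%:~R * l * nu + 3 * a6%:~R * l ^+ 2 * nu in
  let den : fps2 := 1 + a2%:~R * l + a4%:~R * l ^+ 2 + a6%:~R * l ^+ 3 in
  let z3 : fps2 := - z1 - z2 - num * fps2_inv den in
  - z3 * fps2_inv (1 - a1%:~R * z3 - a3%:~R * fps2_comp wser z3).

(* The logarithm is the integral of the invariant differential
   dT / F_X(0, T), F the formal group law. *)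
Definition flog : nat -> rat := fun n =>
  if n is k.+1 then (fps_inv (fgl 1%N : fps int) k)%:Q / k.+1%:Q else 0.

End WeierstrassInvariants.

Definition wchange (u r s t : rat) (W W' : weierstrass) : Prop :=
  [/\ u * (wa1 W')%:Q = (wa1 W)%:Q + 2 * s,
      u ^+ 2 * (wa2 W')%:Q = (wa2 W)%:Q - s * (wa1 W)%:Q + 3 * r - s ^+ 2,
      u ^+ 3 * (wa3 W')%:Q = (wa3 W)%:Q + r * (wa1 W)%:Q + 2 * t,
      u ^+ 4 * (wa4 W')%:Q = (wa4 W)%:Q - s * (wa3 W)%:Q + 2 * r * (wa2 W)%:Q
        - (t + r * s) * (wa1 W)%:Q + 3 * r ^+ 2 - 2 * s * t
    & u ^+ 6 * (wa6 W')%:Q = (wa6 W)%:Q + r * (wa4 W)%:Q + r ^+ 2 * (wa2 W)%:Q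
        + r ^+ 3 - t * (wa3 W)%:Q - t ^+ 2 - r * t * (wa1 W)%:Q].

Definition minimal_model (W : weierstrass) : Prop :=
  wdisc W != 0 /\
  forall (W' : weierstrass) (u r s t : rat), u != 0 -> wchange u r s t W W' ->
    `|wdisc W| <= `|wdisc W'|.

(* X is a subset of T, thought of as an abelian group under [add], and Y is an
   abelian group. The tensor product X (x)_Z Y is the set of finite formal sums
   of symbols x (x) y modulo the congruence generated by bilinearity. *)
Section Tensor.
Variables (T : choiceType) (X : set T) (add : T -> T -> T) (Y : zmodType).

Inductive tens_eq : seq (X * Y) -> seq (X * Y) -> Prop :=
| tens_refl s : tens_eq s s
| tens_sym s t : tens_eq s t -> tens_eq t s
| tens_trans s t u : tens_eq s t -> tens_eq t u -> tens_eq s u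
| tens_perm s t : perm_eq s t -> tens_eq s t
| tens_cat s t u : tens_eq s t -> tens_eq (s ++ u) (t ++ u)
| tens_addl (x x' x'' : X) y : val x'' = add (val x) (val x') ->
    tens_eq [:: (x'', y)] [:: (x, y); (x', y)]
| tens_addr (x : X) y y' : tens_eq [:: (x, y + y')] [:: (x, y); (x, y')]
| tens_zero (x : X) : tens_eq [:: (x, 0)] [::].

Definition tens_eqb (s t : seq (X * Y)) : bool := `[< tens_eq s t >].

Lemma tens_eqb_equiv : equiv_class_of tens_eqb.
Proof.
split=> [s|s t|t s u].
- exact/asboolP/tens_refl.
- by apply/asboolP/asboolP => /tens_sym.
- by move=> /asboolP st /asboolP tu; apply/asboolP/(tens_trans st tu).
Qed.

Canonical tens_equiv := EquivRelPack tens_eqb_equiv.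
Canonical tens_encModRel := defaultEncModRel tens_eqb.

Definition tens : Type := {eq_quot tens_eqb}.
HB.instance Definition _ := EqQuotient.on tens.
HB.instance Definition _ := Choice.on tens.

Lemma tens_piP s t : \pi_tens s = \pi_tens t <-> tens_eq s t.
Proof. by split=> [/eqmodP/asboolP|st]; last exact/eqmodP/asboolP. Qed.

Lemma tens_catr s t u : tens_eq s t -> tens_eq (u ++ s) (u ++ t).
Proof.
move=> st; apply: (tens_trans (tens_perm (permEl (perm_catC _ _)))).
by apply: (tens_trans (tens_cat u st)); apply: tens_perm; rewrite perm_catC.
Qed.

Lemma tens_cat2 s s' t t' :
  tens_eq s s' -> tens_eq t t' -> tens_eq (s ++ t) (s' ++ t').
Proof. by move=> ss tt; apply: (tens_trans (tens_cat t ss)); apply: tens_catr. Qed.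

Definition tens_oppseq (s : seq (X * Y)) := [seq (a.1, - a.2) | a <- s].

Lemma tens_subr_seq s : tens_eq (tens_oppseq s ++ s) [::].
Proof.
elim: s => [|[x y] s IHs] /=; first exact: tens_refl.
have pe : perm_eq ((x, - y) :: tens_oppseq s ++ (x, y) :: s)
                  ([:: (x, - y); (x, y)] ++ (tens_oppseq s ++ s)).
  by rewrite /= perm_cons -cat1s perm_catCA.
apply: (tens_trans (tens_perm pe)); rewrite -[[::]]cats0.
apply: tens_cat2 IHs; apply: tens_trans (tens_sym (tens_addr _ _ _)) _.
by rewrite addNr; apply: tens_zero.
Qed.

Lemma tens_opp_eq s t : tens_eq s t -> tens_eq (tens_oppseq s) (tens_oppseq t).
Proof.
move=> st; rewrite -[tens_oppseq s]cats0.
apply: tens_trans (tens_catr _ (tens_sym (tens_subr_seq t))) _.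
have pe : perm_eq (tens_oppseq s ++ (tens_oppseq t ++ t))
                  ((tens_oppseq s ++ t) ++ tens_oppseq t).
  by rewrite -catA perm_cat2l perm_catC.
apply: (tens_trans (tens_perm pe)).
rewrite -[X in tens_eq _ X]cat0s; apply: tens_cat.
apply: tens_trans (tens_catr _ (tens_sym st)) _; exact: tens_subr_seq.
Qed.

Definition tens0 : tens := \pi_tens [::].
Definition tens_add (a b : tens) : tens := \pi_tens (repr a ++ repr b).
Definition tens_opp (a : tens) : tens := \pi_tens (tens_oppseq (repr a)).

Lemma tens_repr s : tens_eq (repr (\pi_tens s)) s.
Proof. by apply/tens_piP; rewrite reprK. Qed.

Lemma tens_addA : associative tens_add.
Proof.
move=> a b c; apply/tens_piP.
apply: tens_trans (tens_catr _ (tens_repr _)) _; rewrite catA.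
exact/tens_sym/tens_cat/tens_repr.
Qed.

Lemma tens_addC : commutative tens_add.
Proof. by move=> a b; apply/tens_piP/tens_perm; rewrite perm_catC. Qed.

Lemma tens_add0 : left_id tens0 tens_add.
Proof.
move=> a; rewrite -[RHS]reprK; apply/tens_piP.
exact: (tens_cat (repr a) (tens_repr [::])).
Qed.

Lemma tens_addN : left_inverse tens0 tens_opp tens_add.
Proof.
move=> a; apply/tens_piP; apply: tens_trans (tens_cat _ (tens_repr _)) _.
exact: tens_subr_seq.
Qed.

HB.instance Definition _ :=
  GRing.isZmodule.Build tens tens_addA tens_addC tens_add0 tens_addN.

(* The pure tensor x (x) y, with the convention 0 when x is not in X. *)
Definition pure_tens (x : T) (y : Y) : tens :=
  if insub x is Some x' then \pi_tens [:: (x', y)] else 0.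

End Tensor.

Section Ideals.
Variables (A : pzRingType) (O : set A).

Definition is_ideal (I : set A) : Prop :=
  [/\ I `<=` O, I 0, forall x y, I x -> I y -> I (x + y)
    & forall a x, O a -> I x -> I (a * x)].

Definition prime_ideal (I : set A) : Prop :=
  [/\ is_ideal I, ~ I 1 & forall x y, O x -> O y -> I (x * y) -> I x \/ I y].

Definition maximal_ideal (I : set A) : Prop :=
  [/\ is_ideal I, I <> O
    & forall J, is_ideal J -> I `<=` J -> J = I \/ J = O].

Definition jacobson : set A :=
  [set x | O x /\ forall I, maximal_ideal I -> I x].

Definition ideal_square (I : set A) : set A :=
  [set x | exists (n : nat) (a b : 'I_n -> A),
     [/\ forall i, I (a i), forall i, I (b i) & x = \sum_i a i * b i]].

End Ideals.

Definition is_subfield (F : set algC) : Prop :=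
  [/\ F 1, forall x y, F x -> F y -> F (x - y),
      forall x y, F x -> F y -> F (x * y) & forall x, F x -> F x^-1].

Definition field_gen (S : set algC) : set algC :=
  [set x | forall F, is_subfield F -> S `<=` F -> F x].

Definition mu (n : nat) : set algC := [set z | z ^+ n = 1].

Definition cyclotomic (n : nat) : set algC := field_gen (mu n).

(* Q(mu_{m p^oo}) *)
Definition cyclotomic_oo (m p : nat) : set algC :=
  field_gen (\bigcup_n mu (m * p ^ n)).

Definition int_ring (F : set algC) : set algC := [set x | F x /\ x \in Aint].

(* Some prime P of the ring of integers has ramification index e(P / l) > 1. *)
Definition ramified (F : set algC) (l : nat) : Prop :=
  exists P, prime_ideal (int_ring F) P /\ ideal_square P l%:R.

Definition field_conductor (F : set algC) (m : nat) : Prop :=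
  [/\ (0 < m)%N, F `<=` cyclotomic m
    & forall m', (0 < m')%N -> F `<=` cyclotomic m' -> (m <= m')%N].

(* Ring endomorphisms of algC are automorphisms, since algC is algebraic over
   its prime field. *)
Definition absGal : Type := {rmorphism algC -> algC}.
HB.instance Definition _ := gen_eqMixin absGal.
HB.instance Definition _ := gen_choiceMixin absGal.

Definition absGal_one : absGal := idfun.
Definition absGal_mul (s t : absGal) : absGal := s \o t.

Definition fixes (F : set algC) (s : absGal) : Prop := forall x, F x -> s x = x.

(* For F normal over Q, Gal(F / Q) as the quotient of the absolute Galois group
   of Q by the relation of having the same restriction to F. *)
Section GaloisGroup.
Variable F : set algC.

Definition gal_eqb (s t : absGal) : bool := `[< forall x, F x -> s x = t x >].

Lemma gal_eqb_equiv : equiv_class_of gal_eqb.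
Proof.
split=> [s|s t|t s u]; first exact/asboolP.
  by apply/asboolP/asboolP => st x /st.
by move=> /asboolP st /asboolP tu; apply/asboolP => x Fx; rewrite st // tu.
Qed.

Canonical gal_equiv := EquivRelPack gal_eqb_equiv.
Canonical gal_encModRel := defaultEncModRel gal_eqb.

Definition galQ : Type := {eq_quot gal_eqb}.
HB.instance Definition _ := EqQuotient.on galQ.
HB.instance Definition _ := Choice.on galQ.

Definition gal_lift (s : galQ) : absGal := repr s.
Definition gal_one : galQ := \pi_galQ absGal_one.
Definition gal_mul (s t : galQ) : galQ :=
  \pi_galQ (absGal_mul (gal_lift s) (gal_lift t)).
Definition gal_inv (s : galQ) : galQ := xget s [set t | gal_mul t s = gal_one].

Definition is_frobenius (p : nat) (s : galQ) : Prop :=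
  forall P, prime_ideal (int_ring F) P -> P p%:R ->
    forall x, int_ring F x -> P (gal_lift s x - x ^+ p).

End GaloisGroup.

Definition gal_res (F F' : set algC) (s : galQ F') : galQ F :=
  \pi_(galQ F) (gal_lift s).

(* Product in the group ring B[Gal(F / Q)], whose elements are seen as functions
   on the (finite) group. *)
Definition gr_mul (B : pzRingType) (F : set algC) (a b : galQ F -> B) :
    galQ F -> B :=
  fun s => \sum_(t \in [set: galQ F]) a t * b (gal_mul (gal_inv t) s).

Record Qp_closure (p : primeNat) := QpClosure {
  qbar :> closedFieldType;
  qbar_emb : {rmorphism padic_num p -> qbar};
  qbar_algebraic : forall c : qbar, algebraicOver qbar_emb c }.

Section Local.
Variables (p : primeNat) (C : Qp_closure p) (W : weierstrass).

Definition Zp_qbar (a : padic_int p) : C := qbar_emb C (Zp_Qp a).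

Definition qbar_int (c : C) : Prop := integralOver Zp_qbar c.

Definition emb : Type := {rmorphism algC -> C}.
Definition emb_comp (i : emb) (s : absGal) : emb := i \o s.

(* F (x) Q_p is identified with its image under the injective ring morphism
   a (x) c |-> (i(a) c)_i into the product of copies of C indexed by the
   embeddings i. *)
Definition kalg (F : set algC) : set (emb -> C) :=
  [set x | exists (n : nat) (a : 'I_n -> algC) (c : 'I_n -> padic_num p),
     (forall k, F (a k)) /\
     forall i : emb, x i = \sum_k i (a k) * qbar_emb C (c k)].

(* The ring of integers of F (x) Q_p, the product of those of its completions. *)
Definition kint (F : set algC) : set (emb -> C) :=
  [set x | kalg F x /\ forall i, qbar_int (x i)].

Definition krad (F : set algC) : set (emb -> C) := jacobson (kint F).

(* The action s (a (x) c) = s(a) (x) c, and the one induced on points. *)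
Definition gal_act (T : Type) (s : absGal) (x : emb -> T) : emb -> T :=
  fun i => x (emb_comp i s).

Definition padic_cvg (u : nat -> emb -> C) (l : emb -> C) : Prop :=
  forall k : nat, exists N : nat, forall n, (N <= n)%N -> forall i,
    exists2 c, qbar_int c & u n i - l i = p%:R ^+ k * c.

Definition padic_lim (u : nat -> emb -> C) : emb -> C :=
  xget 0 [set l | padic_cvg u l].

Definition ser_eval (a : nat -> rat) (x : emb -> C) : emb -> C :=
  padic_lim (fun n i => \sum_(k < n) ratr (a k) * x i ^+ k).

Definition fg_add (x y : emb -> C) : emb -> C :=
  padic_lim (fun n i =>
    \sum_(k < n) \sum_(l < n) (fgl W k l)%:~R * x i ^+ k * y i ^+ l).

(* The action of a on the pro-p group E^(m_n), as the limit of the multiples of x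
   by the residues of a modulo p^n. *)
Definition fg_scale (a : padic_int p) (x : emb -> C) : emb -> C :=
  padic_lim (fun n => iter `|zres a n|%N (fg_add x) 0).

Definition fg_log (x : emb -> C) : emb -> C := ser_eval (flog W) x.

Definition fg_grmul (F : set algC) (c : galQ F -> padic_int p) (x : emb -> C) :
    emb -> C :=
  \big[fg_add/0]_(s \in [set: galQ F]) fg_scale (c s) (gal_act (gal_lift s) x).

(* Trace from F' to its subfield F. *)
Definition fg_trace (F F' : set algC) (x : emb -> C) : emb -> C :=
  \big[fg_add/0]_(s \in [set s : galQ F' | fixes F (gal_lift s)])
    gal_act (gal_lift s) x.

Definition homogeneous_coord (X Y Z : C) (P : wpoint C) : Prop :=
  if P is Some (x, y) then [/\ Z != 0, X = x * Z & Y = y * Z]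
  else [/\ X = 0, Y != 0 & Z = 0].

(* E(F (x) Q_p): a point with homogeneous coordinates in F (x) Q_p, given by its
   images under all the embeddings. *)
Definition kpoints (F : set algC) : set (emb -> wpoint C) :=
  [set P | (forall i, in_wcurve W (P i)) /\
     exists X Y Z, [/\ kalg F X, kalg F Y, kalg F Z
       & forall i, homogeneous_coord (X i) (Y i) (Z i) (P i)]].

Definition kzero : emb -> wpoint C := fun=> None.
Definition kadd (P Q : emb -> wpoint C) : emb -> wpoint C :=
  fun i => wadd W (P i) (Q i).

Definition ptorsion_free (F : set algC) : Prop :=
  forall P, kpoints F P -> iter p (kadd P) kzero = kzero -> P = kzero.

(* z |-> (z / w(z), - 1 / w(z)) *)
Definition fg_point (z : emb -> C) : emb -> wpoint C :=
  fun i => if z i == 0 then None else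
    let w := ser_eval (fun n => (wser W n)%:Q) z i in Some (z i / w, - w^-1).

Variable K : set algC.

(* [tower N] is K_n for n = N - 1. *)
Definition tower (N : nat) : set algC := field_gen (K `|` mu (p ^ N)).

Definition Epts_oo : set (emb -> wpoint C) :=
  [set P | exists N, kpoints (tower N) P].

Definition EQpZp : zmodType := tens Epts_oo kadd (QpZp p).

Definition EQpZp_dual : Type := {additive EQpZp -> QpZp p}.

Definition ptens (P : emb -> wpoint C) (t : QpZp p) : EQpZp :=
  pure_tens Epts_oo kadd P t.

(* Z_p[[G_oo]] = lim Z_p[G_n] *)
Record iwasawa := Iwasawa {
  iw_val :> forall N, galQ (tower N) -> padic_int p;
  iw_compat : forall N (t : galQ (tower N)), iw_val t =
    \sum_(s \in [set s : galQ (tower N.+1) | gal_res (tower N) s = t]) iw_val s }.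

(* h = r g for the Z_p[[G_oo]]-module structure on the Pontryagin dual extending
   the action (s g)(x) = g(s^-1 x) of G_oo. *)
Definition is_iw_action (r : iwasawa) (g h : EQpZp_dual) : Prop :=
  forall N P t, kpoints (tower N) P -> h (ptens P t) =
    \sum_(s \in [set: galQ (tower N)])
      QpZp_scale (r N s) (g (ptens (gal_act (gal_lift (gal_inv s)) P) t)).

Definition iw_linear (Phi : EQpZp_dual -> iwasawa) : Prop :=
  (forall (g h : EQpZp_dual) N s,
     Phi (g \+ h : {additive EQpZp -> QpZp p}) N s = Phi g N s + Phi h N s) /\
  (forall r g, exists2 h, is_iw_action r g h
     & forall N, Phi h N = gr_mul (r N) (Phi g N)).

(* lim Hom_{Z_p}(E^(m_n), Z_p), with the restrictions as transition maps. *)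
Record fg_dual_lim := FgDualLim {
  fd_val :> forall N, krad (tower N) -> padic_int p;
  fd_add : forall N (x y z : krad (tower N)), val z = fg_add (val x) (val y) ->
    fd_val z = fd_val x + fd_val y;
  fd_scale : forall N (a : padic_int p) (x z : krad (tower N)),
    val z = fg_scale a (val x) -> fd_val z = a * fd_val x;
  fd_compat : forall N (x : krad (tower N)) (y : krad (tower N.+1)),
    val y = val x -> fd_val y = fd_val x }.

(* f in lim E^(m_n)^* and g in (E(k_oo) (x) Q_p/Z_p)^vee correspond to each other:
   g restricts to f_n (x) id on each E^(m_n) (x) Q_p/Z_p. *)
Definition natural_corr (f : fg_dual_lim) (g : EQpZp_dual) : Prop :=
  forall N (x : krad (tower N)) t,
    g (ptens (fg_point (val x)) t) = QpZp_scale (f N x) t.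

(* Col_n, n = N - 1, with d'_n = alpha^-(n+1) d_n; [insub] only recasts s(d'_n) as
   an element of the subtype m_n. *)
Definition coleman_level (alpha : padic_int p) (d : nat -> emb -> C) (N : nat)
    (f : krad (tower N) -> padic_int p) : galQ (tower N) -> padic_int p :=
  fun s => oapp f 0 (insub (gal_act (gal_lift s) (fg_scale (alpha ^- N) (d N)))).

(* Finite-order characters of G_oo, inflated to the absolute Galois group. *)
Definition is_character (psi : absGal -> C) : Prop :=
  [/\ psi absGal_one = 1,
      forall s t, psi (absGal_mul s t) = psi s * psi t
    & exists N, forall s, fixes (tower N) s -> psi s = 1].

Definition char_conductor (psi : absGal -> C) (M : nat) : Prop :=
  [/\ (0 < M)%N, forall s, fixes (mu M) s -> psi s = 1
    & forall M', (0 < M')%N -> (forall s, fixes (mu M') s -> psi s = 1) ->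
        (M <= M')%N].

Definition least_multiple (S : seq nat) (m m' : nat) : Prop :=
  let P k := [/\ (0 < k)%N, (m %| k)%N
    & forall l, prime l -> (l %| k)%N = (l \in S)] in
  P m' /\ forall k, P k -> (m' <= k)%N.

Definition gauss_sum (iota : emb) (zeta : nat -> algC) (psi : absGal -> C)
    (M : nat) : C :=
  \sum_(s \in [set: galQ (cyclotomic M)])
    psi (gal_lift s) * iota (gal_lift s (zeta M)).

(* [d N] is d_n for n = N - 1, and the conductor of psi is m p^(n_psi + 1) with
   N = n_psi + 1. In the case N = 0, psi(p) is the value of psi at any s raising
   the m-th roots of unity to the power p. *)
Record is_coleman_system (alpha beta : padic_int p) (phi : galQ (tower 0)) (iota : emb)
    (zeta : nat -> algC) (S : seq nat) (d : nat -> emb -> C) : Prop := {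
  cs_mem : forall N, krad (tower N) (d N);
  cs_trace : forall N, (0 < N)%N ->
    fg_trace (tower N) (tower N.+1) (d N.+1) = fg_scale alpha (d N);
  cs_trace0 : fg_trace (tower 0) (tower 1) (d 1%N) =
    fg_add (fg_scale alpha (d 0%N))
      (fg_scale (-1) (gal_act (gal_lift (gal_inv phi)) (d 0%N)));
  cs_gen : forall N, krad (tower N) =
    [set fg_grmul c (d N) | c in [set: galQ (tower N) -> padic_int p]];
  cs_char : forall psi m N m', is_character psi ->
    char_conductor psi (m * p ^ N) -> ~~ (p %| m)%N -> least_multiple S m m' ->
    let lhs := \sum_(s \in [set: galQ (tower N)])
      gal_act (gal_lift s) (fg_log (d N)) iota * psi (gal_lift s) in
    let tau := gauss_sum iota zeta psi (m' * p ^ N) in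
    if N is 0%N then
      forall s : absGal, (forall z, mu m z -> s z = z ^+ p) ->
        lhs = (1 - (Zp_qbar beta)^-1 * (psi s)^-1)^-1 * tau
    else lhs = tau }.

End Local.

(* Main.v *)
(** Write m_n for the Jacobson radical of the ring of integers of k_n. As [K_0 : K]
    divides p - 1, the trace m_0 -> m_(-1) is onto, so the relation
    Tr d_0 = (alpha - phi^-1) d_(-1) makes alpha - phi^-1 invertible on the group
    ring; hence alpha^f - 1 is a unit, f the order of Frobenius. Now alpha is a_p
    modulo p, and the number of points of the reduction over the field of p^f
    elements, which contains the residue fields of all the k_n because p is
    unramified in K and totally ramified in the cyclotomic tower, is 1 - a_p^f
    modulo p. So some M prime to p maps E(k_n) into the kernel of reduction, which
    is the formal group on m_n; as M is invertible on Q_p/Z_p, the dual of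
    E(k_oo) (x) Q_p/Z_p is the limit of the duals of the formal groups.
    The formal group on m_n is torsion-free of Z_p-rank [K_n : Q], the number of
    conjugates of d_n, so these generators are independent and a functional is
    determined, arbitrarily, by its values on them: this is the Coleman map being
    bijective at each level. The trace relations make the levels compatible.

    The group law on the curve is obtained from the class group of the coordinate
    ring, and the formal group law from the chord construction in the coordinates
    z = - x / y, w = - 1 / y. *)
Require Import Defs.
From HB Require Import structures.
From mathcomp Require Import all_boot all_order all_algebra all_fingroup.
From mathcomp Require Import all_solvable all_field.
From mathcomp Require Import generic_quotient ring_quotient.
From mathcomp Require Import boolp classical_sets functions cardinality fsbigop.
From mathcomp Require Import ring zify.

Import Defs.

Set Implicit Arguments.
Unset Strict Implicit.
Unset Printing Implicit Defensive.

Import Order.TTheory GRing.Theory Num.Theory.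
Local Open Scope classical_set_scope.
Local Open Scope quotient_scope.
Local Open Scope ring_scope.

(** The closure of Q_p is only given as an algebraically closed algebraic extension, without an
    absolute value and without completeness. Size is therefore measured by divisibility by powers of
    p in the integral closure V of Z_p; that V is a valuation ring comes from lifting idempotents in
    the orders Z_p[c]. Limits are taken in F (x) Q_p, where coordinates in a basis of F reduce
    convergence to Z_p. The axioms of the formal group are read off from the points of the curve,
    and the intersection identities of a line with the curve are stated with divided differences,
    which remain meaningful when two points coincide. Independence of the conjugates of d_n comes
    from the first-order expansion of the group law: on points divisible by p^J, addition and
    scaling are linear modulo p^(2J). The bottom level is exceptional: Tr d_0 is (alpha - phi^-1)
    d_(-1) instead of alpha d_(-1), so the direct formula for Col_(-1) does not fit with the others.
    The component of Col at [N = 0] is the projection of the one at [N = 1], and statements about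
    Col are settled at positive levels and pushed down. *)

Section PadicIntegerTheory.
Variable p : primeNat.
Local Notation Zp := (padic_int p).
Implicit Types x y : Zp.

Lemma pexp_gt0 n : 0 < pexp p n.
Proof. by rewrite /pexp exprn_gt0 // ltz_nat prime_gt0 // prime_valP. Qed.

Lemma pexp_neq0 n : pexp p n != 0.
Proof. by rewrite gt_eqF // pexp_gt0. Qed.

Lemma zresD x y n : zres (x + y) n = ((zres x n + zres y n) %% pexp p n)%Z.
Proof. by []. Qed.

Lemma zresN x n : zres (- x) n = ((- zres x n) %% pexp p n)%Z.
Proof. by []. Qed.

Lemma zresM x y n : zres (x * y) n = ((zres x n * zres y n) %% pexp p n)%Z.
Proof. by []. Qed.

Lemma zres0 n : zres (0 : Zp) n = 0.
Proof. exact: mod0z. Qed.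

Lemma zres_nat k n : zres (k%:R : Zp) n = (k%:Z %% pexp p n)%Z.
Proof.
elim: k => [|k IHk]; first by rewrite zres0 mod0z.
by rewrite -addn1 natrD zresD IHk PoszD modzDm.
Qed.

Lemma zres_int (k : int) n : zres (k%:~R : Zp) n = (k %% pexp p n)%Z.
Proof.
case: k => k; first by rewrite -pmulrn zres_nat.
by rewrite NegzE mulrNz zresN -pmulrn zres_nat modzNm.
Qed.

Lemma zres_ge0 x n : 0 <= zres x n.
Proof. by rewrite -zres_mod modz_ge0 // pexp_neq0. Qed.

Lemma zres_lt x n : zres x n < pexp p n.
Proof. by rewrite -zres_mod ltz_pmod // pexp_gt0. Qed.

Lemma zres_le x n m : (n <= m)%N -> (zres x m %% pexp p n)%Z = zres x n.
Proof. by move=> /subnKC <-; rewrite zres_mod_le. Qed.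

Lemma pexpD n m : pexp p (n + m) = pexp p n * pexp p m.
Proof. exact: exprD. Qed.

Lemma pexpE n : pexp p n = (p ^ n)%N%:Z.
Proof. by rewrite /pexp; elim: n => // n IHn; rewrite exprS IHn expnS PoszM. Qed.

Lemma natr_pexp (R : pzRingType) n : (pexp p n)%:~R = p%:R ^+ n :> R.
Proof. by rewrite pexpE -pmulrn natrX. Qed.

(** The quotient has the residues [zres x (n + k) %/ pexp p n] modulo p^k; they are coherent because
    passing from n + k to n + k + 1 changes [zres x] by a multiple of p^(n + k). *)
Lemma Zp_dvd_zres x n : zres x n = 0 -> exists c : Zp, x = p%:R ^+ n * c.
Proof.
move=> xn0.
have uP k : ((zres x (n + k.+1) %/ pexp p n)%Z
             = (zres x (n + k) %/ pexp p n)%Z %[mod pexp p k])%Z.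
  have E := zresS x (n + k); rewrite -addnS in E.
  have [m -> ] : exists m, zres x (n + k.+1) = zres x (n + k) + m * pexp p (n + k).
    by exists (zres x (n + k.+1) %/ pexp p (n + k))%Z; rewrite -E addrC -divz_eq.
  rewrite pexpD mulrCA divzDr ?dvdz_mulr // mulKz ?pexp_neq0 //.
  by rewrite addrC modzMDl.
exists (Zp_of_seq uP); apply: Zp_ext => k.
rewrite zresM -natr_pexp zres_int /= modzMm.
have [kn|nk] := leqP k n.
  have -> : zres x k = 0 by rewrite -(zres_le x kn) xn0 mod0z.
  have /dvdzP[q ->] : (pexp p k %| pexp p n)%Z.
    by rewrite -(subnKC kn) pexpD dvdz_mulr.
  by rewrite mulrAC modzMl.
have d0 : (pexp p n %| zres x (n + k))%Z.
  by apply/dvdz_mod0P; rewrite zres_mod_le.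
by rewrite mulrC divzK // addnC zres_mod_le.
Qed.

Lemma zres_pexpM x n : zres (p%:R ^+ n * x) n = 0.
Proof. by rewrite zresM -natr_pexp zres_int modzz mul0r mod0z. Qed.

Lemma Zp_zresB x n : exists c : Zp, x = (zres x n)%:~R + p%:R ^+ n * c.
Proof.
have [|c E] := @Zp_dvd_zres (x - (zres x n)%:~R) n.
  by rewrite zresD zresN zres_int zres_mod modzDmr subrr mod0z.
by exists c; rewrite -E addrC subrK.
Qed.

Lemma Zp_zres_abszB x n : exists c : Zp, x = `|zres x n|%N%:R + p%:R ^+ n * c.
Proof.
have [c E] := Zp_zresB x n; exists c; rewrite {1}E; congr (_ + _).
by rewrite -[in LHS](gez0_abs (zres_ge0 x n)) -pmulrn.
Qed.

(** An element prime to p is invertible modulo every p^n by Bezout, and uniqueness of inverses makes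
    the choices coherent. *)
Lemma Zp_unitE x : (x \is a GRing.unit) = (zres x 1 != 0).
Proof.
apply/idP/idP => [ux|x1].
  apply/eqP => /Zp_dvd_zres[c xE]; have := divrr ux.
  move/(congr1 (fun y => zres y 1)); rewrite {1}xE -mulrA zres_pexpM.
  by move/eqP; rewrite -[1]/(1%:R) zres_nat modz_small ?pexp_gt1.
have cop n : coprimez (zres x n) (pexp p n).
  case: n => [|n]; first by rewrite coprimezE coprimen1.
  rewrite coprimezXr // coprimez_sym coprimezE prime_coprime ?prime_valP //.
  apply: contra x1 => /dvdnP[k xk].
  rewrite -(zres_le x (ltn0Sn n)) -(gez0_abs (zres_ge0 x n.+1)) xk.
  by rewrite /pexp expr1 PoszM modzMl.
have ex n : exists u : int, (u * zres x n = 1 %[mod pexp p n])%Z.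
  have /coprimezP[[u v] /= uv] := cop n; exists u.
  by apply/eqP; rewrite eqz_mod_dvd -uv opprD addNKr -mulNr dvdz_mull.
have [u uE] := choice ex.
have uP n : (u n.+1 = u n %[mod pexp p n])%Z.
  have E1 : (u n.+1 * zres x n = 1 %[mod pexp p n])%Z.
    rewrite -(zresS x n) modzMmr -(modz_pexpS p) uE.
    by rewrite modz_pexpS.
  apply/eqP; rewrite eqz_mod_dvd.
  have cop' : coprimez (pexp p n) (zres x n) by rewrite coprimez_sym.
  rewrite -(Gauss_dvdzl _ cop').
  by rewrite mulrBl -eqz_mod_dvd E1 uE.
apply/unitrPr; exists (Zp_of_seq uP); apply: Zp_ext => n.
by rewrite zresM /= modzMmr mulrC uE.
Qed.

Lemma Zp_unit_ndvd x : ~ (exists c, x = p%:R * c) -> x \is a GRing.unit.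
Proof.
by move=> xN; rewrite Zp_unitE; apply/eqP => /Zp_dvd_zres.
Qed.

Lemma p_nunit : (p%:R : Zp) \isn't a GRing.unit.
Proof.
rewrite Zp_unitE negbK zres_nat /pexp expr1; apply/eqP.
exact: modzz.
Qed.

Lemma p_neq0 : p%:R != 0 :> Zp.
Proof.
apply/eqP => /(congr1 (fun z => zres z 2)); rewrite zres_nat zres0 /pexp.
move/eqP; rewrite modz_small ?expr2 ?le0z_nat //=.
  by rewrite eqz_nat => /eqP p0; have := prime_valP p; rewrite p0.
by rewrite -PoszM ltz_nat ltn_Pmull ?prime_gt1 ?prime_gt0 ?prime_valP.
Qed.

Lemma pX_neq0 n : p%:R ^+ n != 0 :> Zp.
Proof. by rewrite expf_neq0 // p_neq0. Qed.

(** The exponent is one less than the first level with a nonzero residue. *)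
Lemma Zp_valP x : x != 0 ->
  exists k (u : Zp), u \is a GRing.unit /\ x = p%:R ^+ k * u.
Proof.
move=> x0; have ex : exists n, zres x n != 0.
  by have [n xn] := Zp_neq0 x0; exists n; apply: contraNneq xn => ->.
have [n nz nmin] := ex_minnP ex.
case: n nz nmin => [|n] nz nmin.
  by case/eqP: nz; rewrite -zres_mod /pexp expr0 modz1.
have [c xE] : exists c : Zp, x = p%:R ^+ n * c.
  apply: Zp_dvd_zres; apply/eqP; apply: contraT => /nmin.
  by rewrite ltnn.
exists n, c; split=> //; rewrite Zp_unitE; apply: contra nz => /eqP/Zp_dvd_zres[d dE].
by rewrite xE dE mulrA -exprD addn1 zres_pexpM.
Qed.

Lemma Zp_coprime_unit (k : nat) : coprime p k -> (k%:R : Zp) \is a GRing.unit.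
Proof.
move=> pk; rewrite Zp_unitE zres_nat /pexp expr1; apply/eqP => E.
have : (p%:Z %| k%:Z)%Z by apply/dvdz_mod0P.
by rewrite dvdzE /= => E2; move: pk; rewrite prime_coprime ?prime_valP ?E2.
Qed.

(** Diagonal limit: its n-th residue is the n-th residue of [a n]. *)
Lemma Zp_lim (a : nat -> Zp) :
    (forall n, exists c, a n.+1 - a n = p%:R ^+ n * c) ->
  exists l, forall n, exists c, l - a n = p%:R ^+ n * c.
Proof.
move=> aP.
have uP n : (zres (a n.+1) n.+1 = zres (a n) n %[mod pexp p n])%Z.
  have [c cE] := aP n; rewrite zresS -[a n.+1](subrK (a n)) cE zresD.
  by rewrite zres_pexpM add0r.
exists (Zp_of_seq uP) => n; apply: Zp_dvd_zres.
by rewrite zresD zresN /= modzDmr modzDml subrr mod0z.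
Qed.

Lemma Zp_sum_lim (z : nat -> Zp) :
  exists l, forall n, exists c, l - \sum_(j < n) p%:R ^+ j * z j = p%:R ^+ n * c.
Proof.
apply: (@Zp_lim (fun n => \sum_(j < n) p%:R ^+ j * z j)) => n; exists (z n).
by rewrite big_ord_recr /= addrAC subrr add0r.
Qed.

Lemma Zp_sep x : (forall n, exists c, x = p%:R ^+ n * c) -> x = 0.
Proof.
by move=> xP; apply: Zp_ext => n; have [c ->] := xP n; rewrite zres_pexpM zres0.
Qed.

End PadicIntegerTheory.

Section PadicNumberTheory.
Variable p : primeNat.
Local Notation Zp := (padic_int p).
Local Notation Qp := (padic_num p).

HB.instance Definition _ := GRing.RMorphism.copy (@Zp_Qp p)
  (@tofrac (padic_int p) : {rmorphism _ -> _}).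

Lemma Zp_Qp_inj : injective (@Zp_Qp p).
Proof. by move=> x y /eqP; rewrite /Zp_Qp tofrac_eq => /eqP. Qed.

Lemma Zp_Qp_p k : Zp_Qp (p%:R ^+ k) = p%:R ^+ k :> Qp.
Proof. by rewrite rmorphXn /= rmorph_nat. Qed.

Lemma Qp_p_neq0 k : p%:R ^+ k != 0 :> Qp.
Proof.
rewrite -Zp_Qp_p -(rmorph0 (@Zp_Qp p)); apply: contra (pX_neq0 p k) => /eqP.
by move/Zp_Qp_inj/eqP.
Qed.

Lemma Zp_Qp_unit (u : Zp) : u \is a GRing.unit -> (Zp_Qp u)^-1 = Zp_Qp u^-1.
Proof.
move=> uu; have u0 : Zp_Qp u != 0.
  rewrite -(rmorph0 (@Zp_Qp p)); apply/eqP => /Zp_Qp_inj u0.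
  by rewrite u0 unitr0 in uu.
by apply: (mulfI u0); rewrite divff // -rmorphM divrr // rmorph1.
Qed.

(** The unit part of a denominator moves into the numerator and leaves a power of p. *)
Lemma Qp_fracP (q : Qp) : exists k (a : Zp), q = Zp_Qp a / p%:R ^+ k.
Proof.
have [n [d [d0 ->]]] : exists n d : Zp, d != 0 /\ q = Zp_Qp n / Zp_Qp d.
  pose r := repr (q : {fraction Zp}); exists (frac r).1, (frac r).2.
  have d0 := denom_ratioP r; split=> //.
  have dF0 : Zp_Qp (frac r).2 != 0 by rewrite /Zp_Qp tofrac_eq0.
  apply: (mulIf dF0); rewrite divfK // /Zp_Qp.
  rewrite -[q in LHS](reprK (q : {fraction Zp})) -/r.
  rewrite !piE; apply/eqP; rewrite FracField.equivf_def.
  by rewrite !numden_Ratio ?mulf_neq0 ?oner_eq0 //= !mulr1 mulrC.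
have [k [u [uu ->]]] := Zp_valP d0.
exists k, (n * u^-1); rewrite !rmorphM /= Zp_Qp_p -(Zp_Qp_unit uu) -mulrA -invfM.
by rewrite [Zp_Qp u * _]mulrC.
Qed.

End PadicNumberTheory.

(** * The group Q_p/Z_p and its endomorphisms *)

Section PruferTheory.
Variable p : primeNat.
Local Notation Zp := (padic_int p).
Local Notation Qp := (padic_num p).
Local Notation T := (QpZp p).

Definition qz_pi (q : Qp) : T := \pi_(Quotient.quot (@Zp_in p)) q.

Lemma qz_piP (t : T) : exists q, t = qz_pi q.
Proof. by exists (repr (t : Quotient.quot (@Zp_in p))); rewrite /qz_pi reprK. Qed.

Lemma qz_piD q r : qz_pi (q + r) = qz_pi q + qz_pi r.
Proof. by rewrite /qz_pi !piE. Qed.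

Lemma qz_pi_eq q r : qz_pi q = qz_pi r <-> exists a, q - r = Zp_Qp a.
Proof.
split=> [/eqP|[a E]].
  by rewrite -Quotient.idealrBE => /asboolP.
by apply/eqP; rewrite -Quotient.idealrBE; apply/asboolP; exists a.
Qed.

Lemma qz_pi0 : qz_pi 0 = 0.
Proof. by apply: (addrI (qz_pi 0)); rewrite -qz_piD !addr0. Qed.

Lemma qz_pi_int a : qz_pi (Zp_Qp a) = 0.
Proof. by rewrite -qz_pi0; apply/qz_pi_eq; exists a; rewrite subr0. Qed.

Lemma qz_scaleE a q : QpZp_scale a (qz_pi q) = qz_pi (Zp_Qp a * q).
Proof.
rewrite /QpZp_scale -/(qz_pi _); apply/qz_pi_eq.
have /qz_pi_eq[b E] : qz_pi (repr (qz_pi q : Quotient.quot (@Zp_in p))) = qz_pi q.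
  by rewrite /qz_pi reprK.
by exists (a * b); rewrite -mulrBr E rmorphM.
Qed.

Lemma qz_scaleDr a (t u : T) :
  QpZp_scale a (t + u) = QpZp_scale a t + QpZp_scale a u.
Proof.
have [q ->] := qz_piP t; have [r ->] := qz_piP u.
by rewrite -qz_piD !qz_scaleE mulrDr qz_piD.
Qed.

Lemma qz_scaleDl a b (t : T) :
  QpZp_scale (a + b) t = QpZp_scale a t + QpZp_scale b t.
Proof.
by have [q ->] := qz_piP t; rewrite !qz_scaleE rmorphD mulrDl qz_piD.
Qed.

Lemma qz_scaleA a b (t : T) : QpZp_scale (a * b) t = QpZp_scale a (QpZp_scale b t).
Proof. by have [q ->] := qz_piP t; rewrite !qz_scaleE rmorphM mulrA. Qed.

Lemma qz_scale1 (t : T) : QpZp_scale 1 t = t.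
Proof. by have [q ->] := qz_piP t; rewrite !qz_scaleE rmorph1 mul1r. Qed.

Lemma qz_scale0 (t : T) : QpZp_scale 0 t = 0.
Proof. by have [q ->] := qz_piP t; rewrite !qz_scaleE rmorph0 mul0r qz_pi0. Qed.

Lemma qz_scaler0 a : QpZp_scale a 0 = 0 :> T.
Proof. by apply: (addrI (QpZp_scale a 0)); rewrite -qz_scaleDr !addr0. Qed.

Lemma qz_scale_nat k (t : T) : QpZp_scale k%:R t = t *+ k.
Proof.
elim: k => [|k IHk]; first by rewrite qz_scale0.
by rewrite -addn1 natrD qz_scaleDl IHk qz_scale1 mulrnDr.
Qed.

Lemma qz_scale_suml I (r : seq I) (P : pred I) (F : I -> Zp) (t : T) :
  QpZp_scale (\sum_(i <- r | P i) F i) t = \sum_(i <- r | P i) QpZp_scale (F i) t.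
Proof.
by elim/big_rec2: _ => [|i a u _ <-]; rewrite ?qz_scale0 // qz_scaleDl.
Qed.

Definition qz_gen k : T := qz_pi (p%:R ^- k).

Lemma qz_genP (t : T) : exists k a, t = QpZp_scale a (qz_gen k).
Proof.
have [q ->] := qz_piP t; have [k [a ->]] := Qp_fracP q.
by exists k, a; rewrite qz_scaleE.
Qed.

Lemma qz_gen_tors k : QpZp_scale (p%:R ^+ k) (qz_gen k) = 0.
Proof. by rewrite qz_scaleE Zp_Qp_p divff ?Qp_p_neq0 // -(qz_pi_int 1) rmorph1. Qed.

Lemma qz_genS k : QpZp_scale p%:R (qz_gen k.+1) = qz_gen k.
Proof.
rewrite qz_scaleE rmorph_nat exprS invfM mulrA mulfV ?mul1r //.
by have := Qp_p_neq0 p 1; rewrite expr1.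
Qed.

Lemma qz_gen_le k l : (k <= l)%N -> qz_gen k = QpZp_scale (p%:R ^+ (l - k)) (qz_gen l).
Proof.
move=> /subnKC; set j := (l - k)%N => <-; elim: j => [|j IHj].
  by rewrite expr0 qz_scale1 addn0.
by rewrite addnS exprSr qz_scaleA qz_genS.
Qed.

Lemma qz_gen_scale0 a k : QpZp_scale a (qz_gen k) = 0 -> exists c, a = p%:R ^+ k * c.
Proof.
rewrite qz_scaleE -qz_pi0 => /qz_pi_eq[c]; rewrite subr0 => E.
exists c; apply: Zp_Qp_inj; rewrite rmorphM /= Zp_Qp_p -E mulrCA divff ?mulr1 //.
exact: Qp_p_neq0.
Qed.

Lemma qz_scale_inj a b : (forall t : T, QpZp_scale a t = QpZp_scale b t) -> a = b.
Proof.
move=> E; apply/eqP; rewrite -subr_eq0; apply/eqP/Zp_sep => n.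
apply: qz_gen_scale0; rewrite qz_scaleDl E -qz_scaleDl subrr.
exact: qz_scale0.
Qed.

Lemma qz_scaleC a b (t : T) :
  QpZp_scale a (QpZp_scale b t) = QpZp_scale b (QpZp_scale a t).
Proof. by rewrite -!qz_scaleA mulrC. Qed.

(** The image of p^-k is killed by p^k, hence is a multiple a_k of p^-k, and the a_k converge in Z_p
    because multiplication by p sends p^-(k+1) to p^-k. This duality turns characters of the tensor
    product into functionals with values in Z_p. *)
Lemma qz_endP (h : T -> T) : {morph h : t u / t + u} ->
  exists a, forall t, h t = QpZp_scale a t.
Proof.
move=> hD.
have h0 : h 0 = 0 by apply: (addrI (h 0)); rewrite -hD !addr0.
have hn t k : h (t *+ k) = h t *+ k.
  by elim: k => [|k IHk]; rewrite ?mulr0n // !mulrS hD IHk.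
have hX k t : h (QpZp_scale (p%:R ^+ k) t) = QpZp_scale (p%:R ^+ k) (h t).
  by rewrite -!natrX !qz_scale_nat hn.
have ex k : exists a, h (qz_gen k) = QpZp_scale a (qz_gen k).
  have [l [a E]] := qz_genP (h (qz_gen k)).
  have [lk|kl] := leqP l k.
    by exists (a * p%:R ^+ (k - l)); rewrite qz_scaleA -qz_gen_le.
  have := hX k (qz_gen k); rewrite qz_gen_tors h0 E -qz_scaleA => /esym.
  move=> /qz_gen_scale0[c]; rewrite -{1}(subnKC (ltnW kl)) exprD -mulrA.
  move=> /(mulfI (pX_neq0 p k)) aE; exists c.
  by rewrite (qz_gen_le (ltnW kl)) -qz_scaleA mulrC -aE.
have [a aE] := choice ex.
have [l lP] : exists l, forall n, exists c, l - a n = p%:R ^+ n * c.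
  apply: Zp_lim => n; apply: qz_gen_scale0; rewrite qz_scaleDl.
  rewrite -(qz_genS n) qz_scaleC -aE.
  have := hX 1 (qz_gen n.+1); rewrite expr1 => <-; rewrite qz_genS aE.
  by rewrite -qz_scaleDl subrr qz_scale0.
exists l => t; have [k [b ->]] := qz_genP t.
have [c E] := lP k; rewrite -[l](subrK (a k)) E qz_scaleDl.
rewrite [QpZp_scale _ _ in X in _ = X + _]qz_scaleC.
have -> : QpZp_scale (p%:R ^+ k * c) (qz_gen k) = 0.
  by rewrite mulrC qz_scaleA qz_gen_tors qz_scaler0.
rewrite qz_scaler0 add0r qz_scaleC -aE.
have [b' ->] := Zp_zres_abszB b k.
rewrite !qz_scaleDl hD !qz_scale_nat hn; congr (_ + _).
rewrite ![p%:R ^+ k * _]mulrC !qz_scaleA qz_gen_tors qz_scaler0 h0 aE.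
by rewrite (qz_scaleC _ (a k)) qz_gen_tors !qz_scaler0.
Qed.

Lemma qz_div (n : Zp) (t : T) : n \is a GRing.unit -> QpZp_scale n (QpZp_scale n^-1 t) = t.
Proof. by move=> un; rewrite -qz_scaleA divrr // qz_scale1. Qed.

End PruferTheory.

(** With u the leading coefficient, [g] is the monic polynomial such that g(u X) = u^n f(X); it
    vanishes at u c. *)
Lemma integral_lead_mul (R : comNzRingType) (K : idomainType) (h : {rmorphism R -> K}) n
    (f : {poly K}) c : (size f <= n.+2)%N -> (forall i, integralOver h f`_i) ->
  f.[c] = 0 -> integralOver h (f`_n.+1 * c).
Proof.
move=> sf fi fc; pose u := f`_n.+1.
pose g := \poly_(j < n.+2) (if j == n.+1 then 1 else f`_j * u ^+ (n - j)).
have gn : g`_n.+1 = 1 by rewrite coef_poly ltnSn eqxx.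
have sg : size g = n.+2.
  apply/eqP; rewrite eqn_leq size_poly ltnNge; apply/negP => sg.
  by move: gn; rewrite nth_default // => /esym/eqP; rewrite oner_eq0.
have ui k : integralOver h (u ^+ k).
  by elim: k => [|k IHk]; [exact: (integral1 h)|rewrite exprS; apply: integral_mul => //; apply: fi].
apply: (@integral_root_monic _ _ h _ g).
- by apply/monicP; rewrite lead_coefE sg.
- apply/eqP; rewrite horner_poly -/u.
  transitivity (u ^+ n * f.[c]); last by rewrite fc mulr0.
  rewrite (horner_coef_wide _ sf) mulr_sumr; apply: eq_bigr => j _.
  case: eqP => [->|/eqP jn].
    by rewrite mul1r exprMn -/u exprS; ring.
  have jn' : (j <= n)%N by have := ltn_ord j; rewrite ltnS leq_eqVlt (negPf jn).
  have -> : u ^+ n = u ^+ (n - j) * u ^+ j by rewrite -exprD subnK.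
  by rewrite exprMn [f`_j * _]mulrC; apply: mulrACA.
move=> _ /(nthP 0)[j _ <-]; rewrite coef_poly; case: ifP => _; last exact: (integral0 h).
by case: ifP => _; [exact: (integral1 h)|apply: integral_mul].
Qed.

(** * The valuation ring of an algebraic closure of Q_p *)

Section IntegersOfClosure.
Variables (p : primeNat) (C : Qp_closure p).
Local Notation Zp := (padic_int p).
Local Notation Qp := (padic_num p).
Local Notation V := (@qbar_int p C).

HB.instance Definition _ := GRing.RMorphism.copy (@Zp_qbar p C)
  ((qbar_emb C \o @Zp_Qp p) : {rmorphism _ -> _}).

(** Replaces the condition v(c) >= k for the valuation normalized by v(p) = 1. *)
Definition pV (k : nat) (c : C) : Prop := exists2 d, V d & c = p%:R ^+ k * d.

(* The maximal ideal, as the radical of the ideal generated by p. *)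
Definition qbar_max (c : C) : Prop := V c /\ exists k, pV 1 (c ^+ k).
Local Notation mm := qbar_max.

Lemma V_Zp a : V (Zp_qbar C a).
Proof. exact: (integral_id (@Zp_qbar p C)). Qed.

Lemma V0 : V 0. Proof. exact: (integral0 (@Zp_qbar p C)). Qed.
Lemma V1 : V 1. Proof. exact: (integral1 (@Zp_qbar p C)). Qed.
Lemma VD a b : V a -> V b -> V (a + b).
Proof. exact: (@integral_add _ _ (@Zp_qbar p C)). Qed.
Lemma VN a : V a -> V (- a).
Proof. exact: (@integral_opp _ _ (@Zp_qbar p C)). Qed.
Lemma VB a b : V a -> V b -> V (a - b).
Proof. by move=> Va Vb; apply: VD => //; apply: VN. Qed.
Lemma VM a b : V a -> V b -> V (a * b).
Proof. exact: (@integral_mul _ _ (@Zp_qbar p C)). Qed.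
Lemma VX a n : V a -> V (a ^+ n).
Proof.
move=> Va; elim: n => [|n IHn]; first exact: V1.
by rewrite exprS; apply: VM.
Qed.
Lemma Vnat n : V n%:R.
Proof. exact: (integral_nat (@Zp_qbar p C)). Qed.
Lemma Vint (n : int) : V n%:~R.
Proof.
case: n => n; first by rewrite -pmulrn; apply: Vnat.
by rewrite NegzE mulrNz; apply/VN/Vnat.
Qed.
Lemma Vsum I (r : seq I) (P : pred I) (F : I -> C) :
  (forall i, P i -> V (F i)) -> V (\sum_(i <- r | P i) F i).
Proof. by move=> VF; apply: (big_ind V) => //; [exact: V0|exact: VD]. Qed.

Lemma V_root (f : {poly C}) c : f \is monic -> (forall i, V f`_i) -> root f c -> V c.
Proof.
move=> fm Vf rc; apply: (@integral_root_monic _ _ (@Zp_qbar p C) _ f) => //.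
by move/integral_poly: Vf; apply.
Qed.

Lemma Zp_qbar_p k : Zp_qbar C (p%:R ^+ k) = p%:R ^+ k.
Proof. by rewrite rmorphXn /= rmorph_nat. Qed.

Lemma Zp_qbar_inj : injective (@Zp_qbar p C).
Proof.
by move=> a b; rewrite /Zp_qbar => /(fmorph_inj (qbar_emb C))/Zp_Qp_inj.
Qed.

Lemma qp_neq0 k : p%:R ^+ k != 0 :> C.
Proof.
rewrite -Zp_qbar_p -(rmorph0 (@Zp_qbar p C)); apply: contra (pX_neq0 p k).
by move=> /eqP/Zp_qbar_inj/eqP.
Qed.

Lemma cp_neq0 : p%:R != 0 :> C.
Proof. by have := qp_neq0 1; rewrite expr1. Qed.

Lemma natC_neq0 n : (0 < n)%N -> n%:R != 0 :> C.
Proof.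
move=> n0; rewrite -(rmorph_nat (@Zp_qbar p C)) -(rmorph0 (@Zp_qbar p C)).
apply/eqP => /Zp_qbar_inj E; move: (congr1 (fun z => zres z n) E).
rewrite zres_nat zres0 pexpE modz_small; last first.
  by rewrite le0z_nat ltz_nat ltn_expl ?prime_gt1 ?prime_valP.
by move=> [] n00; rewrite n00 in n0.
Qed.

(** The polynomial p^(k n) Q(X / p^k), for a monic equation Q of c, is monic and kills p^k c; it is
    integral once p^k clears the denominators of the coefficients of Q. *)
Lemma qbar_clear c : exists k, V (p%:R ^+ k * c).
Proof.
have /integral_algebraic[Q Qm Qc] := qbar_algebraic c.
have exk j : exists k, V (p%:R ^+ k * qbar_emb C Q`_j).
  have [k [a ->]] := Qp_fracP Q`_j; exists k.
  rewrite fmorph_div /= rmorphXn rmorph_nat mulrC divfK ?qp_neq0 //.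
  exact: V_Zp.
have [kk kkP] := choice exk.
pose k := (\sum_(j < size Q) kk j)%N; exists k.
have VQ j : V (p%:R ^+ k * qbar_emb C Q`_j).
  have [jQ|Qj] := ltnP j (size Q); last first.
    by rewrite nth_default // rmorph0 mulr0; apply: V0.
  rewrite /k (bigD1 (Ordinal jQ)) //= addnC exprD -mulrA.
  by apply: VM; [apply/VX/Vnat|apply: kkP].
pose n := (size Q).-1.
have sQ : size Q = n.+1.
  by rewrite /n prednK // lt0n size_poly_eq0 monic_neq0.
pose f := \poly_(j < n.+1) (p%:R ^+ (k * (n - j)) * qbar_emb C Q`_j).
have fn : f`_n = 1.
  rewrite coef_poly ltnSn subnn muln0 mul1r.
  by have /monicP := Qm; rewrite lead_coefE sQ /= => ->; rewrite rmorph1.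
have sf : size f = n.+1.
  apply/eqP; rewrite eqn_leq size_poly ltnNge; apply/negP => sf.
  by move: fn; rewrite nth_default // => /esym/eqP; rewrite oner_eq0.
apply: (@V_root f).
- by apply/monicP; rewrite lead_coefE sf.
- move=> j; rewrite coef_poly; case: ltnP => jn; last exact: V0.
  move: jn; rewrite ltnS leq_eqVlt => /predU1P[->|jn].
    rewrite subnn muln0 mul1r.
    by have /monicP := Qm; rewrite lead_coefE sQ /= => ->; rewrite rmorph1; apply: V1.
  have -> : (n - j)%N = (n - j.+1).+1 by rewrite subnSK.
  rewrite mulnS addnC exprD -mulrA; apply: VM => //; exact/VX/Vnat.
move: Qc; rewrite /root => /eqP Qc; apply/eqP.
rewrite horner_poly.
transitivity (p%:R ^+ (k * n) * (map_poly (qbar_emb C) Q).[c]); last by rewrite Qc mulr0.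
rewrite horner_coef size_map_poly sQ mulr_sumr; apply: eq_bigr => j _.
rewrite coef_map /= exprMn -exprM.
have -> : p%:R ^+ (k * n) = p%:R ^+ (k * (n - j)) * p%:R ^+ (k * j) :> C.
  by rewrite -exprD -mulnDr subnK // leq_ord.
exact: mulrACA.
Qed.

(** Multiplied by p^n, an integral equation of 1/p writes 0 as 1 plus a multiple of p in Z_p. Later
    arguments refute integrality by reaching this contradiction. *)
Lemma V_pinv : ~ V p%:R^-1.
Proof.
move=> [P Pm]; rewrite /root => /eqP P0.
pose n := (size P).-1.
have sP : size P = n.+1 by rewrite /n prednK // lt0n size_poly_eq0 monic_neq0.
have Pn : P`_n = 1 by have /monicP := Pm; rewrite lead_coefE sP.
have : Zp_qbar C (1 + p%:R * \sum_(j < n) P`_j * p%:R ^+ (n - j.+1)) = Zp_qbar C 0.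
  rewrite rmorph0; transitivity (p%:R ^+ n * (map_poly (@Zp_qbar p C) P).[p%:R^-1]);
    last by rewrite P0 mulr0.
  rewrite horner_coef size_map_poly_id0; last first.
    by have /monicP -> := Pm; rewrite rmorph1 oner_eq0.
  rewrite sP big_ord_recr /= coef_map /= Pn rmorph1 mul1r mulrDr.
  rewrite exprVn divff ?qp_neq0 // rmorphD rmorph1 addrC; congr (_ + _).
  rewrite rmorphM rmorph_sum mulr_sumr mulr_sumr; apply: eq_bigr => j _ /=.
  rewrite coef_map /= rmorphM rmorph_nat /= Zp_qbar_p.
  have -> : p%:R ^+ n = p%:R ^+ j * p%:R * p%:R ^+ (n - j.+1) :> C.
    by rewrite -exprSr -exprD subnKC.
  by rewrite exprVn; have := qp_neq0 j; move=> h; field.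
move/Zp_qbar_inj/eqP; rewrite addr_eq0 => /eqP E.
have /negP[] := p_nunit p; apply/unitrPr.
by exists (- \sum_(j < n) P`_j * p%:R ^+ (n - j.+1)); rewrite mulrN -E.
Qed.

(** A q outside Z_p is a unit times a negative power of p; if it were integral, so would be 1/p. *)
Lemma V_Qp (q : Qp) : V (qbar_emb C q) -> exists a, q = Zp_Qp a.
Proof.
have [-> _|q0] := eqVneq q 0; first by exists 0; rewrite rmorph0.
have [k [a E]] := Qp_fracP q.
have a0 : a != 0 by apply: contra_neq q0 => a0; rewrite E a0 rmorph0 mul0r.
have [j [u [uu aE]]] := Zp_valP a0.
have [kj|jk] := leqP k j.
  exists (p%:R ^+ (j - k) * u); rewrite E aE -{1}(subnKC kj) exprD !rmorphM /= !Zp_Qp_p.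
  by rewrite -!mulrA mulrC -!mulrA mulVf ?mulr1 ?Qp_p_neq0 // -Zp_Qp_p.
move=> Vq; case: V_pinv.
have -> : p%:R^-1 = qbar_emb C q * Zp_qbar C u^-1 * p%:R ^+ (k - j.+1).
  rewrite E fmorph_div -[qbar_emb C (Zp_Qp a)]/(Zp_qbar C a) aE rmorphM /=.
  rewrite Zp_qbar_p rmorphXn rmorph_nat.
  rewrite -[in p%:R ^+ k](subnKC jk) exprD exprSr !invfM.
  have uuC : Zp_qbar C u * Zp_qbar C u^-1 = 1 by rewrite -rmorphM divrr // rmorph1.
  transitivity (p%:R^-1 * (Zp_qbar C u * Zp_qbar C u^-1)); first by rewrite uuC mulr1.
  have := qp_neq0 j; have := qp_neq0 (k - j.+1); have := cp_neq0.
  by move=> h1 h2 h3; field; rewrite h1 h2 h3.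
by apply: VM; [apply: VM => //; apply: V_Zp|apply/VX/Vnat].
Qed.

Lemma pV0 k : pV k 0.
Proof. by exists 0; [exact: V0|rewrite mulr0]. Qed.
Lemma pVD k a b : pV k a -> pV k b -> pV k (a + b).
Proof. by move=> [c Vc ->] [d Vd ->]; exists (c + d); rewrite ?mulrDr //; apply: VD. Qed.
Lemma pVN k a : pV k a -> pV k (- a).
Proof. by move=> [c Vc ->]; exists (- c); rewrite ?mulrN //; apply: VN. Qed.
Lemma pVB k a b : pV k a -> pV k b -> pV k (a - b).
Proof. by move=> ? ?; apply: pVD => //; apply: pVN. Qed.
Lemma pVM k l a b : pV k a -> pV l b -> pV (k + l) (a * b).
Proof.
move=> [c Vc ->] [d Vd ->]; exists (c * d); first exact: VM.
by rewrite exprD; ring.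
Qed.
Lemma pVW k l a : (l <= k)%N -> pV k a -> pV l a.
Proof.
move=> /subnKC <- [c Vc ->]; exists (p%:R ^+ (k - l) * c).
  by apply: VM => //; apply/VX/Vnat.
by rewrite exprD mulrA.
Qed.
Lemma pV_V k a : pV k a -> V a.
Proof. by move=> [c Vc ->]; apply: VM => //; apply/VX/Vnat. Qed.
Lemma pV0E a : pV 0 a <-> V a.
Proof. by split=> [/pV_V//|Va]; exists a; rewrite ?mul1r. Qed.
Lemma pVMl k a b : V a -> pV k b -> pV k (a * b).
Proof. by move=> /pV0E Va Vb; apply: (pVM Va Vb). Qed.
Lemma pVX k n a : pV k a -> pV (k * n) (a ^+ n).
Proof.
move=> ka; elim: n => [|n IHn]; first by rewrite muln0; apply/pV0E/V1.
by rewrite exprS mulnS; apply: pVM.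
Qed.
Lemma pVsum k I (r : seq I) (P : pred I) (F : I -> C) :
  (forall i, P i -> pV k (F i)) -> pV k (\sum_(i <- r | P i) F i).
Proof. by move=> VF; apply: (big_ind (pV k)) => //; [exact: pV0|exact: pVD]. Qed.

(** If p^j / c is integral and p^(j+1) divides c, then 1/p is integral. *)
Lemma qbar_sep c : (forall k, pV k c) -> c = 0.
Proof.
move=> cP; apply/eqP; apply: contraT => c0; case: V_pinv.
have [j Vj] := qbar_clear c^-1; have [d Vd cE] := cP j.+1.
have -> : p%:R^-1 = p%:R ^+ j * c^-1 * d :> C.
  have d0 : d != 0 by apply: contraNneq c0 => d0; rewrite cE d0 mulr0.
  rewrite cE exprSr; have := cp_neq0; have := qp_neq0 j => h1 h2.
  by field; rewrite h1 h2 d0.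
exact: VM.
Qed.

(** For an integral equation P of a, the polynomial [R] is p^n P((X - 1) / p), which kills b = 1 + p
    a. Its constant term e is a unit, so with R = S X + e the relation b S(b) = - e exhibits an
    integral inverse. *)
Lemma V_1p_inv a : V a -> 1 + p%:R * a != 0 /\ V (1 + p%:R * a)^-1.
Proof.
move=> [P Pm]; rewrite /root => /eqP P0; set b := 1 + _.
pose n := (size P).-1.
have sP : size P = n.+1 by rewrite /n prednK // lt0n size_poly_eq0 monic_neq0.
have Pn : P`_n = 1 by have /monicP := Pm; rewrite lead_coefE sP.
pose R : {poly Zp} := \sum_(j < n.+1) (P`_j * p%:R ^+ (n - j)) *: ('X - 1) ^+ j.
(* The terms with j < n carry a factor p, and the top one contributes (-1)^n. *)
have R0 : R.[0] \is a GRing.unit.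
  rewrite /R horner_sum big_ord_recr /= subnn mulr1 Pn scale1r !hornerE.
  apply: Zp_unit_ndvd => -[c E0].
  have E : p%:R * c - \sum_(i < n) ((P`_i * p%:R ^+ (n - i)) *: ('X - 1) ^+ i).[0] = (-1) ^+ n.
    by rewrite -E0 addrAC subrr add0r.
  have /negP[] := p_nunit p; apply/unitrPr.
  exists ((c - \sum_(j < n) P`_j * p%:R ^+ (n - j.+1) * (-1) ^+ j) * (-1) ^+ n).
  rewrite mulrA mulrBr mulr_sumr.
  rewrite (_ : _ - _ = (-1) ^+ n) -?expr2 ?sqrr_sign //.
  rewrite -E; congr (_ - _); apply: eq_bigr => j _; rewrite !hornerE ?sub0r.
  by rewrite (_ : n - j = (n - j.+1).+1)%N ?exprS /=; [ring|rewrite subnSK].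
have Rb : (map_poly (@Zp_qbar p C) R).[b] = 0.
  transitivity (p%:R ^+ n * (map_poly (@Zp_qbar p C) P).[a]); last by rewrite P0 mulr0.
  rewrite [(map_poly _ P).[a]]horner_coef size_map_poly_id0; last first.
    by have /monicP -> := Pm; rewrite rmorph1 oner_eq0.
  rewrite sP rmorph_sum horner_sum mulr_sumr; apply: eq_bigr => j _.
  rewrite coef_map /= map_polyZ /= rmorphXn rmorphB /= map_polyX rmorph1 !hornerE.
  rewrite /b [1 + _]addrC addrK rmorphM /= Zp_qbar_p exprMn.
  rewrite -[in p%:R ^+ n](subnK (leq_ord j)) exprD.
  by ring.
have [S [e RE]] : exists S e, R = S * 'X + e%:P.
  by elim/poly_ind: (R) => [|S e _]; [exists 0, 0; rewrite mul0r add0r|exists S, e].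
have eE : e = R.[0] by rewrite RE !hornerE ?mulr0 ?add0r.
rewrite -eE in R0.
have bS : b * (map_poly (@Zp_qbar p C) S).[b] = - Zp_qbar C e.
  by move: Rb; rewrite RE rmorphD rmorphM /= map_polyX map_polyC !hornerE => /eqP; rewrite addr_eq0 mulrC => /eqP.
have eK : Zp_qbar C e * Zp_qbar C e^-1 = 1 by rewrite -rmorphM divrr // rmorph1.
have b1 : b * (- (map_poly (@Zp_qbar p C) S).[b] * Zp_qbar C e^-1) = 1.
  by rewrite mulrA mulrN bS opprK.
have b0 : b != 0 by apply: contra_eq_neq b1 => ->; rewrite mul0r eq_sym oner_eq0.
split=> //; rewrite (_ : b^-1 = - (map_poly (@Zp_qbar p C) S).[b] * Zp_qbar C e^-1).
  apply: VM; last exact: V_Zp.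
  apply: VN; rewrite horner_coef; apply: Vsum => i _; rewrite coef_map.
  apply: VM; first exact: V_Zp.
  apply/VX/VD; first exact: V1.
  by apply: VM; [exact: Vnat|exists P => //; apply/eqP].
by apply: (mulfI b0); rewrite b1 divff.
Qed.

(** * Idempotents in the order Z_p[c] *)

Section Monogenic.
Variable c : C.
Hypothesis Vc : V c.

Definition inZpc (x : C) := exists Q : {poly Zp}, x = (map_poly (@Zp_qbar p C) Q).[c].

(** Division by a monic equation of c leaves finitely many powers of c as generators. The finiteness
    of Z_p[c] / p and the coordinatewise limits both rest on this. *)
Lemma inZpc_bound : exists n, forall x, inZpc x ->
  exists a : nat -> Zp, x = \sum_(j < n) Zp_qbar C (a j) * c ^+ j.
Proof.
have [P Pm P0] := Vc; exists (size P) => _ [Q ->].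
exists (fun j => (Q %% P)`_j); rewrite {1}(Pdiv.IdomainMonic.divp_eq Pm Q).
rewrite rmorphD rmorphM /= hornerD hornerM (eqP P0) mulr0 add0r.
rewrite (@horner_coef_wide _ (size P)).
  by apply: eq_bigr => j _; rewrite coef_map.
rewrite (leq_trans (size_poly _ _)) // ltnW // ltn_modpN0 //.
by rewrite monic_neq0.
Qed.

Lemma inZpc1 : inZpc 1.
Proof. by exists 1; rewrite rmorph1 hornerC. Qed.
Lemma inZpcD x y : inZpc x -> inZpc y -> inZpc (x + y).
Proof. by move=> [Q ->] [R ->]; exists (Q + R); rewrite rmorphD hornerD. Qed.
Lemma inZpcM x y : inZpc x -> inZpc y -> inZpc (x * y).
Proof. by move=> [Q ->] [R ->]; exists (Q * R); rewrite rmorphM hornerM. Qed.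
Lemma inZpcN x : inZpc x -> inZpc (- x).
Proof. by move=> [Q ->]; exists (- Q); rewrite rmorphN hornerN. Qed.
Lemma inZpcZ a : inZpc (Zp_qbar C a).
Proof. by exists a%:P; rewrite map_polyC hornerC. Qed.
Lemma inZpcX k : inZpc (c ^+ k).
Proof. by exists 'X^k; rewrite map_polyXn hornerXn. Qed.
Lemma inZpc_V x : inZpc x -> V x.
Proof.
move=> [Q ->]; rewrite horner_coef; apply: Vsum => i _; rewrite coef_map.
by apply: VM; [exact: V_Zp|exact: VX].
Qed.

Lemma inZpc_nat n : inZpc n%:R.
Proof. by rewrite -(rmorph_nat (@Zp_qbar p C)); apply: inZpcZ. Qed.

(** Pigeonhole in the finite ring Z_p[c] / p: two powers of c agree modulo p, and a suitable further
    power is then idempotent. *)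
Lemma power_idempotent_mod_p :
  exists2 k, (0 < k)%N & exists2 x, inZpc x & c ^+ k ^+ 2 - c ^+ k = p%:R * x.
Proof.
have [n nP] := inZpc_bound.
have [a aP] := choice (fun j => nP _ (inZpcX j)).
pose r (j : 'I_(p ^ n).+1) : {ffun 'I_n -> 'I_p} :=
  [ffun k : 'I_n => insubd (Ordinal (prime_gt0 (prime_valP p))) `|zres (a j k) 1|%N].
have /injectivePn[i [j ij rij]] : ~~ injectiveb r.
  apply/negP => /injectiveP/leq_card; rewrite card_ord card_ffun !card_ord.
  by rewrite ltnn.
have E (k : 'I_n) : zres (a i k) 1 = zres (a j k) 1.
  have := congr1 (fun f : {ffun 'I_n -> 'I_p} => val (f k)) rij.
  have lt1 (x : Zp) : (`|zres x 1| < p)%N.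
    rewrite -ltz_nat gez0_abs ?zres_ge0 //.
    by rewrite -[X in _ < X]expr1; apply: zres_lt.
  rewrite !ffunE !val_insubd !lt1 => E.
  by rewrite -(gez0_abs (zres_ge0 (a i k) 1)) E gez0_abs ?zres_ge0.
have {i j ij rij E a aP r} [u [d [d0 [x Ax xE]]]] :
    exists u d, (0 < d)%N /\ exists2 x, inZpc x & c ^+ u * (c ^+ d - 1) = p%:R * x.
  have main (i' j' : 'I_(p ^ n).+1) : (i' < j')%N ->
      (forall k : 'I_n, zres (a i' k) 1 = zres (a j' k) 1) ->
      exists2 x, inZpc x & c ^+ i' * (c ^+ (j' - i') - 1) = p%:R * x.
    move=> ij' E'.
    have /choice[z zP] (k : 'I_n) : exists z : Zp, a j' k - a i' k = p%:R * z.
      have [|z zE] := @Zp_dvd_zres p (a j' k - a i' k) 1.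
        by rewrite zresD zresN E' modzDmr subrr mod0z.
      by exists z; rewrite zE expr1.
    exists (\sum_(k < n) Zp_qbar C (z k) * c ^+ k).
      elim/big_rec: _ => [|k y _ Ay]; first by exists 0; rewrite rmorph0 horner0.
      by apply: inZpcD => //; apply: inZpcM; [exact: inZpcZ|exact: inZpcX].
    rewrite mulrBr mulr1 -exprD subnKC ?(ltnW ij') // !aP -sumrB mulr_sumr.
    apply: eq_bigr => k _; rewrite -mulrBl -rmorphB zP rmorphM rmorph_nat.
    by rewrite mulrA.
  case: (ltngtP i j) => [ij'|ji'|/val_inj ij']; last by rewrite ij' eqxx in ij.
    have [x Ax xE] := main _ _ ij' E; exists i, (j - i)%N.
    by split; [rewrite subn_gt0|exists x].
  have [x Ax xE] := main _ _ ji' (fun k => esym (E k)); exists j, (i - j)%N.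
  by split; [rewrite subn_gt0|exists x].
(* The exponent has to be a multiple of the period d and at least the preperiod u. *)
exists (d * u.+1)%N; first by rewrite muln_gt0 d0.
have [y Ay yE] : exists2 y, inZpc y & c ^+ (d * u.+1) - 1 = (c ^+ d - 1) * y.
  exists (\sum_(k < u.+1) (c ^+ d) ^+ k).
    elim/big_rec: _ => [|k y _ Ay]; first by exists 0; rewrite rmorph0 horner0.
    by apply: inZpcD => //; rewrite -exprM; apply: inZpcX.
  by rewrite -subrX1 exprM.
exists (c ^+ (d * u.+1 - u) * x * y).
  by apply: inZpcM => //; apply: inZpcM => //; apply: inZpcX.
have le : (u <= d * u.+1)%N by rewrite mulnS (leq_trans (leq_pmull u d0)) ?leq_addl.
rewrite expr2 -[X in _ - X]mulr1 -mulrBr yE.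
rewrite -[X in c ^+ X * (_ * y)](subnK le) exprD.
transitivity (c ^+ (d * u.+1 - u) * (c ^+ u * (c ^+ d - 1)) * y); first by ring.
by rewrite xE; ring.
Qed.

(** The Newton iteration f |-> 3 f^2 - 2 f^3 lifts an idempotent modulo p to an idempotent of V,
    which is 0 or 1 because C is a field. *)
Lemma lift_idempotent e : inZpc e -> (exists2 x, inZpc x & e ^+ 2 - e = p%:R * x) ->
  exists2 x, V x & e = p%:R * x \/ e - 1 = p%:R * x.
Proof.
move=> Ae e2.
have step (j : nat) (f : C) : exists g, inZpc f ->
    (exists2 x, inZpc x & f ^+ 2 - f = p%:R ^+ j.+1 * x) ->
    [/\ inZpc g, exists2 x, inZpc x & g ^+ 2 - g = p%:R ^+ j.+2 * x
      & exists2 x, inZpc x & g - f = p%:R ^+ j.+1 * x].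
  (* The new defect is (f^2 - f)^2 (4 (f^2 - f) - 3); recording a gain of one power of p per step is
     enough. *)
  exists (3 * f ^+ 2 - 2 * f ^+ 3) => Af [x Ax fx].
  have A2 : inZpc (f ^+ 2) by rewrite expr2; apply: inZpcM.
  have A3 : inZpc (f ^+ 3) by rewrite exprS; apply: inZpcM.
  split.
  - by apply: inZpcD; [|apply: inZpcN]; apply: inZpcM => //; apply: inZpc_nat.
  - exists (p%:R ^+ j * x ^+ 2 * (4 * (f ^+ 2 - f) - 3)).
      apply: inZpcM; first apply: inZpcM.
      + by rewrite -Zp_qbar_p; apply: inZpcZ.
      + by rewrite expr2; apply: inZpcM.
      + apply: inZpcD; last by apply/inZpcN/inZpc_nat.
        by apply: inZpcM; [exact: inZpc_nat|apply: inZpcD => //; apply: inZpcN].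
    transitivity ((f ^+ 2 - f) ^+ 2 * (4 * (f ^+ 2 - f) - 3)); first by ring.
    by rewrite {1}fx !exprS; ring.
  - exists ((1 - 2 * f) * x).
      apply: inZpcM => //; apply: inZpcD; first exact: inZpc1.
      by apply/inZpcN/inZpcM => //; apply: inZpc_nat.
    transitivity ((1 - 2 * f) * (f ^+ 2 - f)); first by ring.
    by rewrite fx; ring.
have [g gP] := choice (fun jf : nat * C => step jf.1 jf.2).
pose s := fix s j := if j is k.+1 then g (k, s k) else e.
have sP j : inZpc (s j) /\
    exists2 x, inZpc x & s j ^+ 2 - s j = p%:R ^+ j.+1 * x.
  elim: j => [|j [IH1 IH2]]; first by split=> //=; rewrite expr1.
  by have [] := gP (j, s j) IH1 IH2.
have ds j : exists2 x, inZpc x & s j.+1 - s j = p%:R ^+ j.+1 * x.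
  by have [sj1 sj2] := sP j; have [] := gP (j, s j) sj1 sj2.
have /choice[x xP] j : exists x, inZpc x /\ s j.+1 - s j = p%:R ^+ j.+1 * x.
  by have [x ? ?] := ds j; exists x.
have [n nP] := inZpc_bound.
(* Convergence takes place on coordinates in Z_p of the increments with respect to 1, c, ...,
   c^(n-1). *)
have [a aP] := choice (fun j => nP _ (xP j).1).
have [l lP] := choice (fun k => Zp_sum_lim (fun j => a j k)).
pose lim := e + p%:R * \sum_(k < n) Zp_qbar C (l k) * c ^+ k.
have sE j : s j = e + p%:R * \sum_(i < j) p%:R ^+ i * x i.
  elim: j => [|j IHj]; first by rewrite big_ord0 mulr0 addr0.
  rewrite big_ord_recr /= mulrDr addrA -IHj mulrA -exprS -(xP j).2.
  by rewrite addrC subrK.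
have limP j : pV j (lim - s j).
  rewrite sE opprD addrACA subrr add0r -mulrBr; apply: pVMl; first exact: Vnat.
  have -> : \sum_(i < j) p%:R ^+ i * x i =
      \sum_(k < n) Zp_qbar C (\sum_(i < j) p%:R ^+ i * a i k) * c ^+ k.
    rewrite (eq_bigr (fun i : 'I_j => \sum_(k < n) Zp_qbar C (p%:R ^+ i * a i k) * c ^+ k)).
      rewrite exchange_big; apply: eq_bigr => k _ /=.
      by rewrite rmorph_sum mulr_suml.
    move=> i _; rewrite {1}aP mulr_sumr; apply: eq_bigr => k _.
    by rewrite rmorphM /= Zp_qbar_p mulrA.
  rewrite -sumrB; apply: pVsum => k _; rewrite -mulrBl -rmorphB.
  have [y ->] := lP k j; rewrite rmorphM /= Zp_qbar_p mulrC.
  by apply: pVMl; [exact: VX|exists (Zp_qbar C y) => //; exact: V_Zp].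
have Vlim : V lim.
  have -> : lim = (lim - s 0%N) + e by rewrite subrK.
  by apply: VD; [apply: pV_V (limP 0%N)|exact: inZpc_V].
have lim2 : lim ^+ 2 - lim = 0.
  apply: qbar_sep => j.
  have -> : lim ^+ 2 - lim = (lim + s j - 1) * (lim - s j) + (s j ^+ 2 - s j) by ring.
  apply: pVD.
    apply: pVMl (limP j); apply: VB V1; apply: VD => //.
    by apply/inZpc_V; case: (sP j).
  have [_ [y Ay ->]] := sP j; apply: (@pVW j.+1); first exact: leqnSn.
  by exists y => //; apply: inZpc_V.
pose y := \sum_(k < n) Zp_qbar C (l k) * c ^+ k.
have Vy : V y by apply: Vsum => k _; apply: VM; [exact: V_Zp|exact: VX].
exists (- y); first exact: VN.
move/eqP: lim2; rewrite expr2 -[X in _ - X]mul1r -mulrBl mulf_eq0 => /orP[|] /eqP E.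
  right; have -> : e = lim - p%:R * y by rewrite /lim addrK.
  by rewrite addrAC E add0r mulrN.
left; have -> : e = lim - p%:R * y by rewrite /lim addrK.
by rewrite E sub0r mulrN.
Qed.

End Monogenic.

(** Some power of c is 0 or 1 modulo p. In the first case c is in the radical of (p); in the second
    it is a unit, as every 1 + p x is. Thus V is local with maximal ideal [qbar_max]. *)
Lemma V_dich c : V c -> mm c \/ (c != 0 /\ V c^-1).
Proof.
move=> Vc; have [k k0 E] := power_idempotent_mod_p Vc.
have [x Vx [xE|xE]] := lift_idempotent Vc (inZpcX c k) E.
  by left; split=> //; exists k, x; rewrite ?expr1.
right; have [b0 Vb] := V_1p_inv Vx.
have cE : c ^+ k = 1 + p%:R * x by rewrite -xE addrC subrK.
have c0 : c != 0 by apply: contraNneq b0 => c0; rewrite -cE c0 expr0n gtn_eqF.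
split=> //; have -> : c^-1 = c ^+ k.-1 * (c ^+ k)^-1.
  by rewrite -[in RHS](prednK k0) exprS /= invfM mulrCA divff ?mulr1 // expf_neq0.
by apply: VM; [exact: VX|rewrite cE].
Qed.

Lemma mmV c : mm c -> V c. Proof. by case. Qed.

Lemma mm_nunit c : mm c -> c != 0 -> ~ V c^-1.
Proof.
move=> [Vc [k [d Vd E]]] c0 Vi; case: V_pinv.
have -> : p%:R^-1 = d * c^-1 ^+ k.
  have d0 : d != 0.
    by apply: contraNneq (expf_neq0 k c0) => d0; rewrite E d0 mulr0.
  by rewrite exprVn E expr1; field; rewrite d0 cp_neq0.
by apply: VM => //; apply: VX.
Qed.

Lemma mm_prime a b : V a -> V b -> mm (a * b) -> mm a \/ mm b.
Proof.
move=> Va Vb ab; have [|[a0 Via]] := V_dich Va; first by left.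
have [|[b0 Vib]] := V_dich Vb; first by right.
case: (mm_nunit ab); first by rewrite mulf_neq0.
by rewrite invfM; apply: VM.
Qed.

Lemma mm0 : mm 0.
Proof. by split; [exact: V0|exists 1%N; rewrite expr1; apply: pV0]. Qed.

Lemma mmM a b : V a -> mm b -> mm (a * b).
Proof.
move=> Va [Vb [k kP]]; split; first exact: VM.
by exists k; rewrite exprMn; apply: pVMl => //; apply: VX.
Qed.

Lemma mmMr a b : mm a -> V b -> mm (a * b).
Proof. by move=> ? ?; rewrite mulrC; apply: mmM. Qed.

Lemma mmN a : mm a -> mm (- a).
Proof. by move=> ma; rewrite -mulN1r; apply: mmM ma; apply/VN/V1. Qed.

Lemma mmD a b : mm a -> mm b -> mm (a + b).
Proof.
move=> [Va [k kP]] [Vb [l lP]]; split; first exact: VD.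
exists (k + l)%N; rewrite exprDn; apply: pVsum => i _; rewrite -mulr_natr mulrC.
apply: pVMl; first exact: Vnat.
have [il|li] := leqP l i.
  by rewrite -(subnKC il) exprD; apply: pVMl; [exact: VX|rewrite mulrC; apply: pVMl => //; exact: VX].
have ki : (k <= k + l - i)%N by rewrite -addnBA ?leq_addr // ltnW.
by rewrite -(subnKC ki) exprD mulrC; apply: pVMl; [exact: VX|rewrite mulrC; apply: pVMl => //; exact: VX].
Qed.

Lemma mmB a b : mm a -> mm b -> mm (a - b).
Proof. by move=> ? ?; apply: mmD => //; apply: mmN. Qed.

Lemma mmsum I (r : seq I) (P : pred I) (F : I -> C) :
  (forall i, P i -> mm (F i)) -> mm (\sum_(i <- r | P i) F i).
Proof. by move=> VF; apply: (big_ind mm) => //; [exact: mm0|exact: mmD]. Qed.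

Lemma pV_mm k c : pV k.+1 c -> mm c.
Proof.
move=> kc; split; first exact: pV_V kc.
by exists 1%N; rewrite expr1; apply: pVW kc.
Qed.

Lemma mm_p : mm p%:R.
Proof. by apply: (@pV_mm 0); exists 1; [exact: V1|rewrite mulr1 expr1]. Qed.

Lemma not_mm1 : ~ mm 1.
Proof. by move/mm_nunit; rewrite oner_neq0 invr1 => /(_ isT); apply; apply: V1. Qed.

Lemma not_mmE c : V c -> ~ mm c -> c != 0 /\ V c^-1.
Proof. by move=> /V_dich[]. Qed.

Lemma mmXn c n : mm c -> (0 < n)%N -> mm (c ^+ n).
Proof. by case: n => // n mc _; rewrite exprS mulrC; apply: mmM => //; apply/VX/mmV. Qed.

Lemma unit_1mm a : mm a -> 1 + a != 0 /\ V (1 + a)^-1.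
Proof.
move=> ma; apply: not_mmE; first by apply: VD; [exact: V1|exact: mmV].
by move=> m1; apply: not_mm1; rewrite -(addrK a 1); apply: mmB.
Qed.

Lemma unit_Dmm a b : a != 0 -> V a^-1 -> mm b -> a + b != 0 /\ V (a + b)^-1.
Proof.
move=> a0 Va mb; have [h1 h2] : 1 + a^-1 * b != 0 /\ V (1 + a^-1 * b)^-1.
  by apply: unit_1mm; apply: mmM.
have -> : a + b = a * (1 + a^-1 * b) by rewrite mulrDr mulr1 mulVKf.
by rewrite mulf_neq0 // invfM; split=> //; apply: VM.
Qed.

Lemma V_lead_mul n (f : {poly C}) c : (size f <= n.+2)%N -> (forall i, V f`_i) ->
  f.[c] = 0 -> V (f`_n.+1 * c).
Proof. exact: (@integral_lead_mul _ _ (@Zp_qbar p C)). Qed.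

(** Induction on the degree. With u the leading coefficient, u c is integral. If u or u c is a unit
    of V the claim follows; otherwise u c is absorbed into the next coefficient, which lowers the
    degree and preserves a unit coefficient. *)
Lemma V_or_inv_poly n (f : {poly C}) c : (size f <= n.+1)%N -> (forall i, V f`_i) ->
  f.[c] = 0 -> (exists i, f`_i != 0 /\ V (f`_i)^-1) -> V c \/ V c^-1.
Proof.
elim: n f => [|n IHn] f sf Vf fc [i [fi0 Vfi]].
  move: fi0 fc; rewrite (size1_polyC sf) hornerC coefC.
  by case: ifP => _; [move=> /eqP|rewrite eqxx].
have Vuc := V_lead_mul sf Vf fc; set u := f`_n.+1 in Vuc.
have [mu|[u0 Viu]] := V_dich (Vf n.+1); last first.
  by left; rewrite -[c](mulKf u0); apply: VM.
have [muc|[uc0 Viuc]] := V_dich Vuc; last first.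
  right; move: uc0; rewrite mulf_eq0 negb_or => /andP[u0 c0].
  have -> : c^-1 = u * (u * c)^-1 by rewrite invfM mulVKf.
  by apply: VM => //; apply: Vf.
pose g := \poly_(j < n.+1) (if j == n then u * c + f`_n else f`_j).
apply: (IHn g); first exact: size_poly.
- move=> j; rewrite coef_poly; case: ifP => _; last exact: V0.
  by case: ifP => _ //; apply: VD.
- rewrite horner_poly big_ord_recr /= eqxx -[RHS]fc (horner_coef_wide _ sf).
  rewrite !big_ord_recr /= -addrA; congr (_ + _).
    by apply: eq_bigr => j _; rewrite ltn_eqF // ltn_ord.
  by rewrite mulrDl addrC -/u exprS mulrA.
(* The leading coefficient is in the maximal ideal, so the unit coefficient survives in [g], at
   worst shifted by the element u c of the maximal ideal. *)
have ni : i != n.+1.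
  by apply: contraPneq Vfi => E; rewrite E; apply: mm_nunit => //; rewrite -E.
have lti : (i < n.+1)%N.
  rewrite ltn_neqAle ni /= -ltnS ltnNge; apply/negP => le.
  by move: fi0; rewrite nth_default ?eqxx // (leq_trans sf).
exists i; rewrite coef_poly lti; case: (i =P n) => [E|//].
by rewrite addrC; apply: unit_Dmm => //; rewrite -E.
Qed.

(** An annihilator over Z_p, divided by the largest power of p dividing it, has a unit coefficient.
    This makes V a valuation ring. *)
Lemma V_or_inv c : V c \/ V c^-1.
Proof.
have [k [R Rm Rc]] := qbar_clear c.
pose P0 : {poly Zp} := R \Po (p%:R ^+ k *: 'X).
have P0c : (map_poly (@Zp_qbar p C) P0).[c] = 0.
  rewrite map_comp_poly horner_comp map_polyZ /= map_polyX !hornerE /= Zp_qbar_p.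
  exact/eqP.
have P00 : P0 != 0.
  rewrite -size_poly_eq0 /P0 size_comp_poly2 ?size_poly_eq0 ?monic_neq0 //.
  by rewrite size_scale ?size_polyX ?pX_neq0.
have [j j0] : exists j, P0`_j != 0.
  by exists (size P0).-1; rewrite -lead_coefE lead_coef_eq0.
have [b [u [uu bE]]] := Zp_valP j0.
have [e [Q [QE [i ui]]]] : exists e (Q : {poly Zp}),
    P0 = p%:R ^+ e *: Q /\ exists i, Q`_i \is a GRing.unit.
  have exE : exists e, `[< exists Q : {poly Zp}, P0 = p%:R ^+ e *: Q >].
    by exists 0%N; apply/asboolP; exists P0; rewrite scale1r.
  (* The valuation b of one nonzero coefficient bounds the power of p that can be removed. *)
  have bd e : `[< exists Q : {poly Zp}, P0 = p%:R ^+ e *: Q >] -> (e <= b)%N.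
    move=> /asboolP[Q QE]; rewrite leqNgt; apply/negP => lt.
    have /negP[] := p_nunit p; apply/unitrPr; exists (p%:R ^+ (e - b.+1) * Q`_j * u^-1).
    apply: (mulfI (pX_neq0 p b)); rewrite mulr1.
    transitivity (P0`_j * u^-1); last by rewrite bE mulrK.
    rewrite [in RHS]QE coefZ -[in RHS](subnKC lt) exprD exprSr; ring.
  have [e /asboolP[Q QE] emax] := ex_maxnP exE bd; exists e, Q; split=> //.
  apply: contrapT => nu.
  have /choice[q qE] i : exists q, Q`_i = p%:R * q.
    by apply: contrapT => /Zp_unit_ndvd ui; apply: nu; exists i.
  suff /emax : `[< exists Q : {poly Zp}, P0 = p%:R ^+ e.+1 *: Q >] by rewrite ltnn.
  apply/asboolP; exists (\poly_(i < size Q) q i); rewrite QE exprSr -scalerA.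
  congr (_ *: _); apply/polyP => i; rewrite coefZ coef_poly.
  by case: ltnP => // le; rewrite nth_default // mulr0.
apply: (@V_or_inv_poly (size Q) (map_poly (@Zp_qbar p C) Q)).
- by rewrite (leq_trans (size_poly _ _)).
- by move=> j'; rewrite coef_map; apply: V_Zp.
- move/eqP: P0c; rewrite QE map_polyZ hornerZ mulf_eq0 /= Zp_qbar_p.
  by rewrite (negPf (qp_neq0 e)) => /eqP.
exists i; rewrite coef_map /=.
have E : Zp_qbar C Q`_i * Zp_qbar C (Q`_i)^-1 = 1 by rewrite -rmorphM divrr // rmorph1.
have n0 : Zp_qbar C Q`_i != 0.
  by apply: contra_eq_neq E => ->; rewrite mul0r eq_sym oner_eq0.
split=> //; rewrite (_ : _^-1 = Zp_qbar C (Q`_i)^-1); first exact: V_Zp.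
by apply: (mulfI n0); rewrite E divff.
Qed.

Lemma V_or_mm c : V c \/ (c != 0 /\ mm c^-1).
Proof.
have [c0|c0] := eqVneq c 0; first by left; rewrite c0; apply: V0.
have [|Vi] := V_or_inv c; first by left.
have [|[_]] := V_dich Vi; first by right.
by rewrite invrK; left.
Qed.

End IntegersOfClosure.

(** * Group law on a Weierstrass curve *)

(* The group law is transported from the class monoid of the coordinate ring: a
   finitely generated ideal is given by a list of generators. *)
Section IdealLists.
Variable R : comNzRingType.
Implicit Types (g h k : seq R) (x y a b : R).

Fixpoint ispan g (x : R) : Prop :=
  if g is a :: g' then exists c, ispan g' (x - c * a) else x = 0.

Definition imul g h : seq R := [seq a * b | a <- g, b <- h].

Definition ieq g h := forall x, ispan g x <-> ispan h x.

Lemma ispan0 g : ispan g 0.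
Proof. by elim: g => [|a g IHg] //=; exists 0; rewrite mul0r subr0. Qed.

Lemma ispanD g x y : ispan g x -> ispan g y -> ispan g (x + y).
Proof.
elim: g x y => [|a g IHg] x y /=; first by move=> -> ->; rewrite addr0.
move=> [c cP] [d dP]; exists (c + d).
have -> : x + y - (c + d) * a = (x - c * a) + (y - d * a) by ring.
exact: IHg.
Qed.

Lemma ispanM g r x : ispan g x -> ispan g (r * x).
Proof.
elim: g x => [|a g IHg] x /=; first by move=> ->; rewrite mulr0.
by move=> [c /IHg cP]; exists (r * c); rewrite -mulrA -mulrBr.
Qed.

Lemma ispan_mem g a : a \in g -> ispan g a.
Proof.
elim: g => //= b g IHg; rewrite inE => /predU1P[->|/IHg ag].
  by exists 1; rewrite mul1r subrr; apply: ispan0.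
by exists 0; rewrite mul0r subr0.
Qed.

Lemma ispan_ind g (P : R -> Prop) : P 0 -> (forall x y, P x -> P y -> P (x + y)) ->
    (forall r x, P x -> P (r * x)) -> (forall a, a \in g -> P a) ->
  forall x, ispan g x -> P x.
Proof.
move=> P0 PD PM; elim: g => [|a g IHg] Pg x /=; first by move=> ->.
move=> [c cP]; rewrite -(subrK (c * a) x); apply: PD.
  by apply: IHg cP => b bg; apply: Pg; rewrite inE bg orbT.
by apply/PM/Pg; rewrite mem_head.
Qed.

Lemma ispan_sub g h : (forall a, a \in g -> ispan h a) -> forall x, ispan g x -> ispan h x.
Proof.
by apply: ispan_ind; [exact: ispan0|exact: ispanD|exact: ispanM].
Qed.

Lemma ieq_sub g h : (forall a, a \in g -> ispan h a) -> (forall a, a \in h -> ispan g a) ->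
  ieq g h.
Proof. by move=> gh hg x; split; apply: ispan_sub. Qed.

Lemma ieq_mem g h : g =i h -> ieq g h.
Proof. by move=> gh; apply: ieq_sub => a; [rewrite gh|rewrite -gh]; apply: ispan_mem. Qed.

Lemma ieq_sym g h : ieq g h -> ieq h g.
Proof. by move=> gh x; split=> /gh. Qed.

Lemma ieq_trans g h k : ieq g h -> ieq h k -> ieq g k.
Proof. by move=> gh hk x; split=> [/gh/hk|/hk/gh]. Qed.

Lemma mem_imul g h x : reflect (exists a b, [/\ a \in g, b \in h & x = a * b]) (x \in imul g h).
Proof.
apply: (iffP allpairsP) => [[[a b] /= [ag bh ->]]|[a [b [ag bh ->]]]].
  by exists a, b.
by exists (a, b).
Qed.

Lemma ispan_imul g h x y : ispan g x -> ispan h y -> ispan (imul g h) (x * y).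
Proof.
move=> gx hy; move: x gx; apply: ispan_ind.
- by rewrite mul0r; apply: ispan0.
- by move=> x x'; rewrite mulrDl; apply: ispanD.
- by move=> r x; rewrite -mulrA; apply: ispanM.
move=> a ag; move: y hy; apply: ispan_ind.
- by rewrite mulr0; apply: ispan0.
- by move=> x x'; rewrite mulrDr; apply: ispanD.
- by move=> r x; rewrite mulrCA; apply: ispanM.
by move=> b bh; apply/ispan_mem/mem_imul; exists a, b.
Qed.

Lemma imulC g h : ieq (imul g h) (imul h g).
Proof.
by apply: ieq_mem => x; apply/mem_imul/mem_imul => -[a [b [? ? ->]]]; exists b, a;
  rewrite mulrC.
Qed.

Lemma imulA g h k : ieq (imul g (imul h k)) (imul (imul g h) k).
Proof.
apply: ieq_mem => x; apply/mem_imul/mem_imul.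
  move=> [a [_ [ag /mem_imul[b [c [bh ck ->]]] ->]]]; exists (a * b), c.
  by split=> //; [apply/mem_imul; exists a, b|rewrite mulrA].
move=> [_ [c [/mem_imul[a [b [ag bh ->]]] ck ->]]]; exists a, (b * c).
by split=> //; [apply/mem_imul; exists b, c|rewrite mulrA].
Qed.

Lemma ieq_imull g g' h : ieq g g' -> ieq (imul g h) (imul g' h).
Proof.
move=> gg; apply: ieq_sub => _ /mem_imul[a [b [ag bh ->]]].
  by apply: ispan_imul; [apply/gg/ispan_mem|apply: ispan_mem].
by apply: ispan_imul; [apply/gg/ispan_mem|apply: ispan_mem].
Qed.

Lemma ieq_imul g g' h h' : ieq g g' -> ieq h h' -> ieq (imul g h) (imul g' h').
Proof.
move=> gg hh; apply: (ieq_trans (ieq_imull h gg)).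
apply: (ieq_trans (imulC _ _)); apply: (ieq_trans (ieq_imull g' hh)); exact: imulC.
Qed.

Lemma imul1 g : ieq (imul [:: 1] g) g.
Proof.
apply: ieq_mem => x; apply/mem_imul/idP => [[a [b [/[!inE]/eqP-> bg ->]]]|xg].
  by rewrite mul1r.
by exists 1, x; rewrite mem_head mul1r.
Qed.

Lemma imul11 a b : imul [:: a] [:: b] = [:: a * b].
Proof. by []. Qed.

Lemma ispan1P a x : ispan [:: a] x <-> exists c, x = c * a.
Proof.
split=> /= -[c E]; exists c; first by apply/eqP; rewrite -subr_eq0 E.
by rewrite E subrr.
Qed.

Lemma ispan_imul1 a g x : ispan (imul [:: a] g) x <-> exists2 y, ispan g y & x = a * y.
Proof.
split=> [|[y gy ->]]; last by apply: ispan_imul => //; apply: ispan_mem; rewrite mem_head.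
have -> : imul [:: a] g = [seq a * b | b <- g] by rewrite /imul /= cats0.
elim: g x => [|b g IHg] x /=; first by move=> ->; exists 0; rewrite ?mulr0.
move=> [c /IHg[y gy E]]; exists (y + c * b).
  by exists c; rewrite addrK.
by rewrite mulrDr -E mulrCA subrK.
Qed.

Lemma factor_list l g : (forall a, a \in g -> exists b, a = l * b) ->
  exists j, g = imul [:: l] j.
Proof.
have E j : imul [:: l] j = [seq l * b | b <- j] by rewrite /imul /= cats0.
elim: g => [|a g IHg] gl; first by exists [::].
have [j jE] : exists j, g = imul [:: l] j.
  by apply: IHg => b bg; apply: gl; rewrite inE bg orbT.
by have [b bE] := gl a (mem_head _ _); exists (b :: j); rewrite E /= -E -jE -bE.
Qed.

End IdealLists.

Section IdealClasses.
Variable R : idomainType.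
Implicit Types (g h k : seq R) (a b : R).

Definition icls g h := exists a b, [/\ a != 0, b != 0
  & ieq (imul [:: a] g) (imul [:: b] h)].

Lemma icls_ieq g h : ieq g h -> icls g h.
Proof.
by move=> gh; exists 1, 1; split; rewrite ?oner_neq0 //; apply: ieq_imul.
Qed.

Lemma icls_sym g h : icls g h -> icls h g.
Proof. by move=> [a [b [a0 b0 E]]]; exists b, a; split=> //; apply: ieq_sym. Qed.

Lemma icls_trans g h k : icls g h -> icls h k -> icls g k.
Proof.
move=> [a [b [a0 b0 E]]] [c [d [c0 d0 E']]]; exists (c * a), (b * d).
split; rewrite ?mulf_neq0 // -!imul11.
apply: (ieq_trans (ieq_sym (imulA _ _ _))).
apply: (ieq_trans (ieq_imul (fun=> iff_refl _) E)).
apply: (ieq_trans (imulA _ _ _)).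
apply: (ieq_trans (ieq_imull _ (imulC _ _))).
apply: (ieq_trans (ieq_sym (imulA _ _ _))).
apply: (ieq_trans (ieq_imul (fun=> iff_refl _) E')).
exact: imulA.
Qed.

Lemma icls_imull g g' h : icls g g' -> icls (imul g h) (imul g' h).
Proof.
move=> [a [b [a0 b0 E]]]; exists a, b; split=> //.
apply: (ieq_trans (imulA _ _ _)); apply: (ieq_trans (ieq_imull h E)).
exact/ieq_sym/imulA.
Qed.

Lemma icls_imul g g' h h' : icls g g' -> icls h h' -> icls (imul g h) (imul g' h').
Proof.
move=> gg hh; apply: (icls_trans (icls_imull h gg)).
apply: (icls_trans (icls_ieq (imulC _ _))).
apply: (icls_trans (icls_imull g' hh)); exact/icls_ieq/imulC.
Qed.

(* If [g = l j] and [g' = l' j'] with [g g' = (l l')], then [j j' = (1)], so [j]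
   itself is the unit ideal. *)
Lemma principal_of_mul g g' l l' : l != 0 -> l' != 0 ->
    (forall a, a \in g -> exists b, a = l * b) ->
    (forall a, a \in g' -> exists b, a = l' * b) ->
  ieq (imul g g') [:: l * l'] -> ieq g [:: l].
Proof.
move=> l0 l'0 /factor_list[j ->] /factor_list[j' ->] E.
have E1 : ieq (imul [:: l * l'] (imul j j')) [:: l * l'].
  apply: ieq_trans E; rewrite -imul11 => x.
  have P : ieq (imul (imul [:: l] [:: l']) (imul j j'))
               (imul (imul [:: l] j) (imul [:: l'] j')).
    apply: (ieq_trans (ieq_sym (imulA _ _ _))).
    apply: ieq_trans (imulA _ _ _); apply: ieq_imul => //.
    apply: (ieq_trans (imulA _ _ _)).
    apply: (ieq_trans (ieq_imull _ (imulC _ _))); exact/ieq_sym/imulA.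
  exact: P.
have /E1/ispan_imul1[y jy yE] : ispan [:: l * l'] (l * l').
  by apply: ispan_mem; rewrite mem_head.
have y1 : y = 1.
  by apply: (@mulfI _ (l * l')); rewrite ?mulf_neq0 // -yE mulr1.
rewrite y1 in jy.
have j1 : ispan j 1.
  apply: ispan_sub jy => _ /mem_imul[a [b [aj bj ->]]].
  by rewrite mulrC; apply/ispanM/ispan_mem.
apply: (@ieq_trans _ _ (imul [:: l] [:: 1])); last by rewrite imul11 mulr1.
apply: ieq_imul => // x; split=> [_|_]; last by rewrite -[x]mulr1; apply: ispanM.
by apply/ispan1P; exists x; rewrite mulr1.
Qed.

End IdealClasses.

(** * The coordinate ring of Y^2 = f(X) for a cubic f *)

Section CoordinateRing.
Variables (F : fieldType) (f : {poly F}).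
Hypothesis sf : size f = 4%N.

(** Elements [cu + cv Y] with Y^2 = f. The proof that f is a cubic is a parameter of the type
    because the integral domain structure depends on it. *)
Record crd_of (sf' : size f = 4%N) := CrdC { cu : {poly F}; cv : {poly F} }.
Local Notation crd := (crd_of sf).
Local Notation Crd := (@CrdC sf).

HB.instance Definition _ := gen_eqMixin crd.
HB.instance Definition _ := gen_choiceMixin crd.

Lemma crdP (a b : crd) : cu a = cu b -> cv a = cv b -> a = b.
Proof. by case: a b => [u v] [u' v'] /= -> ->. Qed.

Definition crd_add (a b : crd) := Crd (cu a + cu b) (cv a + cv b).
Definition crd_opp (a : crd) := Crd (- cu a) (- cv a).
Definition crd_mul (a b : crd) :=
  Crd (cu a * cu b + cv a * cv b * f) (cu a * cv b + cv a * cu b).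

Fact crd_addA : associative crd_add.
Proof. by move=> a b c; apply: crdP => /=; ring. Qed.
Fact crd_addC : commutative crd_add.
Proof. by move=> a b; apply: crdP => /=; ring. Qed.
Fact crd_add0 : left_id (Crd 0 0) crd_add.
Proof. by move=> a; apply: crdP => /=; ring. Qed.
Fact crd_addN : left_inverse (Crd 0 0) crd_opp crd_add.
Proof. by move=> a; apply: crdP => /=; ring. Qed.

HB.instance Definition _ := GRing.isZmodule.Build crd
  crd_addA crd_addC crd_add0 crd_addN.

Fact crd_mulA : associative crd_mul.
Proof. by move=> a b c; apply: crdP => /=; ring. Qed.
Fact crd_mulC : commutative crd_mul.
Proof. by move=> a b; apply: crdP => /=; ring. Qed.
Fact crd_mul1 : left_id (Crd 1 0) crd_mul.
Proof. by move=> a; apply: crdP => /=; ring. Qed.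
Fact crd_mulD : left_distributive crd_mul (+%R : crd -> crd -> crd).
Proof. by move=> a b c; apply: crdP => /=; ring. Qed.
Fact crd_1neq0 : Crd 1 0 != 0.
Proof. by apply/eqP => -[] /eqP; rewrite oner_eq0. Qed.

HB.instance Definition _ := GRing.Zmodule_isComNzRing.Build crd
  crd_mulA crd_mulC crd_mul1 crd_mulD crd_1neq0.

Lemma cuD (a b : crd) : cu (a + b) = cu a + cu b. Proof. by []. Qed.
Lemma cvD (a b : crd) : cv (a + b) = cv a + cv b. Proof. by []. Qed.
Lemma cuN (a : crd) : cu (- a) = - cu a. Proof. by []. Qed.
Lemma cvN (a : crd) : cv (- a) = - cv a. Proof. by []. Qed.
Lemma cuM (a b : crd) : cu (a * b) = cu a * cu b + cv a * cv b * f. Proof. by []. Qed.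
Lemma cvM (a b : crd) : cv (a * b) = cu a * cv b + cv a * cu b. Proof. by []. Qed.

Definition crd_norm (a : crd) : {poly F} := cu a ^+ 2 - cv a ^+ 2 * f.

Lemma crd_normM a b : crd_norm (a * b) = crd_norm a * crd_norm b.
Proof. by rewrite /crd_norm cuM cvM; ring. Qed.

Lemma f_neq0 : f != 0.
Proof. by rewrite -size_poly_eq0 sf. Qed.

Lemma size_sqr (u : {poly F}) : size (u ^+ 2) = if u == 0 then 0%N else (2 * size u).-1.
Proof.
case: eqP => [->|/eqP u0]; first by rewrite expr0n size_poly0.
by rewrite expr2 size_mul // mul2n addnn.
Qed.

(** The terms u^2 and v^2 f have degrees of opposite parity, so nothing cancels. *)
Lemma size_crd_norm a : size (crd_norm a) =
  maxn (if cu a == 0%R then 0%N else (2 * size (cu a)).-1)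
       (if cv a == 0%R then 0 else 2 * size (cv a) + 2)%N.
Proof.
have sv : size (cv a ^+ 2 * f) = (if cv a == 0%R then 0 else 2 * size (cv a) + 2)%N.
  case: eqP => [->|/eqP v0]; first by rewrite expr0n mul0r size_poly0.
  rewrite size_mul ?expf_neq0 ?f_neq0 // size_sqr (negPf v0) sf.
  by have := v0; rewrite -size_poly_gt0; lia.
rewrite /crd_norm -size_sqr -sv.
have : size (cu a ^+ 2) != size (cv a ^+ 2 * f) \/ (cu a == 0 /\ cv a == 0).
  rewrite size_sqr sv; have [u0|u0] := eqVneq (cu a) 0; have [v0|v0] := eqVneq (cv a) 0.
  - by right.
  - by left; rewrite -?size_poly_gt0 in v0 *; lia.
  - by left; rewrite -?size_poly_gt0 in u0 *; lia.
  - by left; rewrite -?size_poly_gt0 in u0 v0 *; lia.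
case=> [|[/eqP-> /eqP->]]; last by rewrite expr0n mul0r subr0 size_poly0.
rewrite neq_ltn => /orP[] lt.
  by rewrite addrC size_polyDl size_polyN //; rewrite (maxn_idPr (ltnW lt)).
by rewrite size_polyDl ?size_polyN // (maxn_idPl (ltnW lt)).
Qed.

Lemma crd_norm_eq0 a : crd_norm a = 0 -> a = 0.
Proof.
move/(congr1 (size : {poly F} -> nat)); rewrite size_crd_norm size_poly0.
case: eqP => u0; case: eqP => v0; first by move=> _; apply: crdP.
- by lia.
- by move/eqP: u0; rewrite -size_poly_gt0; lia.
- by lia.
Qed.

Lemma crd_norm_unit a : (size (crd_norm a) <= 1)%N -> a != 0 -> exists c : F, c != 0 /\ a = Crd c%:P 0.
Proof.
rewrite size_crd_norm => le a0.
have v0 : cv a = 0.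
  apply/eqP; move: le; rewrite geq_max => /andP[_]; case: ifP => // _; lia.
have su : (size (cu a) <= 1)%N.
  move: le; rewrite geq_max => /andP[le _]; move: le; case: eqP => [->|/eqP u0].
    by rewrite size_poly0.
  by rewrite -size_poly_gt0 in u0; lia.
exists (cu a)`_0; have uE := size1_polyC su; split; last exact: crdP.
by apply: contra_neq a0 => u00; apply: crdP => //; rewrite uE u00.
Qed.

(** Degree 1 is neither even nor 3 plus an even number. This is what keeps the ideal of a point from
    being principal. *)
Lemma crd_norm_size2 a : size (crd_norm a) <> 2%N.
Proof.
rewrite size_crd_norm; case: eqP => u0; case: eqP => v0; try lia.
  by move/eqP: v0; rewrite -size_poly_gt0; lia.
by move/eqP: v0; rewrite -size_poly_gt0; lia.
Qed.

Fact crd_mulf_eq0 (a b : crd) : a * b = 0 -> (a == 0) || (b == 0).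
Proof.
move/(congr1 crd_norm); rewrite crd_normM {3}/crd_norm expr0n mul0r subr0.
move/eqP; rewrite mulf_eq0 => /orP[] /eqP/crd_norm_eq0 ->; rewrite eqxx ?orbT //.
Qed.

Definition crd_unit : {pred crd} := fun x => `[< exists y : crd, y * x = 1 >].
Definition crd_inv (x : crd) : crd := xget x [set y | y * x = 1].

Fact crd_mulV : {in crd_unit, left_inverse 1 crd_inv *%R}.
Proof. by move=> x /asboolP[y yx]; rewrite /crd_inv; case: xgetP => // /(_ y). Qed.

Fact crd_unitP (x y : crd) : y * x = 1 -> crd_unit x.
Proof. by move=> yx; apply/asboolP; exists y. Qed.

Fact crd_inv_out : {in [predC crd_unit], crd_inv =1 id}.
Proof.
move=> x /negP xN; rewrite /crd_inv; case: xgetP => // y _ /= yx.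
by case: xN; apply: crd_unitP yx.
Qed.

HB.instance Definition _ := GRing.ComNzRing_hasMulInverse.Build crd
  crd_mulV crd_unitP crd_inv_out.
HB.instance Definition _ := GRing.ComUnitRing_isIntegral.Build crd crd_mulf_eq0.

Definition crd_iota (u : {poly F}) : crd := Crd u 0.

Fact crd_iota_additive : zmod_morphism crd_iota.
Proof. by move=> u v; apply: crdP => //=; rewrite subr0. Qed.
Fact crd_iota_multiplicative : monoid_morphism crd_iota.
Proof. by split=> // u v; apply: crdP => /=; rewrite !(mul0r, mulr0, addr0). Qed.
HB.instance Definition _ := GRing.isZmodMorphism.Build _ _ crd_iota crd_iota_additive.
HB.instance Definition _ := GRing.isMonoidMorphism.Build _ _ crd_iota crd_iota_multiplicative.

Definition crd_Y : crd := Crd 0 1.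

Lemma crd_Y2 : crd_Y ^+ 2 = crd_iota f.
Proof. by rewrite expr2; apply: crdP => /=; ring. Qed.

Definition crd_ev (x0 y0 : F) (a : crd) : F := (cu a).[x0] + (cv a).[x0] * y0.

Lemma crd_ev_iota x0 y0 u : crd_ev x0 y0 (crd_iota u) = u.[x0].
Proof. by rewrite /crd_ev /= horner0 mul0r addr0. Qed.

Lemma crd_evM x0 y0 a b : y0 ^+ 2 = f.[x0] ->
  crd_ev x0 y0 (a * b) = crd_ev x0 y0 a * crd_ev x0 y0 b.
Proof. by move=> E; rewrite /crd_ev cuM cvM !hornerE -E; ring. Qed.

Lemma crd_evB x0 y0 a b : crd_ev x0 y0 (a - b) = crd_ev x0 y0 a - crd_ev x0 y0 b.
Proof. by rewrite /crd_ev cuD cvD cuN cvN !hornerE; ring. Qed.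

Lemma crd_evD x0 y0 a b : crd_ev x0 y0 (a + b) = crd_ev x0 y0 a + crd_ev x0 y0 b.
Proof. by rewrite /crd_ev cuD cvD !hornerE /=; ring. Qed.

End CoordinateRing.

Section ImulExtra.
Variable R : comNzRingType.
Implicit Types (g h k : seq R).

Lemma imulACA g h g' h' :
  ieq (imul (imul g h) (imul g' h')) (imul (imul g g') (imul h h')).
Proof.
apply: (ieq_trans (ieq_sym (imulA _ _ _))); apply: ieq_trans (imulA _ _ _).
apply: ieq_imul => //; apply: (ieq_trans (imulA _ _ _)).
by apply: (ieq_trans (ieq_imull _ (imulC _ _))); apply/ieq_sym/imulA.
Qed.

(** Of the eight products of generators, seven contain l, and the remaining one is x1 x2 x3 = l
    l'. *)
Lemma triple_dvd (x1 x2 x3 l l' : R) : x1 * x2 * x3 = l * l' ->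
  forall a, a \in imul [:: x1; l] (imul [:: x2; l] [:: x3; l]) -> exists b, a = l * b.
Proof.
move=> E _ /mem_imul[a [_ [ag /mem_imul[b [c [bg cg ->]]] ->]]].
move: ag bg cg; rewrite !inE => /orP[] /eqP-> /orP[] /eqP-> /orP[] /eqP->;
  try by [exists (b * c); rewrite ?mulrA
        |exists (a * c); ring|exists (a * b); ring].
all: try by exists (x1 * x2); ring.
all: try by exists (x1 * x3); ring.
all: try by exists (x2 * x3); ring.
all: try by exists (x1 * l); ring.
all: try by exists (x2 * l); ring.
all: try by exists (x3 * l); ring.
all: try by exists (l * l); ring.
by exists l'; rewrite mulrA.
Qed.

Lemma ieq_shear (x y l c : R) : l = y - c * x -> ieq [:: x; y] [:: x; l].
Proof.
move=> ->; apply: ieq_sub => a; rewrite !inE => /orP[] /eqP->.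
- by apply: ispan_mem; rewrite mem_head.
- rewrite -[a in ispan _ a](subrK (c * x)); apply: ispanD.
    by apply: ispan_mem; rewrite !inE eqxx orbT.
  by apply/ispanM/ispan_mem; rewrite mem_head.
- by apply: ispan_mem; rewrite mem_head.
- apply: ispanD; first by apply: ispan_mem; rewrite !inE eqxx orbT.
  by rewrite -mulNr; apply/ispanM/ispan_mem; rewrite mem_head.
Qed.

End ImulExtra.

(** Bundled so that the group structure can be attached to a type of points. Characteristic 2 is
    excluded in order to complete the square. *)
Record ecurve (F : fieldType) := ECurve {
  ec_W :> weierstrass;
  ec_two : (2 : F) != 0;
  ec_disc : (wdisc ec_W)%:~R != 0 :> F }.

(** * Points of the curve as ideal classes *)

Section CurveGroup.
Variables (F : fieldType) (E : ecurve F).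
Let a1 : F := (wa1 E)%:~R. Let a2 : F := (wa2 E)%:~R. Let a3 : F := (wa3 E)%:~R.
Let a4 : F := (wa4 E)%:~R. Let a6 : F := (wa6 E)%:~R.
Implicit Types P Q : wpoint F.

Lemma wdiscE : (wdisc E)%:~R = (- (a1 ^+ 2 + 4 * a2) ^+ 2 *
    (a1 ^+ 2 * a6 + 4 * a2 * a6 - a1 * a3 * a4 + a2 * a3 ^+ 2 - a4 ^+ 2)
  - 8 * (2 * a4 + a1 * a3) ^+ 3 - 27 * (a3 ^+ 2 + 4 * a6) ^+ 2
  + 9 * (a1 ^+ 2 + 4 * a2) * (2 * a4 + a1 * a3) * (a3 ^+ 2 + 4 * a6)) :> F.
Proof. by rewrite /wdisc /a1 /a2 /a3 /a4 /a6; ring. Qed.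

(** Translating the point to the origin leaves the discriminant unchanged and replaces a2, a3, a4,
    a6 by c2, c3, c4, c6. At a singular point c3, c4 and c6 vanish, and the discriminant with
    them. *)
Lemma wnonsingular x y : on_wcurve E x y -> 2 * y + a1 * x + a3 = 0 ->
  3 * x ^+ 2 + 2 * a2 * x + a4 - a1 * y != 0.
Proof.
move=> /eqP; rewrite -/a1 -/a2 -/a3 -/a4 -/a6 => W0 e1.
apply: contra (ec_disc E) => /eqP e2; rewrite wdiscE.
pose c2 := a2 + 3 * x.
pose c3 := a3 + a1 * x + 2 * y.
pose c4 := a4 + 2 * x * a2 - y * a1 + 3 * x ^+ 2.
pose c6 := a6 + x * a4 + x ^+ 2 * a2 + x ^+ 3 - y * a3 - y ^+ 2 - x * y * a1.
have c30 : c3 = 0 by rewrite -e1 /c3; ring.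
have c40 : c4 = 0 by rewrite -e2 /c4; ring.
have c60 : c6 = 0.
  transitivity (x ^+ 3 + a2 * x ^+ 2 + a4 * x + a6 - (y ^+ 2 + a1 * x * y + a3 * y)).
    by rewrite /c6; ring.
  by rewrite W0 subrr.
apply/eqP; transitivity (- (a1 ^+ 2 + 4 * c2) ^+ 2 *
    (a1 ^+ 2 * c6 + 4 * c2 * c6 - a1 * c3 * c4 + c2 * c3 ^+ 2 - c4 ^+ 2)
  - 8 * (2 * c4 + a1 * c3) ^+ 3 - 27 * (c3 ^+ 2 + 4 * c6) ^+ 2
  + 9 * (a1 ^+ 2 + 4 * c2) * (2 * c4 + a1 * c3) * (c3 ^+ 2 + 4 * c6)).
  by rewrite /c2 /c3 /c4 /c6; ring.
by rewrite c30 c40 c60; ring.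
Qed.

Definition wneg P : wpoint F :=
  if P is Some (x, y) then Some (x, - y - a1 * x - a3) else None.

Lemma wneg_in P : in_wcurve E P -> in_wcurve E (wneg P).
Proof.
case: P => [[x y]|] //=; rewrite /on_wcurve -/a1 -/a2 -/a3 -/a4 -/a6 => /eqP <-.
by apply/eqP; ring.
Qed.

(** Halves are kept as opaque witnesses of c = 2 h, so that the identities involving them are
    polynomial. *)
Fact whalf_ex (c : F) : {h : F | c = 2 * h}.
Proof. by exists (c / 2); rewrite mulrC divfK // ec_two. Qed.
Let h1 := sval (whalf_ex a1). Let h3 := sval (whalf_ex a3).
(** Completing the square: the curve is (y + h1 x + h3)^2 = f(x). *)
Let f : {poly F} := 'X ^+ 3 + (a2 + h1 ^+ 2)%:P * 'X ^+ 2
  + (a4 + 2 * h1 * h3)%:P * 'X + (a6 + h3 ^+ 2)%:P.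

Fact size_wpoly : size f = 4%N.
Proof.
rewrite /f -!addrA size_polyDl size_polyXn // (leq_ltn_trans (size_polyD _ _)) //.
rewrite gtn_max; apply/andP; split.
  rewrite (leq_ltn_trans (size_polyMleq _ _)) // size_polyXn.
  by rewrite size_polyC; case: eqP.
rewrite (leq_ltn_trans (size_polyD _ _)) // gtn_max size_polyC; apply/andP; split.
  rewrite (leq_ltn_trans (size_polyMleq _ _)) // size_polyX.
  by rewrite size_polyC; case: eqP.
by case: eqP.
Qed.

Local Notation crd := (crd_of size_wpoly).
Let cC (c : F) : crd := crd_iota size_wpoly c%:P.
Let cX : crd := crd_iota size_wpoly 'X.
Let cY : crd := crd_Y size_wpoly - cC h1 * cX - cC h3.

Fact cC_zmod_morphism : zmod_morphism cC.
Proof. by move=> a b; rewrite /cC !rmorphB. Qed.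
Fact cC_monoid_morphism : monoid_morphism cC.
Proof. by split=> [|a b]; rewrite /cC ?rmorph1 // !rmorphM. Qed.
HB.instance Definition _ := GRing.isZmodMorphism.Build _ _ cC cC_zmod_morphism.
HB.instance Definition _ := GRing.isMonoidMorphism.Build _ _ cC cC_monoid_morphism.

Lemma a1E : a1 = 2 * h1. Proof. exact: svalP (whalf_ex a1). Qed.
Lemma a3E : a3 = 2 * h3. Proof. exact: svalP (whalf_ex a3). Qed.

Lemma crd_weq : cY ^+ 2 + cC a1 * cX * cY + cC a3 * cY =
  cX ^+ 3 + cC a2 * cX ^+ 2 + cC a4 * cX + cC a6.
Proof.
have Y2 := crd_Y2 size_wpoly.
have fE : crd_iota size_wpoly f = cX ^+ 3 + (cC a2 + cC h1 ^+ 2) * cX ^+ 2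
    + (cC a4 + 2 * cC h1 * cC h3) * cX + (cC a6 + cC h3 ^+ 2).
  transitivity (crd_iota size_wpoly ('X ^+ 3 + (a2 + h1 ^+ 2)%:P * 'X ^+ 2
    + (a4 + 2 * h1 * h3)%:P * 'X + (a6 + h3 ^+ 2)%:P)); first by [].
  by rewrite /cX /cC !(rmorph_nat, rmorphD, rmorphM, rmorphXn).
rewrite fE in Y2; rewrite /cY a1E a3E !(rmorph_nat, rmorphM) /=.
set Y := crd_Y _ in Y2 *; set A := cC h1; set B := cC h3.
apply/eqP; rewrite -subr_eq0; apply/eqP.
transitivity (Y ^+ 2 - (cX ^+ 3 + (cC a2 + A ^+ 2) * cX ^+ 2
    + (cC a4 + 2 * A * B) * cX + (cC a6 + B ^+ 2))); first by ring.
by rewrite Y2 subrr.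
Qed.

(** Generators of the ideal of functions vanishing at the point; the point at infinity corresponds
    to the unit ideal. *)
Definition gpt P : seq crd :=
  if P is Some (x, y) then [:: cX - cC x; cY - cC y] else [:: 1].

Lemma on_wcurve_crd x y : on_wcurve E x y ->
  cC y ^+ 2 + cC a1 * cC x * cC y + cC a3 * cC y =
  cC x ^+ 3 + cC a2 * cC x ^+ 2 + cC a4 * cC x + cC a6.
Proof.
by move=> /eqP/(congr1 cC); rewrite !(rmorphD, rmorphM, rmorphXn).
Qed.

Lemma crd_subX_neq0 x : cX - cC x != 0.
Proof. by apply/eqP => -[] /eqP; rewrite polyXsubC_eq0. Qed.

(** The product visibly lies in (X - x). That X - x belongs to it holds because one of the partial
    derivatives of the equation is nonzero at the point. *)
Lemma gpt_neg x y : on_wcurve E x y ->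
  ieq (imul (gpt (Some (x, y))) (gpt (wneg (Some (x, y))))) [:: cX - cC x].
Proof.
move=> xy; set g := imul _ _.
have e0 := on_wcurve_crd xy; have e := crd_weq.
have y'E : cC (- y - a1 * x - a3) = - cC y - cC a1 * cC x - cC a3.
  by rewrite !(rmorphB, rmorphN, rmorphM).
have K : (cY - cC y) * (cY - cC (- y - a1 * x - a3)) = (cX - cC x) *
    (cX ^+ 2 + cX * cC x + cC x ^+ 2 + cC a2 * (cX + cC x) + cC a4 - cC a1 * cY).
  apply/eqP; rewrite -subr_eq0; apply/eqP.
  transitivity ((cY ^+ 2 + cC a1 * cX * cY + cC a3 * cY -
       (cX ^+ 3 + cC a2 * cX ^+ 2 + cC a4 * cX + cC a6)) -
     (cC y ^+ 2 + cC a1 * cC x * cC y + cC a3 * cC y -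
       (cC x ^+ 3 + cC a2 * cC x ^+ 2 + cC a4 * cC x + cC a6))).
    by rewrite y'E; ring.
  by rewrite e e0 !subrr.
have g1 : ispan g ((cX - cC x) * (cX - cC x)) by apply: ispan_mem; rewrite !inE eqxx.
have g2 : ispan g ((cX - cC x) * (cY - cC (- y - a1 * x - a3))).
  by apply: ispan_mem; rewrite !inE eqxx ?orbT.
have g3 : ispan g ((cY - cC y) * (cX - cC x)).
  by apply: ispan_mem; rewrite !inE eqxx ?orbT.
have g4 : ispan g ((cY - cC y) * (cY - cC (- y - a1 * x - a3))).
  by apply: ispan_mem; rewrite !inE eqxx ?orbT.
have unitC c (z : crd) : c != 0 -> ispan g (cC c * z) -> ispan g z.
  move=> c0 gz; rewrite -[z]mul1r -(rmorph1 cC) -(mulVf c0) rmorphM -mulrA.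
  exact: ispanM.
apply: ieq_sub => a; last first.
  rewrite inE => /eqP ->.
  (* A nonzero derivative, in y or else in x, provides a combination of the generators equal to a
     nonzero constant times X - x. *)
  have [y0|y0] := eqVneq (2 * y + a1 * x + a3) 0; last first.
    apply: (unitC _ _ y0).
    have -> : cC (2 * y + a1 * x + a3) * (cX - cC x) =
        (cX - cC x) * (cY - cC (- y - a1 * x - a3)) + (-1) * ((cY - cC y) * (cX - cC x)).
      by rewrite y'E !(rmorph_nat, rmorphD, rmorphM) /=; ring.
    by apply: ispanD => //; apply: ispanM.
  apply: (unitC _ _ (wnonsingular xy y0)).
  have -> : cC (3 * x ^+ 2 + 2 * a2 * x + a4 - a1 * y) * (cX - cC x) =
      (cY - cC y) * (cY - cC (- y - a1 * x - a3))
      + (- (cX + 2 * cC x + cC a2)) * ((cX - cC x) * (cX - cC x))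
      + cC a1 * ((cY - cC y) * (cX - cC x)).
    by rewrite K !(rmorph_nat, rmorphB, rmorphD, rmorphM, rmorphXn) /=; ring.
  apply: ispanD; last exact: ispanM.
  by apply: ispanD => //; apply: ispanM.
have X1 : ispan [:: cX - cC x] (cX - cC x) by apply: ispan_mem; rewrite mem_head.
rewrite !inE => /or4P[] /eqP->; rewrite ?K.
- exact: ispanM.
- by rewrite mulrC; apply: ispanM.
- exact: ispanM.
- by rewrite mulrC; apply: ispanM.
Qed.

(** The relation imposed on l is the divided difference of the equation along the line, common to
    chords and tangents. It places a third point on the line; the product of the three ideals is
    generated by the equation of the line, and multiplying by the ideal of the opposite of the third
    point gives the class of the sum. *)
Lemma gpt_chord x1 y1 x2 y2 l :
    on_wcurve E x1 y1 -> on_wcurve E x2 y2 -> y2 = y1 + l * (x2 - x1) ->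
    l * (2 * y1 + l * (x2 - x1)) + a1 * (y1 + l * x2) + a3 * l =
      x1 ^+ 2 + x1 * x2 + x2 ^+ 2 + a2 * (x1 + x2) + a4 ->
  let x3 := l ^+ 2 + a1 * l - a2 - x1 - x2 in
  let y3 := - (l + a1) * x3 - (y1 - l * x1) - a3 in
  on_wcurve E x3 y3 /\
  icls (imul (gpt (Some (x1, y1))) (gpt (Some (x2, y2)))) (gpt (Some (x3, y3))).
Proof.
move=> P1 P2 y2E H x3 y3.
(* The third intersection point is (x3, y3'); the sum is its opposite. *)
pose y3' := y1 + l * (x3 - x1).
have y3E : y3 = - y3' - a1 * x3 - a3 by rewrite /y3 /y3'; ring.
have G (t : F) : (y1 + l * (t - x1)) ^+ 2 + a1 * t * (y1 + l * (t - x1))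
    + a3 * (y1 + l * (t - x1)) - (t ^+ 3 + a2 * t ^+ 2 + a4 * t + a6)
    = - (t - x1) * (t - x2) * (t - x3).
  transitivity ((y1 ^+ 2 + a1 * x1 * y1 + a3 * y1 -
      (x1 ^+ 3 + a2 * x1 ^+ 2 + a4 * x1 + a6)) + (t - x1) *
      ((l * (2 * y1 + l * (x2 - x1)) + a1 * (y1 + l * x2) + a3 * l -
      (x1 ^+ 2 + x1 * x2 + x2 ^+ 2 + a2 * (x1 + x2) + a4)) - (t - x2) * (t - x3))).
    by rewrite /x3; ring.
  by rewrite H (eqP P1) !subrr add0r; ring.
have T3 : on_wcurve E x3 y3'.
  apply/eqP/eqP; rewrite -subr_eq0; apply/eqP.
  by rewrite -/a1 -/a2 -/a3 -/a4 -/a6 /y3' G subrr mulr0.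
have S3 : on_wcurve E x3 y3 by rewrite y3E; have := wneg_in (P := Some (x3, y3')); apply.
split=> //.
pose X1 := cX - cC x1; pose X2 := cX - cC x2; pose X3 := cX - cC x3.
pose m := cC y1 + cC l * (cX - cC x1).
(* [ll'] is, up to sign, the conjugate of the line [ll] under P |-> -P, so the product of the two is
   a polynomial in X. *)
pose ll := cY - m; pose ll' := cY + m + cC a1 * cX + cC a3.
have ll0 : ll != 0.
  apply/eqP => /(congr1 (@cv _ _ _)); rewrite /ll /m /cY /cX /cC /=.
  rewrite !(mul0r, mulr0, addr0, subr0, oppr0).
  by apply/eqP; rewrite oner_eq0.
have ll'0 : ll' != 0.
  apply/eqP => /(congr1 (@cv _ _ _)); rewrite /ll' /m /cY /cX /cC /=.
  rewrite !(mul0r, mulr0, addr0, subr0, oppr0).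
  by apply/eqP; rewrite oner_eq0.
have X123 : X1 * X2 * X3 = ll * ll'.
  have x3E : cC x3 = cC l ^+ 2 + cC a1 * cC l - cC a2 - cC x1 - cC x2.
    by rewrite /x3 !(rmorphB, rmorphD, rmorphM, rmorphXn).
  have HC := congr1 cC H; rewrite !(rmorph_nat, rmorphB, rmorphD, rmorphM, rmorphXn) /= in HC.
  have e1 := on_wcurve_crd P1; have e := crd_weq.
  apply/eqP; rewrite -subr_eq0; apply/eqP.
  transitivity ((cC y1 ^+ 2 + cC a1 * cC x1 * cC y1 + cC a3 * cC y1 -
      (cC x1 ^+ 3 + cC a2 * cC x1 ^+ 2 + cC a4 * cC x1 + cC a6)) + (cX - cC x1) *
      (cC l * (2 * cC y1 + cC l * (cC x2 - cC x1)) + cC a1 * (cC y1 + cC l * cC x2) + cC a3 * cC l -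
      (cC x1 ^+ 2 + cC x1 * cC x2 + cC x2 ^+ 2 + cC a2 * (cC x1 + cC x2) + cC a4)) -
      (cY ^+ 2 + cC a1 * cX * cY + cC a3 * cY -
        (cX ^+ 3 + cC a2 * cX ^+ 2 + cC a4 * cX + cC a6))).
    by rewrite /X1 /X2 /X3 /ll /ll' /m x3E; ring.
  by rewrite HC e e1 !subrr mulr0 addr0 subrr.
have line x y : y = y1 + l * (x - x1) -> ieq (gpt (Some (x, y))) [:: cX - cC x; ll].
  move=> yE; apply: (@ieq_shear _ _ _ _ (cC l)).
  by rewrite /ll /m yE !(rmorphB, rmorphD, rmorphM) /=; ring.
have line' x y : y = y1 + l * (x - x1) ->
    ieq (gpt (wneg (Some (x, y)))) [:: cX - cC x; ll'].
  move=> yE; apply: (@ieq_shear _ _ _ _ (- (cC l + cC a1))).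
  by rewrite /ll' /m yE !(rmorphB, rmorphN, rmorphD, rmorphM) /=; ring.
have y1E : y1 = y1 + l * (x1 - x1) by rewrite subrr mulr0 addr0.
pose g := imul [:: X1; ll] (imul [:: X2; ll] [:: X3; ll]).
pose g' := imul [:: X1; ll'] (imul [:: X2; ll'] [:: X3; ll']).
have gE : ieq g (imul (gpt (Some (x1, y1))) (imul (gpt (Some (x2, y2))) (gpt (Some (x3, y3'))))).
  by apply: ieq_imul; last apply: ieq_imul; apply: ieq_sym; apply: line.
have g'E : ieq g' (imul (gpt (wneg (Some (x1, y1))))
    (imul (gpt (wneg (Some (x2, y2)))) (gpt (wneg (Some (x3, y3')))))).
  by apply: ieq_imul; last apply: ieq_imul; apply: ieq_sym; apply: line'.
(* The ideals of the three points and of their opposites multiply to (X1 X2 X3) = (ll ll'), which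
   forces each triple product to be principal. *)
have gl : ieq g [:: ll].
  apply: (@principal_of_mul _ g g' ll ll') => //.
  - exact: triple_dvd X123.
  - by apply: (@triple_dvd _ _ _ _ _ ll); rewrite X123 mulrC.
  apply: (ieq_trans (ieq_imul gE g'E)).
  apply: (ieq_trans (imulACA _ _ _ _)).
  apply: (@ieq_trans _ _ (imul [:: X1] (imul [:: X2] [:: X3]))).
    apply: ieq_imul; first exact: gpt_neg.
    apply: (ieq_trans (imulACA _ _ _ _)).
    by apply: ieq_imul; apply: gpt_neg.
  by rewrite !imul11 mulrA X123.
exists X3, ll; split=> //; first exact: crd_subX_neq0.
have -> : Some (x3, y3) = wneg (Some (x3, y3')) by rewrite /= -y3E.
apply: ieq_trans (ieq_imull _ (ieq_trans (ieq_sym gE) gl)).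
apply: (@ieq_trans _ _ (imul (imul (gpt (Some (x1, y1))) (gpt (Some (x2, y2)))) [:: X3])).
  exact: imulC.
apply: (@ieq_trans _ _ (imul (imul (gpt (Some (x1, y1))) (gpt (Some (x2, y2))))
   (imul (gpt (Some (x3, y3'))) (gpt (wneg (Some (x3, y3'))))))).
  by apply: ieq_imul => //; apply/ieq_sym/gpt_neg.
by apply: (ieq_trans (imulA _ _ _)); apply: ieq_imull; apply/ieq_sym/imulA.
Qed.

Lemma on_wcurve_sub x1 y1 x2 y2 : on_wcurve E x1 y1 -> on_wcurve E x2 y2 ->
  (y2 - y1) * (y1 + y2 + a1 * x2 + a3) = (x2 - x1) *
   (x1 ^+ 2 + x1 * x2 + x2 ^+ 2 + a2 * (x1 + x2) + a4 - a1 * y1).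
Proof.
move=> /eqP; rewrite -/a1 -/a2 -/a3 -/a4 -/a6 => P1.
move=> /eqP; rewrite -/a1 -/a2 -/a3 -/a4 -/a6 => P2.
apply/eqP; rewrite -subr_eq0; apply/eqP.
transitivity ((y2 ^+ 2 + a1 * x2 * y2 + a3 * y2 -
  (x2 ^+ 3 + a2 * x2 ^+ 2 + a4 * x2 + a6)) - (y1 ^+ 2 + a1 * x1 * y1 + a3 * y1 -
  (x1 ^+ 3 + a2 * x1 ^+ 2 + a4 * x1 + a6))); first by ring.
by rewrite P1 P2 !subrr.
Qed.

Lemma gpt_add P Q : in_wcurve E P -> in_wcurve E Q ->
  in_wcurve E (wadd E P Q) /\ icls (imul (gpt P) (gpt Q)) (gpt (wadd E P Q)).
Proof.
case: P => [[x1 y1]|] P1; last first.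
  by move=> Q1; split=> //; apply/icls_ieq/imul1.
case: Q => [[x2 y2]|] P2; last first.
  by split=> //; apply/icls_ieq; apply: (ieq_trans (imulC _ _)); apply: imul1.
rewrite /wadd -/a1 -/a2 -/a3 -/a4 -/a6; case: ifP => [/andP[/eqP x12 /eqP y12]|N].
  split=> //.
  have -> : Some (x2, y2) = wneg (Some (x1, y1)).
    rewrite /= -x12; congr (Some (_, _)); move: y12; rewrite -x12 => y12.
    by apply/eqP; rewrite -subr_eq0 -y12; apply/eqP; ring.
  exists 1, (cX - cC x1); split; rewrite ?oner_neq0 ?crd_subX_neq0 //.
  by apply: (ieq_trans (imul1 _)); apply: (ieq_trans (gpt_neg P1)); rewrite imul11 mulr1.
have D := on_wcurve_sub P1 P2.
case: (eqVneq x1 x2) N D => [x12 /= N|x12 _] D; apply: gpt_chord => //.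
- move/eqP: D; rewrite x12 subrr mul0r mulf_eq0 N orbF subr_eq0 => /eqP ->.
  by rewrite mulr0 addr0.
- have y12 : y2 = y1.
    move/eqP: D; rewrite x12 subrr mul0r mulf_eq0 N orbF subr_eq0 => /eqP ->.
    by [].
  have n0 : 2 * y1 + a1 * x1 + a3 != 0.
    by move/negbT: N; rewrite y12 -x12; apply: contra => /eqP <-; apply/eqP; ring.
  rewrite x12 in n0 *; rewrite subrr mulr0 addr0.
  by field.
- by rewrite divfK ?subr_eq0 1?eq_sym // addrC subrK.
have n0 : x2 - x1 != 0 by rewrite subr_eq0 eq_sym.
apply: (mulfI n0); rewrite -[RHS](subrK (a1 * y1 * (x2 - x1))).
transitivity ((y2 - y1) * (y1 + y2 + a1 * x2 + a3) + a1 * y1 * (x2 - x1)).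
  by field.
by rewrite D; ring.
Qed.

(** A generator h of the ideal of the point has norm dividing the norm of X - x, which has degree 2.
    Degree 0 makes h a nonzero constant, which does not vanish at the point; degree 1 is not the
    degree of a norm; degree 2 makes h proportional to X - x, which does not divide Y - y. *)
Lemma gpt_nprincipal x y : on_wcurve E x y -> ~ icls (gpt (Some (x, y))) [:: 1].
Proof.
move=> xy [a [b [a0 b0 ab]]].
have /ab/ispan_imul1[h gh bE] : ispan (imul [:: b] [:: 1]) b.
  by apply: ispan_mem; rewrite imul11 mulr1 mem_head.
have h0 : h != 0 by apply: contraNneq b0 => h0; rewrite bE h0 mulr0.
have mult z : ispan (gpt (Some (x, y))) z -> exists w, z = h * w.
  move=> gz; have /ab : ispan (imul [:: a] (gpt (Some (x, y)))) (a * z).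
    by apply/ispan_imul1; exists z.
  move=> /ispan_imul1[w _ E1]; exists w; apply: (mulfI a0).
  by rewrite E1 bE mulrA.
have [h' XE] : exists h', cX - cC x = h * h'.
  by apply/mult/ispan_mem; rewrite mem_head.
have h'0 : h' != 0 by apply: contraNneq (crd_subX_neq0 x) => E0; rewrite XE E0 mulr0.
have yy : (y + h1 * x + h3) ^+ 2 = f.[x].
  rewrite /f !hornerE /=; move/eqP: xy; rewrite -/a1 -/a2 -/a3 -/a4 -/a6 a1E a3E => xy.
  apply/eqP; rewrite -subr_eq0; apply/eqP.
  transitivity ((y ^+ 2 + 2 * h1 * x * y + 2 * h3 * y) - (x ^+ 3 + a2 * x ^+ 2 + a4 * x + a6)).
    by ring.
  by rewrite xy subrr.
pose ev := @crd_ev _ _ size_wpoly x (y + h1 * x + h3).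
have evC c : ev (cC c) = c by rewrite /ev /cC crd_ev_iota hornerC.
have evX : ev cX = x by rewrite /ev crd_ev_iota hornerX.
have evg z : ispan (gpt (Some (x, y))) z -> ev z = 0.
  move: z; apply: ispan_ind.
  - by rewrite /ev /crd_ev /= !horner0 mul0r addr0.
  - by move=> u v Eu Ev; rewrite /ev crd_evD -!/(ev _) Eu Ev addr0.
  - by move=> r u Eu; rewrite /ev crd_evM // -/(ev u) Eu mulr0.
  move=> u; rewrite !inE => /orP[] /eqP->; rewrite /ev crd_evB -!/(ev _) evC ?evX ?subrr //.
  rewrite /cY /ev !crd_evB crd_evM // -!/(ev _) !evC evX /ev /crd_ev /=.
  by rewrite !hornerE; ring.
have sN : size (crd_norm h * crd_norm h') = 3%N.
  rewrite -crd_normM -XE size_crd_norm /=.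
  rewrite subr0 eqxx polyXsubC_eq0 size_XsubC.
  by [].
have n0 : crd_norm h != 0 by apply: contra_neq h0; apply: crd_norm_eq0.
have n'0 : crd_norm h' != 0 by apply: contra_neq h'0; apply: crd_norm_eq0.
move: sN; rewrite size_mul // => sN.
have [/crd_norm_unit/(_ h0)[c [c0 hE]]|s1] := leqP (size (crd_norm h)) 1.
  have := evg h gh; rewrite hE -[CrdC _ _ _]/(cC c) evC => /eqP.
  by rewrite (negPf c0).
have s2 : size (crd_norm h) <> 2%N by apply: crd_norm_size2.
have /crd_norm_unit/(_ h'0)[c [c0 h'E]] : (size (crd_norm h') <= 1)%N.
  by move: sN s1 s2; move: (size _) (size _) => A B; lia.
have [w] : exists w, cY - cC y = h * w.
  by apply/mult/ispan_mem; rewrite !inE eqxx orbT.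
have -> : h = (cX - cC x) * cC c^-1.
  rewrite XE h'E -[CrdC _ _ _]/(cC c) -mulrA -rmorphM divff // rmorph1 mulr1 //.
move/(congr1 (@cv _ _ _)); rewrite /cY /cX /cC /=.
rewrite !(mul0r, mulr0, addr0, subr0, oppr0) => /(congr1 (horner^~ x)).
by rewrite !hornerE subrr !mul0r => /eqP; rewrite oner_eq0.
Qed.

Lemma wadd_neg_eq0 P Q : wadd E P (wneg Q) = None -> P = Q.
Proof.
case: P Q => [[x1 y1]|] [[x2 y2]|] //=; rewrite -/a1 -/a2 -/a3 -/a4 -/a6.
case: ifP => // /andP[/eqP -> /eqP E0] _; congr (Some (_, _)).
by apply/eqP; rewrite -subr_eq0 -E0; apply/eqP; ring.
Qed.

(** P - Q has trivial class, hence is the point at infinity. Through this injectivity, commutativity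
    and associativity of the product of ideals pass to the chord law. *)
Lemma gpt_inj P Q : in_wcurve E P -> in_wcurve E Q -> icls (gpt P) (gpt Q) -> P = Q.
Proof.
move=> PE QE PQ; apply: wadd_neg_eq0.
have nQ := wneg_in QE; have [SE Scl] := gpt_add PE nQ.
have [_ Qcl] := gpt_add QE nQ.
have Q0 : wadd E Q (wneg Q) = None.
  case: (Q) => [[x y]|] //=; rewrite -/a1 -/a3 eqxx /=.
  by rewrite (_ : _ + _ == 0) //; apply/eqP; ring.
rewrite Q0 in Qcl.
have : icls (gpt (wadd E P (wneg Q))) [:: 1].
  apply: (icls_trans (icls_sym Scl)); apply: icls_trans Qcl.
  exact: icls_imull.
by case: (wadd E P (wneg Q)) SE => // -[x y] SE /(gpt_nprincipal SE).
Qed.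

Definition ecpoint := {P : wpoint F | in_wcurve E P}.
HB.instance Definition _ := Choice.on ecpoint.

Definition pt_add (P Q : ecpoint) : ecpoint :=
  exist _ (wadd E (val P) (val Q)) (gpt_add (valP P) (valP Q)).1.
Definition pt_opp (P : ecpoint) : ecpoint := exist _ (wneg (val P)) (wneg_in (valP P)).
Definition pt0 : ecpoint := exist _ None isT.

Fact pt_addC : commutative pt_add.
Proof.
move=> P Q; apply: val_inj; apply: gpt_inj; try exact: valP.
apply: (icls_trans (icls_sym (gpt_add (valP P) (valP Q)).2)).
apply: icls_trans (gpt_add (valP Q) (valP P)).2; exact/icls_ieq/imulC.
Qed.

Fact pt_addA : associative pt_add.
Proof.
move=> P Q R; apply: val_inj; apply: gpt_inj; try exact: valP.
apply: (icls_trans (icls_sym (gpt_add (valP P) (valP (pt_add Q R))).2)).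
apply: icls_trans (gpt_add (valP (pt_add P Q)) (valP R)).2.
apply: (@icls_trans _ _ (imul (gpt (val P)) (imul (gpt (val Q)) (gpt (val R))))).
  apply: icls_imul; first exact: icls_ieq.
  exact/icls_sym/(gpt_add (valP Q) (valP R)).2.
apply: (icls_trans (icls_ieq (imulA _ _ _))).
by apply: icls_imull; apply: (gpt_add (valP P) (valP Q)).2.
Qed.

Fact pt_add0 : left_id pt0 pt_add.
Proof. by move=> P; apply: val_inj. Qed.

Fact pt_addN : left_inverse pt0 pt_opp pt_add.
Proof.
move=> P; apply: val_inj => /=; case: (val P) => [[x y]|] //=.
rewrite -/a1 -/a3 eqxx /= (_ : _ + _ == 0) //; apply/eqP; ring.
Qed.

HB.instance Definition _ := GRing.isZmodule.Build ecpoint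
  pt_addA pt_addC pt_add0 pt_addN.

Lemma val_ptD (P Q : ecpoint) : val (P + Q) = wadd E (val P) (val Q).
Proof. by []. Qed.
Lemma val_ptN (P : ecpoint) : val (- P) = wneg (val P).
Proof. by []. Qed.

End CurveGroup.

(** * Residue field and reduction of points *)

Section ResidueField.
Variables (p : primeNat) (C : Qp_closure p).
Local Notation V := (@qbar_int p C).
Local Notation mm := (@qbar_max p C).

Definition Vpred : {pred C} := fun c => `[< V c >].

Fact Vpred_subring : subring_closed Vpred.
Proof.
split; first exact/asboolP/V1.
  by move=> a b /asboolP Va /asboolP Vb; apply/asboolP/VB.
by move=> a b /asboolP Va /asboolP Vb; apply/asboolP/VM.
Qed.
HB.instance Definition _ := GRing.isSubringClosed.Build C Vpred Vpred_subring.

Record Vring := VRing { Vval : C; Vval_in : Vpred Vval }.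
HB.instance Definition _ := [isSub for Vval].
HB.instance Definition _ := [Choice of Vring by <:].
HB.instance Definition _ := [SubChoice_isSubComNzRing of Vring by <:].

Definition mmpred : {pred Vring} := fun x => `[< mm (val x) >].

Fact mmpred_ideal : idealr_closed mmpred.
Proof.
split.
- by apply/asboolP; rewrite rmorph0; apply: mm0.
- by apply/negP => /asboolP; rewrite rmorph1; apply: not_mm1.
move=> a u v /asboolP mu /asboolP mv; apply/asboolP.
rewrite rmorphD rmorphM; apply: mmD => //; apply: mmM => //.
exact/asboolP/(valP a).
Qed.
HB.instance Definition _ := isIdealr.Build Vring mmpred mmpred_ideal.

Definition kbar : Type := {ideal_quot mmpred}.
HB.instance Definition _ := GRing.ComNzRing.on kbar.

Definition kpi (x : Vring) : kbar := \pi_{ideal_quot mmpred} x.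
Fact kpi_zmod : zmod_morphism kpi.
Proof. by move=> x y; rewrite /kpi !piE. Qed.
Fact kpi_monoid : monoid_morphism kpi.
Proof. by split=> [|x y]; rewrite /kpi !piE. Qed.
HB.instance Definition _ := GRing.isZmodMorphism.Build _ _ kpi kpi_zmod.
HB.instance Definition _ := GRing.isMonoidMorphism.Build _ _ kpi kpi_monoid.

Lemma kpi_eq0 x : kpi x = 0 <-> mm (val x).
Proof.
rewrite -(rmorph0 kpi) /kpi; split=> [/eqP|mx].
  by rewrite -Quotient.idealrBE subr0 => /asboolP.
by apply/eqP; rewrite -Quotient.idealrBE subr0; apply/asboolP.
Qed.

Lemma kpi_surj (r : kbar) : exists x, r = kpi x.
Proof. by exists (repr (r : {ideal_quot mmpred})); rewrite /kpi reprK. Qed.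

Definition kinv (r : kbar) : kbar := if r == 0 then 0 else xget r [set s | s * r = 1].

Fact kmulVf (r : kbar) : r != 0 -> kinv r * r = 1.
Proof.
move=> r0; have [s sr] : exists s, s * r = 1.
  have [x rE] := kpi_surj r.
  have nm : ~ mm (val x) by move=> /kpi_eq0 x0; rewrite rE x0 eqxx in r0.
  have [x0 Vx] := not_mmE (elimT (asboolP _) (valP x)) nm.
  exists (kpi (VRing (introT (asboolP _) Vx))); rewrite rE -rmorphM -(rmorph1 kpi).
  by congr (kpi _); apply: val_inj; rewrite rmorphM rmorph1 /= mulVf.
by rewrite /kinv (negPf r0); case: xgetP => // /(_ s).
Qed.

Fact kinv0 : kinv 0 = 0.
Proof. by rewrite /kinv eqxx. Qed.

HB.instance Definition _ := GRing.ComNzRing_isField.Build kbar kmulVf kinv0.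

(** A non-integral element receives the default residue 0. *)
Definition rc (c : C) : kbar := kpi (insubd 0 c).

Lemma val_insubdV c : V c -> val (insubd (0 : Vring) c) = c.
Proof. by move=> Vc; rewrite insubdK //; apply/asboolP. Qed.

Lemma rcD a b : V a -> V b -> rc (a + b) = rc a + rc b.
Proof.
move=> Va Vb; rewrite /rc -rmorphD; congr kpi; apply: val_inj.
by rewrite rmorphD /= !val_insubdV //; apply: VD.
Qed.
Lemma rcM a b : V a -> V b -> rc (a * b) = rc a * rc b.
Proof.
move=> Va Vb; rewrite /rc -rmorphM; congr kpi; apply: val_inj.
by rewrite rmorphM /= !val_insubdV //; apply: VM.
Qed.
Lemma rcN a : V a -> rc (- a) = - rc a.
Proof.
move=> Va; rewrite /rc -rmorphN; congr kpi; apply: val_inj.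
by rewrite rmorphN /= !val_insubdV //; apply: VN.
Qed.
Lemma rcB a b : V a -> V b -> rc (a - b) = rc a - rc b.
Proof. by move=> Va Vb; rewrite rcD ?rcN //; apply: VN. Qed.
Lemma rc1 : rc 1 = 1.
Proof.
rewrite /rc -(rmorph1 kpi); congr kpi; apply: val_inj.
by rewrite rmorph1 /= val_insubdV //; apply: V1.
Qed.
Lemma rc0 : rc 0 = 0.
Proof. by rewrite -(subrr 1) rcB ?subrr //; apply: V1. Qed.
Lemma rcX a n : V a -> rc (a ^+ n) = rc a ^+ n.
Proof.
move=> Va; elim: n => [|n IHn]; first by rewrite !expr0 rc1.
by rewrite !exprS rcM ?IHn //; apply: VX.
Qed.
Lemma rc_nat n : rc n%:R = n%:R.
Proof.
elim: n => [|n IHn]; first exact: rc0.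
by rewrite -addn1 !natrD rcD ?IHn ?rc1 //; [apply: Vnat|apply: V1].
Qed.
Lemma rc_int (n : int) : rc n%:~R = n%:~R.
Proof.
case: n => n; first by rewrite -!pmulrn rc_nat.
by rewrite NegzE !mulrNz rcN -?pmulrn ?rc_nat //; apply: Vnat.
Qed.
Lemma rc_eq0 a : V a -> rc a = 0 <-> mm a.
Proof. by move=> Va; rewrite kpi_eq0 val_insubdV. Qed.
Lemma rc_eq a b : V a -> V b -> rc a = rc b <-> mm (a - b).
Proof.
move=> Va Vb; rewrite -rc_eq0 ?rcB //; last exact: VB.
by split=> [->|/eqP]; [rewrite subrr|rewrite subr_eq0 => /eqP].
Qed.
Lemma rc_surj r : exists2 a, V a & rc a = r.
Proof.
have [x ->] := kpi_surj r; exists (val x); first exact/asboolP/(valP x).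
by rewrite /rc valKd.
Qed.
Lemma rc_unit a : V a -> rc a != 0 -> a != 0 /\ V a^-1.
Proof. by move=> Va ra; apply: not_mmE => // /(rc_eq0 Va) E; rewrite E eqxx in ra. Qed.
Lemma rcV a : V a -> rc a != 0 -> rc a^-1 = (rc a)^-1.
Proof.
move=> Va ra; have [a0 Vi] := rc_unit Va ra.
by apply: (mulfI ra); rewrite -rcM // !divff // rc1.
Qed.
Lemma kbar_char : p%:R = 0 :> kbar.
Proof. by rewrite -rc_nat; apply/rc_eq0; [apply: Vnat|apply: mm_p]. Qed.
(** C is algebraically closed, and a square root of an integral element is integral. *)
Lemma kbar_sqrt (r : kbar) : exists s, s ^+ 2 = r.
Proof.
have [a Va <-] := rc_surj r.
have [s sE] : exists s : C, s ^+ 2 = a.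
  have [s E] := @solve_monicpoly C 2 (fun i => if i == 0%N then a else 0) isT.
  by exists s; rewrite E big_ord_recl big_ord1 /= mulr1 mul0r addr0.
exists (rc s); rewrite -rcX ?sE //.
apply: (@V_root _ _ ('X^2 - a%:P)).
- exact: monicXnsubC.
- move=> i; rewrite coefB coefXn coefC; apply: VB; first exact: Vnat.
  by case: ifP => _ //; apply: V0.
by rewrite /root !hornerE sE subrr.
Qed.

(** X^q - X splits over C with integral roots. Its reduction has derivative -1, so the q reduced
    roots remain distinct. *)
Lemma kbar_frobenius_fixed q : (0 < q)%N -> q%:R = 0 :> kbar ->
  exists s : seq kbar, [/\ uniq s, size s = q & forall r, (r \in s) = (r ^+ q == r)].
Proof.
move=> q0 qk.
have q1 : (1 < q)%N.
  by case: q q0 qk => [|[|q]] // _ /eqP; rewrite oner_eq0.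
have [s sE] := closed_field_poly_normal ('X^q - 'X : {poly C}).
have lead : size ('X^q - 'X : {poly C}) = q.+1.
  by rewrite size_polyDl size_polyXn // size_polyN size_polyX.
have mon : ('X^q - 'X : {poly C}) \is monic.
  apply/monicP; rewrite lead_coefE lead /= coefB coefXn eqxx coefX.
  by rewrite gtn_eqF // subr0.
rewrite (monicP mon) scale1r in sE.
have ss : size s = q.
  by apply: succn_inj; rewrite -lead sE size_prod_XsubC.
have Vs z : z \in s -> V z.
  move=> zs; apply: (V_root mon).
    move=> i; rewrite coefB coefXn coefX; apply: VB; exact: Vnat.
  by rewrite sE root_prod_XsubC.
have PE : ('X^q - 'X : {poly Vring}) = \prod_(z <- [seq insubd (0 : Vring) z | z <- s]) ('X - z%:P).
  have [v vE] : exists v : {rmorphism Vring -> C}, v =1 val by exists \val.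
  apply: (@map_inj_poly _ _ v); [by move=> x y; rewrite !vE => /val_inj|exact: rmorph0|].
  rewrite rmorphB /= map_polyXn map_polyX sE rmorph_prod big_map.
  rewrite big_seq [RHS]big_seq; apply: eq_bigr => z zs.
  by rewrite /= rmorphB /= map_polyX map_polyC /= vE val_insubdV //; apply: Vs.
have KE : ('X^q - 'X : {poly kbar}) = \prod_(z <- [seq rc z | z <- s]) ('X - z%:P).
  have := congr1 (map_poly kpi) PE.
  rewrite rmorphB /= map_polyXn map_polyX => ->; rewrite rmorph_prod !big_map.
  by apply: eq_bigr => z _; rewrite /= rmorphB /= map_polyX map_polyC.
exists [seq rc z | z <- s]; split.
- rewrite -separable_prod_XsubC -KE separable_poly.unlock derivB derivXn derivX.
  have -> : ('X^(q.-1) *+ q = 0 :> {poly kbar})%R.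
    by rewrite -mulr_natr -polyC_natr qk mulr0.
  by rewrite sub0r coprimep_sym -scaleN1r coprimepZl ?oppr_eq0 ?oner_neq0 // coprime1p.
- by rewrite size_map.
by move=> r; rewrite -root_prod_XsubC -KE /root !hornerE subr_eq0.
Qed.

End ResidueField.

(** * Reduction of points *)

Section Reduction.
Variables (p : primeNat) (C : Qp_closure p) (W : weierstrass).
Hypothesis p_odd : odd p.
Hypothesis good : ~~ (p%:Z %| wdisc W)%Z.
Local Notation V := (@qbar_int p C).
Local Notation mm := (@qbar_max p C).
Local Notation k := (kbar C).

Lemma kbar_int_eq0 (n : int) : ((n%:~R : k) == 0) = (p%:Z %| n)%Z.
Proof.
apply/idP/idP => [/eqP n0|/dvdzP[m ->]]; last first.
  by rewrite rmorphM /= -pmulrn kbar_char mulr0.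
apply: contraT => pn.
have /coprimezP[[u v] /= uv] : coprimez p%:Z n.
  by rewrite coprimezE prime_coprime ?prime_valP.
have /eqP := congr1 (fun m : int => m%:~R : k) uv.
by rewrite rmorphD !rmorphM /= n0 mulr0 -pmulrn kbar_char mulr0 addr0 eq_sym oner_eq0.
Qed.

Lemma two_kbar : (2 : k) != 0.
Proof.
rewrite (_ : 2 = (2%:Z)%:~R) // kbar_int_eq0 dvdzE /=.
apply: contraTN p_odd => /(@dvdn_leq p 2 isT); have := prime_gt1 (prime_valP p).
by case: (p : nat) => [|[|[|n]]].
Qed.

(** Transparent, so that the underlying equation computes to [W]. *)
Definition curveK : ecurve k.
Proof.
by exists W; [exact: two_kbar|rewrite kbar_int_eq0].
Defined.

Lemma disc_C : (wdisc W)%:~R != 0 :> C.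
Proof.
apply: contra good => /eqP d0; rewrite -kbar_int_eq0 -rc_int d0 rc0.
by [].
Qed.

Definition curveC : ecurve C.
Proof. by exists W; [exact: (natC_neq0 C (n := 2))|exact: disc_C]. Defined.

Let a1 : C := (wa1 W)%:~R. Let a2 : C := (wa2 W)%:~R. Let a3 : C := (wa3 W)%:~R.
Let a4 : C := (wa4 W)%:~R. Let a6 : C := (wa6 W)%:~R.
Let V_a1 : V a1. Proof. exact: Vint. Qed.
Let V_a2 : V a2. Proof. exact: Vint. Qed.
Let V_a3 : V a3. Proof. exact: Vint. Qed.
Let V_a4 : V a4. Proof. exact: Vint. Qed.
Let V_a6 : V a6. Proof. exact: Vint. Qed.

Ltac vsolve := repeat first [assumption | apply: VD | apply: VB | apply: VM
  | apply: VX | apply: VN | exact: Vnat | exact: V1 | exact: V0].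

Lemma V_quad (b c t : C) : V b -> V c -> t ^+ 2 + b * t = c -> V t.
Proof.
move=> Vb Vc E; apply: (@V_root _ _ ('X^2 + (b *: 'X - c%:P))).
- rewrite monicE lead_coefDl ?lead_coefXn // size_polyXn.
  rewrite (leq_ltn_trans (size_polyD _ _)) // gtn_max size_polyN size_polyC.
  rewrite (leq_ltn_trans (size_scale_leq _ _)) ?size_polyX //=.
  by case: (c != 0).
- move=> i; rewrite !coefE; vsolve.
  by case: ifP => _ //; apply: V0.
apply/eqP; transitivity (t ^+ 2 + b * t - c); first by rewrite !hornerE /=; ring.
by rewrite E subrr.
Qed.

Lemma V_ycoord x y : on_wcurve W x y -> V x -> V y.
Proof.
move=> /eqP; rewrite -/a1 -/a2 -/a3 -/a4 -/a6 => E Vx.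
apply: (@V_quad (a1 * x + a3) (x ^+ 3 + a2 * x ^+ 2 + a4 * x + a6)); try vsolve.
by rewrite -E; ring.
Qed.

Definition red (P : wpoint C) : wpoint k :=
  if P is Some (x, y) then if `[< V x >] then Some (rc x, rc y) else None else None.

Ltac rcpush := repeat first [rewrite rcB; [|vsolve|vsolve] | rewrite rcD; [|vsolve|vsolve]
  | rewrite rcM; [|vsolve|vsolve] | rewrite rcX; [|vsolve] | rewrite rcN; [|vsolve]
  | rewrite rc_int | rewrite rc_nat].

Lemma red_on x y : on_wcurve W x y -> V x -> on_wcurve W (rc x) (rc y).
Proof.
move=> xy Vx; have Vy := V_ycoord xy Vx.
move/eqP: xy; rewrite -/a1 -/a2 -/a3 -/a4 -/a6 => /(congr1 (@rc p C)).
by rcpush; rewrite /on_wcurve => ->.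
Qed.

Lemma red_in P : in_wcurve W P -> in_wcurve W (red P).
Proof.
by case: P => [[x y]|] //= xy; case: asboolP => //= Vx; apply: red_on.
Qed.

(** The slope satisfies l (x2 - x1) = y2 - y1 and l d = N. If the reductions are not opposite, x2 -
    x1 or d is a unit, so l is integral and reduces to the slope of the reduced points. If they are
    opposite, an integral l would make N reduce to 0 along with d, against nonsingularity of the
    reduced curve. *)
Lemma red_add_int x1 y1 x2 y2 : on_wcurve W x1 y1 -> on_wcurve W x2 y2 -> V x1 -> V x2 ->
  red (wadd W (Some (x1, y1)) (Some (x2, y2))) =
  wadd W (red (Some (x1, y1))) (red (Some (x2, y2))).
Proof.
move=> P1 P2 Vx1 Vx2; have Vy1 := V_ycoord P1 Vx1; have Vy2 := V_ycoord P2 Vx2.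
have -> : red (Some (x1, y1)) = Some (rc x1, rc y1) by rewrite /= asboolT.
have -> : red (Some (x2, y2)) = Some (rc x2, rc y2) by rewrite /= asboolT.
have D := on_wcurve_sub (E := curveC) P1 P2; rewrite /= -/a1 -/a2 -/a3 -/a4 in D.
set d := y1 + y2 + a1 * x2 + a3 in D.
set N := x1 ^+ 2 + x1 * x2 + x2 ^+ 2 + a2 * (x1 + x2) + a4 - a1 * y1 in D.
have Vd : V d by rewrite /d; vsolve.
have VN' : V N by rewrite /N; vsolve.
have rcd : rc d = rc y1 + rc y2 + (wa1 W)%:~R * rc x2 + (wa3 W)%:~R.
  by rewrite /d; rcpush.
have rcN' : rc N = rc x1 ^+ 2 + rc x1 * rc x2 + rc x2 ^+ 2 + (wa2 W)%:~R * (rc x1 + rc x2)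
    + (wa4 W)%:~R - (wa1 W)%:~R * rc y1 by rewrite /N; rcpush.
have rD : (rc y2 - rc y1) * rc d = (rc x2 - rc x1) * rc N.
  rewrite -rcB // -rcM //; last exact: VB.
  by rewrite D (rcM (VB Vx2 Vx1) VN') rcB.
rewrite /wadd -/a1 -/a2 -/a3 -/a4 -/d -rcd.
set l := (if x1 == x2 then _ else _).
have lx : x1 != x2 -> l * (x2 - x1) = y2 - y1.
  move=> x12; rewrite /l (negPf x12) divfK // subr_eq0 eq_sym //.
have ld : (x1 == x2) && (d == 0) = false -> l * d = N.
  have [x12 /= d0|x12 _] := eqVneq x1 x2; last first.
    apply: (@mulfI _ (x2 - x1)); first by rewrite subr_eq0 eq_sym.
    by rewrite -D -(lx x12) mulrA [_ * l]mulrC.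
  have y12 : y2 = y1.
    by move/eqP: D; rewrite x12 subrr mul0r mulf_eq0 d0 orbF subr_eq0 => /eqP.
  have dE : d = 2 * y1 + a1 * x1 + a3 by rewrite /d y12 x12; ring.
  have NE : N = 3 * x1 ^+ 2 + 2 * a2 * x1 + a4 - a1 * y1 by rewrite /N x12; ring.
  by rewrite /l x12 eqxx -x12 -NE -dE divfK // d0.
set cond := (rc x1 == rc x2) && _.
have [cT|cF] := boolP cond.
  move/andP: cT => [/eqP rx /eqP rd].
  case: ifP => // cC; have {}ld := ld cC.
  (* Were x3 integral, l would be integral as a root of l^2 + a1 l = x3 + a2 + x1 + x2. *)
  rewrite /red asboolF // => Vx3.
  have Vl : V l.
    apply: (@V_quad a1 (l ^+ 2 + a1 * l - a2 - x1 - x2 + (a2 + x1 + x2))) => //.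
      by vsolve.
    by ring.
  have ry : rc y1 = rc y2.
    have [x12|x12] := eqVneq x1 x2.
      move/eqP: D; rewrite x12 subrr mul0r mulf_eq0.
      by rewrite x12 eqxx /= in cC; rewrite cC orbF subr_eq0 => /eqP ->.
    have := congr1 (@rc p C) (lx x12); rewrite rcM ?rcB //; last exact: VB.
    by rewrite -rx subrr mulr0 => /esym/eqP; rewrite subr_eq0 => /eqP.
  have k0 : 2 * rc y1 + (wa1 W)%:~R * rc x1 + (wa3 W)%:~R = 0.
    by rewrite -rd rcd -ry rx; ring.
  have := wnonsingular (E := curveK) (red_on P1 Vx1) k0.
  have -> : 3 * rc x1 ^+ 2 + 2 * (wa2 W)%:~R * rc x1 + (wa4 W)%:~R - (wa1 W)%:~R * rc y1 = rc N.
    by rewrite rcN' -rx; ring.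
  by rewrite -ld rcM // rd mulr0 eqxx.
have cC : (x1 == x2) && (d == 0) = false.
  apply: contraNF cF => /andP[/eqP x12 /eqP d0].
  by rewrite /cond x12 eqxx d0 rc0 eqxx.
have {}ld := ld cC; rewrite cC.
have [Vl rl] : V l /\ rc l = (if rc x1 == rc x2
   then (3 * rc x1 ^+ 2 + 2 * (wa2 W)%:~R * rc x1 + (wa4 W)%:~R - (wa1 W)%:~R * rc y1) /
           (2 * rc y1 + (wa1 W)%:~R * rc x1 + (wa3 W)%:~R)
   else (rc y2 - rc y1) / (rc x2 - rc x1)).
  have [rx|rx] := eqVneq (rc x1) (rc x2).
    have rd0 : rc d != 0 by move: cF; rewrite /cond rx eqxx.
    have [d0 Vid] := rc_unit Vd rd0.
    have lE : l = N * d^-1 by rewrite -ld mulfK.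
    have ry : rc y2 = rc y1.
      by move/eqP: rD; rewrite rx subrr mul0r mulf_eq0 (negPf rd0) orbF subr_eq0 => /eqP.
    split; first by rewrite lE; apply: VM.
    rewrite lE rcM // rcV // rcN' rcd -rx ry; congr (_ / _); by ring.
  have x12 : x1 != x2 by apply: contra_neq rx => ->.
  have Vd' : V (x2 - x1) by apply: VB.
  have r0 : rc (x2 - x1) != 0 by rewrite rcB // subr_eq0 eq_sym.
  have [n0 Vi] := rc_unit Vd' r0.
  have lE : l = (y2 - y1) * (x2 - x1)^-1 by rewrite /l (negPf x12).
  have Vy : V (y2 - y1) by apply: VB.
  split; first by rewrite lE; apply: VM.
  by rewrite lE rcM // rcV // !rcB.
rewrite -rl /red asboolT; last by vsolve.
congr (Some (_, _)).
  by rcpush.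
by rcpush.
Qed.

(** With s = 1 / x1 in the maximal ideal and t = y1 s^2 integral, x3 becomes an integral expression
    divided by the unit (1 - x2 s)^2. *)
Lemma x3_integral x1 y1 x2 y2 : on_wcurve W x1 y1 -> on_wcurve W x2 y2 ->
  ~ V x1 -> V x2 -> exists x3 y3, wadd W (Some (x1, y1)) (Some (x2, y2)) = Some (x3, y3) /\ V x3.
Proof.
move=> P1 P2 nVx1 Vx2; have Vy2 := V_ycoord P2 Vx2.
have [//|[x10 ms]] := V_or_mm x1; set s := x1^-1 in ms.
have x12 : x1 != x2 by apply: contra_not_neq nVx1 => ->.
rewrite /wadd (negPf x12) /=; set x3 := _ ^+ 2 + _ - _ - _ - _; eexists _, _; split=> //.
move/eqP: P1; rewrite -/a1 -/a2 -/a3 -/a4 -/a6 => P1.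
move/eqP: P2; rewrite -/a1 -/a2 -/a3 -/a4 -/a6 => P2.
pose t := y1 * s ^+ 2.
have Vs := mmV ms.
have s0 : s != 0 by rewrite invr_eq0.
have x1E : x1 = s^-1 by rewrite invrK.
have tE : t ^+ 2 + (a1 * s + a3 * s ^+ 2) * t = s * (1 + a2 * s + a4 * s ^+ 2 + a6 * s ^+ 3).
  transitivity ((y1 ^+ 2 + a1 * x1 * y1 + a3 * y1) * s ^+ 4).
    by rewrite /t x1E; field.
  by rewrite P1 x1E; field.
have Vt : V t.
  by apply: (@V_quad (a1 * s + a3 * s ^+ 2) (s * (1 + a2 * s + a4 * s ^+ 2 + a6 * s ^+ 3))); vsolve.
have [n0 Vn] : 1 - x2 * s != 0 /\ V (1 - x2 * s)^-1.
  by apply: unit_1mm; apply/mmN/mmM.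
have y1E : y1 = t * x1 ^+ 2 by rewrite /t /s; field.
have x3E : x3 = (x2 * (1 + x2 * s) + 2 * a2 * x2 * s + a4 * s * (1 + x2 * s) + 2 * a6 * s ^+ 2
   - a3 * (t + y2 * s ^+ 2) - 2 * y2 * t - a1 * (y2 * s + x2 * t)) * (1 - x2 * s)^-1 ^+ 2.
  have d0 : x2 - x1 != 0 by rewrite subr_eq0 eq_sym.
  have K : (y2 - y1) ^+ 2 + a1 * (y2 - y1) * (x2 - x1) - (a2 + x1 + x2) * (x2 - x1) ^+ 2 =
    x1 * x2 * (x1 + x2) + 2 * a2 * x1 * x2 + a4 * (x1 + x2) + 2 * a6
    - a3 * (y1 + y2) - 2 * y1 * y2 - a1 * (x1 * y2 + x2 * y1).
    apply/eqP; rewrite -subr_eq0; apply/eqP.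
    transitivity ((y1 ^+ 2 + a1 * x1 * y1 + a3 * y1 - (x1 ^+ 3 + a2 * x1 ^+ 2 + a4 * x1 + a6))
      + (y2 ^+ 2 + a1 * x2 * y2 + a3 * y2 - (x2 ^+ 3 + a2 * x2 ^+ 2 + a4 * x2 + a6))).
      by ring.
    by rewrite P1 P2 !subrr addr0.
  transitivity (((y2 - y1) ^+ 2 + a1 * (y2 - y1) * (x2 - x1)
    - (a2 + x1 + x2) * (x2 - x1) ^+ 2) / (x2 - x1) ^+ 2).
    by rewrite /x3 -/a1 -/a2; field.
  rewrite K y1E /s; field.
  by rewrite d0 x10 -[x1 - x2]opprB oppr_eq0 d0.
by rewrite x3E; vsolve.
Qed.

Definition redp (P : ecpoint curveC) : ecpoint curveK :=
  exist _ (red (val P)) (red_in (valP P)).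

Definition integral_pt (P : wpoint C) := if P is Some (x, _) then V x else False.

Lemma red_None (P : wpoint C) : red P = None <-> ~ integral_pt P.
Proof.
by case: P => [[x y]|] /=; last (by split=> // _ []); case: asboolP => Vx; split=> // nV; case: nV.
Qed.

Lemma redp_add_int (P Q : ecpoint curveC) : integral_pt (val P) -> integral_pt (val Q) ->
  redp (P + Q) = redp P + redp Q.
Proof.
case: P Q => [P P1] [Q Q1] iP iQ; apply: val_inj => /=.
case: P P1 iP => [[x1 y1]|] // P1 Vx1.
by case: Q Q1 iQ => [[x2 y2]|] // P2 Vx2; apply: red_add_int.
Qed.

Lemma integral_opp (P : ecpoint curveC) : integral_pt (val P) -> integral_pt (val (- P)).
Proof. by rewrite val_ptN; case: (val P) => [[x y]|]. Qed.

Lemma redp_opp P : redp (- P) = - redp P.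
Proof.
case: P => [P P1]; apply: val_inj => /=.
case: P P1 => [[x y]|] //= xy; case: asboolP => //= Vx.
by have Vy := V_ycoord xy Vx; rewrite -/a1 -/a3; congr (Some (_, _)); rcpush.
Qed.

Lemma redp_add_mixed (P Q : ecpoint curveC) : ~ integral_pt (val P) -> integral_pt (val Q) ->
  redp (P + Q) = redp Q.
Proof.
move=> nP iQ; have iR : integral_pt (val (P + Q)).
  rewrite val_ptD.
  case: (val P) (valP P) nP => [[x1 y1]|] P1 nVx1 //.
  case: (val Q) (valP Q) iQ => [[x2 y2]|] P2 Vx2 //.
  have [x3 [y3 [E Vx3]]] := x3_integral P1 P2 nVx1 Vx2.
  by change (integral_pt (wadd W (Some (x1, y1)) (Some (x2, y2)))); rewrite E.
have := redp_add_int iR (integral_opp iQ); rewrite addrK redp_opp.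
have -> : redp P = 0 by apply: val_inj => /=; apply/red_None.
by move=> /esym/eqP; rewrite subr_eq0 => /eqP.
Qed.

(** The remaining case is that of two points reducing to infinity: if their sum R were integral, P =
    R - Q would have the finite reduction of R by the mixed case. *)
Lemma redpD (P Q : ecpoint curveC) : redp (P + Q) = redp P + redp Q.
Proof.
have r0 (R : ecpoint curveC) : ~ integral_pt (val R) -> redp R = 0.
  by move=> nR; apply: val_inj => /=; apply/red_None.
have [iP|nP] := pselect (integral_pt (val P)); have [iQ|nQ] := pselect (integral_pt (val Q)).
- exact: redp_add_int.
- by rewrite addrC redp_add_mixed // (r0 _ nQ) addr0.
- by rewrite redp_add_mixed // (r0 _ nP) add0r.
rewrite (r0 _ nP) (r0 _ nQ) addr0; apply: (r0) => iR.
have nQ' : ~ integral_pt (val (- Q)).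
  by move=> /integral_opp; rewrite opprK.
have := redp_add_mixed nQ' iR; rewrite addrC addrK (r0 _ nP) => E.
move: (congr1 val E); rewrite /= => /esym/red_None; exact.
Qed.

End Reduction.

(** * Counting points modulo p *)

Section FrobeniusCoefficient.
Variables (k : fieldType) (p : nat).
Hypotheses (p_prime : prime p) (p_odd : odd p) (pk : p%:R = 0 :> k).

Let pchark : p \in [pchar k].
Proof. by rewrite inE p_prime; apply/eqP. Qed.

Lemma frobD (a b : k) : (a + b) ^+ p = a ^+ p + b ^+ p.
Proof. by rewrite exprDn_pchar // pnatE. Qed.

Lemma frobqD f (a b : k) : (a + b) ^+ (p ^ f) = a ^+ (p ^ f) + b ^+ (p ^ f).
Proof.
elim: f => [|f IHf]; first by rewrite expn0 !expr1.
by rewrite expnSr !exprM IHf frobD.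
Qed.

Lemma frobq_nat f n : (n%:R : k) ^+ (p ^ f) = n%:R.
Proof.
elim: n => [|n IHn]; first by rewrite expr0n gtn_eqF // expn_gt0 prime_gt0.
by rewrite -addn1 natrD frobqD IHn expr1n.
Qed.

Lemma frobq_opp f (a : k) : (- a) ^+ (p ^ f) = - (a ^+ (p ^ f)).
Proof. by rewrite exprNn -signr_odd oddX p_odd orbT expr1 mulN1r. Qed.

Lemma frobq_int f (n : int) : (n%:~R : k) ^+ (p ^ f) = n%:~R.
Proof.
case: n => n; first by rewrite -pmulrn frobq_nat.
by rewrite NegzE mulrNz frobq_opp -pmulrn frobq_nat.
Qed.

Lemma poly_frob (g : {poly k}) : (forall i, g`_i ^+ p = g`_i) -> g ^+ p = g \Po 'X^p.
Proof.
move=> gF.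
have pcharP : p \in [pchar {poly k}] by rewrite pchar_poly.
have FD (u v : {poly k}) : (u + v) ^+ p = u ^+ p + v ^+ p.
  by rewrite exprDn_pchar // pnatE.
have F0 : (0 : {poly k}) ^+ p = 0 by rewrite expr0n gtn_eqF ?prime_gt0.
rewrite -[in LHS](coefK g) poly_def (big_morph (fun u => u ^+ p) FD F0).
rewrite comp_polyE; apply: eq_bigr => i _.
by rewrite exprZn gF -exprM mulnC exprM.
Qed.

Lemma coef_comp_Xp (g : {poly k}) i :
  (g \Po 'X^p)`_i = if (p %| i)%N then g`_(i %/ p) else 0.
Proof. by rewrite coef_comp_poly_Xn // prime_gt0. Qed.

Variable h : {poly k}.
Hypotheses (sh : (size h <= 4)%N) (hF : forall i, h`_i ^+ p = h`_i).

Let hX_frob n i : (h ^+ n)`_i ^+ p = (h ^+ n)`_i.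
Proof.
elim: n i => [|n IHn] i.
  rewrite expr0 coef1; case: (i == 0%N); rewrite ?expr1n //.
  by rewrite expr0n gtn_eqF ?prime_gt0.
have F0 : (0 : k) ^+ p = 0 by rewrite expr0n gtn_eqF ?prime_gt0.
rewrite exprS coefM (big_morph (fun u : k => u ^+ p) frobD F0).
by apply: eq_bigr => j _; rewrite exprMn hF IHn.
Qed.

Lemma size_hX n : (size (h ^+ n) <= (3 * n).+1)%N.
Proof.
apply: (leq_trans (size_poly_exp_leq _ _)); rewrite ltnS leq_mul //.
by move: sh; case: (size h).
Qed.

(** With q = p^f one has (p q - 1)/2 = (p - 1)/2 + p (q - 1)/2, and the p-th power of a polynomial
    with Frobenius-fixed coefficients is its value at X^p. In the resulting product only the
    coefficient of index p - 1 of the first factor contributes. *)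
Lemma hasse_power f :
  (h ^+ ((p ^ f).-1)./2)`_(p ^ f).-1 = (h ^+ p.-1./2)`_p.-1 ^+ f.
Proof.
have p0 := prime_gt0 p_prime.
elim: f => [|f IHf]; first by rewrite expn0 /= expr0 coef1 eqxx.
have q0 : (0 < p ^ f)%N by rewrite expn_gt0 p0.
have oq : odd (p ^ f) by rewrite oddX p_odd orbT.
have E : ((p ^ f.+1).-1./2 = p.-1./2 + (p ^ f).-1./2 * p)%N.
  have [a pE] : exists a, p = a.*2.+1.
    by exists p./2; rewrite -[LHS]odd_double_half p_odd.
  have [b qE] : exists b, (p ^ f = b.*2.+1)%N.
    by exists (p ^ f)./2; rewrite -[LHS]odd_double_half oq.
  have e1 : p.-1./2 = a by rewrite pE /= doubleK.
  have e2 : (p ^ f).-1./2 = b by rewrite qE /= doubleK.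
  rewrite e1 e2 expnS qE.
  have e3 : (p * b.*2 = (b * p).*2)%N by rewrite mulnC -doubleMl.
  by rewrite mulnS e3 {1}pE addSn /= -doubleD doubleK.
rewrite E exprD exprM poly_frob; last exact: hX_frob.
rewrite coefM.
have pl : (p.-1 < (p ^ f.+1).-1.+1)%N.
  by rewrite ltnS; have := leq_pmulr p q0; rewrite expnS; lia.
rewrite (bigD1 (Ordinal pl)) //= big1 ?addr0.
  have Ed : ((p ^ f.+1).-1 - p.-1 = (p ^ f).-1 * p)%N.
    by rewrite expnS; have := leq_pmulr p q0; lia.
  by rewrite Ed coef_comp_Xp dvdn_mull // mulnK // IHf exprS.
move=> i; rewrite -val_eqE /= => ip.
have [le|lt] := leqP (size (h ^+ p.-1./2)) i; first by rewrite nth_default // mul0r.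
rewrite coef_comp_Xp; case: ifP => [dv|_]; last by rewrite mulr0.
have i2 : (i <= 3 * p.-1./2)%N by rewrite -ltnS (leq_trans lt) // size_hX.
exfalso; move/eqP: ip; apply.
have il : (i <= (p ^ f.+1).-1)%N by rewrite -ltnS ltn_ord.
have : (p %| i.+1)%N.
  have Q0 : (0 < p ^ f.+1)%N by rewrite expn_gt0 p0.
  have e : (((p ^ f.+1).-1 - i) + i.+1 = p ^ f.+1)%N.
    by rewrite addnS subnK // prednK.
  have : (p %| ((p ^ f.+1).-1 - i) + i.+1)%N by rewrite e expnS dvdn_mulr.
  by rewrite dvdn_addr.
move=> /dvdnP[c cE].
(* The index is congruent to -1 modulo p and at most 3 (p - 1)/2, which is less than 2 p - 1; hence
   it is p - 1. *)
have : (i < 2 * p - 1)%N.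
  have : ((p.-1./2).*2 = p.-1)%N.
    by have := odd_double_half p.-1; rewrite -subn1 oddB // p_odd.
  by rewrite -muln2; have := prime_gt1 p_prime; lia.
case: c cE => [|[|c]] cE; [by []|by rewrite mul1n in cE; lia|].
by rewrite !mulSn in cE; lia.
Qed.

End FrobeniusCoefficient.

Section Counting.
Variables (k : fieldType) (p : nat).
Hypotheses (p_prime : prime p) (p_odd : odd p) (pk : p%:R = 0 :> k).
Hypothesis sqrtk : forall c : k, exists r, r ^+ 2 = c.
Variables (f : nat) (T : seq k).
Hypothesis f_gt0 : (0 < f)%N.
Let q := (p ^ f)%N.
Hypotheses (uT : uniq T) (sT : size T = q) (memT : forall r, (r \in T) = (r ^+ q == r)).

Let p0 : (0 < p)%N. Proof. exact: prime_gt0. Qed.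
Let q1 : (1 < q)%N.
Proof. by rewrite /q -(exp1n f) ltn_exp2r // prime_gt1. Qed.
Let q0 : (0 < q)%N. Proof. exact: ltnW. Qed.
Let qk : q%:R = 0 :> k.
Proof. by rewrite /q -(prednK f_gt0) expnS natrM pk mul0r. Qed.
Let oq : odd q. Proof. by rewrite /q oddX p_odd orbT. Qed.
Let qh : ((q.-1./2).*2 = q.-1)%N.
Proof. by have := odd_double_half q.-1; rewrite -subn1 oddB // oq. Qed.

Lemma T0 : 0 \in T. Proof. by rewrite memT expr0n gtn_eqF. Qed.
Lemma TD a b : a \in T -> b \in T -> a + b \in T.
Proof. by rewrite !memT /q frobqD // => /eqP-> /eqP->. Qed.
Lemma TN a : a \in T -> - a \in T.
Proof. by rewrite !memT /q frobq_opp // => /eqP->. Qed.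
Lemma TB a b : a \in T -> b \in T -> a - b \in T.
Proof. by move=> aT bT; rewrite TD // TN. Qed.
Lemma TM a b : a \in T -> b \in T -> a * b \in T.
Proof. by rewrite !memT exprMn => /eqP-> /eqP->. Qed.
Lemma TV a : a \in T -> a^-1 \in T.
Proof. by rewrite !memT exprVn => /eqP->. Qed.
Lemma TX a n : a \in T -> a ^+ n \in T.
Proof. by rewrite !memT -exprM mulnC exprM => /eqP->. Qed.
Lemma Tint (n : int) : n%:~R \in T.
Proof. by rewrite memT /q frobq_int. Qed.
Lemma Tnat n : n%:R \in T.
Proof. by rewrite memT /q frobq_nat. Qed.

Lemma T_unit a : a \in T -> a != 0 -> a ^+ q.-1 = 1.
Proof.
rewrite memT => /eqP aq a0; apply: (mulfI a0).
by rewrite -exprS prednK // aq mulr1.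
Qed.

Lemma perm_T (g : k -> k) : injective g -> (forall a, a \in T -> g a \in T) ->
  perm_eq [seq g a | a <- T] T.
Proof.
move=> gI gT; have ug : uniq [seq g a | a <- T] by rewrite map_inj_uniq.
have sub : {subset [seq g a | a <- T] <= T} by move=> _ /mapP[a aT ->]; apply: gT.
have [|_ E] := uniq_min_size ug sub; first by rewrite size_map.
exact: uniq_perm.
Qed.

Lemma sumT_perm (g : k -> k) (F : k -> k) : injective g ->
  (forall a, a \in T -> g a \in T) -> \sum_(a <- T) F (g a) = \sum_(a <- T) F a.
Proof.
by move=> gI gT; rewrite -[RHS](perm_big _ (perm_T gI gT)) /= big_map.
Qed.

(** Multiplication by some u with u^j != 1 permutes the field and scales the sum. The range up to 2
    (q - 1) accommodates the degree 3 (q - 1)/2 of the polynomial to be summed. *)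
Lemma power_sum0 j : (0 < j < 2 * q.-1)%N -> j != q.-1 -> \sum_(a <- T) a ^+ j = 0.
Proof.
move=> /andP[j0 j2] jq.
have [u [uT' u0 uj]] : exists u, [/\ u \in T, u != 0 & u ^+ j != 1].
  apply: contrapT => N.
  have all1 u : u \in T -> u != 0 -> u ^+ j = 1.
    move=> uT' u0; apply: contrapT => uj; apply: N; exists u; split=> //.
    exact/eqP.
  (* Exponents matter only modulo q - 1, and X^i - 1 cannot have q - 1 roots when i < q - 1. *)
  have [i [i0 iq iP]] : exists i, [/\ (0 < i)%N, (i < q.-1)%N
      & forall u, u \in T -> u != 0 -> u ^+ i = 1].
    have [jlt|jge] := ltnP j q.-1; first by exists j.
    exists (j - q.-1)%N; split; [by rewrite subn_gt0 ltn_neqAle eq_sym jq|lia|].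
    move=> u uT' u0; have := all1 u uT' u0.
    by rewrite -{1}(subnK jge) exprD T_unit // mulr1.
  have : (size (rem 0%R T) < size ('X^i - 1 : {poly k})%R)%N.
    apply: max_poly_roots.
    - by rewrite -size_poly_gt0 size_XnsubC.
    - apply/allP => u; rewrite mem_rem_uniq // inE => /andP[u0 uT'].
      by rewrite /root !hornerE iP ?subrr.
    - exact: rem_uniq.
  by rewrite size_rem ?T0 // sT size_XnsubC //; lia.
have E : u ^+ j * \sum_(a <- T) a ^+ j = \sum_(a <- T) a ^+ j.
  rewrite mulr_sumr -[RHS](@sumT_perm (fun a => u * a)); first last.
  - by move=> a aT; apply: TM.
  - exact: mulfI.
  by apply: eq_bigr => a _; rewrite exprMn.
move/eqP: E; rewrite -subr_eq0 -[X in _ - X]mul1r -mulrBl mulf_eq0 subr_eq0.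
by rewrite (negPf uj) => /eqP.
Qed.

Lemma power_sum1 : \sum_(a <- T) a ^+ q.-1 = -1.
Proof.
have q10 : (0 < q.-1)%N by have := q1; lia.
rewrite (perm_big _ (perm_to_rem T0)) big_cons expr0n gtn_eqF //= add0r.
rewrite big_seq (eq_bigr (fun=> 1)); last first.
  move=> a; rewrite mem_rem_uniq // inE => /andP[a0 aT]; exact: T_unit.
rewrite -big_seq big_const_seq count_predT iter_addr_0 size_rem ?T0 // sT.
by rewrite -subn1 natrB // qk sub0r.
Qed.

Lemma poly_sum (H : {poly k}) : (size H <= 2 * q.-1)%N ->
  \sum_(a <- T) H.[a] = - H`_q.-1.
Proof.
move=> sH; under eq_bigr do rewrite (horner_coef_wide _ sH).
rewrite exchange_big /=.
have ql : (q.-1 < 2 * q.-1)%N by have := q1; lia.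
rewrite (bigD1 (Ordinal ql)) //= -mulr_sumr power_sum1 mulrN1 big1 ?addr0 //.
move=> i; rewrite -val_eqE /= => iq; rewrite -mulr_sumr.
have [i0|i0] := posnP (i : nat).
  under eq_bigr do rewrite i0 expr0.
  by rewrite big_const_seq count_predT iter_addr_0 sT qk mulr0.
by rewrite power_sum0 ?mulr0 // i0 ltn_ord.
Qed.

(** Euler's criterion: a square root r of c exists in k, and r^(q-1) = c^((q-1)/2) decides whether
    it belongs to the field of q elements. *)
Lemma count_sqrt c : c \in T -> (count (fun r => r ^+ 2 == c) T)%:R = 1 + c ^+ q.-1./2.
Proof.
move=> cT; have h0 : (0 < q.-1./2)%N by have := qh; rewrite -muln2; have := q1; have := oq; case: (q) => [|[|[|n]]] //; lia.
have [->|c0] := eqVneq c 0.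
  rewrite expr0n gtn_eqF // addr0 (eq_count (a2 := pred1 0)); last first.
    by move=> r /=; rewrite sqrf_eq0.
  by rewrite count_uniq_mem // T0.
have [r rc] := sqrtk c; have r0 : r != 0 by apply: contraNneq c0 => r0; rewrite -rc r0 expr0n.
have rN : r != - r.
  apply: contraNneq r0 => E; have : 2 * r = 0 by rewrite mulr2n mulrDl mul1r {1}E addNr.
  move/eqP; rewrite mulf_eq0 => /orP[] // /eqP two0.
  move: pk; rewrite -(odd_double_half p) p_odd natrD -muln2 natrM two0 mulr0 addr0 => /eqP.
  by rewrite oner_eq0.
have rq : r ^+ q.-1 = c ^+ q.-1./2 by rewrite -rc -exprM mulnC muln2 qh.
have rE s : (s ^+ 2 == c) = (s == r) || (s == - r).
  by rewrite -rc eqf_sqr.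
have : (c ^+ q.-1./2) ^+ 2 == 1 by rewrite -exprM muln2 qh T_unit.
rewrite sqrf_eq1 => /orP[] /eqP E.
  have rT : r \in T by rewrite memT -(prednK q0) exprS rq E mulr1.
  rewrite (eq_count (a2 := predU (pred1 r) (pred1 (- r)))); last by move=> s /=; rewrite rE.
  have := count_predUI (pred1 r) (pred1 (- r)) T.
  rewrite (eq_count (a2 := pred0) (a1 := predI _ _)); last first.
    by move=> s /=; apply/negbTE/negP => /andP[/eqP-> /eqP]; apply/eqP.
  by rewrite count_pred0 addn0 => ->; rewrite !count_uniq_mem // TN // rT E.
rewrite (eq_in_count (a2 := pred0)); first by rewrite count_pred0 E subrr.
move=> s sTs /=; rewrite rE; apply/negbTE/negP => /orP[] /eqP sE.
  have := T_unit sTs; rewrite sE r0 rq E => /(_ isT)/esym/eqP.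
  rewrite -addr_eq0 -(mulr2n 1) => /eqP two0.
  by move: pk; rewrite -(odd_double_half p) p_odd natrD -muln2 natrM two0 mulr0 addr0 => /eqP; rewrite oner_eq0.
have sTN := TN sTs; rewrite sE opprK in sTN.
have := T_unit sTN r0; rewrite rq E => /esym/eqP.
rewrite -addr_eq0 -(mulr2n 1) => /eqP two0.
by move: pk; rewrite -(odd_double_half p) p_odd natrD -muln2 natrM two0 mulr0 addr0 => /eqP; rewrite oner_eq0.
Qed.

Variable W : weierstrass.
Let a1 : k := (wa1 W)%:~R. Let a2 : k := (wa2 W)%:~R. Let a3 : k := (wa3 W)%:~R.
Let a4 : k := (wa4 W)%:~R. Let a6 : k := (wa6 W)%:~R.

(** On the curve, (2 y + a1 x + a3)^2 equals this polynomial in x. *)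
Definition hpoly : {poly k} :=
  4%:P * 'X ^+ 3 + (a1 ^+ 2 + 4 * a2)%:P * 'X ^+ 2 + (2 * a1 * a3 + 4 * a4)%:P * 'X + (a3 ^+ 2 + 4 * a6)%:P.

Definition affine_pts : seq (k * k) :=
  [seq xy <- [seq (x, y) | x <- T, y <- T] | on_wcurve W xy.1 xy.2].

Lemma two_neq0 : (2 : k) != 0.
Proof.
apply/eqP => two0; move: pk; rewrite -(odd_double_half p) p_odd natrD -muln2.
by rewrite natrM two0 mulr0 addr0 => /eqP; rewrite oner_eq0.
Qed.

Lemma size_hpoly : (size hpoly <= 4)%N.
Proof.
rewrite /hpoly; do !(rewrite (leq_trans (size_polyD _ _)) // geq_max; apply/andP; split);
  rewrite ?(leq_trans (size_polyC_leq1 _)) //;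
  rewrite (leq_trans (size_polyMleq _ _)) // ?size_polyXn ?size_polyX size_polyC;
  by case: (_ != 0).
Qed.

Lemma hpoly_int : exists h : {poly int}, hpoly = map_poly intr h.
Proof.
exists (4%:P * 'X ^+ 3 + (wa1 W ^+ 2 + 4 * wa2 W)%:P * 'X ^+ 2
  + (2 * wa1 W * wa3 W + 4 * wa4 W)%:P * 'X + (wa3 W ^+ 2 + 4 * wa6 W)%:P).
rewrite !(rmorphD, rmorphM, rmorphXn) /= !map_polyX !map_polyC /= /hpoly.
by rewrite !(rmorphD, rmorphM, rmorphXn).
Qed.

(** Euler's criterion turns the count into the sum over x of 1 + h(x)^((q-1)/2), of which only the
    coefficient of degree q - 1 survives. *)
Lemma count_affine :
  (size affine_pts)%:R = - (hpoly ^+ q.-1./2)`_q.-1 :> k.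
Proof.
have -> : size affine_pts = (\sum_(x <- T) count (fun y => on_wcurve W x y) T)%N.
  rewrite /affine_pts size_filter.
  have gen (s : seq k) : count (fun xy => on_wcurve W xy.1 xy.2) [seq (x, y) | x <- s, y <- T] =
      (\sum_(x <- s) count (fun y => on_wcurve W x y) T)%N.
    elim: s => [|x s IHs]; first by rewrite big_nil.
    by rewrite big_cons /= count_cat IHs count_map.
  exact: gen.
rewrite natr_sum big_seq.
have xE x : x \in T -> (count (fun y => on_wcurve W x y) T)%:R
    = 1 + (hpoly ^+ q.-1./2).[x].
  move=> xT; pose g y := 2 * y + a1 * x + a3.
  have gI : injective g.
    by move=> y y' /addIr/addIr/(mulfI two_neq0).
  have gT y : y \in T -> g y \in T.
    move=> yT; do !apply: TD; try exact: Tint; apply: TM => //; [exact: Tnat|exact: Tint].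
  have hE : hpoly.[x] = 4 * x ^+ 3 + (a1 ^+ 2 + 4 * a2) * x ^+ 2 + (2 * a1 * a3 + 4 * a4) * x
       + (a3 ^+ 2 + 4 * a6).
    by rewrite /hpoly !hornerE /=; ring.
  have hT : hpoly.[x] \in T.
    by rewrite hE; repeat first [assumption|exact: Tint|exact: Tnat|apply: TD|apply: TM|apply: TX].
  rewrite (eq_count (a2 := preim g (fun r => r ^+ 2 == hpoly.[x]))); last first.
    move=> y /=; rewrite /on_wcurve -/a1 -/a2 -/a3 -/a4 -/a6.
    rewrite -subr_eq0 -[RHS]subr_eq0.
    have -> : g y ^+ 2 - hpoly.[x] = 4 * (y ^+ 2 + a1 * x * y + a3 * y
        - (x ^+ 3 + a2 * x ^+ 2 + a4 * x + a6)) by rewrite hE /g; ring.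
    have -> : (4 : k) = 2 * 2 by ring.
    by rewrite !mulf_eq0 (negPf two_neq0).
  rewrite -count_map (seq.permP (perm_T gI gT)) count_sqrt //.
  by rewrite horner_exp.
rewrite (eq_bigr _ xE) -big_seq big_split /= big_const_seq count_predT iter_addr_0 sT qk add0r.
apply: poly_sum; apply: (leq_trans (size_hX size_hpoly _)).
by have := qh; rewrite -muln2; have := q1; have := oq; case: (q) => [|[|[|n]]] //=; lia.
Qed.

Lemma count_affine_power :
  (size affine_pts)%:R = - (hpoly ^+ p.-1./2)`_p.-1 ^+ f :> k.
Proof.
rewrite count_affine hasse_power //; first exact: size_hpoly.
by move=> i; have [h ->] := hpoly_int; rewrite coef_map /= -[p in LHS]expn1 frobq_int.
Qed.

End Counting.

Section PrimeFieldEmbedding.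
Variables (p : nat) (k : fieldType).
Hypotheses (p_prime : prime p) (pk : p%:R = 0 :> k).

Definition Fp_emb (a : 'F_p) : k := (a : nat)%:R.

Lemma natr_modp n : (n %% p)%:R = n%:R :> k.
Proof. by rewrite {2}(divn_eq n p) natrD natrM pk mulr0 add0r. Qed.

Lemma Fp_emb_nat n : Fp_emb n%:R = n%:R.
Proof. by rewrite /Fp_emb val_Fp_nat // natr_modp. Qed.

Lemma Fp_embD a b : Fp_emb (a + b) = Fp_emb a + Fp_emb b.
Proof.
have D (m n : nat) : Fp_emb (m%:R + n%:R) = m%:R + n%:R.
  by rewrite -natrD Fp_emb_nat natrD.
by have := D a b; rewrite !natr_Zp.
Qed.

Fact Fp_emb_zmod : zmod_morphism Fp_emb.
Proof. by move=> a b; have := Fp_embD (a - b) b; rewrite subrK => ->; rewrite addrK. Qed.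

Fact Fp_emb_monoid : monoid_morphism Fp_emb.
Proof.
split; first by rewrite (_ : 1 = 1%:R) // Fp_emb_nat.
move=> a b; have M (m n : nat) : Fp_emb (m%:R * n%:R) = m%:R * n%:R.
  by rewrite -natrM Fp_emb_nat natrM.
by have := M a b; rewrite !natr_Zp.
Qed.

HB.instance Definition _ := GRing.isZmodMorphism.Build _ _ Fp_emb Fp_emb_zmod.
HB.instance Definition _ := GRing.isMonoidMorphism.Build _ _ Fp_emb Fp_emb_monoid.

Lemma on_wcurve_Fp W x y : on_wcurve W (Fp_emb x) (Fp_emb y) = on_wcurve W x y.
Proof.
rewrite /on_wcurve -!(rmorph_int Fp_emb) -!(rmorphM, rmorphD, rmorphXn).
by rewrite (inj_eq (fmorph_inj Fp_emb)).
Qed.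

End PrimeFieldEmbedding.

(** * An annihilator of the rational points of the reduction *)

Section Lagrange.
Variables (p : primeNat) (C : Qp_closure p) (W : weierstrass).
Hypothesis p_odd : odd p.
Hypothesis good : ~~ (p%:Z %| wdisc W)%Z.
Local Notation k := (kbar C).
Local Notation EK := (curveK C p_odd good).

Let p_prime : prime p. Proof. exact: prime_valP. Qed.
Let pk : p%:R = 0 :> k. Proof. exact: kbar_char. Qed.

(** Both sides are the number of affine points over the prime field, read in the residue field: the
    coefficient is the Hasse invariant. *)
Lemma hasse_trace : - (hpoly k W ^+ p.-1./2)`_p.-1 = - (wtrace W p)%:~R.
Proof.
have [|T [uT sT memT]] := @kbar_frobenius_fixed p C p (prime_gt0 p_prime); first exact: pk.
have sT' : size T = (p ^ 1)%N by rewrite expn1.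
have memT' r : (r \in T) = (r ^+ (p ^ 1) == r) by rewrite expn1.
have := count_affine_power p_prime p_odd pk (kbar_sqrt (C := C)) (ltn0Sn 0) uT sT' memT' W.
rewrite expr1 => <-.
have -> : size (affine_pts T W) = #|[pred xy : 'F_p * 'F_p | on_wcurve W xy.1 xy.2]|.
  pose F := @Fp_emb p k.
  have FI : injective F by apply: (fmorph_inj (Fp_emb k : {rmorphism 'F_p -> k})).
  rewrite cardE -(size_map (fun xy => (F xy.1, F xy.2))).
  apply: perm_size; apply: uniq_perm.
  - by rewrite filter_uniq // allpairs_uniq // => -[a b] [c d].
  - by rewrite map_inj_uniq ?enum_uniq // => -[a b] [c d] [/FI-> /FI->].
  have FT a : F a \in T by rewrite memT' /F /Fp_emb frobq_nat.
  have TF r : r \in T -> exists a, r = F a.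
    move=> rT; have uF : uniq [seq F a | a <- enum 'F_p] by rewrite map_inj_uniq ?enum_uniq.
    have sub : {subset [seq F a | a <- enum 'F_p] <= T}.
      by move=> _ /mapP[a _ ->]; apply: FT.
    have [|_ E] := uniq_min_size uF sub.
      by rewrite size_map -cardE card_Fp // sT.
    by move: rT; rewrite -E => /mapP[a _ ->]; exists a.
  move=> [x y]; rewrite mem_filter /=; apply/andP/mapP => [[on /allpairsP[[x' y'] /= [xT yT [xE yE]]]]|].
    have [a aE] := TF _ xT; have [b bE] := TF _ yT; exists (a, b); last first.
      by rewrite xE yE aE bE.
    by rewrite mem_enum inE /= -(on_wcurve_Fp p_prime pk) -/(F a) -aE -/(F b) -bE -xE -yE.
  move=> [[a b]]; rewrite mem_enum inE /= => on [-> ->].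
  by rewrite on_wcurve_Fp // on; split=> //; apply/allpairsP; exists (F a, F b); split=> //=; apply: FT.
rewrite /wtrace /wcount; set n := #|_|.
by rewrite -addn1 PoszD rmorphB !rmorphD /= -!pmulrn pk; ring.
Qed.

Definition frob_point f (R : wpoint k) : bool :=
  if R is Some (x, y) then (x ^+ (p ^ f) == x) && (y ^+ (p ^ f) == y) else true.

(** The points fixed by the q-power Frobenius, q = p^f, form a finite group of order congruent to 1
    - a_p^f modulo p. Translation by R permutes it, and comparing the sums of its elements shows
    that its order kills R. *)
Lemma frob_lagrange f : (0 < f)%N -> ~~ (p%:Z %| wtrace W p ^+ f - 1)%Z ->
  exists M, coprime p M /\
    forall R : ecpoint EK, frob_point f (val R) -> R *+ M = 0.
Proof.
move=> f0 npt.
have qk : (p ^ f)%:R = 0 :> k by rewrite -(prednK f0) expnS natrM pk mul0r.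
have q0 : (0 < p ^ f)%N by rewrite expn_gt0 prime_gt0.
have [T [uT sT memT]] := kbar_frobenius_fixed q0 qk.
have cnt := count_affine_power p_prime p_odd pk (kbar_sqrt (C := C)) f0 uT sT memT W.
pose L : seq (wpoint k) := None :: [seq Some xy | xy <- affine_pts T W].
have memL R : (R \in L) = in_wcurve W R && frob_point f R.
  rewrite inE; case: R => [[x y]|] //=.
  rewrite mem_map; last by move=> ? ? [].
  rewrite mem_filter /=; congr (_ && _); apply/allpairsP/andP.
    by move=> [[x' y'] /= [+ + [-> ->]]]; rewrite !memT.
  by rewrite -!memT => -[xT yT]; exists (x, y).
pose A : seq (ecpoint EK) := pmap insub L.
have memA (R : ecpoint EK) : (R \in A) = frob_point f (val R).
  by rewrite mem_pmap_sub memL /= (valP R).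
have uA : uniq A.
  have uaff : uniq (affine_pts T W).
    by rewrite filter_uniq // allpairs_uniq // => -[? ?] [? ?].
  rewrite pmap_sub_uniq //= map_inj_uniq ?uaff ?andbT; last by move=> ? ? [].
  by apply/mapP => -[].
have sA : size A = (size (affine_pts T W)).+1.
  rewrite size_pmap_sub (eq_in_count (a2 := predT)); last first.
    by move=> R; rewrite memL => /andP[->].
  by rewrite count_predT /= size_map.
exists (size A); split.
  rewrite prime_coprime //; apply: contra npt => /dvdnP[c cE].
  rewrite -(kbar_int_eq0 C) rmorphB rmorphXn /=.
  have : (size A)%:R = 0 :> k by rewrite cE natrM pk mulr0.
  rewrite sA -addn1 natrD cnt => /eqP; rewrite addrC subr_eq0 => /eqP E.
  by rewrite subr_eq0 [X in _ == X]E; have := hasse_trace => /oppr_inj ->.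
have TD' := TD p_prime pk memT; have TM' := TM memT; have TV' := TV memT.
have TN' := TN p_odd memT; have TX' := TX memT; have Ti := Tint p_prime p_odd pk memT.
have Tn := Tnat p_prime pk memT.
have TB' a b : a \in T -> b \in T -> a - b \in T by move=> ? ?; apply: (TD') => //; apply: (TN').
have clos (R S : ecpoint EK) : R \in A -> S \in A -> R + S \in A.
  rewrite !memA val_ptD.
  case: (val R) => [[x1 y1]|] //; case: (val S) => [[x2 y2]|] //.
  rewrite /frob_point -!memT => /andP[xT yT] /andP[x'T y'T].
  rewrite /wadd; case: ifP => // _; set l := (if x1 == x2 then _ else _).
  have lT : l \in T.
    rewrite /l; case: ifP => _; apply: (TM') => //; try apply: (TV');
    by repeat first [assumption|exact: Ti|exact: Tn|apply: (TX')|apply: (TB')|apply: (TD')|apply: (TM')|apply: (TN')].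
  by rewrite -!memT; apply/andP; split;
    repeat first [assumption|exact: Ti|exact: Tn|apply: (TX')|apply: (TB')|apply: (TD')|apply: (TM')|apply: (TN')].
move=> R; rewrite -memA => RA.
have uRA : uniq [seq R + B | B <- A] by rewrite map_inj_uniq //; apply: addrI.
have sub : {subset [seq R + B | B <- A] <= A} by move=> _ /mapP[B BA ->]; apply: clos.
have [|_ E] := uniq_min_size uRA sub; first by rewrite size_map.
have E2 : \sum_(B <- [seq R + B | B <- A]) B = \sum_(B <- A) B.
  by apply: perm_big; apply: uniq_perm.
move: E2; rewrite big_map big_split /= big_const_seq count_predT iter_addr_0.
by move/(congr1 (fun z => z - \sum_(i <- A) i)); rewrite addrK subrr.
Qed.

End Lagrange.

(** * Galois number fields inside the algebraic numbers *)

Lemma rmorph_ext (R S : nzRingType) (f g : {rmorphism R -> S}) : f =1 g -> f = g.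
Proof.
case: f g => f [[fm1] [fm2]] [g [[gm1] [gm2]]] /= /funext fg.
rewrite fg in fm1 fm2 *.
by rewrite (Prop_irrelevance fm1 gm1) (Prop_irrelevance fm2 gm2).
Qed.

Local Notation pQtoC := (map_poly (ratr : rat -> algC)).

(** The splitting field of the minimal polynomial of x is Galois over Q, and its automorphisms
    extend to [algC]; hence x lies in their fixed field. *)
Lemma fixed_Crat (x : algC) : (forall s : absGal, s x = x) -> x \in Crat.
Proof.
move=> sx; have [P [PE Pm] Pmin] := minCpolyP x.
have [r rE] := closed_field_poly_normal (pQtoC P : {poly algC}).
rewrite lead_coef_map (monicP Pm) rmorph1 scale1r in rE.
have xr : x \in r by rewrite -root_prod_XsubC -rE Pmin dvdpp.
have [Qn [QnC [rr rrE genQn]]] := num_field_exists r.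
have QE : map_poly (in_alg Qn) P = \prod_(y <- rr) ('X - y%:P).
  apply: (@map_inj_poly _ _ QnC); [exact: fmorph_inj|exact: rmorph0|].
  rewrite rmorph_prod /= -map_poly_comp.
  rewrite (eq_map_poly (g := ratr)); last first.
    by move=> a; rewrite /= rmorphZ_num rmorph1 mulr1.
  rewrite rE -rrE big_map; apply: eq_bigr => y _.
  by rewrite rmorphB /= map_polyX map_polyC.
have over1 : map_poly (in_alg Qn) P \is a polyOver 1%AS.
  by apply/polyOverP => i; rewrite coef_map /= memvZ ?mem1v.
have split1 : splittingFieldFor 1 (map_poly (in_alg Qn) P) {:Qn}.
  by exists rr; rewrite ?genQn // QE eqpxx.
have Qn_ax : FieldExt_isSplittingField _ Qn.
  by constructor; exists (map_poly (in_alg Qn) P).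
pose Qs : splittingFieldType rat := HB.pack_for (splittingFieldType rat) Qn Qn_ax.
have gal : galois 1 {:Qs}.
  apply/and3P; split; rewrite ?sub1v ?normalFieldf //.
  by apply/separableP => z _; apply: pcharf0_separable => q; rewrite pchar_lalg pchar_num.
have /mapP[y yr xE] : x \in map QnC rr by rewrite rrE.
have : (y : Qs) \in fixedField 'Gal({:Qs} / 1)%g.
  apply/fixedFieldP; first exact: memvf.
  move=> g _; have [nu nuE] := extend_algC_subfield_aut (Qs := Qs) QnC g.
  by apply: (fmorph_inj QnC); rewrite nuE -xE sx.
rewrite (galois_fixedField gal) => /vlineP[c cE].
by rewrite xE cE rmorphZ_num rmorph1 mulr1 Crat_rat.
Qed.

Section Embeddings.
Variables (p : primeNat) (C : Qp_closure p) (iota : emb C).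

Lemma emb_conj (i : emb C) x : exists y, i x = iota y.
Proof.
have [P [PE Pm] Pmin] := minCpolyP x.
have [r rE] := closed_field_poly_normal (pQtoC P : {poly algC}).
rewrite lead_coef_map (monicP Pm) rmorph1 scale1r in rE.
have E (j : emb C) : map_poly j (pQtoC P) = map_poly ratr P.
  by rewrite -map_poly_comp; apply: eq_map_poly => a /=; rewrite fmorph_rat.
have : root (map_poly i (pQtoC P)) (i x) by rewrite fmorph_root Pmin dvdpp.
rewrite E -(E iota) rE rmorph_prod /=.
rewrite (eq_bigr (fun y => 'X - (iota y)%:P)); last first.
  by move=> y _; rewrite rmorphB /= map_polyX map_polyC.
by rewrite -(big_map iota predT (fun y => 'X - y%:P)) root_prod_XsubC => /mapP[y _ ->]; exists y.
Qed.

(** Every i(x) is the image under iota of a conjugate of x, so i factors through the injection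
    iota. *)
Lemma emb_transitive (i : emb C) : exists s : absGal, i = emb_comp iota s.
Proof.
have [s sE] := choice (emb_conj i).
have sB : zmod_morphism s.
  by move=> x y; apply: (fmorph_inj iota); rewrite rmorphB -!sE rmorphB.
have sM : monoid_morphism s.
  split; first by apply: (fmorph_inj iota); rewrite -sE !rmorph1.
  by move=> x y; apply: (fmorph_inj iota); rewrite rmorphM -!sE rmorphM.
pose s' : absGal := HB.pack s (GRing.isZmodMorphism.Build _ _ s sB)
  (GRing.isMonoidMorphism.Build _ _ s sM).
by exists s'; apply: rmorph_ext => x /=; rewrite sE.
Qed.

End Embeddings.

Definition absGal_inv (s : absGal) : absGal := algC_invaut s.

(** Finite Galois extensions of Q inside [algC]. Finiteness is a spanning family, which is directly
    available for K(mu_{p^N}). *)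
Record galfield (F : set algC) : Prop := GalField {
  gf_sub : is_subfield F;
  gf_normal : forall (s : absGal) x, F x -> F (s x);
  gf_fin : exists (n : nat) (b : 'I_n -> algC), (forall k, F (b k)) /\
    forall x, F x -> exists q : 'I_n -> rat, x = \sum_k ratr (q k) * b k }.

Section Subfield.
Variable F : set algC.
Hypothesis sF : is_subfield F.

Lemma sf1 : F 1. Proof. by case: sF. Qed.
Lemma sfB x y : F x -> F y -> F (x - y). Proof. by case: sF => _ h _ _; apply: h. Qed.
Lemma sfM x y : F x -> F y -> F (x * y). Proof. by case: sF => _ _ h _; apply: h. Qed.
Lemma sfV x : F x -> F x^-1. Proof. by case: sF => _ _ _; apply. Qed.
Lemma sf0 : F 0. Proof. by rewrite -(subrr 1); apply: sfB; apply: sf1. Qed.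
Lemma sfN x : F x -> F (- x). Proof. by move=> Fx; rewrite -sub0r; apply: sfB => //; apply: sf0. Qed.
Lemma sfD x y : F x -> F y -> F (x + y).
Proof. by move=> Fx Fy; rewrite -[y]opprK; apply: sfB => //; apply: sfN. Qed.
Lemma sfX x n : F x -> F (x ^+ n).
Proof. by move=> Fx; elim: n => [|n IHn]; [exact: sf1|rewrite exprS; apply: sfM]. Qed.
Lemma sfnat n : F n%:R.
Proof. by elim: n => [|n IHn]; [exact: sf0|rewrite -addn1 natrD; apply: sfD => //; apply: sf1]. Qed.
Lemma sfint (n : int) : F n%:~R.
Proof.
case: n => n; first by rewrite -pmulrn; apply: sfnat.
by rewrite NegzE mulrNz; apply/sfN/sfnat.
Qed.

Lemma sfsum I (r : seq I) (P : pred I) (G : I -> algC) :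
  (forall i, P i -> F (G i)) -> F (\sum_(i <- r | P i) G i).
Proof. by move=> FG; apply: (big_ind F) => //; [exact: sf0|exact: sfD]. Qed.

End Subfield.

Section GaloisField.
Variable F : set algC.
Hypothesis gF : galfield F.
Let sF := gf_sub gF.
Local Notation G := (galQ F).

Lemma gal_piP (s t : absGal) : \pi_(galQ F) s = \pi_(galQ F) t <-> (forall x, F x -> s x = t x).
Proof.
split=> [/eqmodP/asboolP|st]; first by [].
exact/eqmodP/asboolP.
Qed.

Lemma gal_liftK (s : absGal) x : F x -> gal_lift (\pi_(galQ F) s) x = s x.
Proof.
have /gal_piP E : \pi_(galQ F) (gal_lift (\pi_(galQ F) s)) = \pi_(galQ F) s.
  by rewrite /gal_lift reprK.
exact: E.
Qed.

Lemma gal_lift_pi (s : G) : \pi_(galQ F) (gal_lift s) = s.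
Proof. exact: reprK. Qed.

Lemma gal_ext (s t : G) : (forall x, F x -> gal_lift s x = gal_lift t x) -> s = t.
Proof. by move=> st; rewrite -(gal_lift_pi s) -(gal_lift_pi t); apply/gal_piP. Qed.

Lemma gal_lift_in (s : G) x : F x -> F (gal_lift s x).
Proof. exact: gf_normal. Qed.

Lemma gal_lift_mul (s t : G) x : F x ->
  gal_lift (gal_mul s t) x = gal_lift s (gal_lift t x).
Proof. by move=> Fx; rewrite /gal_mul gal_liftK. Qed.

Lemma gal_lift1 x : F x -> gal_lift (gal_one F) x = x.
Proof. by move=> Fx; rewrite /gal_one gal_liftK. Qed.

Lemma absGal_Kinv (s : absGal) x : absGal_inv s (s x) = x.
Proof. exact: algC_autK. Qed.

Lemma gal_mulVg (s : G) : gal_mul (gal_inv s) s = gal_one F.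
Proof.
rewrite /gal_inv; case: xgetP => // /(_ (\pi_(galQ F) (absGal_inv (gal_lift s)))) [].
apply: gal_ext => x Fx; rewrite gal_lift_mul // gal_lift1 // gal_liftK ?absGal_Kinv //.
exact: gal_lift_in.
Qed.

Lemma gal_mulA (s t u : G) : gal_mul s (gal_mul t u) = gal_mul (gal_mul s t) u.
Proof.
apply: gal_ext => x Fx; rewrite !gal_lift_mul //; exact: gal_lift_in.
Qed.

Lemma gal_mul1g (s : G) : gal_mul (gal_one F) s = s.
Proof.
apply: gal_ext => x Fx; rewrite gal_lift_mul // gal_lift1 //; exact: gal_lift_in.
Qed.

Lemma gal_mulg1 (s : G) : gal_mul s (gal_one F) = s.
Proof. by apply: gal_ext => x Fx; rewrite gal_lift_mul // gal_lift1. Qed.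

Lemma gal_mulKg (s t : G) : gal_mul (gal_inv s) (gal_mul s t) = t.
Proof. by rewrite gal_mulA gal_mulVg gal_mul1g. Qed.

Lemma gal_mulgV (s : G) : gal_mul s (gal_inv s) = gal_one F.
Proof.
rewrite -[LHS](gal_mul1g) -{1}(gal_mulVg (gal_inv s)) -gal_mulA.
by rewrite (gal_mulA (gal_inv s)) gal_mulVg gal_mul1g gal_mulVg.
Qed.

Lemma gal_mulKVg (s t : G) : gal_mul s (gal_mul (gal_inv s) t) = t.
Proof. by rewrite gal_mulA gal_mulgV gal_mul1g. Qed.

(** An automorphism is determined by its values on the spanning family, each of them a root of a
    fixed polynomial. *)
Lemma gal_finite : finite_set [set: G].
Proof.
have [n [b [Fb bspan]]] := gf_fin gF.
have /choice[r rP] k : exists r : seq algC, forall s : absGal, s (b k) \in r.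
  have [P [PE Pm] Pmin] := minCpolyP (b k).
  have [r rE] := closed_field_poly_normal (pQtoC P : {poly algC}).
  rewrite lead_coef_map (monicP Pm) rmorph1 scale1r in rE.
  exists r => s; rewrite -root_prod_XsubC -rE -PE -(minCpoly_aut s).
  exact: root_minCpoly.
pose M := (\sum_k size (r k)).+1.
pose c (s : G) : {ffun 'I_n -> 'I_M} := [ffun k => inord (index (gal_lift s (b k)) (r k))].
have cI s t : c s = c t -> s = t.
  move=> st; apply: gal_ext => x /bspan[q ->].
  rewrite !rmorph_sum; apply: eq_bigr => k _; rewrite !(fmorph_rat, rmorphM).
  congr (_ * _); have := congr1 (fun f : {ffun 'I_n -> 'I_M} => val (f k)) st.
  have lt (u : G) : (index (gal_lift u (b k)) (r k) < M)%N.
    rewrite ltnS (leq_trans (index_size _ _)) // (bigD1 k) //= leq_addr //.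
  by rewrite !ffunE /= !inordK //; apply: index_inj (rP k _).
have : finite_set [set` {ffun 'I_n -> 'I_M}] by apply: finite_finpred.
pose h (f : {ffun 'I_n -> 'I_M}) : G := xget (gal_one F) [set s | c s = f].
move/(finite_image h); apply: sub_finite_set => s _; exists (c s) => //.
by rewrite /h; case: xgetP => [t _ /= /cI //|/(_ s) /= /(_ erefl)].
Qed.

Lemma gal_seq_ex : {gs : seq G | uniq gs /\ forall s, s \in gs}.
Proof.
apply: cid; have /finite_seqP[s sE] := gal_finite.
exists (undup s); split; first exact: undup_uniq.
by move=> t; rewrite mem_undup; have : [set` s] t by rewrite -sE.
Qed.

Definition gal_seq : seq G := sval gal_seq_ex.
Lemma gal_seq_uniq : uniq gal_seq. Proof. by case: (svalP gal_seq_ex). Qed.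
Lemma mem_gal_seq s : s \in gal_seq. Proof. by case: (svalP gal_seq_ex). Qed.

Lemma gal_setT : [set: G] = [set` gal_seq].
Proof. by apply/seteqP; split=> s //= _; rewrite mem_gal_seq. Qed.

Lemma fsum_gal (Y : nmodType) (f : G -> Y) : \sum_(s \in [set: G]) f s = \sum_(s <- gal_seq) f s.
Proof. by rewrite gal_setT -fsbig_seq // gal_seq_uniq. Qed.

Lemma perm_gal_mul (t : G) : perm_eq [seq gal_mul t s | s <- gal_seq] gal_seq.
Proof.
apply: uniq_perm; rewrite ?gal_seq_uniq //.
  rewrite map_inj_uniq ?gal_seq_uniq // => s u /(congr1 (gal_mul (gal_inv t))).
  by rewrite !gal_mulKg.
move=> s; rewrite mem_gal_seq; apply/mapP; exists (gal_mul (gal_inv t) s).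
  exact: mem_gal_seq.
by rewrite gal_mulKVg.
Qed.

Lemma sum_gal_mul (Y : nmodType) (t : G) (f : G -> Y) :
  \sum_(s <- gal_seq) f (gal_mul t s) = \sum_(s <- gal_seq) f s.
Proof. by rewrite -[RHS](perm_big _ (perm_gal_mul t)) big_map. Qed.

(** Dedekind's argument: the relation at x0 x minus s(x0) times the relation at x eliminates s and
    shortens the relation. *)
Lemma gal_independent (us : seq G) (c : G -> algC) : uniq us ->
  (forall x, F x -> \sum_(s <- us) c s * gal_lift s x = 0) ->
  forall s, s \in us -> c s = 0.
Proof.
have [n] := ubnP (size us); elim: n us c => // n IHn us c; rewrite ltnS => sus uus H s sus'.
apply: contrapT => cs.
have rec (x0 : algC) : F x0 -> forall t, t \in us -> t != s ->
    c t * (gal_lift t x0 - gal_lift s x0) = 0.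
  move=> Fx0 t tus ts.
  apply: (IHn (rem s us) (fun t => c t * (gal_lift t x0 - gal_lift s x0))).
  - by rewrite size_rem //; case: (us) sus' sus => // a l _ /=; rewrite ltnS.
  - exact: rem_uniq.
  - move=> x Fx; have := H _ (sfM sF Fx0 Fx); have := H _ Fx.
    rewrite !(perm_big _ (perm_to_rem sus')) !big_cons /= => H1 H2.
    have : \sum_(t <- rem s us) c t * gal_lift t (x0 * x)
        - gal_lift s x0 * \sum_(t <- rem s us) c t * gal_lift t x = 0.
      move/eqP: H1; rewrite addrC addr_eq0 => /eqP ->.
      move/eqP: H2; rewrite addrC addr_eq0 => /eqP ->.
      by rewrite rmorphM; ring.
    move=> E; rewrite -[RHS]E mulr_sumr -sumrB; apply: eq_bigr => u _.
    by rewrite rmorphM; ring.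
  by rewrite mem_rem_uniq // inE ts.
have c0 t : t \in us -> t != s -> c t = 0.
  move=> tus ts; apply: contrapT => /eqP ct.
  move/eqP: (ts); apply; apply: gal_ext => x Fx.
  by have /eqP := rec x Fx t tus ts; rewrite mulf_eq0 (negPf ct) /= subr_eq0 => /eqP.
have := H 1 (sf1 sF); rewrite (perm_big _ (perm_to_rem sus')) big_cons /= big1_seq.
  by rewrite rmorph1 mulr1 addr0 => /cs.
move=> t /=; rewrite mem_rem_uniq // inE => /andP[ts tus].
by rewrite c0 // mul0r.
Qed.

Definition gal_n := size gal_seq.
Definition gal_nth (j : 'I_gal_n) : G := tnth (in_tuple gal_seq) j.

Lemma gal_nth_inj : injective gal_nth.
Proof. by apply/tuple_uniqP; apply: gal_seq_uniq. Qed.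

Lemma gal_nthP s : exists j, s = gal_nth j.
Proof. exact/tnthP/mem_gal_seq. Qed.

Lemma sum_gal_nth (Y : nmodType) (f : G -> Y) :
  \sum_(s <- gal_seq) f s = \sum_j f (gal_nth j).
Proof. exact: big_tnth. Qed.

(** By independence of characters the matrix of conjugates of a spanning family has full rank, so n
    of its rows form an invertible matrix. The coordinates of x in the chosen elements are fixed by
    every automorphism, which merely permutes the columns, and are therefore rational. *)
Lemma gal_basis : exists w : 'I_gal_n -> algC, [/\ forall k, F (w k),
  (\matrix_(k, j) gal_lift (gal_nth j) (w k)) \in unitmx
  & forall x, F x -> exists q : 'I_gal_n -> rat, x = \sum_k ratr (q k) * w k].
Proof.
have [D [b [Fb bspan]]] := gf_fin gF.
pose A : 'M[algC]_(D, gal_n) := \matrix_(k, j) gal_lift (gal_nth j) (b k).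
have fA : row_full A.
  rewrite /row_full -mxrank_tr -/(row_free A^T) -kermx_eq0.
  apply/eqP/matrixP => i j; rewrite [RHS]mxE; set K := kermx A^T.
  have KA : K *m A^T = 0 by apply: mulmx_ker.
  pose c (s : G) : algC := \sum_(j | gal_nth j == s) K i j.
  have cE j' : c (gal_nth j') = K i j'.
    rewrite /c (big_pred1 j') // => j''; exact: (inj_eq gal_nth_inj).
  rewrite -cE; apply: (gal_independent gal_seq_uniq _ (mem_gal_seq _)) => x /bspan[q ->].
  rewrite sum_gal_nth.
  transitivity (\sum_k ratr (q k) * (K *m A^T) i k); last first.
    by rewrite KA big1 // => k _; rewrite mxE mulr0.
  under [RHS]eq_bigr do rewrite mxE mulr_sumr.
  rewrite exchange_big /=; apply: eq_bigr => j' _.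
  rewrite cE rmorph_sum mulr_sumr; apply: eq_bigr => k _.
  by rewrite !mxE rmorphM fmorph_rat mulrCA.
pose g := fullrankfun fA.
pose w k := b (g k).
have wE : \matrix_(k, j) gal_lift (gal_nth j) (w k) = rowsub g A.
  by apply/matrixP => k j; rewrite !mxE.
have uw : (\matrix_(k, j) gal_lift (gal_nth j) (w k)) \in unitmx.
  by rewrite wE -row_full_unit; apply: fullrowsub_full.
exists w; split=> [k||x Fx]; [exact: Fb|exact: uw|].
set B := (\matrix_(k, j) _) in uw.
pose y : 'rV[algC]_gal_n := \row_j gal_lift (gal_nth j) x.
pose q := y *m invmx B.
have qB : q *m B = y by rewrite mulmxKV.
have qfix (s : absGal) : map_mx s q = q.
  have /choice[pi piE] j : exists j', forall z, F z -> s (gal_lift (gal_nth j) z) = gal_lift (gal_nth j') z.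
    have [j' j'E] := gal_nthP (\pi_(galQ F) (absGal_mul s (gal_lift (gal_nth j)))).
    by exists j' => z Fz; rewrite -j'E gal_liftK.
  have piI : injective pi.
    move=> j1 j2 E; apply: gal_nth_inj; apply: gal_ext => z Fz.
    by apply: (fmorph_inj s); rewrite !piE // E.
  have E : map_mx s q *m B = y.
    apply/rowP => j; have [j' <-] : exists j', pi j' = j.
      by have [pi' _ K] := injF_bij piI; exists (pi' j); rewrite K.
    have := congr1 (fun M : 'rV_gal_n => s (M 0 j')) qB.
    rewrite !mxE piE // => <-; rewrite rmorph_sum; apply: eq_bigr => k _.
    by rewrite !mxE rmorphM piE //; apply: Fb.
  by rewrite -(mulmxK uw (map_mx s q)) E.
have /choice[r rE] k : exists r, q 0 k = ratr r.
  apply/CratP/fixed_Crat => s.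
  by have := congr1 (fun M : 'rV_gal_n => M 0 k) (qfix s); rewrite [X in X = _]mxE.
exists r.
have [j0 j0E] := gal_nthP (gal_one F).
have := congr1 (fun M : 'rV_gal_n => M 0 j0) qB.
rewrite !mxE -j0E gal_lift1 // => <-; apply: eq_bigr => k _.
rewrite rE; congr (_ * _); rewrite mxE -j0E gal_lift1 //; exact: Fb.
Qed.

End GaloisField.

(** If S X + c is the minimal polynomial of x, then x^-1 = - S(x) / c, a polynomial expression in
    x. *)
Lemma subring_inv (T : set algC) : T 1 -> (forall x y, T x -> T y -> T (x - y)) ->
    (forall x y, T x -> T y -> T (x * y)) -> (forall q, T (ratr q)) ->
  forall x, T x -> T x^-1.
Proof.
move=> T1 TB TM Tq x Tx; have [->|x0] := eqVneq x 0; first by rewrite invr0 -(subrr 1); apply: (TB).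
have T0 : T 0 by rewrite -(subrr 1); apply: (TB).
have TD y z : T y -> T z -> T (y + z).
  by move=> Ty Tz; rewrite -[z]opprK -[- z]sub0r; apply: (TB) => //; apply: (TB).
have [P [PE Pm] Pmin] := minCpolyP x.
have Px : root (map_poly (ratr : rat -> algC) P) x by rewrite Pmin dvdpp.
have [S [c RE]] : exists S c, P = S * 'X + c%:P.
  by elim/poly_ind: (P) => [|S c _]; [exists 0, 0; rewrite mul0r add0r|exists S, c].
have S0 : S != 0.
  apply: contraTneq Px => S0; rewrite RE S0 mul0r add0r map_polyC /root hornerC fmorph_eq0.
  by move: (monic_neq0 Pm); rewrite RE S0 mul0r add0r polyC_eq0.
have E : x * (map_poly (ratr : rat -> algC) S).[x] = - ratr c.
  move: Px; rewrite RE rmorphD rmorphM /= map_polyX map_polyC /root !hornerE.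
  by rewrite addr_eq0 mulrC => /eqP.
have c0 : c != 0.
  apply/eqP => c0; move: E; rewrite c0 rmorph0 oppr0 => /eqP; rewrite mulf_eq0 (negPf x0) /=.
  move=> rS; have : P %| S by rewrite -Pmin.
  move/(dvdp_leq S0); rewrite RE c0 addr0 size_mulX // ltnn.
  by [].
have -> : x^-1 = (map_poly (ratr : rat -> algC) S).[x] * ratr (- c^-1).
  apply: (mulfI x0); rewrite divff // mulrA E -rmorphN -rmorphM mulrNN divff //.
  by rewrite rmorph1.
have TX n : T (x ^+ n) by elim: n => [|n IHn] //; rewrite exprS; apply: (TM).
apply: (TM) => //; rewrite horner_coef; apply: (big_ind T) => //.
by move=> i _; rewrite coef_map; apply: (TM); [exact: Tq|exact: TX].
Qed.

(** * The fields K(mu_{p^N}) *)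

Section Tower.
Variables (p : primeNat) (L : splittingFieldType rat) (e : {rmorphism L -> algC}).
Local Notation K := (range e).

Lemma e_rat (c : rat) : e c%:A = ratr c.
Proof. by rewrite rmorphZ_num rmorph1 mulr1. Qed.

Section Level.
Variables (N : nat) (z : algC).
Hypothesis zprim : (p ^ N).-primitive_root z.
Local Notation T := (tower p K N).

(** The polynomials in z over K form a ring of algebraic numbers containing Q, which is already a
    field. *)
Lemma towerP x : T x <-> exists q : {poly L}, x = (map_poly e q).[z].
Proof.
split=> [Tx|[q ->] F [F1 FB FM FV] sub]; last first.
  have Fz : F z by apply: sub; right; apply: (prim_expr_order zprim).
  have FD a b : F a -> F b -> F (a + b).
    move=> Fa Fb; rewrite -[b]opprK -[- b]sub0r; apply: (FB) => //; apply: (FB) => //.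
    by rewrite -(subrr 1); apply: (FB).
  have FX n : F (z ^+ n) by elim: n => [|n IHn] //; rewrite exprS; apply: (FM).
  rewrite horner_coef; apply: (big_ind F) => //; first by rewrite -(subrr 1); apply: (FB).
  move=> i _; apply: (FM); first by rewrite coef_map; apply: sub; left; exists q`_i.
  exact: FX.
pose S : set algC := [set y | exists q : {poly L}, y = (map_poly e q).[z]].
have S1 : S 1 by exists 1; rewrite rmorph1 hornerC.
have SB a b : S a -> S b -> S (a - b).
  by move=> [q ->] [r ->]; exists (q - r); rewrite rmorphB hornerD hornerN.
have SM a b : S a -> S b -> S (a * b).
  by move=> [q ->] [r ->]; exists (q * r); rewrite rmorphM hornerM.
have Sq q : S (ratr q) by exists (q%:A)%:P; rewrite map_polyC hornerC /= e_rat.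
apply: (Tx S).
  by split=> //; apply: subring_inv.
move=> y [[l _ <-]|yM]; first by exists l%:P; rewrite map_polyC hornerC.
have /(prim_rootP zprim)[i ->] : y ^+ (p ^ N) = 1 by exact: yM.
by exists 'X^i; rewrite map_polyXn hornerXn.
Qed.

Lemma tower_subfield : is_subfield T.
Proof.
split=> [F [F1 _ _ _] _ //|x y Tx Ty F FF sub|x y Tx Ty F FF sub|x Tx F FF sub].
- by have [_ FB _ _] := FF; apply: (FB); [apply: Tx|apply: Ty].
- by have [_ _ FM _] := FF; apply: (FM); [apply: Tx|apply: Ty].
- by have [_ _ _ FV] := FF; apply: FV; apply: Tx.
Qed.

Lemma K_tower : K `<=` T.
Proof. by move=> x Kx F _ sub; apply: sub; left. Qed.

Lemma mu_tower : mu (p ^ N) `<=` T.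
Proof. by move=> x Kx F _ sub; apply: sub; right. Qed.

Lemma K_normal (s : absGal) l : exists l', s (e l) = e l'.
Proof.
by have [nu0 nuE] := restrict_aut_to_normal_num_field e s; exists (nu0 l); rewrite nuE.
Qed.

Lemma tower_normal (s : absGal) x : T x -> T (s x).
Proof.
move=> /towerP[q ->]; have sT := tower_subfield.
rewrite horner_coef rmorph_sum; apply: (sfsum sT) => i _; rewrite rmorphM coef_map.
apply: (sfM sT).
  by have [l' ->] := K_normal s q`_i; apply: K_tower; exists l'.
apply: mu_tower; rewrite /mu /= -rmorphXn -exprM mulnC exprM.
by rewrite (prim_expr_order zprim) expr1n rmorph1.
Qed.

(** Division by X^(p^N) - 1 shows that the products of a basis of K with the z^j, j < p^N, span. *)
Lemma tower_galfield : galfield T.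
Proof.
split; [exact: tower_subfield|exact: tower_normal|].
pose M := (p ^ N)%N; pose D := \dim {:L}.
pose I := ('I_M * 'I_D)%type.
pose b0 (jd : I) : algC := e (vbasis {:L})`_jd.2 * z ^+ jd.1.
exists #|{: I}|, (fun k => b0 (enum_val k)); split.
  move=> k; apply: (sfM tower_subfield); first by apply: K_tower; eexists.
  apply: (sfX tower_subfield); apply: mu_tower; exact: (prim_expr_order zprim).
move=> x /towerP[q ->].
have M0 : (0 < M)%N by rewrite expn_gt0 prime_gt0 // prime_valP.
have mon : ('X^M - 1 : {poly L}) \is monic by rewrite -polyC1 monicXnsubC.
pose r := (q %% ('X^M - 1))%R.
have sr : (size r <= M)%N.
  have sX : size ('X^M - 1 : {poly L})%R = M.+1.
    by have := size_XnsubC (1 : L) M0; rewrite polyC1.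
  by rewrite -ltnS -sX ltn_modp monic_neq0.
have -> : (map_poly e q).[z] = (map_poly e r).[z].
  rewrite {1}(divp_eq q ('X^M - 1)) rmorphD rmorphM /= hornerD hornerM.
  rewrite [map_poly e ('X^M - 1)]rmorphB /= map_polyXn rmorph1 !hornerE.
  by rewrite (prim_expr_order zprim) subrr mulr0 add0r.
pose c (jd : I) : rat := coord (vbasis {:L}) jd.2 r`_jd.1.
exists (fun k => c (enum_val k)).
transitivity (\sum_(jd : I) ratr (c jd) * b0 jd); last first.
  rewrite (reindex_omap (enum_val : 'I_#|{: I}| -> I) (fun i => Some (enum_rank i))) /=.
    by apply: eq_bigl => k; rewrite enum_valK eqxx.
  by move=> i _; rewrite /= enum_rankK.
rewrite -(pair_bigA _ (fun j d => ratr (c (j, d)) * b0 (j, d))) /=.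
rewrite (@horner_coef_wide _ M); last by rewrite size_map_poly.
apply: eq_bigr => j _; rewrite coef_map /=.
rewrite {1}(coord_vbasis (memvf r`_j)) rmorph_sum mulr_suml; apply: eq_bigr => d _.
by rewrite rmorphZ_num /b0 /= mulrA.
Qed.

End Level.

Lemma tower0 : tower p K 0 = K.
Proof.
apply/seteqP; split; last exact: K_tower.
have KK : is_subfield K.
  split.
  - by exists 1 => //; rewrite rmorph1.
  - by move=> _ _ [a _ <-] [b _ <-]; exists (a - b) => //; rewrite rmorphB.
  - by move=> _ _ [a _ <-] [b _ <-]; exists (a * b) => //; rewrite rmorphM.
  - by move=> _ [a _ <-]; exists a^-1 => //; rewrite fmorphV.
move=> x Tx; apply: Tx => // y [//|]; rewrite /mu /= expn0 expr1 => ->.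
by case: KK.
Qed.

Lemma tower_mono N : tower p K N `<=` tower p K N.+1.
Proof.
move=> x Tx F FF sub; apply: Tx => // y [Ky|yM]; apply: sub; [by left|right].
by rewrite /mu /= expnSr exprM; move: yM; rewrite /mu /= => ->; rewrite expr1n.
Qed.

Lemma tower_le N M : (N <= M)%N -> tower p K N `<=` tower p K M.
Proof.
move=> /subnKC <-; elim: (M - N)%N => [|k IHk]; first by rewrite addn0.
by rewrite addnS => x /IHk; apply: tower_mono.
Qed.

Lemma tower_cyclotomic_oo m N : K `<=` cyclotomic m -> (0 < m)%N ->
  tower p K N `<=` cyclotomic_oo m p.
Proof.
move=> Km m0 x Tx F FF sub; apply: Tx => // y [/Km Ky|yM].
  apply: Ky => // w wm; apply: sub; exists 0%N => //.
  by rewrite /mu /= expn0 muln1.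
apply: sub; exists N => //; rewrite /mu /= mulnC exprM.
by move: yM; rewrite /mu /= => ->; rewrite expr1n.
Qed.

End Tower.

(** * The algebra of completions of a number field *)

Section Completion.
Variables (p : primeNat) (C : Qp_closure p) (iota : emb C).
Variable F : set algC.
Hypothesis gF : galfield F.
Local Notation Zp := (padic_int p).
Local Notation Qp := (padic_num p).
Local Notation V := (@qbar_int p C).
Local Notation mm := (@qbar_max p C).
Local Notation n := (gal_n gF).
Local Notation qe := (qbar_emb C).
Local Notation kalg := (@kalg p C F).
Local Notation kint := (@kint p C F).
Local Notation krad := (@krad p C F).
Implicit Types x y : emb C -> C.

Definition embj (j : 'I_n) : emb C := emb_comp iota (gal_lift (gal_nth j)).

(** Only finitely many embeddings differ on F, which makes bounds over all embeddings uniform. *)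
Lemma emb_on (i : emb C) : exists j, forall a, F a -> i a = embj j a.
Proof.
have [s ->] := emb_transitive iota i.
have [j jE] := gal_nthP gF (\pi_(galQ F) s); exists j => a Fa.
by rewrite /embj /= -jE gal_liftK.
Qed.

Lemma kalg_dep x (i j : emb C) : kalg x -> (forall a, F a -> i a = j a) -> x i = x j.
Proof.
by move=> [m [a [c [Fa xE]]]] ij; rewrite !xE; apply: eq_bigr => k _; rewrite ij.
Qed.

Lemma kalg_emb a : F a -> kalg (fun i => i a).
Proof.
move=> Fa; exists 1%N, (fun=> a), (fun=> 1); split=> // i.
by rewrite big_ord1 rmorph1 mulr1.
Qed.

Lemma kalg_cst (q : Qp) : kalg (fun=> qe q).
Proof.
exists 1%N, (fun=> 1), (fun=> q); split=> [_|i]; first exact: (sf1 (gf_sub gF)).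
by rewrite big_ord1 rmorph1 mul1r.
Qed.

Lemma kalgD x y : kalg x -> kalg y -> kalg (x + y).
Proof.
move=> [m [a [c [Fa xE]]]] [m' [a' [c' [Fa' yE]]]].
exists (m + m')%N, (fun k => match fintype.split k with inl k => a k | inr k => a' k end),
  (fun k => match fintype.split k with inl k => c k | inr k => c' k end); split.
  by move=> k; case: (fintype.split k).
move=> i; rewrite big_split_ord /= fctE xE yE; congr (_ + _); apply: eq_bigr => k _.
  by rewrite (unsplitK (inl k)).
by rewrite (unsplitK (inr k)).
Qed.

Lemma kalgM x y : kalg x -> kalg y -> kalg (x * y).
Proof.
move=> [m [a [c [Fa xE]]]] [m' [a' [c' [Fa' yE]]]].
exists #|{: 'I_m * 'I_m'}|, (fun k => a (enum_val k).1 * a' (enum_val k).2),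
  (fun k => c (enum_val k).1 * c' (enum_val k).2); split.
  by move=> k; apply: (sfM (gf_sub gF)).
move=> i; rewrite fctE xE yE big_distrlr /=.
rewrite (pair_bigA _ (fun k l => i (a k) * qe (c k) * (i (a' l) * qe (c' l)))) /=.
rewrite (reindex_omap (enum_val : 'I_#|{: 'I_m * 'I_m'}| -> _) (fun i => Some (enum_rank i))) /=.
  apply: eq_big => [k|k _]; first by rewrite enum_valK eqxx.
  by rewrite !rmorphM; ring.
by move=> k _; rewrite /= enum_rankK.
Qed.

Lemma kalg_ext x y : (forall i, x i = y i) -> kalg x -> kalg y.
Proof. by move=> /funext ->. Qed.

Lemma kalg1 : kalg 1.
Proof. by apply: kalg_ext (kalg_cst 1) => i; rewrite rmorph1. Qed.

Lemma kalg0 : kalg 0.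
Proof. by apply: kalg_ext (kalg_cst 0) => i; rewrite rmorph0. Qed.

Lemma kalgN x : kalg x -> kalg (- x).
Proof.
move=> kx; apply: kalg_ext (kalgM (kalg_cst (-1)) kx) => i.
by rewrite !fctE rmorphN rmorph1 mulN1r.
Qed.

Lemma kalgB x y : kalg x -> kalg y -> kalg (x - y).
Proof. by move=> kx ky; apply: kalgD => //; apply: kalgN. Qed.

Lemma kalgX x m : kalg x -> kalg (x ^+ m).
Proof.
by move=> kx; elim: m => [|m IHm]; [exact: kalg1|rewrite exprS; apply: kalgM].
Qed.

Lemma fctX x m i : (x ^+ m) i = x i ^+ m.
Proof. by elim: m => [|m IHm]; rewrite ?expr0 // !exprS fctE IHm. Qed.

Lemma kalg_int (m : int) : kalg (fun=> m%:~R).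
Proof. by apply: kalg_ext (kalg_cst m%:~R) => i; rewrite rmorph_int. Qed.

Lemma kalg_sum (I : Type) (r : seq I) (P : pred I) (f : I -> emb C -> C) :
  (forall k, P k -> kalg (f k)) -> kalg (fun i => \sum_(k <- r | P k) f k i).
Proof.
move=> kf; have E : (fun i => \sum_(k <- r | P k) f k i) = \sum_(k <- r | P k) f k.
  by apply/funext => i; rewrite fct_sumE.
by rewrite E; apply: (big_ind kalg) => //; [exact: kalg0|exact: kalgD].
Qed.

Lemma kalg_horner x (Q : {poly Qp}) : kalg x -> kalg (fun i => (map_poly qe Q).[x i]).
Proof.
move=> kx; apply: (@kalg_ext (fun i => \sum_(k < size Q) qe Q`_k * x i ^+ k)).
  by move=> i; rewrite horner_coef size_map_poly; apply: eq_bigr => k _; rewrite coef_map.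
apply: kalg_sum => k _; apply: kalg_ext (kalgM (kalg_cst Q`_k) (kalgX k kx)) => i.
by rewrite fctE fctX.
Qed.

(* [x] takes finitely many values, all algebraic: a polynomial [R] over Q_p gives
   the inverses of the nonzero ones. *)
Lemma kalgV x : kalg x -> kalg (fun i => (x i)^-1).
Proof.
move=> kx.
have /choice[P PP] (j : 'I_n) : exists P : {poly Qp}, P != 0 /\ (map_poly qe P).[x (embj j)] = 0.
  by have [P P0 /eqP rP] := qbar_algebraic (x (embj j)); exists P.
have [R [c [c0 RP]]] : exists R (c : Qp), c != 0 /\
    forall j, x (embj j) != 0 -> x (embj j) * (map_poly qe R).[x (embj j)] = - qe c.
  pose Q := \prod_j P j.
  have Q0 : Q != 0 by apply/prodf_neq0 => j _; have [] := PP j.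
  have [m [S [S0 QE]]] := multiplicity_XsubC Q 0.
  rewrite Q0 /= in S0; have [R [c SE]] : exists R c, S = R * 'X + c%:P.
    by elim/poly_ind: (S) => [|R c _]; [exists 0, 0; rewrite mul0r add0r|exists R, c].
  exists R, c; split.
    by apply: contraNneq S0 => c0; rewrite SE c0 addr0 rootM rootX eqxx orbT.
  move=> j xj0; apply/eqP; rewrite -addr_eq0; apply/eqP.
  have : (map_poly qe Q).[x (embj j)] = 0.
    rewrite /Q (bigD1 j) //= rmorphM hornerM; have [_ ->] := PP j.
    by rewrite mul0r.
  rewrite QE subr0 rmorphM rmorphXn /= map_polyX hornerM hornerXn => /eqP.
  rewrite mulf_eq0 expf_eq0 (negPf xj0) andbF orbF SE rmorphD rmorphM /= map_polyX map_polyC.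
  by rewrite !hornerE mulrC => /eqP.
pose y := (fun i => (map_poly qe R).[x i]).
have ky : kalg y by apply: kalg_horner.
apply: kalg_ext (kalgM kx (kalgX 2 (kalgM ky (kalg_cst c^-1)))) => i.
rewrite !(fctE, fctX) /y.
have [j ij] := emb_on i; rewrite (kalg_dep kx ij).
have [->|xj0] := eqVneq (x (embj j)) 0; first by rewrite mul0r invr0.
have qc0 : qe c != 0 by rewrite fmorph_eq0.
have := RP j xj0; set r := (map_poly qe R).[_] => E.
apply: (mulfI xj0); rewrite divff // fmorphV.
have -> : x (embj j) * (x (embj j) * (r / qe c) ^+ 2) = (x (embj j) * r) ^+ 2 / qe c ^+ 2.
  by field.
by rewrite E sqrrN divff // expf_neq0.
Qed.

(** x x^-1 is the idempotent supported where x is nonzero. Case distinctions of the addition law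
    thereby stay inside F (x) Q_p. *)
Lemma kalg_if x y z : kalg x -> kalg y -> kalg z ->
  kalg (fun i => if x i == 0 then y i else z i).
Proof.
move=> kx ky kz; have kd := kalgM kx (kalgV kx).
apply: kalg_ext (kalgD (kalgM ky (kalgB kalg1 kd)) (kalgM kz kd)) => i.
rewrite !fctE; case: eqP => [->|/eqP x0].
  by rewrite mul0r subr0 mulr1 mulr0 addr0.
by rewrite divff // subrr mulr0 add0r mulr1.
Qed.

Lemma kalg_act (s : absGal) x : kalg x -> kalg (gal_act s x).
Proof.
move=> [m [a [c [Fa xE]]]]; exists m, (fun k => s (a k)), c; split.
  by move=> k; apply: gf_normal.
by move=> i; rewrite /gal_act xE.
Qed.

Lemma kalg_bound x : kalg x -> exists c, forall i, V (p%:R ^+ c * x i).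
Proof.
move=> kx; have [c cP] := choice (fun j => qbar_clear (x (embj j))).
exists (\sum_j c j)%N => i; have [j ij] := emb_on i; rewrite (kalg_dep kx ij).
rewrite (bigD1 j) //= addnC exprD -mulrA; apply: VM => //; exact/VX/Vnat.
Qed.

Definition kbasis := cid (gal_basis gF).
Definition kw := sval kbasis.

Lemma kwF k : F (kw k).
Proof. by have [] := svalP kbasis. Qed.

Lemma kalg_coord x : kalg x -> exists q : 'I_n -> Qp, forall i, x i = \sum_k i (kw k) * qe (q k).
Proof.
move=> [m [a [c [Fa xE]]]].
have /choice[r rE] l : exists r : 'I_n -> rat, a l = \sum_k ratr (r k) * kw k.
  by have [_ _ /(_ _ (Fa l))] := svalP kbasis.
exists (fun k => \sum_l ratr (r l k) * c l) => i; rewrite xE.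
under eq_bigr => l _ do rewrite rE rmorph_sum mulr_suml.
rewrite exchange_big /=; apply: eq_bigr => k _; rewrite rmorph_sum mulr_sumr.
by apply: eq_bigr => l _; rewrite !(fmorph_rat, rmorphM) /=; ring.
Qed.

Lemma kalg_of_coord (q : 'I_n -> Qp) : kalg (fun i => \sum_k i (kw k) * qe (q k)).
Proof. by exists n, kw, q; split=> // k; apply: kwF. Qed.

(** The inverse of the matrix of conjugates of the basis expresses the coordinates through the
    values, with a fixed denominator. *)
Lemma kcoord_bound : exists c, forall (q : 'I_n -> Qp),
  (forall i : emb C, V (\sum_k i (kw k) * qe (q k))) ->
  forall k, exists a : Zp, p%:R ^+ c * q k = Zp_Qp a.
Proof.
have [_ uB _] := svalP kbasis; set B := (\matrix_(k, j) _) in uB.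
pose BC := map_mx iota B.
have uBC : BC \in unitmx by rewrite map_unitmx.
have [c cP] := choice (fun jk : 'I_n * 'I_n => qbar_clear (invmx BC jk.1 jk.2)).
pose cc := (\sum_jk c jk)%N; exists cc => q Vq k.
have ccP j k' : V (p%:R ^+ cc * invmx BC j k').
  rewrite /cc (bigD1 (j, k')) //= addnC exprD -mulrA; apply: VM; first exact/VX/Vnat.
  exact: (cP (j, k')).
pose qv : 'rV[C]_n := \row_k qe (q k).
have qE : qv = (qv *m BC) *m invmx BC by rewrite mulmxK.
apply: (@V_Qp p C); rewrite rmorphM rmorphXn rmorph_nat.
have -> : qe (q k) = qv 0 k by rewrite mxE.
rewrite qE mxE mulr_sumr; apply: Vsum => j _; rewrite mulrCA; apply: VM => //.
rewrite mxE; have := Vq (embj j); congr (V _); apply: eq_bigr => l _.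
by rewrite !mxE mulrC.
Qed.

(** Scaled by p^c, the coordinates of the sequence are Cauchy sequences in Z_p. *)
Lemma kint_complete (u : nat -> emb C -> C) : (forall m, kint (u m)) ->
    (forall m i, pV m (u m.+1 i - u m i)) ->
  exists2 l, kint l & forall m i, pV m (l i - u m i).
Proof.
move=> ku du; have [c cP] := kcoord_bound.
have /choice[q qE] m := kalg_coord (ku m).1.
have /choice[a aE] m : exists a : 'I_n -> Zp, forall k, p%:R ^+ c * q m k = Zp_Qp (a k).
  suff /choice[b bE] : forall k, exists b : Zp, p%:R ^+ c * q m k = Zp_Qp b by exists b.
  by apply: cP => i; rewrite -qE; apply: (ku m).2.
have da m k : exists d, a m.+1 k - a m k = p%:R ^+ m * d.
  have [|d dE] := cP (fun k => (q m.+1 k - q m k) / p%:R ^+ m) _ k.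
    move=> i; have [d Vd E] := du m i.
    have -> : \sum_k i (kw k) * qe ((q m.+1 k - q m k) / p%:R ^+ m)
        = (u m.+1 i - u m i) / p%:R ^+ m.
      rewrite !qE -sumrB mulr_suml; apply: eq_bigr => l _.
      by rewrite fmorph_div rmorphB /= rmorphXn rmorph_nat; ring.
    by rewrite E mulrC mulKf // qp_neq0.
  exists d; apply: Zp_Qp_inj; rewrite rmorphM rmorphB /= Zp_Qp_p -!aE -dE.
  rewrite -mulrBr [RHS]mulrCA; congr (_ * _); rewrite mulrC divfK //.
  exact: Qp_p_neq0.
have /choice[l lP] k := Zp_lim (fun m => da m k).
have [c' c'P] : exists c', forall k (i : emb C), V (p%:R ^+ c' * i (kw k)).
  have /choice[b bP] k := kalg_bound (kalg_emb (kwF k)).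
  exists (\sum_k b k)%N => k i; rewrite (bigD1 k) //= addnC exprD -mulrA.
  by apply: VM => //; apply/VX/Vnat.
pose x := fun i : emb C => \sum_k i (kw k) * qe (Zp_Qp (l k) / p%:R ^+ c).
have kx : kalg x by apply: kalg_of_coord.
(* The shift by c + c' makes up for the denominators of the coordinates and of the basis. *)
have rough m i : pV m (x i - u (m + c + c')%N i).
  rewrite /x qE -sumrB; apply: pVsum => k _; rewrite -mulrBr -rmorphB.
  have [d dE] := lP k (m + c + c')%N.
  have -> : Zp_Qp (l k) / p%:R ^+ c - q (m + c + c')%N k = p%:R ^+ m * p%:R ^+ c' * Zp_Qp d.
    apply: (mulfI (Qp_p_neq0 p c)); rewrite mulrBr aE mulrC divfK ?Qp_p_neq0 //.
    rewrite -rmorphB dE rmorphM /= Zp_Qp_p !exprD; ring.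
  rewrite !rmorphM !rmorphXn !rmorph_nat /=.
  exists ((p%:R ^+ c' * i (kw k)) * Zp_qbar C d); last by rewrite /Zp_qbar; ring.
  by apply: VM => //; apply: V_Zp.
have tele m m' i : (m <= m')%N -> pV m (u m' i - u m i).
  move=> /subnKC <-; elim: (m' - m)%N => [|j IHj]; first by rewrite addn0 subrr; apply: pV0.
  rewrite addnS -[u (m + j).+1 i](subrK (u (m + j)%N i)) -addrA; apply: pVD => //.
  exact: (pVW (leq_addr j m) (du _ i)).
have fine m i : pV m (x i - u m i).
  rewrite -[x i](subrK (u (m + c + c')%N i)) -addrA; apply: pVD; first exact: rough.
  by apply: tele; rewrite -addnA leq_addr.
exists x => //; split=> // i.
rewrite -[x i](subrK (u 0%N i)); apply: VD; first exact: pV_V (fine 0%N i).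
by have [_] := ku 0%N; apply.
Qed.

Lemma kintD x y : kint x -> kint y -> kint (x + y).
Proof. by move=> [kx Vx] [ky Vy]; split; [exact: kalgD|move=> i; apply: VD]. Qed.
Lemma kintN x : kint x -> kint (- x).
Proof. by move=> [kx Vx]; split; [exact: kalgN|move=> i; apply: VN]. Qed.
Lemma kintB x y : kint x -> kint y -> kint (x - y).
Proof. by move=> kx ky; apply: kintD => //; apply: kintN. Qed.
Lemma kintM x y : kint x -> kint y -> kint (x * y).
Proof. by move=> [kx Vx] [ky Vy]; split; [exact: kalgM|move=> i; apply: VM]. Qed.
Lemma kint1 : kint 1.
Proof. by split; [exact: kalg1|move=> i; apply: V1]. Qed.
Lemma kint0 : kint 0.
Proof. by split; [exact: kalg0|move=> i; apply: V0]. Qed.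
Lemma kintX x m : kint x -> kint (x ^+ m).
Proof. by move=> kx; elim: m => [|m IHm]; [exact: kint1|rewrite exprS; apply: kintM]. Qed.

Lemma V_power c : V c -> exists2 k, (0 < k)%N & pV 1 (c ^+ k) \/ pV 1 (c ^+ k - 1).
Proof.
move=> Vc; have [k k0 E] := power_idempotent_mod_p Vc.
have [x Vx [xE|xE]] := lift_idempotent Vc (inZpcX c k) E; exists k => //.
  by left; exists x; rewrite ?expr1.
by right; exists x; rewrite ?expr1.
Qed.

(** For each i, the y with y(i) in the maximal ideal of V form a maximal ideal, since an element
    outside it has a power congruent to 1 modulo p at i. Conversely, a maximal ideal missing x would
    contain some 1 - x r, which is invertible. *)
Lemma kradP x : krad x <-> kalg x /\ forall i, mm (x i).
Proof.
split=> [[[kx Vx] xI]|[kx mx]].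
  split=> // i; apply: contrapT => nmx.
  pose I : set (emb C -> C) := [set y | kint y /\ mm (y i)].
  suff /xI[_] : maximal_ideal kint I by [].
  have idI : is_ideal kint I.
    split=> [y []//|||].
    - by split; [exact: kint0|exact: mm0].
    - by move=> y z [ky my] [kz mz]; split; [exact: kintD|exact: mmD].
    - by move=> a y ka [ky my]; split; [exact: kintM|apply: mmM => //; case: ka].
  split=> //.
    by move=> E; have : I 1 by [rewrite E; apply: kint1]; case=> _ /not_mm1.
  move=> J [JO J0 JD JM] IJ.
  have [JI|nJI] := pselect (J `<=` I); first by left; apply/seteqP.
  right; apply/seteqP; split=> // y ky.
  have [z Jz nIz] : exists2 z, J z & ~ I z.
    by apply: contrapT => N; apply: nJI => z Jz; apply: contrapT => nI; apply: N; exists z.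
  have kz := JO _ Jz.
  have nmz : ~ mm (z i) by move=> mz; apply: nIz.
  have [k k0 [E|E]] := V_power (kz.2 i).
    by case: nmz; split; [exact: kz.2|exists k].
  have J1 : J 1.
    have -> : 1 = z ^+ k.-1 * z + (1 - z ^+ k) by rewrite -exprSr prednK // addrC subrK.
    apply: (JD); first by apply: JM => //; apply: kintX.
    apply: IJ; split; first by apply: kintB; [exact: kint1|exact: kintX].
    have -> : (1 - z ^+ k) i = - (z i ^+ k - 1) by rewrite opprB -fctX.
    by apply: mmN; apply: pV_mm E.
  by rewrite -[y]mulr1; apply: JM.
have kix : kint x by split=> // i; apply: mmV.
split=> // I [idI IO Imax].
have [IO' I0 ID IM] := idI.
pose J : set (emb C -> C) := [set y | exists t r, [/\ I t, kint r & y = t + x * r]].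
have idJ : is_ideal kint J.
  split.
  - by move=> _ [t [r [It kr ->]]]; apply: kintD; [exact: IO'|exact: kintM].
  - by exists 0, 0; split=> //; [exact: kint0|rewrite mulr0 addr0].
  - move=> _ _ [t [r [It kr ->]]] [t' [r' [It' kr' ->]]]; exists (t + t'), (r + r').
    by split; [exact: ID|exact: kintD|ring].
  - move=> a _ ka [t [r [It kr ->]]]; exists (a * t), (a * r).
    by split; [exact: IM|exact: kintM|ring].
have IJ : I `<=` J.
  by move=> t It; exists t, 0; split=> //; [exact: kint0|rewrite mulr0 addr0].
have [JI|JO] := Imax J idJ IJ.
  rewrite -JI; exists 0, 1; split=> //; [exact: kint1|by rewrite mulr1 add0r].
have : J 1 by rewrite JO; apply: kint1.
move=> [t [r [It kr E]]]; case: IO; apply/seteqP; split=> // y ky.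
have un i : t i != 0 /\ V (t i)^-1.
  have -> : t i = 1 + - (x i * r i).
    have E1 : 1 = t i + x i * r i := congr1 (fun f : emb C -> C => f i) E.
    by rewrite E1 addrK.
  by apply: unit_1mm; apply/mmN/mmMr => //; case: kr.
have kt := IO' _ It.
have kti : kint (fun i => (t i)^-1).
  by split; [apply: kalgV; case: kt|move=> i; case: (un i)].
have -> : y = (y * (fun i => (t i)^-1)) * t.
  by apply/funext => i; rewrite !fctE divfK //; case: (un i).
by apply: IM => //; apply: kintM.
Qed.

(** x takes finitely many values, so one exponent serves all embeddings. *)
Lemma krad_uniform x : krad x -> exists2 a, (0 < a)%N & forall i, pV 1 (x i ^+ a).
Proof.
move=> /kradP[kx mx].
have /choice[a aP] (j : 'I_n) : exists a, pV 1 (x (embj j) ^+ a) by case: (mx (embj j)).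
exists (\sum_j a j).+1 => // i; have [j ij] := emb_on i; rewrite (kalg_dep kx ij).
rewrite (bigD1 j) //= -addSn addnC exprD exprS.
rewrite mulrA; apply: pVMl => //.
by apply: VM; [apply: VX|]; apply: mmV.
Qed.

End Completion.

(** * Evaluation of power series *)

Section FormalSeries.

(** Membership in the K-th power of the ideal (z1, z2); identities of series are proved modulo all
    these powers. *)
Definition vanishes (K : nat) (f : fps2) := forall m n, (m + n < K)%N -> f m n = 0.

Lemma fps2D (f g : fps2) m n : (f + g) m n = f m n + g m n. Proof. by []. Qed.
Lemma fps2N (f : fps2) m n : (- f) m n = - f m n. Proof. by []. Qed.
Lemma fps2B (f g : fps2) m n : (f - g) m n = f m n - g m n. Proof. by []. Qed.
Lemma fps2_1 m n : (1 : fps2) m n = ((m == 0%N) && (n == 0%N))%:R.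
Proof. by case: m => [|m] //; case: n. Qed.

Lemma fps2M (f g : fps2) m n :
  (f * g) m n = \sum_(i < m.+1) \sum_(j < n.+1) f i j * g (m - i)%N (n - j)%N.
Proof.
transitivity ((\sum_(i < m.+1) f i * g (m - i)%N) n); first by [].
have E (I : Type) (r : seq I) (F : I -> fps int) : (\sum_(i <- r) F i) n = \sum_(i <- r) F i n.
  by elim: r => [|a r IHr]; rewrite ?big_nil // !big_cons -IHr.
by rewrite E.
Qed.

Lemma vanishesM K L f g : vanishes K f -> vanishes L g -> vanishes (K + L) (f * g).
Proof.
move=> fK gL m n lt; rewrite fps2M big1 // => i _; rewrite big1 // => j _.
have im := leq_ord i; have jn := leq_ord j.
have [h|h] := ltnP (i + j) K; first by rewrite fK // mul0r.
by rewrite gL ?mulr0 //; lia.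
Qed.

Lemma vanishes0 f : vanishes 0 f. Proof. by []. Qed.

Lemma vanishesX K f n : vanishes K f -> vanishes (K * n) (f ^+ n).
Proof.
move=> fK; elim: n => [|n IHn]; first by rewrite muln0; apply: vanishes0.
by rewrite exprS mulnS; apply: vanishesM.
Qed.

Lemma vanishesW K L f : (L <= K)%N -> vanishes K f -> vanishes L f.
Proof. by move=> LK fK m n lt; apply: fK; apply: leq_trans LK. Qed.

Lemma vanishesD K f g : vanishes K f -> vanishes K g -> vanishes K (f + g).
Proof. by move=> fK gK m n lt; rewrite fps2D fK // gK // addr0. Qed.

Lemma vanishesN K f : vanishes K f -> vanishes K (- f).
Proof. by move=> fK m n lt; rewrite fps2N fK // oppr0. Qed.

Lemma fps2_sum (I : Type) (r : seq I) (F : I -> fps2) m n :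
  (\sum_(i <- r) F i) m n = \sum_(i <- r) F i m n.
Proof. by elim: r => [|a r IHr]; rewrite ?big_nil // !big_cons -IHr. Qed.

Lemma fps2_inv_sum (u : fps2) K : vanishes 1 (1 - u) ->
  vanishes K (fps2_inv u - \sum_(k < K) (1 - u) ^+ k).
Proof.
move=> u1 m n lt; rewrite fps2B fps2_sum /fps2_inv.
have -> : \sum_(k < K) ((1 - u) ^+ k) m n = \sum_(k < (m + n).+1) ((1 - u) ^+ k) m n.
  rewrite -!(big_mkord xpredT (fun k => ((1 - u) ^+ k) m n)).
  rewrite (big_cat_nat (n := (m + n).+1)) //= [X in _ + X]big1_seq ?addr0 // => k.
  rewrite mem_index_iota => /andP[_ /andP[lk _]].
  by rewrite (vanishesX (n := k) u1) // mul1n.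
by rewrite subrr.
Qed.

Lemma fps2_ext (f g : fps2) : (forall K, vanishes K (f - g)) -> f = g.
Proof.
move=> fg; apply/funext => m; apply/funext => n; apply/eqP; rewrite -subr_eq0.
by rewrite -fps2B (fg (m + n).+1).
Qed.

Lemma fps2_mulV (u : fps2) : vanishes 1 (1 - u) -> u * fps2_inv u = 1.
Proof.
move=> u1; apply: fps2_ext => K.
have E : u * \sum_(k < K) (1 - u) ^+ k = 1 - (1 - u) ^+ K.
  have := subrXX 1 (1 - u) K; rewrite expr1n subKr => ->; congr (_ * _).
  by apply: eq_bigr => k _; rewrite expr1n mul1r.
have -> : u * fps2_inv u - 1 = u * (fps2_inv u - \sum_(k < K) (1 - u) ^+ k) - (1 - u) ^+ K.
  by rewrite mulrBr E; ring.
apply: vanishesD.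
  by rewrite -[K]add0n; apply: vanishesM; [exact: vanishes0|exact: fps2_inv_sum].
by apply: vanishesN; rewrite -[X in vanishes X]mul1n; apply: vanishesX.
Qed.

Lemma fps2_comp_sum (a : fps int) (u : fps2) K : vanishes 1 u ->
  vanishes K (fps2_comp a u - \sum_(k < K) (a k)%:~R * u ^+ k).
Proof.
move=> u1 m n lt; rewrite fps2B fps2_sum /fps2_comp.
have cE k (f : fps2) : ((a k)%:~R * f) m n = a k * f m n.
  have cN j : (j%:R * f) m n = j%:R * f m n.
    elim: j => [|j IHj]; first by rewrite !mul0r.
    by rewrite -addn1 !natrD !mulrDl fps2D IHj !mul1r.
  case: (a k) => j; first by rewrite -pmulrn cN natz.
  by rewrite NegzE mulrNz -pmulrn mulNr fps2N cN natz mulNr.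
have -> : \sum_(k < K) ((a k)%:~R * u ^+ k) m n = \sum_(k < (m + n).+1) a k * (u ^+ k) m n.
  rewrite -(big_mkord xpredT (fun k => ((a k)%:~R * u ^+ k) m n)).
  rewrite -(big_mkord xpredT (fun k => a k * (u ^+ k) m n)).
  rewrite (big_cat_nat (n := (m + n).+1)) //= [X in _ + X]big1_seq ?addr0.
    by apply: eq_bigr => k _; rewrite cE.
  move=> k; rewrite mem_index_iota => /andP[_ /andP[lk _]].
  by rewrite cE (vanishesX (n := k) u1) ?mulr0 // mul1n.
by rewrite subrr.
Qed.

End FormalSeries.

Section Evaluation.
Variables (p : primeNat) (C : Qp_closure p) (iota : emb C).
Variable F : set algC.
Hypothesis gF : galfield F.
Local Notation V := (@qbar_int p C).
Local Notation mm := (@qbar_max p C).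
Local Notation kint := (@kint p C F).
Local Notation krad := (@krad p C F).
Implicit Types x y : emb C -> C.

Lemma padic_lim_unique (u : nat -> emb C -> C) l l' :
  padic_cvg u l -> padic_cvg u l' -> l = l'.
Proof.
move=> ul ul'; apply/funext => i; apply/eqP; rewrite -subr_eq0; apply/eqP/qbar_sep => k.
have [N NP] := ul k; have [N' NP'] := ul' k.
have [c Vc cE] := NP _ (leq_maxl N N') i; have [c' Vc' cE'] := NP' _ (leq_maxr N N') i.
exists (c' - c); first exact: VB.
rewrite mulrBr -cE -cE'; ring.
Qed.

Lemma padic_limE (u : nat -> emb C -> C) l : padic_cvg u l -> padic_lim u = l.
Proof.
move=> ul; rewrite /padic_lim; case: xgetP => [l' _ ul'|/(_ l)//].
exact: padic_lim_unique ul' ul.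
Qed.

Lemma padic_cvgP (u : nat -> emb C -> C) l : padic_cvg u l <->
  forall k, exists N, forall n, (N <= n)%N -> forall i, pV k (u n i - l i).
Proof.
by split=> ul k; have [N NP] := ul k; exists N => n Nn i; have [c ? ?] := NP n Nn i; exists c.
Qed.

Variables x y : emb C -> C.
Hypotheses (kx : krad x) (ky : krad y).

(** Square truncations, in the exact form used by [fg_add], which is thereby convertible to [ev] at
    the formal group law. *)
Definition psum (f : fps2) n : emb C -> C :=
  fun i => \sum_(k < n) \sum_(l < n) (f k l)%:~R * x i ^+ k * y i ^+ l.

Definition ev (f : fps2) : emb C -> C := padic_lim (psum f).

Lemma radexp_ex : exists2 a, (0 < a)%N &
  forall i, pV 1 (x i ^+ a) /\ pV 1 (y i ^+ a).
Proof.
have [a a0 aP] := krad_uniform iota gF kx; have [b b0 bP] := krad_uniform iota gF ky.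
have Vx i : V (x i) by have /(kradP iota gF)[_ /(_ i)/mmV] := kx.
have Vy i : V (y i) by have /(kradP iota gF)[_ /(_ i)/mmV] := ky.
exists (a + b)%N; first by rewrite addn_gt0 a0.
move=> i; rewrite !exprD; split; first by rewrite mulrC; apply: pVMl => //; apply: VX.
by apply: pVMl => //; apply: VX.
Qed.

(** Twice an exponent a with p dividing x^a and y^a: if k + l >= 2 a t, then k >= a t or l >= a t,
    so p^t divides x^k y^l. *)
Definition radexp := (s2val (cid2 radexp_ex)).*2.

Lemma Vx i : V (x i). Proof. by have /(kradP iota gF)[_ /(_ i)/mmV] := kx. Qed.
Lemma Vy i : V (y i). Proof. by have /(kradP iota gF)[_ /(_ i)/mmV] := ky. Qed.

Lemma monomial_small i k l t : (radexp * t <= k + l)%N -> pV t (x i ^+ k * y i ^+ l).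
Proof.
rewrite /radexp; case: (cid2 _) => a /= a0 aP le; have [ax ay] := aP i.
have [h|h] := leqP (a * t) k.
  rewrite -(subnK h) exprD mulrC mulrA; apply: pVMl.
    by apply: VM; apply: VX; [exact: Vy|exact: Vx].
  by rewrite exprM -[t in pV t]mul1n; apply: pVX.
have h' : (a * t <= l)%N by move: le h; rewrite -muln2 -mulnA (mulnC 2) mulnA muln2; lia.
rewrite -(subnK h') exprD mulrA; apply: pVMl.
  by apply: VM; apply: VX; [exact: Vx|exact: Vy].
by rewrite exprM -[t in pV t]mul1n; apply: pVX.
Qed.

Lemma Vmon i k l : V (x i ^+ k * y i ^+ l).
Proof. by apply: VM; apply: VX; [exact: Vx|exact: Vy]. Qed.

Lemma psum_kint f n : kint (psum f n).
Proof.
have kix : kint x by case: kx. have kiy : kint y by case: ky.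
split=> [|i]; last first.
  apply: Vsum => k _; apply: Vsum => l _; rewrite -mulrA; apply: VM; first exact: Vint.
  exact: Vmon.
apply: (kalg_sum gF) => k _; apply: (kalg_sum gF) => l _.
have := kalgM gF (kalgM gF (kalg_int C gF (f k l)) (kalgX gF k kix.1)) (kalgX gF l kiy.1).
by apply: kalg_ext => i; rewrite !fctE.
Qed.

Lemma psum_small f n K t : vanishes K f -> (radexp * t <= K)%N ->
  forall i, pV t (psum f n i).
Proof.
move=> fK le i; apply: pVsum => k _; apply: pVsum => l _; rewrite -mulrA.
have [h|h] := ltnP (k + l) K; first by rewrite fK // mul0r; apply: pV0.
by apply: pVMl; [exact: Vint|apply: monomial_small; apply: leq_trans h].
Qed.

Lemma psum_diff f n n' t : (n <= n')%N -> (radexp * t <= n)%N ->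
  forall i, pV t (psum f n' i - psum f n i).
Proof.
move=> nn le i.
pose A k l := (f k l)%:~R * x i ^+ k * y i ^+ l.
have -> : psum f n i = \sum_(k < n') \sum_(l < n') (if (k < n)%N && (l < n)%N then A k l else 0).
  rewrite /psum -(subnKC nn) big_split_ord /= [X in _ = _ + X]big1 ?addr0; last first.
    by move=> k _; rewrite big1 // => l _; rewrite ltnNge leq_addr.
  apply: eq_bigr => k _; rewrite big_split_ord /= [X in _ = _ + X]big1 ?addr0; last first.
    by move=> l _; rewrite [(n + l < n)%N]ltnNge leq_addr andbF.
  by apply: eq_bigr => l _; rewrite !ltn_ord.
rewrite /psum -sumrB; apply: pVsum => k _; rewrite -sumrB; apply: pVsum => l _.
case: ifP => [_|/negbT]; first by rewrite subrr; apply: pV0.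
rewrite negb_and -!leqNgt subr0 /A -mulrA => kl; apply: pVMl; first exact: Vint.
by apply: monomial_small; apply: (leq_trans le); case/orP: kl => h; lia.
Qed.

Lemma ev_ex f : exists2 l, kint l & forall t n, (radexp * t <= n)%N ->
  forall i, pV t (l i - psum f n i).
Proof.
have [] := @kint_complete p C iota F gF (fun t => psum f (radexp * t)).
- by move=> t; apply: psum_kint.
- by move=> t i; apply: psum_diff => //; rewrite leq_mul2l leqnSn orbT.
move=> l kl lP; exists l => // t n le i.
rewrite -[l i](subrK (psum f (radexp * t) i)) -addrA; apply: pVD => //.
by rewrite -opprB; apply: pVN; apply: psum_diff.
Qed.

Lemma evP f : kint (ev f) /\ forall t n, (radexp * t <= n)%N ->
  forall i, pV t (ev f i - psum f n i).
Proof.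
have [l kl lP] := ev_ex f.
suff -> : ev f = l by [].
apply: padic_limE; apply/padic_cvgP => t; exists (radexp * t)%N => n le i.
by rewrite -opprB; apply: pVN; apply: lP.
Qed.

Lemma ev_unique f l : (forall t, exists n, [/\ (radexp * t <= n)%N & forall i, pV t (l i - psum f n i)]) ->
  ev f = l.
Proof.
move=> lP; apply/funext => i; apply/eqP; rewrite -subr_eq0; apply/eqP/qbar_sep => t.
have [n [le nP]] := lP t.
have -> : ev f i - l i = (ev f i - psum f n i) - (l i - psum f n i) by ring.
by apply: pVB => //; apply: (evP f).2.
Qed.

Lemma ev_vanish f K t : vanishes K f -> (radexp * t <= K)%N -> forall i, pV t (ev f i).
Proof.
move=> fK le i; rewrite -[ev f i](subrK (psum f K i)); apply: pVD.
  exact: (evP f).2.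
exact: psum_small fK le i.
Qed.

Lemma evD f g : ev (f + g) = ev f + ev g.
Proof.
apply: ev_unique => t; exists (radexp * t)%N; split=> // i.
have -> : psum (f + g) (radexp * t) i = psum f (radexp * t) i + psum g (radexp * t) i.
  rewrite /psum -big_split; apply: eq_bigr => k _ /=; rewrite -big_split; apply: eq_bigr => l _ /=.
  by rewrite fps2D rmorphD /= -!mulrDl.
rewrite fctE opprD addrACA; apply: pVD; exact: (evP _).2.
Qed.

Lemma psum_delta (f : fps2) a b n i : (forall k l, f k l = ((k == a) && (l == b))%:R) ->
  (a < n)%N -> (b < n)%N -> psum f n i = x i ^+ a * y i ^+ b.
Proof.
move=> fE an bn; rewrite /psum (bigD1 (Ordinal an)) //= (bigD1 (Ordinal bn)) //=.
rewrite fE !eqxx /= mul1r big1 => [|l lb]; last first.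
  by rewrite fE -[_ == b :> nat]/(l == Ordinal bn) (negPf lb) andbF !mul0r.
rewrite addr0 big1 ?addr0 // => k ka; apply: big1 => l _.
by rewrite fE -[_ == a :> nat]/(k == Ordinal an) (negPf ka) !mul0r.
Qed.

Lemma ev_delta (f : fps2) a b : (forall k l, f k l = ((k == a) && (l == b))%:R) ->
  ev f = x ^+ a * y ^+ b.
Proof.
move=> fE; apply: ev_unique => t; exists (radexp * t + (a + b).+1)%N; split=> [|i].
  exact: leq_addr.
by rewrite (psum_delta i fE) ?fctE ?subrr; first exact: pV0; lia.
Qed.

Lemma ev1 : ev 1 = 1.
Proof. by rewrite (ev_delta (a := 0) (b := 0) fps2_1) !expr0 mulr1. Qed.

Lemma evN f : ev (- f) = - ev f.
Proof.
apply: (addrI (ev f)); rewrite subrr -evD subrr.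
apply: (addrI (ev 0)); by rewrite -evD !addr0.
Qed.

Lemma evB f g : ev (f - g) = ev f - ev g.
Proof. by rewrite evD evN. Qed.

(** Truncations multiply as polynomials in two variables, and the discrepancy consists of monomials
    of degree at least n. *)
Lemma psumM f g n t : (radexp * t <= n)%N ->
  forall i, pV t (psum f n i * psum g n i - psum (f * g) n i).
Proof.
move=> le i.
pose A (h : fps2) k l := (h k l)%:~R * (x i ^+ k * y i ^+ l).
have pE (h : fps2) m : psum h m i = \sum_(k < m) \sum_(l < m) A h k l.
  by apply: eq_bigr => k _; apply: eq_bigr => l _; rewrite /A mulrA.
pose P : {poly {poly C}} := \poly_(k < n) \poly_(l < n) (f k l)%:~R.
pose Q : {poly {poly C}} := \poly_(k < n) \poly_(l < n) (g k l)%:~R.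
have hE (R : {poly {poly C}}) m : (size R <= m)%N -> (forall k, (size (R`_k)%R <= m)%N) ->
    R.[(x i)%:P].[y i] = \sum_(k < m) \sum_(l < m) R`_k`_l * (x i ^+ k * y i ^+ l).
  move=> sR sRk; rewrite (horner_coef_wide _ sR) horner_sum; apply: eq_bigr => k _.
  rewrite hornerM -polyC_exp hornerC (horner_coef_wide _ (sRk k)) mulr_suml.
  by apply: eq_bigr => l _; ring.
have sPk (h : fps2) k : (size ((\poly_(k < n) \poly_(l < n) (h k l)%:~R : {poly {poly C}})`_k)%R <= n)%N.
  by rewrite coef_poly; case: ifP => _; rewrite ?size_poly0 // size_poly.
have psP (h : fps2) : psum h n i = (\poly_(k < n) \poly_(l < n) (h k l)%:~R : {poly {poly C}}).[(x i)%:P].[y i].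
  rewrite (hE _ n) ?size_poly // pE; apply: eq_bigr => k _; apply: eq_bigr => l _.
  by rewrite coef_poly ltn_ord coef_poly ltn_ord.
rewrite !psP -!hornerM -/P -/Q -hornerN -hornerD -hornerN -hornerD.
set R := P * Q - _.
have Rlow k l : (k < n)%N -> (l < n)%N -> R`_k`_l = 0.
  move=> kn ln; rewrite /R coefB coefB coef_poly kn coef_poly ln coefM coef_sum.
  apply/eqP; rewrite subr_eq0; apply/eqP; rewrite fps2M rmorph_sum.
  apply: eq_bigr => k' _; have k'n : (k' < n)%N by apply: leq_ltn_trans (leq_ord k') kn.
  rewrite !coef_poly k'n (leq_ltn_trans (leq_subr _ _) kn) coefM rmorph_sum.
  apply: eq_bigr => l' _; have l'n : (l' < n)%N by apply: leq_ltn_trans (leq_ord l') ln.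
  by rewrite !coef_poly l'n (leq_ltn_trans (leq_subr _ _) ln) rmorphM.
have VR k l : V R`_k`_l.
  have Vc (h : fps2) a b : V ((\poly_(k < n) \poly_(l < n) (h k l)%:~R : {poly {poly C}})`_a)`_b.
    rewrite coef_poly; case: ifP => _; last by rewrite coef0; apply: V0.
    by rewrite coef_poly; case: ifP => _; [exact: Vint|exact: V0].
  rewrite /R coefB coefB; apply: VB => //; rewrite coefM coef_sum; apply: Vsum => a _.
  by rewrite coefM; apply: Vsum => b _; apply: VM; [exact: (Vc f)|exact: (Vc g)].
pose m := (size R + \sum_(k < size R) size (R`_k)%R)%N.
rewrite (hE R m); first last.
- move=> k; have [lt|ge] := ltnP k (size R); last by rewrite nth_default // size_poly0.
  by rewrite /m (bigD1 (Ordinal lt)) //= addnCA leq_addr.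
- exact: leq_addr.
apply: pVsum => k _; apply: pVsum => l _.
have [/andP[kn ln]|] := boolP ((k < n) && (l < n))%N.
  by rewrite Rlow // mul0r; apply: pV0.
rewrite negb_and -!leqNgt => kl; apply: pVMl => //; apply: monomial_small.
by apply: (leq_trans le); case/orP: kl => h; lia.
Qed.

Lemma evM f g : ev (f * g) = ev f * ev g.
Proof.
apply: ev_unique => t; exists (radexp * t)%N; split=> // i.
set n := (radexp * t)%N.
have -> : (ev f * ev g) i - psum (f * g) n i =
   (ev f i - psum f n i) * ev g i + psum f n i * (ev g i - psum g n i)
   + (psum f n i * psum g n i - psum (f * g) n i) by rewrite fctE; ring.
have [[_ Vf] Pf] := evP f; have [[_ Vg] Pg] := evP g.
apply: pVD; last exact: psumM.
apply: pVD; first by rewrite mulrC; apply: pVMl => //; apply: Pf.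
by apply: pVMl; [have [_] := psum_kint f n; apply|apply: Pg].
Qed.

Lemma evX f n : ev (f ^+ n) = ev f ^+ n.
Proof. by elim: n => [|n IHn]; rewrite ?expr0 ?ev1 // !exprS evM IHn. Qed.

Lemma ev_z1 : ev (fpsX _ : fps2) = x.
Proof.
rewrite (ev_delta (a := 1) (b := 0)) ?expr1 ?expr0 ?mulr1 // => k l.
by case: k => [|[|k]] //; case: l.
Qed.

Lemma ev_z2 : ev (fpsC (fpsX _) : fps2) = y.
Proof.
rewrite (ev_delta (a := 0) (b := 1)) ?expr1 ?expr0 ?mul1r // => k l.
by case: k => [|k] //; case: l => [|[|l]].
Qed.

Lemma ev_krad f : f 0%N 0%N = 0 -> krad (ev f).
Proof.
move=> f0; apply/(kradP iota gF); have [[kf _] fP] := evP f; split=> // i.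
rewrite -[ev f i](subrK (psum f (radexp * 1) i)); apply: mmD.
  by apply: (@pV_mm _ _ 0); apply: fP.
have mx : mm (x i) by have /(kradP iota gF)[_ /(_ i)] := kx.
have my : mm (y i) by have /(kradP iota gF)[_ /(_ i)] := ky.
apply: mmsum => k _; apply: mmsum => l _; rewrite -mulrA.
case: (posnP (k + l)) => [/eqP|].
  rewrite addn_eq0 => /andP[/eqP-> /eqP->].
  by rewrite f0 mul0r; apply: mm0.
move=> kl; apply: mmM; first exact: Vint.
case: (posnP k) => [k0|k0]; last by apply: mmMr; [exact: mmXn|exact: VX (Vy i)].
by apply: mmM; [exact: VX (Vx i)|apply: mmXn => //; rewrite k0 in kl].
Qed.

End Evaluation.

(** * The chord construction in the coordinates (z, w) *)

Definition wf (R : comNzRingType) (W : weierstrass) (z w : R) : R :=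
  z ^+ 3 + (wa1 W)%:~R * z * w + (wa2 W)%:~R * z ^+ 2 * w + (wa3 W)%:~R * w ^+ 2
  + (wa4 W)%:~R * z * w ^+ 2 + (wa6 W)%:~R * w ^+ 3.

(** Divided difference of [wf] in w; the next definition is the one in z. Being polynomials, they
    make sense for equal arguments too. *)
Definition wf_slope (R : comNzRingType) (W : weierstrass) (z w w' : R) : R :=
  (wa1 W)%:~R * z + (wa2 W)%:~R * z ^+ 2 + (wa3 W)%:~R * (w + w')
  + (wa4 W)%:~R * z * (w + w') + (wa6 W)%:~R * (w ^+ 2 + w * w' + w' ^+ 2).

Definition wf_zslope (R : comNzRingType) (W : weierstrass) (z z' w : R) : R :=
  z ^+ 2 + z * z' + z' ^+ 2 + (wa1 W)%:~R * w + (wa2 W)%:~R * (z + z') * w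
  + (wa4 W)%:~R * w ^+ 2.

(** Coefficient of z^3 in f(z, l z + nu) - (l z + nu); the next definition is the coefficient of
    z^2. *)
Definition chord_den (R : comNzRingType) (W : weierstrass) (l : R) : R :=
  1 + (wa2 W)%:~R * l + (wa4 W)%:~R * l ^+ 2 + (wa6 W)%:~R * l ^+ 3.

Definition chord_num (R : comNzRingType) (W : weierstrass) (l nu : R) : R :=
  (wa1 W)%:~R * l + (wa2 W)%:~R * nu + (wa3 W)%:~R * l ^+ 2
    + 2 * (wa4 W)%:~R * l * nu + 3 * (wa6 W)%:~R * l ^+ 2 * nu.

Lemma wf_sub (R : comNzRingType) W (z w z' w' : R) :
  wf W z w - wf W z' w' = (z - z') * wf_zslope W z z' w + (w - w') * wf_slope W z' w w'.
Proof. by rewrite /wf /wf_slope /wf_zslope; ring. Qed.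

Lemma wf_subr (R : comNzRingType) W (z w w' : R) :
  wf W z w - wf W z w' = (w - w') * wf_slope W z w w'.
Proof. by rewrite wf_sub subrr mul0r add0r. Qed.

Lemma wf0r (R : comNzRingType) W (z : R) : wf W z 0 = z ^+ 3.
Proof. by rewrite /wf; ring. Qed.

Definition zw_point (K : fieldType) (z w : K) : wpoint K :=
  if z == 0 then None else Some (z / w, - w^-1).

Section Chord.
Variables (K : fieldType) (W : weierstrass).
Let a1 : K := (wa1 W)%:~R. Let a2 : K := (wa2 W)%:~R. Let a3 : K := (wa3 W)%:~R.
Let a4 : K := (wa4 W)%:~R. Let a6 : K := (wa6 W)%:~R.

Lemma zw_point_in (z w : K) : w = wf W z w -> (w == 0) = (z == 0) ->
  in_wcurve W (zw_point z w).
Proof.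
rewrite /zw_point /wf -/a1 -/a2 -/a3 -/a4 -/a6 => e wz; case: ifP => //= z0.
have w0 : w != 0 by rewrite wz z0.
rewrite /on_wcurve -/a1 -/a2 -/a3 -/a4 -/a6; apply/eqP; apply: (mulIf (expf_neq0 3 w0)).
have -> : ((- w^-1) ^+ 2 + a1 * (z / w) * (- w^-1) + a3 * (- w^-1)) * w ^+ 3 =
  w - a1 * z * w - a3 * w ^+ 2 by field.
have -> : ((z / w) ^+ 3 + a2 * (z / w) ^+ 2 + a4 * (z / w) + a6) * w ^+ 3 =
  z ^+ 3 + a2 * z ^+ 2 * w + a4 * z * w ^+ 2 + a6 * w ^+ 3 by field.
rewrite {1}e; ring.
Qed.

Lemma wf_opp (z w : K) (u := 1 - a1 * z - a3 * w) : u != 0 -> w = wf W z w ->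
  - w / u = wf W (- z / u) (- w / u).
Proof.
move=> u0; rewrite /wf -/a1 -/a2 -/a3 -/a4 -/a6 => e; apply: (mulIf (expf_neq0 3 u0)).
have -> : - w / u * u ^+ 3 = - w * u ^+ 2 by field.
have -> : ((- z / u) ^+ 3 + a1 * (- z / u) * (- w / u) + a2 * (- z / u) ^+ 2 * (- w / u) +
   a3 * (- w / u) ^+ 2 + a4 * (- z / u) * (- w / u) ^+ 2 + a6 * (- w / u) ^+ 3) * u ^+ 3 =
   - (z ^+ 3 + a1 * z * w + a2 * z ^+ 2 * w + a3 * w ^+ 2 + a4 * z * w ^+ 2 + a6 * w ^+ 3)
   + (1 + u) * (a1 * z * w + a3 * w ^+ 2) by field.
by rewrite -e /u; ring.
Qed.

Variables z1 z2 z3 l nu : K.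
Let w1 := l * z1 + nu. Let w2 := l * z2 + nu. Let w3 := l * z3 + nu.
Let den := chord_den W l. Let num := chord_num W l nu.
Let c1 := a1 * nu + 2 * a3 * l * nu + a4 * nu ^+ 2 + 3 * a6 * l * nu ^+ 2 - l.
Let c0 := a3 * nu ^+ 2 + a6 * nu ^+ 3 - nu.
Hypothesis den0 : den != 0.
Hypothesis hz3 : den * (z1 + z2 + z3) = - num.
Hypothesis hw1 : w1 = wf W z1 w1.
Hypothesis hl : l = wf_zslope W z1 z2 w1 + l * wf_slope W z2 w1 w2.

Lemma chord_cubic z : wf W z (l * z + nu) - (l * z + nu) =
  den * z ^+ 3 + num * z ^+ 2 + c1 * z + c0.
Proof.
by rewrite /wf /den /num /chord_den /chord_num /c1 /c0 -/a1 -/a2 -/a3 -/a4 -/a6; ring.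
Qed.

(** By [hl] the divided difference of the cubic at z1 and z2 vanishes, which is the second Vieta
    relation even when z1 = z2. *)
Lemma chord_vieta2 : den * (z1 * z2 + z3 * (z1 + z2)) = c1.
Proof.
have -> : den * (z1 * z2 + z3 * (z1 + z2)) =
  (z1 + z2) * (den * (z1 + z2 + z3)) - den * (z1 ^+ 2 + z1 * z2 + z2 ^+ 2) by ring.
rewrite hz3; apply: subr0_eq.
transitivity (l - (wf_zslope W z1 z2 w1 + l * wf_slope W z2 w1 w2)); last first.
  by rewrite -hl subrr.
rewrite /wf_zslope /wf_slope /w1 /w2 /den /num /chord_den /chord_num /c1 -/a1 -/a2 -/a3 -/a4 -/a6.
ring.
Qed.

Lemma chord_vieta3 : den * (z1 * z2 * z3) = - c0.
Proof.
have -> : den * (z1 * z2 * z3) = den * z1 ^+ 3 - den * (z1 + z2 + z3) * z1 ^+ 2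
  + den * (z1 * z2 + z3 * (z1 + z2)) * z1 by ring.
rewrite chord_vieta2 hz3 mulNr opprK; apply: subr0_eq; rewrite opprK -chord_cubic.
by rewrite -/w1 -hw1 subrr.
Qed.

Lemma chord_wf3 : w3 = wf W z3 w3.
Proof.
apply/esym/subr0_eq; rewrite /w3 chord_cubic -chord_vieta2.
have -> : c0 = - (den * (z1 * z2 * z3)) by rewrite chord_vieta3 opprK.
have -> : num = - (den * (z1 + z2 + z3)) by rewrite hz3 opprK.
ring.
Qed.

(** Together with [chord_sum] this determines the sum of the three x-coordinates z / w from the
    Vieta relations. *)
Lemma chord_prod : den * (w1 * w2 * w3) = nu ^+ 3.
Proof.
have -> : den * (w1 * w2 * w3) = l ^+ 3 * (den * (z1 * z2 * z3))
  + l ^+ 2 * nu * (den * (z1 * z2 + z3 * (z1 + z2)))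
  + l * nu ^+ 2 * (den * (z1 + z2 + z3)) + nu ^+ 3 * den by rewrite /w1 /w2 /w3; ring.
rewrite chord_vieta2 chord_vieta3 hz3 /den /num /chord_den /chord_num /c1 /c0 -/a1 -/a2 -/a3 -/a4 -/a6.
ring.
Qed.

Lemma chord_sum : den * (z1 * (w2 * w3) + z2 * (w1 * w3) + z3 * (w1 * w2)) =
  nu * (l ^+ 2 + a1 * l * nu - a2 * nu ^+ 2).
Proof.
have -> : den * (z1 * (w2 * w3) + z2 * (w1 * w3) + z3 * (w1 * w2)) =
  3 * l ^+ 2 * (den * (z1 * z2 * z3)) + 2 * l * nu * (den * (z1 * z2 + z3 * (z1 + z2)))
  + nu ^+ 2 * (den * (z1 + z2 + z3)) by rewrite /w1 /w2 /w3; ring.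
rewrite chord_vieta2 chord_vieta3 hz3 /den /num /chord_den /chord_num /c1 /c0 -/a1 -/a2 -/a3 -/a4 -/a6.
ring.
Qed.

Hypothesis wz1 : (w1 == 0) = (z1 == 0).
Hypothesis wz2 : (w2 == 0) = (z2 == 0).
Hypothesis wz3 : (w3 == 0) = (z3 == 0).
Let u := 1 - a1 * z3 - a3 * w3.
Hypothesis u0 : u != 0.
Hypothesis slope1 : 1 - wf_slope W z2 w1 w2 != 0.

(** The conclusion says that z' is the formal inverse - z / (1 - a1 z - a3 w) of z, where w = l z:
    two points on a line through the identity are opposite. *)
Lemma chord_nu0 (z z' : K) : nu = 0 -> den * (z + z') = - num -> den * (z * z') = c1 ->
  z' * (a1 + a3 * l) * z = z + z'.
Proof.
move=> n0 s2 p2; apply: (mulfI den0); rewrite s2.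
have -> : den * (z' * (a1 + a3 * l) * z) = den * (z * z') * (a1 + a3 * l) by ring.
rewrite p2 /c1 /num /chord_num n0 -/a1 -/a2 -/a3 -/a4 -/a6; ring.
Qed.

(** If nu = 0, the line passes through the identity z = w = 0, so one of the three points is the
    identity and the other two are opposite. Otherwise the line is y = (l / nu) x - 1 / nu in affine
    coordinates, and l / nu has to be recognized as the slope of the affine formulas. *)
Lemma chord_add : wadd W (zw_point z1 w1) (zw_point z2 w2) = zw_point (- z3 / u) (- w3 / u).
Proof.
have [n0|n0] := eqVneq nu 0.
  have : z1 * z2 * z3 = 0.
    by apply: (mulfI den0); rewrite chord_vieta3 /c0 n0; ring.
  have k3 : w3 = l * z3 by rewrite /w3 n0 addr0.
  have uE : u = 1 - z3 * (a1 + a3 * l) by rewrite /u k3; ring.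
  move/eqP; rewrite !mulf_eq0 -orbA => /or3P[] /eqP zz0.
  - have e : - z3 / u = z2.
      apply: (mulIf u0); rewrite mulfVK // uE.
      have s2 : z3 * (a1 + a3 * l) * z2 = z2 + z3.
        apply: chord_nu0 => //; first by rewrite -hz3 zz0; ring.
        by rewrite -chord_vieta2 zz0; ring.
      rewrite mulrBr mulr1 [z2 * (_ * _)]mulrC s2; ring.
    have -> : - w3 / u = w2 by rewrite /w2 -e k3 n0; ring.
    by rewrite e {1}/zw_point zz0 eqxx.
  - have e : - z3 / u = z1.
      apply: (mulIf u0); rewrite mulfVK // uE.
      have s2 : z3 * (a1 + a3 * l) * z1 = z1 + z3.
        apply: chord_nu0 => //; first by rewrite -hz3 zz0; ring.
        by rewrite -chord_vieta2 zz0; ring.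
      rewrite mulrBr mulr1 [z1 * (_ * _)]mulrC s2; ring.
    have -> : - w3 / u = w1 by rewrite /w1 -e k3 n0; ring.
    by rewrite e [X in wadd W _ X]/zw_point zz0 eqxx; case: (zw_point z1 w1) => [[]|].
  rewrite [RHS]/zw_point zz0 oppr0 mul0r eqxx.
  rewrite /zw_point; case: (eqVneq z1 0) => [y0|z10].
    have z20 : z2 = 0.
      have : den * (z1 + z2) = - num by rewrite -hz3 zz0 addr0.
      have : den * (z1 * z2) = c1 by rewrite -chord_vieta2 zz0; ring.
      move=> h1 /(chord_nu0 n0)/(_ h1); rewrite y0 !mulr0 add0r //.
    by rewrite z20 eqxx.
  case: (eqVneq z2 0) => [z20|z20].
    have : den * (z1 + z2) = - num by rewrite -hz3 zz0 addr0.
    have : den * (z1 * z2) = c1 by rewrite -chord_vieta2 zz0; ring.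
    move=> h1 /(chord_nu0 n0)/(_ h1); rewrite z20 !mul0r addr0 => z1E.
    by rewrite -z1E eqxx in z10.
  have w10 : w1 != 0 by rewrite wz1.
  have l0 : l != 0 by apply: contraNneq w10 => lE; rewrite /w1 lE n0 mul0r addr0.
  have e1 : w1 = l * z1 by rewrite /w1 n0 addr0.
  have e2 : w2 = l * z2 by rewrite /w2 n0 addr0.
  rewrite /= e1 e2; have -> : z1 / (l * z1) = l^-1 by field; rewrite l0.
  have -> : z2 / (l * z2) = l^-1 by field; rewrite l0.
  rewrite eqxx -/a1 -/a3 /=.
  have s2 : z2 * (a1 + a3 * l) * z1 = z1 + z2.
    apply: chord_nu0 => //; first by rewrite -hz3 zz0 addr0.
    by rewrite -chord_vieta2 zz0; ring.
  rewrite ifT //; apply/eqP; apply: (mulfI (mulf_neq0 l0 (mulf_neq0 z10 z20))).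
  have -> : l * (z1 * z2) * (- (l * z1)^-1 - (l * z2)^-1 + a1 / l + a3) =
    z2 * (a1 + a3 * l) * z1 - (z1 + z2) by field; rewrite l0 z10 z20.
  by rewrite s2 subrr mulr0.
have z10 : z1 != 0.
  apply/negP => /eqP e; have : w1 == 0 by rewrite wz1 e.
  by rewrite /w1 e mulr0 add0r (negPf n0).
have z20 : z2 != 0.
  apply/negP => /eqP e; have : w2 == 0 by rewrite wz2 e.
  by rewrite /w2 e mulr0 add0r (negPf n0).
have z30 : z3 != 0.
  apply/negP => /eqP e; have : w3 == 0 by rewrite wz3 e.
  by rewrite /w3 e mulr0 add0r (negPf n0).
have w10 : w1 != 0 by rewrite wz1.
have w20 : w2 != 0 by rewrite wz2.
have w30 : w3 != 0 by rewrite wz3.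
have z40 : - z3 / u != 0 by rewrite mulf_neq0 ?invr_eq0 ?oppr_eq0.
rewrite /zw_point (negPf z10) (negPf z20) (negPf z40).
have xline z : l * z + nu != 0 -> - (l * z + nu)^-1 = l / nu * (z / (l * z + nu)) - nu^-1.
  by move=> w0; field; rewrite n0 w0.
have fin lam : lam = l / nu ->
  Some (lam ^+ 2 + a1 * lam - a2 - z1 / w1 - z2 / w2,
     - (lam + a1) * (lam ^+ 2 + a1 * lam - a2 - z1 / w1 - z2 / w2)
     - (- w1^-1 - lam * (z1 / w1)) - a3)
   = Some (- z3 / u / (- w3 / u), - (- w3 / u)^-1).
  move=> ->.
  have x3E : (l / nu) ^+ 2 + a1 * (l / nu) - a2 - z1 / w1 - z2 / w2 = z3 / w3.
    apply/eqP; rewrite !subr_eq; apply/eqP.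
    have -> : z3 / w3 + z2 / w2 + z1 / w1 =
      (den * (z1 * (w2 * w3) + z2 * (w1 * w3) + z3 * (w1 * w2))) / (den * (w1 * w2 * w3)).
      by field; rewrite den0 w10 w20 w30.
    by rewrite chord_sum chord_prod; field.
  have opp_ratio (a b c : K) : b != 0 -> c != 0 -> - a / c / (- b / c) = a / b.
    by move=> b0 c0'; rewrite invf_div mulrA mulfVK // invrN mulrNN.
  rewrite x3E opp_ratio //.
  congr (Some (_, _)).
  rewrite [- w1^-1]xline // -/w1.
  have -> : - (- w3 / u)^-1 = - (- w3^-1) - a1 * (z3 / w3) - a3.
    have opp_inv (b c : K) : b != 0 -> c != 0 -> - (- b / c)^-1 = c / b.
      by move=> b0 c0'; rewrite invf_div invrN mulrN opprK.
    by rewrite opp_inv // /u; field.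
  rewrite [- w3^-1]xline // -/w3; ring.
rewrite /= -/a1 -/a2 -/a3 -/a4.
(* On a line y = lam x - 1 / nu, equal x-coordinates mean equal points: what remains is the
   tangent. *)
have [x12|x12] := eqVneq (z1 / w1) (z2 / w2); last first.
  rewrite /=; apply: fin.
  rewrite [- w2^-1]xline // [- w1^-1]xline // -/w1 -/w2.
  have x0 : z2 / w2 - z1 / w1 != 0 by rewrite subr_eq0 eq_sym.
  apply: (mulIf x0); rewrite mulfVK //; ring.
have y12 : w1^-1 = w2^-1.
  by apply: oppr_inj; rewrite [- w1^-1]xline // [- w2^-1]xline // -/w1 -/w2 x12.
have w12 : w2 = w1 by rewrite -[w1]invrK y12 invrK.
have z12 : z2 = z1 by move: x12; rewrite w12 => /(mulIf (invr_neq0 w10)).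
move: hl slope1; rewrite w12 z12 => hl' s1.
pose A := wf_zslope W z1 z1 w1; pose B := wf_slope W z1 w1 w1.
have hA : A = l * (1 - B) by rewrite mulrBr mulr1 {1}hl' -/A -/B addrK.
pose D := - w1^-1 + - w1^-1 + a1 * (z1 / w1) + a3.
have nuD : nu * (1 - B) = w1 ^+ 2 * D.
  have -> : nu = w1 - l * z1 by rewrite /w1; ring.
  have -> : (w1 - l * z1) * (1 - B) = w1 * (1 - B) - z1 * (l * (1 - B)) by ring.
  rewrite -hA; have -> : w1 ^+ 2 * D = w1 * (- 2 + a1 * z1 + a3 * w1) by rewrite /D; field.
  apply: subr0_eq; transitivity (3 * (w1 - wf W z1 w1)).
    by rewrite /A /B /wf_zslope /wf_slope /wf -/a1 -/a2 -/a3 -/a4 -/a6; ring.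
  by rewrite -hw1 subrr mulr0.
(* nu != 0 and [slope1] exclude a vertical tangent. *)
have D0 : D != 0.
  by have := mulf_neq0 n0 s1; rewrite nuD mulf_eq0 negb_or => /andP[].
rewrite -/D (negPf D0) /=.
have := fin ((3 * (z1 / w1) ^+ 2 + 2 * a2 * (z1 / w1) + a4 - a1 * (- w1^-1)) /
           (2 * (- w1^-1) + a1 * (z1 / w1) + a3)).
rewrite w12 z12; apply.
have -> : 2 * (- w1^-1) + a1 * (z1 / w1) + a3 = D by rewrite /D; ring.
apply: (mulIf D0); rewrite mulfVK //.
have -> : 3 * (z1 / w1) ^+ 2 + 2 * a2 * (z1 / w1) + a4 - a1 * (- w1^-1) = A / w1 ^+ 2.
  by rewrite /A /wf_zslope -/a1 -/a2 -/a3 -/a4 -/a6; field.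
apply: (mulIf (expf_neq0 2 w10)); rewrite mulfVK ?expf_neq0 // hA.
have -> : l / nu * D * w1 ^+ 2 = l / nu * (w1 ^+ 2 * D) by ring.
by rewrite -nuD; field.
Qed.

End Chord.

(** * The formal group law as a power series *)

Section FormalGroupLaw.
Variable W : weierstrass.

Lemma fpsX_mul (R : comNzRingType) (f : fps R) m :
  (fpsX R * f : fps R) m = if m is m'.+1 then f m' else 0.
Proof.
transitivity (\sum_(i < m.+1) fpsX R i * f (m - i)%N); first by [].
case: m => [|m]; first by rewrite big_ord1 mul0r.
rewrite !big_ord_recl big1 => [|i _]; last by rewrite mul0r.
by rewrite mul0r add0r addr0 mul1r subSS subn0.
Qed.

Lemma fpsC_mul (R : comNzRingType) (c : R) (f : fps R) m : (fpsC c * f : fps R) m = c * f m.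
Proof.
transitivity (\sum_(i < m.+1) fpsC c i * f (m - i)%N); first by [].
rewrite big_ord_recl big1 => [|i _]; last by rewrite mul0r.
by rewrite addr0 subn0.
Qed.

Definition fz1 : fps2 := fpsX _.
Definition fz2 : fps2 := fpsC (fpsX _).

Lemma fz1M (f : fps2) m n : (fz1 * f) m n = if m is m'.+1 then f m' n else 0.
Proof. by rewrite /fz1 fpsX_mul; case: m. Qed.

Lemma fz2M (f : fps2) m n : (fz2 * f) m n = if n is n'.+1 then f m n' else 0.
Proof. by rewrite /fz2 fpsC_mul fpsX_mul. Qed.

Lemma fz1X k m n : (fz1 ^+ k) m n = ((m == k) && (n == 0%N))%:R.
Proof. by elim: k m => [|k IHk] m; rewrite ?expr0 ?fps2_1 // exprS fz1M; case: m. Qed.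

Lemma fz2X k m n : (fz2 ^+ k) m n = ((m == 0%N) && (n == k))%:R.
Proof.
elim: k n => [|k IHk] n; rewrite ?expr0 ?fps2_1 // exprS fz2M; case: n => //.
by rewrite andbF.
Qed.

Lemma vanishes_fz1 : vanishes 1 fz1. Proof. by case=> [|m] [|n]. Qed.
Lemma vanishes_fz2 : vanishes 1 fz2. Proof. by case=> [|m] [|n]. Qed.

Lemma fz12_cancel (f : fps2) : (fz1 - fz2) * f = 0 -> f = 0.
Proof.
move=> f0; have E m n : (fz1 * f) m n = (fz2 * f) m n.
  by apply: subr0_eq; rewrite -fps2B -mulrBl f0.
apply/funext => m; apply/funext => n; elim: n m => [|n IHn] m.
  by have := E m.+1 0%N; rewrite fz1M fz2M.
by have := E m.+1 n.+1; rewrite fz1M fz2M => ->; apply: IHn.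
Qed.

Lemma vanishesB K f g : vanishes K f -> vanishes K g -> vanishes K (f - g).
Proof. by move=> ? ?; apply: vanishesD => //; apply: vanishesN. Qed.

Lemma vanishesMr K f g : vanishes K f -> vanishes K (f * g).
Proof. by move=> vf; rewrite -[K]addn0; apply: vanishesM. Qed.

Lemma vanishesMl K f g : vanishes K g -> vanishes K (f * g).
Proof. by move=> vf; rewrite mulrC; apply: vanishesMr. Qed.

Lemma vanishes_sum K (I : Type) (r : seq I) (P : pred I) (G : I -> fps2) :
  (forall i, P i -> vanishes K (G i)) -> vanishes K (\sum_(i <- r | P i) G i).
Proof. by move=> GK; apply: (big_ind (vanishes K)) => //; apply: vanishesD. Qed.

Lemma vanishes_slope K (z w w' : fps2) : vanishes K.+1 z -> vanishes K.+1 w ->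
  vanishes K.+1 w' -> vanishes K.+1 (wf_slope W z w w').
Proof.
move=> vz vw vw'; have vx (f : fps2) : vanishes K.+1 f -> vanishes K.+1 (f ^+ 2).
  by move=> vf; rewrite expr2; apply: vanishesMr.
rewrite /wf_slope; do ?apply: vanishesD; apply: vanishesMl => //; do ?apply: vanishesD => //.
- exact: vx.
- exact: vx.
- exact: vanishesMr.
- exact: vx.
Qed.

Local Notation uu k := (iter k (wser_step W) (0 : {poly int})).

(** Every w in f(z, w) is multiplied by z or by another w, itself divisible by z; each iteration
    therefore gains one order of precision. *)
Lemma wser_step_diff k (v s r : {poly int}) : v = 'X * s -> exists r',
  wser_step W (v + 'X^(k.+1) * r) = wser_step W v + 'X^(k.+2) * r'.
Proof.
move=> ->; rewrite /wser_step -!mul_polyC.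
set b1 := (wa1 W)%:P; set b2 := (wa2 W)%:P; set b3 := (wa3 W)%:P.
set b4 := (wa4 W)%:P; set b6 := (wa6 W)%:P.
pose t : {poly int} := 'X^k * r.
exists (r * (b1 + b2 * 'X + b3 * (s + s + t) + b4 * 'X * (s + s + t)
  + b6 * 'X * ((s + t) ^+ 2 + (s + t) * s + s ^+ 2))).
rewrite !exprS /t; move: ('X^k : {poly int}) => T; move: ('X : {poly int}) => Y.
ring.
Qed.

Lemma wser_iterS k : exists s, uu k = 'X * s.
Proof.
case: k => [|k]; first by exists 0; rewrite mulr0.
elim: k => [|k [s sE]].
  by exists ('X^2); rewrite /= /wser_step !(expr0n, mulr0, scaler0, addr0) -exprS.
rewrite iterS sE /wser_step -!mul_polyC.
exists ('X^2 + (wa1 W)%:P * ('X * s) + (wa2 W)%:P * 'X^2 * s + (wa3 W)%:P * 'X * s ^+ 2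
  + (wa4 W)%:P * 'X^2 * s ^+ 2 + (wa6 W)%:P * 'X^2 * s ^+ 3).
by move: ('X : {poly int}) => Y; ring.
Qed.

Lemma wser_iter_diff k : exists r, uu k.+1 = uu k + 'X^(k.+1) * r.
Proof.
elim: k => [|k [r rE]].
  by exists ('X^2); rewrite /= /wser_step !(expr0n, mulr0, scaler0, addr0) add0r -exprS.
have [s sE] := wser_iterS k; have [r' r'E] := wser_step_diff k r sE.
by exists r'; rewrite iterS {1}rE r'E.
Qed.

Lemma wser_iterE j k : (j < k)%N -> (uu k)`_j = wser W j.
Proof.
move=> /subnK <-; elim: (k - j.+1)%N => [|n IHn]; first by rewrite add0n.
rewrite addSn; have [r ->] := wser_iter_diff (n + j.+1).
by rewrite coefD coefXnM ifT ?addr0 //; lia.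
Qed.

Lemma wser_approx (z : fps2) k : vanishes 1 z ->
  vanishes k (fps2_comp (wser W) z - (map_poly intr (uu k)).[z]).
Proof.
move=> vz; set U := map_poly _ _.
have -> : fps2_comp (wser W) z - U.[z] =
    (fps2_comp (wser W) z - \sum_(j < k) (wser W j)%:~R * z ^+ j)
    - (U.[z] - \sum_(j < k) (wser W j)%:~R * z ^+ j) by ring.
apply: vanishesB; first exact: fps2_comp_sum.
rewrite (horner_coef_wide z (leq_addl k (size U))) big_split_ord /=.
have aux (A B D : fps2) : A = D -> vanishes k B -> vanishes k (A + B - D).
  by move=> ->; rewrite addrC addrA addNr add0r.
apply: aux; first by apply: eq_bigr => i _; rewrite coef_map -(wser_iterE (ltn_ord i)).
apply: vanishes_sum => i _; apply: vanishesMl.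
by apply: (@vanishesW (k + i)); [exact: leq_addr|rewrite -[X in vanishes X]mul1n; apply: vanishesX].
Qed.

Lemma wser_step_eval (R : comNzRingType) (z : R) (v : {poly int}) :
  (map_poly intr (wser_step W v)).[z] = wf W z (map_poly intr v).[z].
Proof.
pose h (P : {poly int}) := (map_poly (intr : int -> R) P).[z].
have hD P Q : h (P + Q) = h P + h Q by rewrite /h rmorphD hornerD.
have hM P Q : h (P * Q) = h P * h Q by rewrite /h rmorphM hornerM.
have hX P n : h (P ^+ n) = h P ^+ n by rewrite /h rmorphXn horner_exp.
have hz : h 'X = z by rewrite /h map_polyX hornerX.
have hZ c P : h (c *: P) = c%:~R * h P by rewrite -mul_polyC hM /h map_polyC hornerC.
change (h (wser_step W v) = wf W z (h v)); rewrite /wser_step /wf.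
move: h hD hM hX hz hZ => h hD hM hX hz hZ.
by rewrite !hD !hZ !(hX, hM, hz) !mulrA.
Qed.

Lemma wser_iter_eval (z : fps2) k :
  (map_poly intr (uu k.+1)).[z] = wf W z (map_poly intr (uu k)).[z].
Proof. exact: wser_step_eval. Qed.

Lemma wser0 : wser W 0 = 0.
Proof. by have [s sE] := wser_iterS 1; rewrite /wser sE coefXM. Qed.

Lemma vanishes_wser (z : fps2) : vanishes 1 (fps2_comp (wser W) z).
Proof. by case=> [|m] [|n] // _; rewrite /fps2_comp big_ord1 wser0 mul0r. Qed.

(** The iterates approximate w(z) to any order, and applying f once preserves the approximation. *)
Lemma wser_eq (z : fps2) : vanishes 1 z ->
  fps2_comp (wser W) z = wf W z (fps2_comp (wser W) z).
Proof.
move=> vz; apply: fps2_ext => k; set w := fps2_comp _ _.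
have -> : w - wf W z w = (w - (map_poly intr (uu k.+1)).[z])
    - (w - (map_poly intr (uu k)).[z]) * wf_slope W z w (map_poly intr (uu k)).[z].
  by rewrite -wf_subr wser_iter_eval; ring.
apply: vanishesB; first by apply: (@vanishesW k.+1); [exact: leqnSn|exact: wser_approx].
exact/vanishesMr/wser_approx.
Qed.

Definition fw1 : fps2 := fun i => fpsC (wser W i).
Definition fw2 : fps2 := fpsC (wser W).

Lemma fw1E : fw1 = fps2_comp (wser W) fz1.
Proof.
apply/funext => m; apply/funext => n; rewrite /fps2_comp /fw1 /fpsC.
have lt : (m < (m + n).+1)%N by rewrite ltnS leq_addr.
rewrite (bigD1 (Ordinal lt)) //= fz1X eqxx /= big1 ?addr0 => [|k km].
  by case: (n == 0%N); rewrite ?mulr1 ?mulr0.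
by rewrite fz1X eq_sym -[_ == m :> nat]/(k == Ordinal lt) (negPf km) mulr0.
Qed.

Lemma fw2E : fw2 = fps2_comp (wser W) fz2.
Proof.
apply/funext => m; apply/funext => n; rewrite /fps2_comp /fw2 /fpsC.
have lt : (n < (m + n).+1)%N by rewrite ltnS leq_addl.
rewrite (bigD1 (Ordinal lt)) //= fz2X eqxx andbT /= big1 ?addr0 => [|k km].
  by case: (m == 0%N); rewrite ?mulr1 ?mulr0.
by rewrite fz2X andbC eq_sym -[_ == n :> nat]/(k == Ordinal lt) (negPf km) mulr0.
Qed.

(** The equation reads w = z^3 + w r with r of order at least 1; feeding it into itself raises the
    order of w from 1 to 2 and then to 3. *)
Lemma wser_small j : (j < 3)%N -> wser W j = 0.
Proof.
have E : fw1 = fz1 ^+ 3 + fw1 * wf_slope W fz1 fw1 0.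
  rewrite {1}fw1E (wser_eq vanishes_fz1) -fw1E -(wf0r W).
  by rewrite -[fw1 in fw1 * _]subr0 -wf_subr; ring.
have v1 : vanishes 1 fw1 by rewrite fw1E; apply: vanishes_wser.
have v3 : vanishes 3 (fz1 ^+ 3).
  by rewrite -[3%N]mul1n; apply: vanishesX; apply: vanishes_fz1.
have vs : vanishes 1 (wf_slope W fz1 fw1 0).
  by apply: vanishes_slope => //; apply: vanishes_fz1.
have v2 : vanishes 2 fw1.
  by rewrite E; apply: vanishesD; [exact: vanishesW v3|exact: (vanishesM v1 vs)].
have v3' : vanishes 3 fw1.
  by rewrite E; apply: vanishesD => //; exact: (vanishesM v2 vs).
by move=> j3; have := v3' j 0%N; rewrite addn0 => /(_ j3).
Qed.

Definition fl : fps2 := fun i j => wser W (i + j).+1.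
Definition fnu : fps2 := fw1 - fl * fz1.
Definition fnum : fps2 := chord_num W fl fnu.
Definition fden : fps2 := chord_den W fl.
Definition fz3 : fps2 := - fz1 - fz2 - fnum * fps2_inv fden.
Definition fu : fps2 := 1 - (wa1 W)%:~R * fz3 - (wa3 W)%:~R * fps2_comp (wser W) fz3.

Lemma fglE : fgl W = - fz3 * fps2_inv fu. Proof. by []. Qed.

Lemma vanishes_fl : vanishes 2 fl.
Proof. by move=> m n lt; rewrite /fl wser_small. Qed.

Lemma flE : (fz1 - fz2) * fl = fw1 - fw2.
Proof.
apply/funext => m; apply/funext => n; rewrite mulrBl !fps2B fz1M fz2M /fl /fw1 /fw2.
case: m => [|m]; case: n => [|n] //=.
- by rewrite [RHS]subrr subr0.
- by rewrite addn0.
- by rewrite addSn addnS subrr; exact/esym/subrr.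
Qed.

(** After multiplication by z1 - z2 this is the difference of the equations w = f(z, w) at the two
    points, and z1 - z2 can be cancelled among series. The identity so obtained can be evaluated at
    equal arguments. *)
Lemma fl_tangent : fl = wf_zslope W fz1 fz2 fw1 + fl * wf_slope W fz2 fw1 fw2.
Proof.
apply: subr0_eq; apply: fz12_cancel; rewrite mulrBr mulrDr [(_ - _) * (fl * _)]mulrA flE.
rewrite -wf_sub {1}fw1E {1}fw2E {1}(wser_eq vanishes_fz1) {1}(wser_eq vanishes_fz2).
by rewrite -fw1E -fw2E subrr.
Qed.

Lemma vanishes_fnu : vanishes 2 fnu.
Proof.
apply: vanishesB; last exact/vanishesMr/vanishes_fl.
move=> m [|n] lt; last by [].
by rewrite /fw1 /= wser_small //; move: lt; rewrite addn0; apply: ltnW.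
Qed.

Lemma vanishes_fnum : vanishes 2 fnum.
Proof.
rewrite /fnum /chord_num; do ?apply: vanishesD.
- exact/vanishesMl/vanishes_fl.
- exact/vanishesMl/vanishes_fnu.
- by apply: vanishesMl; rewrite expr2; apply/vanishesMr/vanishes_fl.
- exact/vanishesMl/vanishes_fnu.
- exact/vanishesMl/vanishes_fnu.
Qed.

Lemma vanishes_fden : vanishes 1 (1 - fden).
Proof.
have -> : 1 - fden = - ((wa2 W)%:~R + (wa4 W)%:~R * fl + (wa6 W)%:~R * fl ^+ 2) * fl.
  by rewrite /fden /chord_den; ring.
by apply: vanishesMl; apply: (vanishesW _ vanishes_fl).
Qed.

Lemma vanishes_fz3 : vanishes 1 fz3.
Proof.
apply: vanishesB; last by apply: vanishesMr; apply: (vanishesW _ vanishes_fnum).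
by apply: vanishesB; [apply: vanishesN; apply: vanishes_fz1|exact: vanishes_fz2].
Qed.

Lemma vanishes_fu : vanishes 1 (1 - fu).
Proof.
have -> : 1 - fu = (wa1 W)%:~R * fz3 + (wa3 W)%:~R * fps2_comp (wser W) fz3.
  by rewrite /fu; ring.
apply: vanishesD; apply: vanishesMl; [exact: vanishes_fz3|exact: vanishes_wser].
Qed.

Lemma fgl_linear : vanishes 2 (fgl W - (fz1 + fz2)).
Proof.
have -> : fgl W - (fz1 + fz2) = fnum * fps2_inv fden + (- fz3) * (fps2_inv fu - 1).
  have -> : fz1 + fz2 = - fz3 - fnum * fps2_inv fden by rewrite /fz3; ring.
  by rewrite fglE; ring.
apply: vanishesD; first exact/vanishesMr/vanishes_fnum.
apply: (@vanishesM 1 1); first exact/vanishesN/vanishes_fz3.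
by have := @fps2_inv_sum fu 1 vanishes_fu; rewrite big_ord1 expr0.
Qed.

End FormalGroupLaw.

(** * Points of the formal group *)

Section RmorphChord.
Variables (R R' : comNzRingType) (h : {rmorphism R -> R'}) (W : weierstrass).

Lemma rmorph_wf z w : h (wf W z w) = wf W (h z) (h w).
Proof. by rewrite /wf !(rmorph_int, rmorphD, rmorphXn, rmorphM). Qed.

Lemma rmorph_slope z w w' : h (wf_slope W z w w') = wf_slope W (h z) (h w) (h w').
Proof. by rewrite /wf_slope !(rmorph_int, rmorphD, rmorphXn, rmorphM). Qed.

Lemma rmorph_zslope z z' w : h (wf_zslope W z z' w) = wf_zslope W (h z) (h z') (h w).
Proof. by rewrite /wf_zslope !(rmorph_int, rmorphD, rmorphXn, rmorphM). Qed.

Lemma rmorph_den l : h (chord_den W l) = chord_den W (h l).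
Proof. by rewrite /chord_den !(rmorph1, rmorph_int, rmorphD, rmorphXn, rmorphM). Qed.

Lemma rmorph_num l nu : h (chord_num W l nu) = chord_num W (h l) (h nu).
Proof. by rewrite /chord_num !(rmorph_nat, rmorph_int, rmorphD, rmorphXn, rmorphM). Qed.

End RmorphChord.

Section SmallRoots.
Variables (p : primeNat) (C : Qp_closure p) (W : weierstrass).
Local Notation V := (@qbar_int p C).
Local Notation mm := (@qbar_max p C).

Lemma mm_slope z w w' : mm z -> mm w -> mm w' -> mm (wf_slope W z w w').
Proof.
move=> mz mw mw'; have m2 c : mm c -> mm (c ^+ 2) by move=> mc; apply: mmXn.
rewrite /wf_slope; do ?apply: mmD.
- by apply: mmM => //; apply: Vint.
- by apply: mmM; [exact: Vint|exact: m2].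
- by apply: mmM; [exact: Vint|exact: mmD].
- by apply: mmM; [by apply: VM; [exact: Vint|exact: mmV]|exact: mmD].
- apply: mmM; first exact: Vint.
  by apply: mmD; [apply: mmD; [exact: m2|by apply: mmM => //; apply: mmV]|exact: m2].
Qed.

Lemma one_sub_mm c : mm c -> 1 - c != 0.
Proof. by move=> /mmN mc; have [] := unit_1mm mc. Qed.

(** The difference of two small solutions equals itself times an element of the maximal ideal. *)
Lemma wf_unique z w w' : mm z -> mm w -> mm w' -> w = wf W z w -> w' = wf W z w' -> w = w'.
Proof.
move=> mz mw mw' e e'; apply: subr0_eq.
apply: (mulIf (one_sub_mm (mm_slope mz mw mw'))); rewrite mul0r mulrBr mulr1 -wf_subr.
by rewrite -e -e' subrr.
Qed.

Lemma wf_root_eq0 z w : mm z -> mm w -> w = wf W z w -> (w == 0) = (z == 0).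
Proof.
move=> mz mw e; have s0 := one_sub_mm (mm_slope mz mw (mm0 C)).
have E : w * (1 - wf_slope W z w 0) = z ^+ 3.
  by rewrite mulrBr mulr1 -[w in w * _]subr0 -wf_subr -e wf0r; ring.
have := congr1 (fun c => c == 0) E.
by rewrite mulf_eq0 (negPf s0) orbF expf_eq0 /=.
Qed.

End SmallRoots.

Section Points.
Variables (p : primeNat) (C : Qp_closure p) (iota : emb C) (W : weierstrass).
Variable F : set algC.
Hypothesis gF : galfield F.
Local Notation V := (@qbar_int p C).
Local Notation mm := (@qbar_max p C).
Local Notation krad := (@krad p C F).
Implicit Types x y : emb C -> C.

(** At each embedding, evaluation is packed as a ring morphism, so that identities of series
    transfer by rewriting. *)
Lemma ev_rmorph x y (kx : krad x) (ky : krad y) i :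
  exists h : {rmorphism fps2 -> C}, forall f, h f = ev x y f i.
Proof.
pose h (f : fps2) := ev x y f i.
have hB : zmod_morphism h.
  by move=> f g; rewrite /h (evB iota gF kx ky) !fctE.
have hM : monoid_morphism h.
  split=> [|f g]; first by rewrite /h (ev1 iota gF kx ky).
  by rewrite /h (evM iota gF kx ky) !fctE.
pose h' : {rmorphism fps2 -> C} := HB.pack h (GRing.isZmodMorphism.Build _ _ h hB)
  (GRing.isMonoidMorphism.Build _ _ h hM).
by exists h'.
Qed.

Definition wz x : emb C -> C := ser_eval (fun n => (wser W n)%:Q) x.

Lemma ev_comp x y (kx : krad x) (ky : krad y) (a : fps int) u : vanishes 1 u ->
  ser_eval (fun n => (a n)%:Q) (ev x y u) = ev x y (fps2_comp a u).
Proof.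
move=> vu; apply: padic_limE; apply/padic_cvgP => t.
exists (radexp iota gF kx ky * t)%N => n le i.
have [h hE] := ev_rmorph kx ky i.
have -> : \sum_(k < n) ratr (a k)%:Q * ev x y u i ^+ k = h (\sum_(k < n) (a k)%:~R * u ^+ k).
  rewrite rmorph_sum; apply: eq_bigr => k _.
  by rewrite ratr_int rmorphM rmorphXn rmorph_int hE.
rewrite -hE -rmorphB -opprB rmorphN; apply: pVN; rewrite hE.
exact: (ev_vanish (fps2_comp_sum (K := n) a vu) le).
Qed.

Lemma krad_mm x i : krad x -> mm (x i).
Proof. by move=> /(kradP iota gF)[_]. Qed.

Lemma vanishes_krad x y (kx : krad x) (ky : krad y) f : vanishes 1 f -> krad (ev x y f).
Proof. by move=> vf; apply: (ev_krad iota gF kx ky); apply: vf. Qed.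

Lemma wzP x : krad x -> krad (wz x) /\ forall i, wz x i = wf W (x i) (wz x i).
Proof.
move=> kx; have e1 : ev x x fz1 = x := ev_z1 iota gF kx kx.
have E : wz x = ev x x (fps2_comp (wser W) fz1).
  by rewrite -(ev_comp kx kx) ?e1 //; apply: vanishes_fz1.
split=> [|i]; first by rewrite E; apply: vanishes_krad => //; apply: vanishes_wser.
have [h hE] := ev_rmorph kx kx i.
by rewrite E -hE {1}(wser_eq W vanishes_fz1) rmorph_wf !hE e1.
Qed.

Lemma wz_unique x i w : krad x -> mm w -> w = wf W (x i) w -> wz x i = w.
Proof.
move=> kx mw e; have [kw we] := wzP kx.
exact: (wf_unique (krad_mm i kx) (krad_mm i kw) mw (we i) e).
Qed.

Lemma wz_eq0 x i : krad x -> (wz x i == 0) = (x i == 0).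
Proof.
move=> kx; have [kw we] := wzP kx.
exact: (wf_root_eq0 (krad_mm i kx) (krad_mm i kw) (we i)).
Qed.

Lemma fg_pointE x i : fg_point W x i = zw_point (x i) (wz x i).
Proof. by []. Qed.

Lemma fg_point_in x i : krad x -> in_wcurve W (fg_point W x i).
Proof.
move=> kx; rewrite fg_pointE; apply: zw_point_in; last exact: wz_eq0.
by have [_] := wzP kx.
Qed.

Lemma fg_add_krad x y : krad x -> krad y -> krad (fg_add W x y).
Proof.
move=> kx ky; have -> : fg_add W x y = ev x y (fgl W) by [].
apply: vanishes_krad => //; rewrite fglE; apply/vanishesMr/vanishesN/vanishes_fz3.
Qed.

(** The formal chord construction, evaluated at i, satisfies the hypotheses of [chord_add]. Its
    w-coordinates are those of the points because small solutions of w = f(z, w) are unique. *)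
Lemma fg_add_point x y : krad x -> krad y ->
  fg_point W (fg_add W x y) = kadd W (fg_point W x) (fg_point W y).
Proof.
move=> kx ky; apply/funext => i; have [h hE] := ev_rmorph kx ky i.
have mh f : vanishes 1 f -> mm (h f).
  by move=> vf; rewrite hE; apply: krad_mm; apply: vanishes_krad.
have hz1 : h fz1 = x i by rewrite hE (ev_z1 iota gF kx ky).
have hz2 : h fz2 = y i by rewrite hE (ev_z2 iota gF kx ky).
have hw1 : h (fw1 W) = wz x i.
  rewrite fw1E hE -(ev_comp kx ky _ vanishes_fz1).
  by rewrite (_ : ev x y fz1 = x) //; exact: (ev_z1 iota gF kx ky).
have hw2 : h (fw2 W) = wz y i.
  rewrite fw2E hE -(ev_comp kx ky _ vanishes_fz2).
  by rewrite (_ : ev x y fz2 = y) //; exact: (ev_z2 iota gF kx ky).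
set l := h (fl W); set nu := h (fnu W); set z3 := h (fz3 W).
have v1l : vanishes 1 (fl W) by apply: (vanishesW _ (@vanishes_fl W)).
have v1n : vanishes 1 (fnu W) by apply: (vanishesW _ (@vanishes_fnu W)).
have ml : mm l by apply: mh.
have mn : mm nu by apply: mh.
have mz3 : mm z3 by apply: mh; apply: vanishes_fz3.
have w1E : l * x i + nu = wz x i.
  by rewrite /nu /fnu rmorphB rmorphM hz1 hw1 -/l; ring.
have w2E : l * y i + nu = wz y i.
  have /(congr1 h) := flE W; rewrite rmorphM !rmorphB hz1 hz2 hw1 hw2 -/l -w1E => e.
  by apply: subr0_eq; transitivity (wz x i - wz y i - (x i - y i) * l);
    [rewrite -w1E; ring|rewrite e -w1E subrr].
have [kwx ex] := wzP kx; have [kwy ey] := wzP ky.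
have inv1 f : vanishes 1 (1 - f) -> h f * h (fps2_inv f) = 1.
  by move=> vf; rewrite -rmorphM fps2_mulV // rmorph1.
have den1 : h (fden W) * h (fps2_inv (fden W)) = 1 by apply/inv1/vanishes_fden.
have denE : h (fden W) = chord_den W l by rewrite /fden rmorph_den.
have den0 : chord_den W l != 0.
  by rewrite -denE; apply/eqP => d0; move: den1; rewrite d0 mul0r => /esym/eqP; rewrite oner_eq0.
have hz3 : chord_den W l * (x i + y i + z3) = - chord_num W l nu.
  rewrite /z3 /fz3 !rmorphB rmorphN rmorphM hz1 hz2 rmorph_num -/l -/nu -denE.
  have -> : h (fden W) * (x i + y i + (- x i - y i - chord_num W l nu * h (fps2_inv (fden W))))
    = - chord_num W l nu * (h (fden W) * h (fps2_inv (fden W))) by ring.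
  by rewrite den1 mulr1.
(* Obtained from the identity of series, hence also valid when x and y agree at i. *)
have tan : l = wf_zslope W (x i) (y i) (l * x i + nu)
    + l * wf_slope W (y i) (l * x i + nu) (l * y i + nu).
  rewrite w1E w2E -hz1 -hz2 -hw1 -hw2 -rmorph_zslope -rmorph_slope -rmorphM -rmorphD.
  by rewrite -fl_tangent.
have c1 : l * x i + nu = wf W (x i) (l * x i + nu) by rewrite w1E; apply: ex.
have w3E := chord_wf3 hz3 c1 tan.
have mw3 : mm (l * z3 + nu) by apply: mmD => //; apply: mmMr => //; apply: mmV.
have wz3 : wz (ev x y (fz3 W)) i = l * z3 + nu.
  apply: wz_unique => //; first by apply: vanishes_krad => //; apply: vanishes_fz3.
  by rewrite -hE.
have uE : h (fu W) = 1 - (wa1 W)%:~R * z3 - (wa3 W)%:~R * (l * z3 + nu).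
  rewrite /fu !rmorphB rmorph1 !rmorphM !rmorph_int -/z3; congr (_ - _ * _).
  rewrite hE -(ev_comp kx ky _ (@vanishes_fz3 W)); exact: wz3.
have u1 : h (fu W) * h (fps2_inv (fu W)) = 1 by apply/inv1/vanishes_fu.
have u0 : h (fu W) != 0.
  by apply/eqP => d0; move: u1; rewrite d0 mul0r => /esym/eqP; rewrite oner_eq0.
have uV : h (fps2_inv (fu W)) = (h (fu W))^-1.
  by apply: (mulfI u0); rewrite u1 mulfV.
have z4E : fg_add W x y i = - z3 / h (fu W).
  rewrite -[fg_add W x y]/(ev x y (fgl W)) -hE fglE rmorphM rmorphN uV //.
have k4 := fg_add_krad kx ky.
have w4E : wz (fg_add W x y) i = - (l * z3 + nu) / h (fu W).
  apply: wz_unique => //; last by rewrite z4E uE; apply: wf_opp => //; rewrite -uE.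
  apply: mmMr; first exact: mmN.
  rewrite -uV -[h _]opprK; apply: VN; rewrite hE.
  have := (evP iota gF kx ky (fps2_inv (fu W))).1 => -[_ /(_ i)] Vi.
  by apply: VN.
rewrite /kadd !fg_pointE w4E z4E uE -w1E -w2E; apply/esym/chord_add => //.
- by rewrite w1E wz_eq0.
- by rewrite w2E wz_eq0.
- exact: (wf_root_eq0 mz3 mw3 w3E).
- by rewrite -uE.
- by rewrite w1E w2E; apply/one_sub_mm/mm_slope; apply: krad_mm.
Qed.

Lemma fg_point_inj x y : krad x -> krad y -> fg_point W x = fg_point W y -> x = y.
Proof.
move=> kx ky e; apply/funext => i; have := congr1 (@^~ i) e; rewrite /= !fg_pointE /zw_point.
case: (eqVneq (x i) 0) => [->|x0]; case: (eqVneq (y i) 0) => [->|y0] //= [e1 e2].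
have wx : wz x i != 0 by rewrite wz_eq0.
have e3 : wz x i = wz y i by apply: invr_inj; apply: oppr_inj.
by move: e1; rewrite -e3 => /(mulIf (invr_neq0 wx)).
Qed.

Lemma fg_point0 : fg_point W (0 : emb C -> C) = @kzero p C.
Proof. by apply/funext => i; rewrite fg_pointE /zw_point eqxx. Qed.

Lemma krad0 : krad 0.
Proof. by apply/(kradP iota gF); split=> [|i]; [exact: kalg0|exact: mm0]. Qed.

Lemma krad_act s x : krad x -> krad (gal_act s x).
Proof.
move=> /(kradP iota gF)[kx mx]; apply/(kradP iota gF); split; first exact: kalg_act.
by move=> i; apply: mx.
Qed.

Lemma wz_act s x : krad x -> wz (gal_act s x) = gal_act s (wz x).
Proof.
move=> kx; apply/funext => i; have [kw we] := wzP kx; apply: wz_unique.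
- exact: krad_act.
- exact: (krad_mm (emb_comp i s) kw).
- exact: we.
Qed.

Lemma fg_point_act s x : krad x -> fg_point W (gal_act s x) = gal_act s (fg_point W x).
Proof. by move=> kx; apply/funext => i; rewrite fg_pointE wz_act. Qed.

Definition fg_neg x : emb C -> C :=
  fun i => - x i / (1 - (wa1 W)%:~R * x i - (wa3 W)%:~R * wz x i).

Lemma fg_neg_unit x i : krad x ->
  1 - (wa1 W)%:~R * x i - (wa3 W)%:~R * wz x i != 0 /\
  V (1 - (wa1 W)%:~R * x i - (wa3 W)%:~R * wz x i)^-1.
Proof.
move=> kx; have [kw _] := wzP kx; rewrite -addrA; apply: unit_1mm; rewrite -opprD.
by apply: mmN; apply: mmD; apply: mmM; [exact: Vint|exact: krad_mm|exact: Vint|exact: krad_mm].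
Qed.

Lemma fg_neg_krad x : krad x -> krad (fg_neg x).
Proof.
move=> kx; have [kw _] := wzP kx.
have /(kradP iota gF)[ax _] := kx; have /(kradP iota gF)[aw _] := kw.
apply/(kradP iota gF); split=> [|i]; last first.
  by apply: mmMr; [apply/mmN/krad_mm|have [] := fg_neg_unit i kx].
have h := kalgB gF (kalgB gF (kalg1 C gF) (kalgM gF (kalg_int C gF (wa1 W)) ax))
  (kalgM gF (kalg_int C gF (wa3 W)) aw).
by apply: kalg_ext (kalgM gF (kalgN gF ax) (kalgV iota gF h)) => i; rewrite !fctE.
Qed.

Lemma fg_neg_point x : krad x ->
  fg_point W (fg_neg x) = fun i => if fg_point W x i is Some (a, b) then
     Some (a, - b - (wa1 W)%:~R * a - (wa3 W)%:~R) else None.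
Proof.
move=> kx; apply/funext => i; have [u0 Vu] := fg_neg_unit i kx.
have [kw we] := wzP kx; have kn := fg_neg_krad kx.
have wE : wz (fg_neg x) i = - wz x i / (1 - (wa1 W)%:~R * x i - (wa3 W)%:~R * wz x i).
  apply: wz_unique => //; first by apply: mmMr => //; apply/mmN/krad_mm.
  exact: (wf_opp u0 (we i)).
rewrite !fg_pointE wE /zw_point {1 2}/fg_neg.
case: (eqVneq (x i) 0) => [->|x0]; first by rewrite oppr0 mul0r eqxx.
rewrite mulf_eq0 oppr_eq0 (negPf x0) invr_eq0 (negPf u0) /=.
have w0 : wz x i != 0 by rewrite wz_eq0.
congr (Some (_, _)).
  by rewrite invf_div mulrA mulfVK // invrN mulrNN.
by rewrite invf_div invrN mulrN opprK; field.
Qed.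

(** The series F(X, Y) - X - Y has order 2, so a factor X or Y can be split off twice. *)
Lemma fg_add_approx x y i : krad x -> krad y -> exists a b c,
  [/\ V a, V b, V c & fg_add W x y i - x i - y i =
       x i ^+ 2 * a + x i * y i * b + y i ^+ 2 * c].
Proof.
move=> kx ky; have [h hE] := ev_rmorph kx ky i.
have Vh f : V (h f) by rewrite hE; have := (evP iota gF kx ky f).1 => -[_]; apply.
pose S1 (f : fps2) : fps2 := fun m n => f m.+1 n.
pose S2 (f : fps2) : fps2 := fun m n => if m == 0%N then f 0%N n.+1 else 0.
have split1 (f : fps2) : vanishes 1 f -> f = fz1 * S1 f + fz2 * S2 f.
  move=> vf; apply/funext => m; apply/funext => n; rewrite fps2D fz1M fz2M /S1 /S2.
  by case: m => [|m]; case: n => [|n] /=; rewrite ?addr0 ?add0r //; exact: vf.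
have [v1 v2] : vanishes 1 (S1 (fgl W - (fz1 + fz2))) /\ vanishes 1 (S2 (fgl W - (fz1 + fz2))).
  split=> m n lt; rewrite /S1 /S2; first by apply: fgl_linear; rewrite addSn ltnS.
  by case: eqP => // _; apply: fgl_linear; rewrite add0n ltnS; move: lt; lia.
set g := fgl W - (fz1 + fz2) in v1 v2 *.
have gE := split1 g (vanishesW (isT : (1 <= 2)%N) (@fgl_linear W)).
exists (h (S1 (S1 g))), (h (S2 (S1 g)) + h (S1 (S2 g))), (h (S2 (S2 g))).
split; [exact: Vh|by apply: VD; exact: Vh|exact: Vh|].
have hz1 : h fz1 = x i by rewrite hE (ev_z1 iota gF kx ky).
have hz2 : h fz2 = y i by rewrite hE (ev_z2 iota gF kx ky).
transitivity (h g).
  by rewrite /g rmorphB rmorphD hz1 hz2 hE; rewrite -[ev x y _]/(fg_add W x y); ring.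
rewrite {1}gE {1}(split1 _ v1) {1}(split1 _ v2) !(rmorphD, rmorphM) hz1 hz2; ring.
Qed.

(** y - y' divides y^b - y'^b, so the congruence passes to truncations, and these approximate both
    sums modulo p^k. *)
Lemma fg_add_cong x y y' k : krad x -> krad y -> krad y' ->
  (forall i, pV k (y i - y' i)) -> forall i, pV k (fg_add W x y i - fg_add W x y' i).
Proof.
move=> kx ky ky' yy i.
pose n := maxn (radexp iota gF kx ky * k) (radexp iota gF kx ky' * k).
have [_ P] := evP iota gF kx ky (fgl W); have [_ P'] := evP iota gF kx ky' (fgl W).
have {}P := P k n (leq_maxl _ _) i; have {}P' := P' k n (leq_maxr _ _) i.
have -> : fg_add W x y i - fg_add W x y' i = (ev x y (fgl W) i - psum x y (fgl W) n i)
   - (ev x y' (fgl W) i - psum x y' (fgl W) n i)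
   + (psum x y (fgl W) n i - psum x y' (fgl W) n i).
  by rewrite -[fg_add W x y]/(ev x y (fgl W)) -[fg_add W x y']/(ev x y' (fgl W)); ring.
apply: pVD; first exact: pVB.
rewrite -sumrB; apply: pVsum => a _; rewrite -sumrB; apply: pVsum => b _.
rewrite -mulrBr; apply: pVMl.
  by apply: VM; [exact: Vint|apply/VX/mmV/krad_mm].
rewrite subrXX mulrC; apply: pVMl => //; apply: Vsum => c _.
by apply: VM; apply/VX/mmV/krad_mm.
Qed.

End Points.

(** * The formal group as a Z_p-module *)

(** The data on which the module structure depends, gathered so that the canonical instances have a
    single argument. *)
Record fgdata (p : primeNat) (C : Qp_closure p) := FgData {
  fd_W : weierstrass;
  fd_good : ~~ (p%:Z %| wdisc fd_W)%Z;
  fd_iota : emb C;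
  fd_F : set algC;
  fd_gal : galfield fd_F }.

Section FormalModule.
Variables (p : primeNat) (C : Qp_closure p) (D : fgdata C).
Local Notation V := (@qbar_int p C).
Local Notation mm := (@qbar_max p C).
Local Notation W := (fd_W D).
Local Notation krad := (@krad p C (fd_F D)).
Local Notation Zp := (padic_int p).
Let iota := fd_iota D.
Let gF := fd_gal D.
Local Notation ECpt := (ecpoint (curveC C (fd_good D))).

Definition fgm : Type := set_type krad.
HB.instance Definition _ := Choice.on fgm.

Definition fgv (x : fgm) : emb C -> C := val x.
Lemma fgvP (x : fgm) : krad (fgv x). Proof. exact: set_valP. Qed.
Definition mkfg x (kx : krad x) : fgm := exist _ x (mem_set kx).
Lemma mkfgK x (kx : krad x) : fgv (mkfg kx) = x. Proof. by []. Qed.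
Lemma fgv_inj (x y : fgm) : fgv x = fgv y -> x = y. Proof. exact: val_inj. Qed.

(** Injection of the formal group into a product of copies of the group of the curve; the group
    axioms are pulled back along it. *)
Definition fgpt (x : fgm) : emb C -> ECpt :=
  fun i => exist _ (fg_point W (fgv x) i) (fg_point_in iota W gF i (fgvP x)).

Lemma fgpt_inj : injective fgpt.
Proof.
move=> x y e; apply: fgv_inj; apply: (@fg_point_inj _ _ iota W _ gF _ _ (fgvP x) (fgvP y)).
by apply/funext => i; have := congr1 (fun f => val (f i)) e.
Qed.

Definition fgm_add (x y : fgm) : fgm := mkfg (fg_add_krad iota W gF (fgvP x) (fgvP y)).
Definition fgm_opp (x : fgm) : fgm := mkfg (fg_neg_krad iota W gF (fgvP x)).
Definition fgm_zero : fgm := mkfg (krad0 iota gF).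

Lemma fgpt_add x y : fgpt (fgm_add x y) = fgpt x + fgpt y.
Proof.
apply/funext => i; apply: val_inj; rewrite fctE val_ptD /=.
by rewrite mkfgK (fg_add_point iota W gF (fgvP x) (fgvP y)).
Qed.

Lemma fgpt_opp x : fgpt (fgm_opp x) = - fgpt x.
Proof.
apply/funext => i; apply: val_inj; rewrite fctE val_ptN /=.
by rewrite mkfgK (fg_neg_point iota W gF (fgvP x)).
Qed.

Lemma fgpt_zero : fgpt fgm_zero = 0.
Proof. by apply/funext => i; apply: val_inj; rewrite /= mkfgK fg_point0. Qed.

Lemma fgm_addA : associative fgm_add.
Proof. by move=> x y z; apply: fgpt_inj; rewrite !fgpt_add addrA. Qed.
Lemma fgm_addC : commutative fgm_add.
Proof. by move=> x y; apply: fgpt_inj; rewrite !fgpt_add addrC. Qed.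
Lemma fgm_add0 : left_id fgm_zero fgm_add.
Proof. by move=> x; apply: fgpt_inj; rewrite !fgpt_add fgpt_zero add0r. Qed.
Lemma fgm_addN : left_inverse fgm_zero fgm_opp fgm_add.
Proof. by move=> x; apply: fgpt_inj; rewrite !fgpt_add fgpt_opp fgpt_zero addNr. Qed.

HB.instance Definition _ := GRing.isZmodule.Build fgm fgm_addA fgm_addC fgm_add0 fgm_addN.

Lemma fgvD (x y : fgm) : fgv (x + y) = fg_add W (fgv x) (fgv y). Proof. by []. Qed.
Lemma fgv0 : fgv 0 = 0. Proof. by []. Qed.
Lemma fgptD (x y : fgm) : fgpt (x + y) = fgpt x + fgpt y. Proof. exact: fgpt_add. Qed.

Lemma fgv_iter (x : fgm) n : iter n (fg_add W (fgv x)) 0 = fgv (x *+ n).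
Proof. by elim: n => [|n IHn] //; rewrite iterS IHn mulrS. Qed.

Implicit Types x y : fgm.

Definition near k x := forall i, pV k (fgv x i).

Lemma near_congD k x y y' : (forall i, pV k (fgv y i - fgv y' i)) ->
  forall i, pV k (fgv (x + y) i - fgv (x + y') i).
Proof. by apply: (fg_add_cong iota W gF); apply: fgvP. Qed.

(** Translation respects congruences of values, so congruence of values modulo p^k is congruence
    modulo the subgroup [near k]. *)
Lemma near_sub k x y : near k (x - y) <-> forall i, pV k (fgv x i - fgv y i).
Proof.
split=> [n i|n i].
  have := @near_congD k y (x - y) 0; rewrite (addrC y) subrK addr0; apply=> j.
  by rewrite fgv0 subr0; apply: n.
have := @near_congD k (- y) x y; rewrite addNr addrC => /(_ n i).
by rewrite fgv0 subr0.
Qed.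

Lemma near0 k : near k 0. Proof. by move=> i; rewrite fgv0; apply: pV0. Qed.

Lemma nearN k x : near k x -> near k (- x).
Proof.
move=> n; rewrite -sub0r; apply/near_sub => i; rewrite fgv0 sub0r.
exact/pVN/n.
Qed.

Lemma nearD k x y : near k x -> near k y -> near k (x + y).
Proof.
move=> nx ny; rewrite -[y]opprK; apply/near_sub => i; apply: pVB; first exact: nx.
exact: nearN.
Qed.

Lemma nearB k x y : near k x -> near k y -> near k (x - y).
Proof. by move=> nx ny; apply: nearD => //; apply: nearN. Qed.

Lemma nearMn k x n : near k x -> near k (x *+ n).
Proof. by move=> nx; elim: n => [|n IHn]; [exact: near0|rewrite mulrS; apply: nearD]. Qed.

Lemma near_eq0 x : (forall k, near k x) -> x = 0.
Proof.
move=> nx; apply: fgv_inj; apply/funext => i; rewrite fgv0.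
by apply: qbar_sep => k; apply: nx.
Qed.

Lemma near_eq x y : (forall k, near k (x - y)) -> x = y.
Proof. by move=> /near_eq0/eqP; rewrite subr_eq0 => /eqP. Qed.

Lemma fgvD_approx x y i : exists a b c,
  [/\ V a, V b, V c & fgv (x + y) i - fgv x i - fgv y i =
       fgv x i ^+ 2 * a + fgv x i * fgv y i * b + fgv y i ^+ 2 * c].
Proof. exact: (fg_add_approx iota W gF i (fgvP x) (fgvP y)). Qed.

Lemma nearD_approx k x y i : near k x -> near k y ->
  pV k.*2 (fgv (x + y) i - fgv x i - fgv y i).
Proof.
move=> nx ny; have [a [b [c [Va Vb Vc ->]]]] := fgvD_approx x y i.
rewrite -addnn !expr2; have := pVM (nx i) (nx i); have := pVM (nx i) (ny i).
have := pVM (ny i) (ny i) => h1 h2 h3.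
by do ?apply: pVD; rewrite mulrC; apply: pVMl.
Qed.

Lemma fgvV x i : V (fgv x i).
Proof. exact/mmV/(krad_mm iota gF)/fgvP. Qed.

Lemma fgvMn_approx x n i : exists2 c, V c & fgv (x *+ n) i = n%:R * fgv x i + fgv x i ^+ 2 * c.
Proof.
elim: n => [|n [c Vc E]]; first by exists 0; [exact: V0|rewrite fgv0 !mul0r mulr0 addr0].
have [a [b [d [Va Vb Vd]]]] := fgvD_approx x (x *+ n) i; rewrite -mulrS => E'.
have Vx := fgvV x i; set t := fgv x i in E E' Vx *.
have Vn : V n%:R := Vnat C n.
exists (c + a + (n%:R + t * c) * b + (n%:R + t * c) ^+ 2 * d).
  have Vntc : V (n%:R + t * c) by apply: VD => //; apply: VM.
  by do ?apply: VD => //; apply: VM => //; apply: VX.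
have -> : fgv (x *+ n.+1) i = fgv (x *+ n.+1) i - t - fgv (x *+ n) i + (t + fgv (x *+ n) i) by ring.
rewrite E' E -[n.+1]addn1 natrD; ring.
Qed.

(** Since [p] y = p y + O(y^2), the values of [p^n] x lie in the ideal (p, x^(n+1)) and are
    divisible by p for large n; from then on each multiplication by p gains a factor p. *)
Lemma near_pexp x k : exists n, near k (x *+ p ^ n).
Proof.
have [a a0 aP] := krad_uniform iota gF (fgvP x).
have stepA n i : exists b c, [/\ V b, V c & fgv (x *+ p ^ n) i = p%:R * b + fgv x i ^+ n.+1 * c].
  elim: n => [|n [b [c [Vb Vc E]]]].
    by exists 0, 1; split; [exact: V0|exact: V1|rewrite mulr0 add0r mulr1 expr1 mulr1n].
  have Vx := fgvV x i.
  have [d Vd] := fgvMn_approx (x *+ p ^ n) p i; rewrite -mulrnA -expnSr => ->.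
  have Vy := fgvV (x *+ p ^ n) i; set y := fgv (x *+ p ^ n) i in E Vy *.
  have Vm : V (fgv x i ^+ n.+1) by apply: VX.
  exists (y + (p%:R * b ^+ 2 + 2 * b * fgv x i ^+ n.+1 * c) * d), (fgv x i ^+ n * c ^+ 2 * d); split.
  - apply: VD => //; apply: VM => //; apply: VD.
      by apply: VM; [exact: Vnat|exact: VX].
    by do ?apply: VM => //; apply: (Vnat C 2).
  - by do ?apply: VM => //; apply: VX.
  rewrite {2}E !exprS; ring.
have near1 : near 1 (x *+ p ^ a).
  move=> i; have [b [c [Vb Vc ->]]] := stepA a i; apply: pVD.
    by exists b => //; rewrite expr1.
  by rewrite exprS mulrC mulrA; apply: pVMl (aP i); apply: VM => //; apply: fgvV.
exists (a + k)%N; elim: k => [|k IHk]; first by rewrite addn0; move=> i; apply: pVW (near1 i).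
have near1k : near 1 (x *+ p ^ (a + k)) by rewrite expnD mulrnA; apply: nearMn.
rewrite addnS expnSr mulrnA => i; have [c Vc ->] := fgvMn_approx (x *+ p ^ (a + k)) p i.
apply: pVD.
  have [d Vd ->] := IHk i; exists d => //; rewrite exprS mulrA //.
rewrite mulrC expr2; apply: pVMl => //; rewrite -add1n; exact: pVM (near1k i) (IHk i).
Qed.

Lemma near_modn x n k m m' : near k (x *+ p ^ n) -> (m = m' %[mod p ^ n])%N ->
  near k (x *+ m - x *+ m').
Proof.
move=> nx; wlog le : m m' / (m' <= m)%N => [H|e].
  move=> e; case/orP: (leq_total m' m) => le; first exact: H.
  by rewrite -opprB; apply/nearN/H.
rewrite -mulrnBr //; have /dvdnP[q ->] : (p ^ n %| m - m')%N by rewrite -eqn_mod_dvd //; apply/eqP.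
by rewrite mulnC mulrnA; apply: nearMn.
Qed.

Lemma fgm_complete (u : nat -> fgm) : (forall n, near n (u n.+1 - u n)) ->
  exists l, forall n, near n (l - u n).
Proof.
move=> cu; have [] := @kint_complete p C iota _ gF (fun n => fgv (u n)).
- by move=> n; have [] := fgvP (u n).
- by move=> n i; apply/near_sub: i.
move=> l kl lP; have krl : krad l.
  apply/(kradP iota gF); split=> [|i]; first by case: kl.
  rewrite -[l i](subrK (fgv (u 1%N) i)); apply: mmD; last exact/(krad_mm iota gF)/fgvP.
  exact: (@pV_mm _ _ 0).
by exists (mkfg krl) => n; apply/near_sub => i; apply: lP.
Qed.

Lemma fgm_complete_sub (u : nat -> fgm) :
  (forall k, exists N, forall n, (N <= n)%N -> near k (u n - u N)) ->
  exists l, forall k, exists N, forall n, (N <= n)%N -> near k (l - u n).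
Proof.
move=> /choice[N NP]; pose M k := (\sum_(j < k.+1) N j)%N.
have NM k : (N k <= M k)%N by rewrite /M big_ord_recr /= leq_addl.
have MS k : (M k <= M k.+1)%N by rewrite {2}/M big_ord_recr /= leq_addr.
have [k|l lP] := @fgm_complete (fun k => u (M k)).
  have -> : u (M k.+1) - u (M k) = (u (M k.+1) - u (N k)) - (u (M k) - u (N k)).
    by rewrite opprB addrA subrK.
  by apply: nearB; apply: NP => //; apply: leq_trans (MS k).
exists l => k; exists (M k) => n le.
rewrite -[l](subrK (u (M k))) -addrA; apply: nearD => //.
have -> : u (M k) - u n = (u (M k) - u (N k)) - (u n - u (N k)) by rewrite opprB addrA subrK.
by apply: nearB; apply: NP => //; apply: leq_trans le.
Qed.

Lemma Posz_pexp n : ((p ^ n)%N : int) = pexp p n.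
Proof. by rewrite /pexp -[LHS]natz natrX natz. Qed.

Lemma zres_absz_mod (a : Zp) n m : (n <= m)%N ->
  (`|zres a m|%N = `|zres a n|%N %[mod p ^ n])%N.
Proof.
move=> le; apply/eqP; rewrite -eqz_nat -!modz_nat; apply/eqP.
have gez j : (`|zres a j|%N : int) = zres a j by rewrite gez0_abs // zres_ge0.
rewrite !gez Posz_pexp zres_mod -(subnKC le); exact: zres_mod_le.
Qed.

(** The multiples by residues of a are eventually constant modulo p^k, namely from level n on as
    soon as p^k divides [p^n] x. *)
Lemma fg_scale_ex (a : Zp) x : exists l, fg_scale W a (fgv x) = fgv l /\
  forall k n, near k (x *+ p ^ n) -> near k (l - x *+ `|zres a n|%N).
Proof.
pose u n := x *+ `|zres a n|%N.
have uP k n m : near k (x *+ p ^ n) -> (n <= m)%N -> near k (u m - u n).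
  by move=> nk le; apply: (near_modn nk); apply: zres_absz_mod.
have [|l lP] := @fgm_complete_sub u.
  by move=> k; have [n nP] := near_pexp x k; exists n => m; apply: uP.
exists l; split.
  apply: padic_limE; apply/padic_cvgP => k; have [N NP] := lP k.
  exists N => n le i; rewrite fgv_iter -opprB; apply: pVN.
  by apply/near_sub: i; apply: NP.
move=> k n nk; have [N NP] := lP k.
rewrite -[l](subrK (u (maxn N n))) -addrA; apply: nearD; first exact/NP/leq_maxl.
exact/uP/leq_maxr.
Qed.

Definition fgm_scale (a : Zp) x : fgm := sval (cid (fg_scale_ex a x)).

Lemma fgv_scale a x : fgv (fgm_scale a x) = fg_scale W a (fgv x).
Proof. by rewrite /fgm_scale; case: cid => l [? ?]. Qed.

(** Any natural number congruent to a modulo p^n may replace a. The module axioms thus reduce to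
    those of natural multiples, up to arbitrarily small errors. *)
Lemma scale_near a x k n m c : near k (x *+ p ^ n) -> a = m%:R + p%:R ^+ n * c ->
  near k (fgm_scale a x - x *+ m).
Proof.
move=> nk aE; rewrite /fgm_scale; case: cid => l [_ /(_ k n nk)] h /=.
rewrite -[l](subrK (x *+ `|zres a n|)) -addrA; apply: nearD => //.
apply: (near_modn nk); apply/eqP; rewrite -eqz_nat -!modz_nat; apply/eqP.
rewrite gez0_abs ?zres_ge0 // Posz_pexp zres_mod aE zresD zres_pexpM.
by rewrite addr0 zres_nat modz_mod.
Qed.

Lemma Zp_approx (a : Zp) n : exists m c, a = m%:R + p%:R ^+ n * c.
Proof. by have [c cE] := Zp_zres_abszB a n; exists `|zres a n|%N, c. Qed.

Lemma near_pexp_le x k n m : (n <= m)%N -> near k (x *+ p ^ n) -> near k (x *+ p ^ m).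
Proof. by move=> /subnKC <- nk; rewrite expnD mulrnA; apply: nearMn. Qed.

Lemma near_pexp2 x y k : exists n, near k (x *+ p ^ n) /\ near k (y *+ p ^ n).
Proof.
have [n nP] := near_pexp x k; have [m mP] := near_pexp y k.
exists (n + m)%N; split; first exact: near_pexp_le (leq_addr _ _) nP.
exact: near_pexp_le (leq_addl _ _) mP.
Qed.

Lemma fgm_scaleDr a x y : fgm_scale a (x + y) = fgm_scale a x + fgm_scale a y.
Proof.
apply: near_eq => k; have [n [nx ny]] := near_pexp2 x y k.
have [m [c aE]] := Zp_approx a n.
have nxy : near k ((x + y) *+ p ^ n) by rewrite mulrnDl; apply: nearD.
have h1 := scale_near nxy aE; have h2 := scale_near nx aE; have h3 := scale_near ny aE.
have := nearB h1 (nearD h2 h3).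
by rewrite mulrnDl [X in _ - X]addrACA -opprD opprB addrA subrK.
Qed.

Lemma fgm_scaleDl x a b : fgm_scale (a + b) x = fgm_scale a x + fgm_scale b x.
Proof.
apply: near_eq => k; have [n nx] := near_pexp x k.
have [m [c aE]] := Zp_approx a n; have [m' [c' bE]] := Zp_approx b n.
have abE : a + b = (m + m')%:R + p%:R ^+ n * (c + c') by rewrite aE bE natrD mulrDr addrACA.
have h1 := scale_near nx abE; have h2 := scale_near nx aE; have h3 := scale_near nx bE.
have := nearB h1 (nearD h2 h3).
by rewrite mulrnDr [X in _ - X]addrACA -opprD opprB addrA subrK.
Qed.

Lemma fgm_scale1 x : fgm_scale 1 x = x.
Proof.
apply: near_eq => k; have [n nx] := near_pexp x k.
have := @scale_near 1 x k n 1 0 nx; rewrite mulr0 addr0 mulr1n; exact.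
Qed.

Lemma fgm_scaleA a b x : fgm_scale a (fgm_scale b x) = fgm_scale (a * b) x.
Proof.
apply: near_eq => k; have [n [nx ny]] := near_pexp2 x (fgm_scale b x) k.
have [m [c aE]] := Zp_approx a n; have [m' [c' bE]] := Zp_approx b n.
have abE : a * b = (m' * m)%:R + p%:R ^+ n * (m%:R * c' + c * b).
  by rewrite {1}aE mulrDl {1}bE natrM mulrDr; ring.
have h1 := scale_near ny aE; have h2 := scale_near nx abE; have h3 := nearMn m (scale_near nx bE).
have := nearB (nearD h1 h3) h2.
by rewrite mulrnBl mulrnA addrA subrK opprB addrA subrK.
Qed.

HB.instance Definition _ := GRing.Zmodule_isLmodule.Build Zp fgm
  fgm_scaleA fgm_scale1 fgm_scaleDr fgm_scaleDl.

Lemma fgvZ a x : fgv (a *: x) = fg_scale W a (fgv x). Proof. exact: fgv_scale. Qed.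

Lemma nearZ_cong k n x a m c : near k (x *+ p ^ n) -> a = m%:R + p%:R ^+ n * c ->
  near k (a *: x - x *+ m).
Proof. exact: scale_near. Qed.

Definition fgm_act (s : absGal) x : fgm := mkfg (krad_act iota gF s (fgvP x)).

Lemma fgv_act s x : fgv (fgm_act s x) = gal_act s (fgv x). Proof. by []. Qed.

Lemma fgpt_act s x i : fgpt (fgm_act s x) i = fgpt x (emb_comp i s).
Proof. by apply: val_inj; rewrite /= fgv_act (fg_point_act iota W gF s (fgvP x)). Qed.

Lemma fgm_actD s x y : fgm_act s (x + y) = fgm_act s x + fgm_act s y.
Proof.
apply: fgpt_inj; apply/funext => i; rewrite fgptD !fctE !fgpt_act fgptD.
by rewrite fctE.
Qed.

Lemma fgm_act_zmod s : zmod_morphism (fgm_act s).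
Proof.
move=> x y; apply: (addIr (fgm_act s y)); rewrite -fgm_actD !subrK //.
Qed.
HB.instance Definition _ s := GRing.isZmodMorphism.Build fgm fgm (fgm_act s) (fgm_act_zmod s).

Lemma near_act s k x : near k x -> near k (fgm_act s x).
Proof. by move=> nx i; apply: nx. Qed.

Lemma fgm_actZ s a x : fgm_act s (a *: x) = a *: fgm_act s x.
Proof.
apply: near_eq => k; have [n nx] := near_pexp x k.
have [m [c aE]] := Zp_approx a n.
have ny : near k (fgm_act s x *+ p ^ n) by rewrite -raddfMn; apply: near_act.
have h1 := near_act s (nearZ_cong nx aE); have h2 := nearZ_cong ny aE.
have := nearB h1 h2; rewrite raddfB raddfMn /= opprB addrA subrK; exact.
Qed.

End FormalModule.

(** * Points over F (x) Q_p *)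

Section KPoints.
Variables (p : primeNat) (C : Qp_closure p) (iota : emb C) (W : weierstrass).
Variable F : set algC.
Hypothesis gF : galfield F.
Local Notation V := (@qbar_int p C).
Local Notation mm := (@qbar_max p C).
Local Notation kalg := (@kalg p C F).
Local Notation krad := (@krad p C F).
Local Notation kpoints := (@kpoints p C W F).
Implicit Types x y z : emb C -> C.

Lemma kalg_add x y : kalg x -> kalg y -> kalg (fun i => x i + y i).
Proof. exact: kalgD. Qed.
Lemma kalg_opp x : kalg x -> kalg (fun i => - x i).
Proof. exact: kalgN. Qed.
Lemma kalg_mul x y : kalg x -> kalg y -> kalg (fun i => x i * y i).
Proof. exact: (kalgM gF). Qed.
Lemma kalg_exp x n : kalg x -> kalg (fun i => x i ^+ n).
Proof. by move=> kx; apply: kalg_ext (kalgX gF n kx) => i; rewrite fctX. Qed.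
Lemma kalg_nat n : kalg (fun=> n%:R).
Proof. exact: (kalg_int C gF n). Qed.
Lemma kalg_one : kalg (fun=> 1). Proof. exact: (kalg_nat 1). Qed.
Lemma kalg_zero : kalg (fun=> 0). Proof. exact: (kalg_nat 0). Qed.

Ltac kalg_tac := repeat first [assumption | apply: kalg_add | apply: kalg_opp | apply: kalg_mul
  | apply: (kalgV iota gF) | apply: (kalg_if iota gF) | apply: kalg_exp | apply: (kalg_int C gF)
  | apply: kalg_nat | apply: kalg_one | apply: kalg_zero].

(** The vanishing of z marks the point at infinity, so that x and y can be total functions on the
    embeddings. *)
Definition affine_form x y z : emb C -> wpoint C :=
  fun i => if z i == 0 then None else Some (x i, y i).

Lemma kpoints_affine P : kpoints P <-> (forall i, in_wcurve W (P i)) /\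
  exists x y z, [/\ kalg x, kalg y, kalg z & P = affine_form x y z].
Proof.
split=> [[inP [X [Y [Z [kX kY kZ h]]]]]|[inP [x [y [z [kx ky kz eP]]]]]].
  split=> //; exists (fun i => X i / Z i), (fun i => Y i / Z i), Z; split=> //; try kalg_tac.
  apply/funext => i; have := h i; rewrite /affine_form; case: (P i) => [[a b]|] /=.
    by move=> [z0 -> ->]; rewrite (negPf z0) !mulfK.
  by move=> [_ _ ->]; rewrite eqxx.
split=> //.
exists (fun i => if z i == 0 then 0 else x i), (fun i => if z i == 0 then 1 else y i),
  (fun i => if z i == 0 then 0 else 1); split; try kalg_tac.
move=> i; rewrite eP /affine_form; case: eqP => _ /=; split=> //; rewrite ?oner_eq0 ?mulr1 //.
Qed.

Hypothesis good : ~~ (p%:Z %| wdisc W)%Z.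

Lemma wadd_in (P Q : wpoint C) : in_wcurve W P -> in_wcurve W Q -> in_wcurve W (wadd W P Q).
Proof.
move=> iP iQ; pose E := curveC C good.
have := valP ((exist _ P iP : ecpoint E) + (exist _ Q iQ : ecpoint E)).
by rewrite val_ptD.
Qed.

(** The branch of the addition law taken varies with the embedding; tests for vanishing glue the
    branches inside F (x) Q_p. *)
Lemma kpoints_add P Q : kpoints P -> kpoints Q -> kpoints (kadd W P Q).
Proof.
move=> /kpoints_affine[iP [x1 [y1 [z1 [kx1 ky1 kz1 eP]]]]].
move=> /kpoints_affine[iQ [x2 [y2 [z2 [kx2 ky2 kz2 eQ]]]]].
apply/kpoints_affine; split=> [i|]; first exact: wadd_in.
pose a1 : C := (wa1 W)%:~R; pose a2 : C := (wa2 W)%:~R; pose a3 : C := (wa3 W)%:~R.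
pose a4 : C := (wa4 W)%:~R.
pose l := fun i => if x1 i - x2 i == 0
  then (3 * x1 i ^+ 2 + 2 * a2 * x1 i + a4 - a1 * y1 i) / (2 * y1 i + a1 * x1 i + a3)
  else (y2 i - y1 i) / (x2 i - x1 i).
have kl : kalg l by rewrite /l /a1 /a2 /a3 /a4; kalg_tac.
pose x3 := fun i => l i ^+ 2 + a1 * l i - a2 - x1 i - x2 i.
have kx3 : kalg x3 by rewrite /x3 /a1 /a2; kalg_tac.
exists (fun i => if z1 i == 0 then x2 i else if z2 i == 0 then x1 i else x3 i).
exists (fun i => if z1 i == 0 then y2 i else if z2 i == 0 then y1 i else
   - (l i + a1) * x3 i - (y1 i - l i * x1 i) - a3).
exists (fun i => if z1 i == 0 then z2 i else if z2 i == 0 then z1 i else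
   if x1 i - x2 i == 0 then (if y1 i + y2 i + a1 * x2 i + a3 == 0 then 0 else 1) else 1).
split; try by rewrite /a1 /a3; kalg_tac.
apply/funext => i; rewrite /kadd eP eQ /affine_form.
case: (eqVneq (z1 i) 0) => [//|z10].
case: (eqVneq (z2 i) 0) => [z20|z20] /=; first by rewrite (negPf z10).
rewrite subr_eq0 -/a1 -/a2 -/a3 -/a4 /x3 /l subr_eq0.
case: (eqVneq (x1 i) (x2 i)) => [e|ne] /=; last by rewrite oner_eq0.
by case: (eqVneq (y1 i + y2 i + a1 * x2 i + a3) 0) => _; rewrite ?eqxx ?oner_eq0.
Qed.

Lemma kpoints0 : kpoints (@kzero p C).
Proof.
apply/kpoints_affine; split=> //; exists (fun=> 0), (fun=> 0), (fun=> 0).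
by split; [kalg_tac..|apply/funext => i; rewrite /affine_form eqxx].
Qed.

Lemma kpoints_act s P : kpoints P -> kpoints (gal_act s P).
Proof.
move=> /kpoints_affine[iP [x [y [z [kx ky kz eP]]]]]; apply/kpoints_affine; split=> [i|].
  exact: iP.
by exists (gal_act s x), (gal_act s y), (gal_act s z); split; try exact: kalg_act; rewrite eP.
Qed.

Lemma krad_kalg x : krad x -> kalg x. Proof. by move=> /(kradP iota gF)[]. Qed.

Lemma fg_point_kpoints x : krad x -> kpoints (fg_point W x).
Proof.
move=> kx; apply/kpoints_affine; split=> [i|]; first exact: (fg_point_in iota W gF).
have /krad_kalg kw := (wzP iota W gF kx).1; have ax := krad_kalg kx.
exists (fun i => x i / wz W x i), (fun i => - (wz W x i)^-1), x.
by split=> //; kalg_tac.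
Qed.

(** If y / x were integral, the equation divided by x^2 would write x as an integral element divided
    by the unit 1 + a2 / x + a4 / x^2 + a6 / x^3, so x would be integral. *)
Lemma nintegral_small (x y : C) : on_wcurve W x y -> ~ V x ->
  [/\ x != 0, y != 0, mm (- x / y), mm (- y^-1) & - y^-1 = wf W (- x / y) (- y^-1)].
Proof.
move=> /eqP c Vx; have [//|[x0 mt]] := V_or_mm x.
pose a1 : C := (wa1 W)%:~R; pose a2 : C := (wa2 W)%:~R; pose a3 : C := (wa3 W)%:~R.
pose a4 : C := (wa4 W)%:~R; pose a6 : C := (wa6 W)%:~R.
rewrite -/a1 -/a2 -/a3 -/a4 -/a6 in c.
have V1' : V a1 by apply: Vint. have V2' : V a2 by apply: Vint.
have V3' : V a3 by apply: Vint. have V4' : V a4 by apply: Vint.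
have V6' : V a6 by apply: Vint.
have [u0 Vu] : 1 + (a2 * x^-1 + a4 * x^-1 ^+ 2 + a6 * x^-1 ^+ 3) != 0 /\
    V (1 + (a2 * x^-1 + a4 * x^-1 ^+ 2 + a6 * x^-1 ^+ 3))^-1.
  by apply: unit_1mm; do ?apply: mmD; apply: mmM => //; apply: mmXn.
have nr : ~ V (y / x).
  move=> Vr; apply: Vx.
  have -> : x = ((y / x) ^+ 2 + a1 * (y / x) + a3 * (y / x) * x^-1)
      / (1 + (a2 * x^-1 + a4 * x^-1 ^+ 2 + a6 * x^-1 ^+ 3)).
    apply: (mulIf u0); rewrite mulfVK //; apply: (mulIf (expf_neq0 2 x0)).
    transitivity (x ^+ 3 + a2 * x ^+ 2 + a4 * x + a6); first by field.
    by rewrite -c; field.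
  apply: VM => //; have Vt := mmV mt.
  by do ?apply: VD; do ?apply: VM => //; apply: VX.
have [//|[r0 mr]] := V_or_mm (y / x).
have y0 : y != 0 by apply: contraNneq r0 => ->; rewrite mul0r.
have mz : mm (- x / y).
  by rewrite mulNr; apply: mmN; rewrite -invf_div.
split=> //.
  have -> : - y^-1 = (- x / y) * x^-1 by field; rewrite x0 y0.
  by apply: mmMr => //; apply: mmV.
rewrite /wf -/a1 -/a2 -/a3 -/a4 -/a6; apply: (mulIf (expf_neq0 3 y0)).
transitivity (- (y ^+ 2 + a1 * x * y + a3 * y) + a1 * x * y + a3 * y); first by field.
by rewrite c; field.
Qed.

(** The parameter is z = - x / y, and w = - 1 / y is the small solution of w = f(z, w). *)
Lemma nintegral_fg_point P : kpoints P -> (forall i, ~ integral_pt (P i)) ->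
  exists2 x, krad x & fg_point W x = P.
Proof.
move=> /kpoints_affine[iP [x [y [z [kx ky kz eP]]]]] nP.
pose t := fun i => if z i == 0 then 0 else - x i / y i.
have kt : kalg t by rewrite /t; kalg_tac.
have pt i : z i != 0 -> [/\ x i != 0, y i != 0, mm (- x i / y i), mm (- (y i)^-1)
    & - (y i)^-1 = wf W (- x i / y i) (- (y i)^-1)].
  move=> z0; apply: nintegral_small.
    by have := iP i; rewrite eP /affine_form (negPf z0).
  by have := nP i; rewrite eP /affine_form (negPf z0).
have krt : krad t.
  apply/(kradP iota gF); split=> // i; rewrite /t.
  by case: (eqVneq (z i) 0) => [_|/pt[]//]; exact: mm0.
exists t => //; apply/funext => i; rewrite fg_pointE /zw_point eP /affine_form {1}/t.
case: (eqVneq (z i) 0) => [|z0]; first by rewrite eqxx.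
have [x0 y0 mz mw we] := pt i z0.
have tE : t i = - x i / y i by rewrite /t (negPf z0).
rewrite mulf_eq0 oppr_eq0 (negPf x0) invr_eq0 (negPf y0) /=.
have -> : wz W t i = - (y i)^-1 by apply: (wz_unique iota gF krt mw); rewrite tE.
rewrite tE; congr (Some (_, _)); first by rewrite invrN invrK mulrN mulfVK // opprK.
by rewrite invrN opprK invrK.
Qed.

End KPoints.

Lemma kalg_mono (p : primeNat) (C : Qp_closure p) (F F' : set algC) (x : emb C -> C) :
  F `<=` F' -> kalg F x -> kalg F' x.
Proof. by move=> FF' [n [a [c [aF h]]]]; exists n, a, c; split=> // k; apply: FF'. Qed.

Lemma kpoints_mono (p : primeNat) (C : Qp_closure p) W (F F' : set algC)
    (P : emb C -> wpoint C) :
  F `<=` F' -> kpoints W F P -> kpoints W F' P.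
Proof.
move=> FF' [iP [X [Y [Z [kX kY kZ h]]]]]; split=> //; exists X, Y, Z.
by split=> //; apply: kalg_mono FF' _.
Qed.

Section FgmTorsion.
Variables (p : primeNat) (C : Qp_closure p) (D : fgdata C).

Lemma fg_point_sum (x : fgm D) n :
  fg_point (fd_W D) (fgv (x *+ n)) = iter n (kadd (fd_W D) (fg_point (fd_W D) (fgv x))) (@kzero p C).
Proof.
elim: n => [|n IHn]; first by rewrite mulr0n fgv0 fg_point0.
rewrite mulrS fgvD (fg_add_point (fd_iota D) (fd_W D) (fd_gal D)) ?IHn //; exact: fgvP.
Qed.

Lemma fgm_ptorsion : ptorsion_free C (fd_W D) (fd_F D) -> forall x : fgm D, x *+ p = 0 -> x = 0.
Proof.
move=> tf x x0; apply: fgv_inj; rewrite fgv0.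
apply: (@fg_point_inj _ _ (fd_iota D) (fd_W D) _ (fd_gal D)); first exact: fgvP.
  exact: (krad0 (fd_iota D) (fd_gal D)).
rewrite fg_point0; apply: tf; last by rewrite -fg_point_sum x0 fgv0 fg_point0.
exact/(fg_point_kpoints (fd_iota D) _ (fd_gal D))/fgvP.
Qed.

End FgmTorsion.

(** * Residue fields of the cyclotomic tower *)

Section AlgebraicIntegers.

Lemma Aint_integral x : x \in Aint <-> integralOver (intr : int -> algC) x.
Proof.
split=> [Ax|[q mq rq]].
  have [q qE] := floorpP Ax; exists q.
    have := minCpoly_monic x; rewrite qE !monicE lead_coef_map_inj //; last exact: intr_inj.
    by rewrite -[1 : algC]/(1%:~R) eqr_int.
  by rewrite -qE root_minCpoly.
apply: (root_monic_Aint rq); first exact: monic_map.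
by apply/polyOverP => i; rewrite coef_map /= intr_int.
Qed.

Lemma Aint_lead_mul n (f : {poly algC}) c : (size f <= n.+2)%N -> (forall i, f`_i \in Aint) ->
  f.[c] = 0 -> f`_n.+1 * c \in Aint.
Proof.
move=> sf fi fc; apply/Aint_integral; apply: (integral_lead_mul sf _ fc) => i.
exact/Aint_integral/fi.
Qed.

Lemma drop_polyS (R : nzSemiRingType) (G : {poly R}) k :
  drop_poly k G = (G`_k)%:P + drop_poly k.+1 G * 'X.
Proof.
apply/polyP => j; rewrite coefD coefC coefMX !coef_drop_poly.
by case: j => [|j]; rewrite ?addr0 ?add0r //= addnS.
Qed.

(** Descending induction on k. The tail value b is the leading coefficient of an equation of y of
    degree k + 1, namely b y^(k+1) plus the lower terms of G, so y b is integral; the next tail is y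
    b plus a coefficient of G. *)
Lemma Aint_horner_tail (G : {poly algC}) y k : (forall i, G`_i \in Aint) -> G.[y] = 0 ->
  (drop_poly k.+1 G).[y] \in Aint /\ y * (drop_poly k.+1 G).[y] \in Aint.
Proof.
move=> Gi Gy.
have [m] := ubnP (size G - k)%N; elim: m k => // m IHm k lt.
have [ge|lt'] := leqP (size G) k.+1.
  by rewrite (_ : drop_poly k.+1 G = 0) ?horner0 ?mulr0 ?rpred0 //; apply/eqP;
     rewrite -size_poly_eq0 size_drop_poly subn_eq0.
have [_ b2] := IHm k.+1 (ltac:(lia)).
set b := (drop_poly k.+1 G).[y].
have bA : b \in Aint by rewrite /b drop_polyS hornerD hornerC hornerMX mulrC rpredD ?Gi.
split=> //; rewrite mulrC.
pose f : {poly algC} := b%:P * 'X^(k.+1) + take_poly k.+1 G.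
have fE : f`_k.+1 = b by rewrite coefD coefCM coefXn eqxx mulr1 coef_take_poly ltnn addr0.
rewrite -fE; apply: Aint_lead_mul.
- rewrite (leq_trans (size_polyD _ _)) // geq_max; apply/andP; split.
    by rewrite (leq_trans (size_polyMleq _ _)) // size_polyXn; have := size_polyC_leq1 b; lia.
  by rewrite (leq_trans (size_take_poly _ _)).
- move=> j; rewrite coefD coefCM coefXn coef_take_poly rpredD //.
    by case: eqP => _; rewrite ?mulr1 ?mulr0 ?rpred0.
  by case: ifP => _; rewrite ?rpred0 ?Gi.
rewrite hornerD hornerM hornerC hornerXn -/b.
rewrite -[RHS]Gy -[in RHS](poly_take_drop k.+1 G) hornerD hornerM hornerXn addrC //.
Qed.

Lemma primitive_annihilator (y : algC) : exists g : {poly int},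
  (map_poly intr g).[y] = 0 /\ zcontents g = 1.
Proof.
have [q [qE mq] _] := minCpolyP y; have [g0 [a a0 gE]] := rat_poly_scale q.
have q0 : q != 0 by apply: monic_neq0.
have g00 : g0 != 0 by apply: contraNneq q0 => g00; rewrite gE g00 rmorph0 scaler0.
exists (zprimitive g0); split; last by rewrite zcontents_primitive g00.
have ra : (a%:~R : algC) != 0 by rewrite intr_eq0.
have : (map_poly intr g0).[y] = 0 :> algC.
  have /eqP : root (minCpoly y) y := root_minCpoly y.
  rewrite qE gE linearZ /= hornerZ fmorphV /= rmorph_int -map_poly_comp.
  move=> /eqP; rewrite mulf_eq0 invr_eq0 (negPf ra) /= => /eqP <-.
  by congr (_.[_]); apply: eq_map_poly => c /=; rewrite ratr_int.
rewrite {1}[g0]zpolyEprim linearZ /= hornerZ => /eqP.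
by rewrite mulf_eq0 intr_eq0 zcontents_eq0 (negPf g00) => /eqP.
Qed.

End AlgebraicIntegers.

(** * Residues and valuations over the unramified field *)

Section Unramified.
Variables (p : primeNat) (C : Qp_closure p) (K : set algC).
Hypothesis gK : galfield K.
Hypothesis unram : ~ ramified K p.
Local Notation V := (@qbar_int p C).
Local Notation mm := (@qbar_max p C).
Let sK : is_subfield K := gf_sub gK.

Definition gal_pow (s : galQ K) n : galQ K := iter n (gal_mul s) (gal_one K).

Variables (phi : galQ K) (f : nat).
Hypotheses (frob : is_frobenius p phi) (f0 : (0 < f)%N) (phif : gal_pow phi f = gal_one K).

Lemma V_Aint (i : emb C) x : x \in Aint -> V (i x).
Proof.
move=> /Aint_integral[q mq /eqP rq]; apply: (@V_root p C (map_poly intr q)).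
- exact: monic_map.
- by move=> j; rewrite coef_map; apply: Vint.
apply/eqP; rewrite -(rmorph0 i) -rq -horner_map -map_poly_comp; congr (_.[_]).
by apply: eq_map_poly => c /=; rewrite rmorph_int.
Qed.

Definition emb_prime (i : emb C) : set algC := [set x | int_ring K x /\ mm (i x)].

Lemma emb_primeP i : prime_ideal (int_ring K) (emb_prime i).
Proof.
split; [split|by move=> [_]; rewrite rmorph1; apply: not_mm1|].
- by move=> x [].
- by split; [split; [exact: (sf0 sK)|exact: rpred0]|rewrite rmorph0; apply: mm0].
- move=> x y [[Kx Ax] mx] [[Ky Ay] my]; split; last by rewrite rmorphD; apply: mmD.
  by split; [exact: (sfD sK)|exact: rpredD].
- move=> a x [Ka Aa] [[Kx Ax] mx]; split; last by rewrite rmorphM; apply: mmM => //; apply: V_Aint.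
  by split; [exact: (sfM sK)|exact: rpredM].
move=> x y [Kx Ax] [Ky Ay] [_]; rewrite rmorphM => /mm_prime[]; [exact: V_Aint|exact: V_Aint|..].
  by left.
by right.
Qed.

Lemma emb_prime_p i : emb_prime i p%:R.
Proof.
split; last by rewrite rmorph_nat; apply: mm_p.
by split; [exact: (sfnat sK)|exact: rpred_nat].
Qed.

Lemma int_ring_act (s : galQ K) x : int_ring K x -> int_ring K (gal_lift s x).
Proof.
move=> [Kx Ax]; split; first exact: gal_lift_in.
by have := Aint_aut (gal_lift s) x; rewrite Ax.
Qed.

(** Frobenius raises residues to the power p, and its f-th iterate is the identity. *)
Lemma frob_Aint (i : emb C) x : int_ring K x -> rc (i x) ^+ (p ^ f) = rc (i x).
Proof.
move=> Ox; have step k : rc (i (gal_lift (gal_pow phi k) x)) = rc (i x) ^+ (p ^ k).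
  elim: k => [|k IHk]; first by rewrite gal_lift1 //; case: Ox.
  have [Kx _] := Ox; rewrite [gal_pow _ _]iterS gal_lift_mul // -/(gal_pow phi k).
  have Oy := int_ring_act (gal_pow phi k) Ox; set y := gal_lift (gal_pow phi k) x in IHk Oy *.
  have [_] := frob (emb_primeP i) (emb_prime_p i) Oy.
  rewrite rmorphB rmorphXn => h; have [_ Ay] := Oy; have [_ Ay'] := int_ring_act phi Oy.
  have /rc_eq -> // : mm (i (gal_lift phi y) - i y ^+ p) by [].
  - by rewrite rcX ?IHk -?exprM ?expnSr //; exact: V_Aint.
  - exact: V_Aint.
  - by apply: VX; exact: V_Aint.
by rewrite -step phif gal_lift1 //; case: Ox.
Qed.

Lemma int_mm_dvd (n : int) : mm (n%:~R : C) -> (p%:Z %| n)%Z.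
Proof.
move=> mn; rewrite -(kbar_int_eq0 C) -rc_int; apply/eqP; apply/rc_eq0 => //.
exact: Vint.
Qed.

(* Localization at the prime of [i]: the denominator is a partial Horner value
   of a primitive annihilator of [y], one of which is a unit. *)
Lemma emb_localize (i : emb C) y : K y -> V (i y) ->
  exists s, [/\ int_ring K s, int_ring K (y * s) & ~ mm (i s)].
Proof.
move=> Ky Vy; have [g [gy g1]] := primitive_annihilator y.
pose G : {poly algC} := map_poly intr g.
have Gi j : G`_j \in Aint by rewrite coef_map; apply: Aint_int.
pose b k := (drop_poly k G).[y].
have bE k : b k = (g`_k)%:~R + b k.+1 * y.
  by rewrite /b drop_polyS hornerD hornerC hornerMX coef_map.
have bK k : K (b k).
  rewrite /b horner_coef; apply: (sfsum sK) => j _; apply: (sfM sK); last exact: (sfX sK).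
  by rewrite coef_drop_poly coef_map; apply: (sfint sK).
have bA k := Aint_horner_tail k Gi gy.
case: (pselect (exists k, ~ mm (i (b k.+1)))) => [[k nm]|all_mm].
  exists (b k.+1); split=> //; split=> //; [|exact: (sfM sK)|]; by have [] := bA k.
have mb k : mm (i (b k.+1)) by apply: contrapT => nm; apply: all_mm; exists k.
have : (p%:Z %| zcontents g)%Z.
  rewrite dvdz_contents; apply/polyOverP => k; apply: int_mm_dvd.
  have -> : (g`_k)%:~R = i (b k) - i (b k.+1) * i y by rewrite bE rmorphD rmorphM rmorph_int addrK.
  apply: mmB; last exact: mmMr.
  case: k => [|k]; last exact: mb.
  by rewrite /b drop_poly0l gy rmorph0; apply: mm0.
rewrite g1 dvdz1 /= => /eqP p1.
by have := prime_gt1 (prime_valP p); rewrite p1.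
Qed.

Lemma frob_K (i : emb C) y : K y -> V (i y) -> rc (i y) ^+ (p ^ f) = rc (i y).
Proof.
move=> Ky Vy; have [s [Os Oys ns]] := emb_localize Ky Vy.
have Vs : V (i s) by apply: V_Aint; case: Os.
have r0 : rc (i s) != 0 by apply/eqP => /(rc_eq0 Vs).
apply: (mulIf r0); rewrite -rcM // -rmorphM -(frob_Aint i Oys) -{1}(frob_Aint i Os).
by rewrite -exprMn -rcM // -rmorphM.
Qed.

(** Otherwise y = p / x is in the maximal ideal. With s a denominator of y that is a unit at i, and
    q = p^f, the identity p = (x s^(q-2)) (y s) + p (1 - s^(q-1)) puts p in the square of the prime,
    against unramifiedness. *)
Lemma unram_Aint (i : emb C) x : int_ring K x -> mm (i x) -> V (i x / p%:R).
Proof.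
move=> Ox mx; have [//|[xp0 myp]] := V_or_mm (i x / p%:R).
have p0 : (p%:R : algC) != 0 by rewrite pnatr_eq0 -lt0n prime_gt0 // prime_valP.
case: unram; exists (emb_prime i); split; first exact: emb_primeP.
have x0 : x != 0 by apply: contraNneq xp0 => ->; rewrite rmorph0 mul0r.
pose y := p%:R / x; have [Kx Ax] := Ox.
have Ky : K y by apply: (sfM sK); [exact: (sfnat sK)|exact: (sfV sK)].
have my : mm (i y) by move: myp; rewrite invf_div /y fmorph_div rmorph_nat.
have [s [Os Oys ns]] := emb_localize Ky (mmV my).
have [Ks As] := Os.
pose q := (p ^ f)%N; have q2 : (1 < q)%N by rewrite -(exp1n f) ltn_exp2r // prime_gt1 // prime_valP.
have Vs : V (i s) by apply: V_Aint.
have r0 : rc (i s) != 0 by apply/eqP => /(rc_eq0 Vs).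
have mu1 : mm (i (1 - s ^+ q.-1)).
  rewrite rmorphB rmorph1 rmorphXn; apply/(rc_eq (V1 C)); first exact: VX.
  rewrite rc1 rcX //; apply: (mulIf r0); rewrite mul1r -exprSr prednK ?frob_Aint //.
  exact: ltnW.
exists 2%N, (fun j : 'I_2 => if j == ord0 then x * s ^+ q.-2 else p%:R),
  (fun j : 'I_2 => if j == ord0 then y * s else 1 - s ^+ q.-1); split.
- move=> j; case: ifP => _; last exact: emb_prime_p.
  split; last by rewrite rmorphM rmorphXn; apply: mmMr => //; apply: VX.
  by split; [apply: (sfM sK) => //; exact: (sfX sK)|rewrite rpredM ?rpredX].
- move=> j; case: ifP => _; split=> //.
    by rewrite rmorphM; apply: mmMr.
  by split; [apply: (sfB sK); [exact: (sf1 sK)|exact: (sfX sK)]|rewrite rpredB ?rpred1 ?rpredX].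
rewrite big_ord_recl big_ord1 /=.
have -> : x * s ^+ q.-2 * (y * s) = p%:R * s ^+ q.-1.
  have -> : s ^+ q.-1 = s ^+ q.-2 * s by rewrite -exprSr; congr (_ ^+ _); lia.
  by rewrite /y; field.
by rewrite mulrBr mulr1 addrC subrK.
Qed.

Lemma unram_K (i : emb C) x : K x -> mm (i x) -> V (i x / p%:R).
Proof.
move=> Kx mx; have [s [Os Oxs ns]] := emb_localize Kx (mmV mx).
have Vs : V (i s) by apply: V_Aint; case: Os.
have [s0 VsV] := not_mmE Vs ns.
have -> : i x / p%:R = i (x * s) / p%:R * (i s)^-1 by rewrite rmorphM; field; rewrite s0 cp_neq0.
by apply: VM => //; apply: unram_Aint => //; rewrite rmorphM; apply: mmMr.
Qed.

Definition Vunit (c : C) := [/\ c != 0, V c & V c^-1].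

Lemma VunitM a b : Vunit a -> Vunit b -> Vunit (a * b).
Proof. by move=> [? ? ?] [? ? ?]; split; rewrite ?mulf_neq0 ?invfM //; apply: VM. Qed.
Lemma VunitV a : Vunit a -> Vunit a^-1.
Proof. by move=> [? ? ?]; split; rewrite ?invr_eq0 ?invrK. Qed.
Lemma VunitX a n : Vunit a -> Vunit (a ^+ n).
Proof. by move=> [? ? ?]; split; rewrite ?expf_neq0 -?exprVn //; apply: VX. Qed.

Lemma pX_Vunit n u : Vunit u -> Vunit (p%:R ^+ n * u) -> n = 0%N.
Proof.
move=> uu /VunitM/(_ (VunitV uu)); have [u0 _ _] := uu; rewrite mulfK //.
case: n => // n [_ _ Vi]; case: (@V_pinv p C).
have -> : p%:R^-1 = p%:R ^+ n * (p%:R ^+ n.+1)^-1 :> C.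
  by rewrite exprS; field; rewrite expf_neq0 cp_neq0.
by apply: VM => //; apply/VX/Vnat.
Qed.

(** p is a uniformizer at i: division by p stays integral until a unit is reached, after a number of
    steps bounded by the denominator of 1 / c. *)
Lemma emb_power_V (i : emb C) c : K c -> c != 0 -> V (i c) -> exists k u, Vunit u /\ i c = p%:R ^+ k * u.
Proof.
move=> Kc c0 Vc; have [n] := qbar_clear (i c)^-1.
have p0 : (p%:R : algC) != 0 by rewrite pnatr_eq0 -lt0n prime_gt0 // prime_valP.
elim: n c Kc c0 Vc => [|n IHn] c Kc c0 Vc Vn.
  exists 0%N, (i c); rewrite mul1r; split=> //; split=> //; first by rewrite fmorph_eq0.
  by move: Vn; rewrite mul1r.
have [mc|[ic0 VcV]] := V_dich Vc; last by exists 0%N, (i c); rewrite mul1r.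
have [|||/=|k [u [uu E]]] := IHn (c / p%:R).
- by apply: (sfM sK) => //; apply/(sfV sK)/(sfnat sK).
- by rewrite mulf_neq0 ?invr_eq0.
- by rewrite fmorph_div rmorph_nat; apply: unram_K.
- by move: Vn; rewrite fmorph_div rmorph_nat invf_div exprSr -mulrA.
exists k.+1, u; split=> //; rewrite exprS -mulrA -E fmorph_div rmorph_nat; field.
exact: cp_neq0.
Qed.

Lemma emb_power (i : emb C) c : K c -> c != 0 -> exists k u, Vunit u /\
  (i c = p%:R ^+ k * u \/ i c = u / p%:R ^+ k).
Proof.
move=> Kc c0; case: (V_or_inv (i c)) => Vc.
  by have [k [u [uu E]]] := emb_power_V Kc c0 Vc; exists k, u; split=> //; left.
have [||| k [u [uu E]]] := @emb_power_V i c^-1.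
- exact: (sfV sK).
- by rewrite invr_eq0.
- by rewrite fmorphV.
exists k, u^-1; split; first exact: VunitV.
by right; apply: invr_inj; rewrite -fmorphV E invfM !invrK mulrC.
Qed.

Variables (i : emb C) (P : C) (d : nat) (u0 : C).
Hypotheses (uu0 : Vunit u0) (Pd : P ^+ d = p%:R * u0).

(** v(c) is an integer multiple of v(p), while v(P) = v(p) / d; hence c P^e cannot have valuation
    0. *)
Lemma ramified_nunit c e : K c -> c != 0 -> (0 < e < d)%N -> ~ Vunit (i c * P ^+ e).
Proof.
move=> Kc c0 ed /(VunitX d); rewrite exprMn exprAC Pd exprMn.
have [k [u [uu [->|->]]]] := emb_power i Kc c0.
  have -> : (p%:R ^+ k * u) ^+ d * (p%:R ^+ e * u0 ^+ e) = p%:R ^+ (k * d + e) * (u ^+ d * u0 ^+ e).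
    by rewrite exprMn -exprM exprD; apply: mulrACA.
  by move=> h; have := pX_Vunit (VunitM (VunitX d uu) (VunitX e uu0)) h; lia.
set w := u ^+ d * u0 ^+ e; have uw : Vunit w by apply: VunitM; apply: VunitX.
have -> : (u / p%:R ^+ k) ^+ d * (p%:R ^+ e * u0 ^+ e) = w * (p%:R ^+ e / p%:R ^+ (k * d)).
  have aux (a b g h : C) : a * b * (g * h) = a * h * (g * b) by ring.
  by rewrite exprMn exprVn -exprM /w aux.
have [le|lt] := leqP (k * d) e.
  have -> : p%:R ^+ e / p%:R ^+ (k * d) = p%:R ^+ (e - k * d) :> C.
    by rewrite -[in LHS](subnK le) exprD mulfK ?expf_neq0 ?cp_neq0.
  rewrite mulrC => h; have := pX_Vunit uw h.
  by move: ed le; case: (k) => [|k']; rewrite ?mulSn; lia.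
move=> /VunitV; have [w0 _ _] := uw.
have -> : (w * (p%:R ^+ e / p%:R ^+ (k * d)))^-1 = p%:R ^+ (k * d - e) * w^-1.
  rewrite invfM invf_div mulrC -[in LHS](subnK (ltnW lt)) exprD.
  by rewrite mulfK ?expf_neq0 ?cp_neq0.
by move=> h; have := pX_Vunit (VunitV uw) h; lia.
Qed.

Lemma ramified_nunit_mm c e : K c -> (0 < e < d)%N -> V (i c * P ^+ e) -> mm (i c * P ^+ e).
Proof.
move=> Kc ed Vc; have [//|[ne Vi]] := V_dich Vc.
have c0 : c != 0 by apply: contraNneq ne => ->; rewrite rmorph0 mul0r.
by case: (ramified_nunit Kc c0 ed).
Qed.

Lemma P_neq0 : (0 < d)%N -> P != 0.
Proof.
move=> d0; apply/eqP => P0; move: Pd; rewrite P0 expr0n eqn0Ngt d0 /= => /esym/eqP.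
by rewrite mulf_eq0 (negPf (cp_neq0 C)) /=; have [/negPf->] := uu0.
Qed.

(** Picks a term of least valuation, V being a valuation ring. *)
Lemma V_max_term (I : Type) (r : seq I) (t : I -> C) : (exists2 j, List.In j r & t j != 0) ->
  exists m, [/\ List.In m r, t m != 0 & forall j, List.In j r -> V (t j / t m)].
Proof.
elim: r => [|a r IHr] [j] //= jr tj0.
case: (pselect (exists2 j, List.In j r & t j != 0)) => [/IHr[m [mr tm0 mP]]|none].
  have [Vam|Vma] := V_or_inv (t a / t m).
    by exists m; split=> //; [right|move=> k [<-|/mP]].
  have [ta0|ta0] := eqVneq (t a) 0.
    exists m; split=> //; [by right|move=> k [<-|/mP//]]; rewrite ta0 mul0r; exact: V0.
  exists a; split=> //; [by left|move=> k [<-|/mP Vk]]; first by rewrite divff //; apply: V1.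
  have -> : t k / t a = t k / t m * (t a / t m)^-1 by field; rewrite ta0 tm0.
  exact: VM.
have tr0 k : List.In k r -> t k = 0.
  by move=> kr; apply/eqP; apply: contrapT => /negP tk; apply: none; exists k.
case: jr => [ja|/tr0 tj]; last by rewrite tj eqxx in tj0.
exists a; split; [by left|by rewrite ja|move=> k [<-|/tr0->]].
  by rewrite divff ?ja //; apply: V1.
by rewrite mul0r; apply: V0.
Qed.

Lemma InP (T : eqType) (x : T) (r : seq T) : List.In x r <-> x \in r.
Proof.
elim: r => //= a r IHr; rewrite inE; split=> [[->|/IHr->]|/orP[/eqP->|/IHr]].
- by rewrite eqxx.
- by rewrite orbT.
- by left.
- by right.
Qed.

(** Nonzero terms of different index have valuations that differ modulo v(p). The term of least
    valuation therefore dominates the sum and is integral with it. *)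
Lemma ramified_sum (c : 'I_d -> algC) : (forall j, K (c j)) ->
  V (\sum_(j < d) i (c j) * P ^+ j) ->
  forall j, V (i (c j) * P ^+ j).
Proof.
move=> Kc VS; pose t (j : 'I_d) := i (c j) * P ^+ j.
have [h|none] := pselect (exists2 j, List.In j (enum 'I_d) & t j != 0); last first.
  move=> j; have -> : i (c j) * P ^+ j = 0; last exact: V0.
  apply/eqP; apply: contrapT => /negP tj; apply: none; exists j => //.
  by apply/InP; rewrite mem_enum.
have [m [_ tm0 mP]] := V_max_term h.
have Vjm j : V (t j / t m) by apply: mP; apply/InP; rewrite mem_enum.
have d0 : (0 < d)%N by apply: leq_ltn_trans (ltn_ord m).
have P0 := P_neq0 d0.
have mjm j : j != m -> mm (t j / t m).
  move=> jm; have [//|[n0 Vi]] := V_dich (Vjm j).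
  have tj0 : t j != 0 by apply: contraNneq n0 => ->; rewrite mul0r.
  have cj0 k : t k != 0 -> c k != 0 by apply: contraNneq => e; rewrite /t e rmorph0 mul0r.
  have Vu : Vunit (t j / t m) by split.
  have jd := ltn_ord j; have md := ltn_ord m.
  have [lt|gt|/val_inj e] := ltngtP m j; last by rewrite e eqxx in jm.
    case: (@ramified_nunit (c j / c m) (j - m)).
    - by apply: (sfM sK) => //; apply: (sfV sK).
    - by rewrite mulf_neq0 ?invr_eq0 ?cj0.
    - by apply/andP; split; lia.
    rewrite fmorph_div /= expfB // ; have -> : i (c j) / i (c m) * (P ^+ j / P ^+ m) = t j / t m.
      by rewrite /t invfM; apply: mulrACA.
    exact: Vu.
  case: (@ramified_nunit (c m / c j) (m - j)).
  - by apply: (sfM sK) => //; apply: (sfV sK).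
  - by rewrite mulf_neq0 ?invr_eq0 ?cj0.
  - by apply/andP; split; lia.
  rewrite fmorph_div /= expfB //; have -> : i (c m) / i (c j) * (P ^+ m / P ^+ j) = (t j / t m)^-1.
    by rewrite invf_div /t invfM; apply: mulrACA.
  exact: VunitV.
have [s0 Vs] : 1 + \sum_(j | j != m) t j / t m != 0 /\ V (1 + \sum_(j | j != m) t j / t m)^-1.
  by apply: unit_1mm; apply: mmsum => j; apply: mjm.
have E : \sum_(j < d) i (c j) * P ^+ j = t m * (1 + \sum_(j | j != m) t j / t m).
  rewrite (bigD1 m) //= mulrDr mulr1 mulr_sumr; congr (_ + _).
  by apply: eq_bigr => j _; rewrite [RHS]mulrC divfK.
have Vm : V (t m).
  by rewrite -(mulfK s0 (t m)) -E; apply: VM.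
by move=> j; rewrite -[i (c j) * P ^+ j]/(t j) -(divfK tm0 (t j)); apply: VM.
Qed.

(** The terms with j > 0 lie in the maximal ideal, so the residue is that of the first coefficient,
    an element of K. *)
Lemma ramified_residue (c : 'I_d -> algC) : (0 < d)%N -> (forall j, K (c j)) ->
  V (\sum_(j < d) i (c j) * P ^+ j) ->
  rc (\sum_(j < d) i (c j) * P ^+ j) ^+ (p ^ f) = rc (\sum_(j < d) i (c j) * P ^+ j).
Proof.
move=> d0 Kc Vx; have Vt := ramified_sum Kc Vx; set x := \sum_(j < d) _ in Vx *.
have V0' : V (i (c (Ordinal d0))) by have := Vt (Ordinal d0); rewrite mulr1.
have -> : rc x = rc (i (c (Ordinal d0))); last exact: frob_K.
apply/rc_eq => //; rewrite /x (bigD1 (Ordinal d0)) //= mulr1 addrC addrK.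
apply: mmsum => j j0; apply: ramified_nunit_mm => //; rewrite ltn_ord andbT lt0n.
by apply: contraNneq j0 => j0; apply/eqP/val_inj.
Qed.

End Unramified.

(** * The uniformizer 1 - z of the cyclotomic tower *)

Section CyclotomicUniformizer.
Variables (p : primeNat) (N : nat) (z : algC).
Hypothesis zprim : (p ^ N.+1).-primitive_root z.
Let p_prime := prime_valP p.
Let p0 : (0 < p)%N := prime_gt0 p_prime.

Lemma prod_multiples (R : comNzRingType) (G : nat -> R) q m : (0 < q)%N ->
  \prod_(0 <= k < q * m | (q %| k)%N) G k = \prod_(0 <= k < m) G (q * k)%N.
Proof.
move=> q0; elim: m => [|m IHm]; first by rewrite muln0 !big_geq.
rewrite big_nat_recr //= -IHm mulnS addnC (big_cat_nat (n := (q * m)%N)) ?leq_addr //=.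
congr (_ * _); rewrite big_ltn_cond ?dvdn_mulr //; last by rewrite -addn1 leq_add2l.
rewrite big_nat_cond big_pred0 ?mulr1 // => k; apply/negP => /andP[/andP[lt1 lt2] /dvdnP[j jE]].
have mj : (m < j)%N by rewrite -(ltn_pmul2l q0) [(q * j)%N]mulnC -jE.
have jm : (j < m.+1)%N by rewrite -(ltn_pmul2l q0) [(q * j)%N]mulnC -jE mulnS addnC.
by move: (leq_trans mj jm); rewrite ltnn.
Qed.

Definition pcoprimes := [seq k <- index_iota 0 (p ^ N.+1) | ~~ (p %| k)%N].

(** Quotient of the factorizations of X^(p^(N+1)) - 1 and X^(p^N) - 1, the roots of the latter being
    the z^k with k divisible by p. *)
Lemma cyclotomic_factor :
  \prod_(k <- pcoprimes) ('X - (z ^+ k)%:P) = \sum_(j < p) 'X^(p ^ N * j) :> {poly algC}.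
Proof.
have m0 : (0 < p ^ N)%N by rewrite expn_gt0 p0.
have zp : (p ^ N).-primitive_root (z ^+ p).
  have := exp_prim_root zprim p; rewrite expnS.
  by rewrite (gcdn_idPl (dvdn_mulr _ (dvdnn p))) mulKn.
have mX : ('X^(p ^ N) - 1 : {poly algC}) != 0 by apply: monic_neq0; apply: monicXnsubC.
apply: (mulfI mX).
have -> : ('X^(p ^ N) - 1) * \sum_(j < p) 'X^(p ^ N * j) = 'X^(p ^ N.+1) - 1 :> {poly algC}.
  rewrite expnSr exprM [RHS]subrX1; congr (_ * _).
  by apply: eq_bigr => j _; rewrite exprM.
have multE : \prod_(0 <= k < p ^ N.+1 | (p %| k)%N) ('X - (z ^+ k)%:P) = 'X^(p ^ N) - 1.
  rewrite expnS (prod_multiples (fun k => 'X - (z ^+ k)%:P)) // -(factor_Xn_sub_1 zp).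
  by apply: eq_bigr => k _; rewrite exprM.
rewrite -(factor_Xn_sub_1 zprim) [RHS](bigID (fun k => p %| k)%N) /= multE; congr (_ * _).
by rewrite /pcoprimes big_filter.
Qed.

Lemma cyclotomic_root : (\sum_(j < p) 'X^(p ^ N * j) : {poly algC}).[z] = 0.
Proof.
have zN : z ^+ (p ^ N) - 1 != 0.
  rewrite subr_eq0 -(prim_order_dvd zprim); apply/negP => /dvdn_leq.
  rewrite expn_gt0 p0 => /(_ isT); rewrite leq_exp2l ?prime_gt1 // ltnn //.
apply: (mulfI zN); rewrite mulr0.
rewrite -[z ^+ _]hornerXn -[X in _ - X](hornerC 1 z) -hornerN -hornerD -hornerM polyC1.
have -> : ('X^(p ^ N) - 1) * \sum_(j < p) 'X^(p ^ N * j) = 'X^(p ^ N.+1) - 1 :> {poly algC}.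
  rewrite expnSr exprM [RHS]subrX1; congr (_ * _).
  by apply: eq_bigr => j _; rewrite exprM.
by rewrite hornerD hornerN hornerXn hornerC (prim_expr_order zprim) subrr.
Qed.

Lemma pcoprimes_gt0 : (0 < size pcoprimes)%N.
Proof.
have : 1%N \in pcoprimes.
  rewrite mem_filter mem_index_iota dvdn1 /=; have := prime_gt1 p_prime.
  case: eqP => [->//|_ p1] /=; rewrite -[1%N](exp1n N.+1) ltn_exp2r //.
by case: pcoprimes.
Qed.

Variables (C : Qp_closure p) (i : emb C).
Local Notation V := (@qbar_int p C).
Local Notation mm := (@qbar_max p C).

Lemma kbar_root1 (r : kbar C) k : r ^+ (p ^ k) = 1 -> r = 1.
Proof.
have ch : (p : nat) \in [pchar (kbar C)] by rewrite inE p_prime /=; apply/eqP/kbar_char.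
elim: k => [|k IHk]; first by rewrite expr1.
rewrite expnSr exprM => e; apply: IHk; apply/eqP; rewrite -subr_eq0.
have : (r ^+ (p ^ k) - 1) ^+ p = (r ^+ (p ^ k)) ^+ p - 1 ^+ p := rmorphB (pFrobenius_aut ch) _ _.
by rewrite e expr1n subrr => /eqP; rewrite expf_eq0 p0.
Qed.

Lemma V_root_unity (t : C) n : (0 < n)%N -> t ^+ n = 1 -> V t.
Proof.
move=> n0 tn; apply: (@V_root p C ('X^n - 1)); first exact: monicXnsubC.
  by move=> j; rewrite coefB coefXn coefC; case: ifP => _; apply: VB; try case: eqP => _; try exact: V1; exact: V0.
by rewrite /root !hornerE /= tn subrr.
Qed.

(** At X = 1 the cyclotomic factorization gives p as the product of the 1 - z^k with k prime to p.
    As z has residue 1, the quotient (1 - z^k) / (1 - z) has residue k, which is not 0. *)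
Lemma uniformizer : exists2 u : C, Vunit u & (1 - i z) ^+ size pcoprimes = p%:R * u.
Proof.
set t := i z; have tn : t ^+ (p ^ N.+1) = 1 by rewrite -rmorphXn (prim_expr_order zprim) rmorph1.
have Vt : V t by apply: V_root_unity tn; rewrite expn_gt0 p0.
have rt : rc t = 1 by apply: (@kbar_root1 _ N.+1); rewrite -rcX // tn rc1.
pose s k := \sum_(j < k) t ^+ j.
have su k : k \in pcoprimes -> Vunit (s k).
  rewrite mem_filter => /andP[pk _].
  have Vs : V (s k) by apply: Vsum => j _; apply: VX.
  suff /(rc_unit Vs)[] : rc (s k) != 0 by [].
  have -> : rc (s k) = k%:R.
    rewrite /s; elim: (k) => [|k' IHk']; first by rewrite big_ord0 rc0.
    rewrite big_ord_recr /= rcD ?IHk' ?rcX ?rt ?expr1n ?natr1 //.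
      by apply: Vsum => j _; apply: VX.
    exact: VX.
  by rewrite pmulrn kbar_int_eq0 dvdzE.
have pE : p%:R = \prod_(k <- pcoprimes) (1 - t ^+ k) :> C.
  have := congr1 (fun P : {poly algC} => i P.[1]) cyclotomic_factor.
  rewrite horner_prod horner_sum.
  have -> : \sum_(j < p) ('X^(p ^ N * j) : {poly algC}).[1] = p%:R.
    rewrite -[X in _ = X%:R]card_ord -sum1_card natr_sum; apply: eq_bigr => j _.
    by rewrite hornerXn expr1n.
  rewrite rmorph_nat => <-; rewrite rmorph_prod; apply: eq_bigr => k _.
  by rewrite hornerXsubC rmorphB rmorph1 rmorphXn.
have {}pE : p%:R = (1 - t) ^+ size pcoprimes * \prod_(k <- pcoprimes) s k.
  rewrite pE; elim: pcoprimes => [|a r IHr]; first by rewrite !big_nil mulr1.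
  rewrite !big_cons IHr /= exprS.
  have -> : 1 - t ^+ a = (1 - t) * s a by rewrite -opprB subrX1 -mulNr opprB.
  by apply: mulrACA.
have uP : Vunit (\prod_(k <- pcoprimes) s k).
  elim: pcoprimes su => [_|a r IHr su].
    by rewrite big_nil; split; rewrite ?oner_neq0 ?invr1 //; apply: V1.
  rewrite big_cons; apply: VunitM; first by apply: su; rewrite mem_head.
  by apply: IHr => k kr; apply: su; rewrite inE kr orbT.
exists (\prod_(k <- pcoprimes) s k)^-1; first exact: VunitV.
by have [u0 _ _] := uP; rewrite pE mulfK.
Qed.

End CyclotomicUniformizer.

Section TowerResidue.
Variables (p : primeNat) (C : Qp_closure p) (L : splittingFieldType rat).
Variable e : {rmorphism L -> algC}.
Local Notation T := (tower p (range e)).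
Local Notation V := (@qbar_int p C).
Local Notation mm := (@qbar_max p C).
Variable zeta : nat -> algC.
Hypothesis zeta_prim : forall n, (0 < n)%N -> n.-primitive_root (zeta n).
Hypothesis unram : ~ ramified (range e) p.
Variables (phi : galQ (T 0)) (f : nat).
Hypotheses (frob : is_frobenius p phi) (f0 : (0 < f)%N) (phif : gal_pow phi f = gal_one (T 0)).

Lemma zetap N : (p ^ N).-primitive_root (zeta (p ^ N)).
Proof. by apply: zeta_prim; rewrite expn_gt0 prime_gt0 // prime_valP. Qed.

Definition tower_gal N : galfield (T N) := tower_galfield e (zetap N).

(** Remainder modulo the cyclotomic polynomial, rewritten in powers of 1 - z. The number of terms is
    the exponent of 1 - z in [uniformizer]. *)
Lemma tower_expansion N x (z := zeta (p ^ N.+1)) : T N.+1 x ->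
  exists c : 'I_(size (pcoprimes p N)) -> algC,
    (forall j, T 0 (c j)) /\ x = \sum_j c j * (1 - z) ^+ j.
Proof.
move=> /(towerP e (zetap N.+1))[q ->].
pose PL : {poly L} := \sum_(j < p) 'X^(p ^ N * j).
have PE : map_poly e PL = \sum_(j < p) 'X^(p ^ N * j).
  by rewrite rmorph_sum; apply: eq_bigr => j _; rewrite [LHS]rmorphXn; congr (_ ^+ _); exact: map_polyX.
have sP : size PL = (size (pcoprimes p N)).+1.
  by rewrite -(size_map_poly e) PE -(cyclotomic_factor (zetap N.+1)) size_prod_XsubC.
have PL0 : PL != 0 by rewrite -size_poly_gt0 sP.
pose r := (q %% PL)%R.
have qr : (map_poly e q).[z] = (map_poly e r).[z].
  have -> : map_poly e q = map_poly e (q %/ PL) * map_poly e PL + map_poly e r.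
    by rewrite -rmorphM -rmorphD -divp_eq.
  rewrite hornerD hornerM PE.
  by rewrite (cyclotomic_root (zetap N.+1)) mulr0 add0r.
pose Q := r \Po (1 - 'X).
have s1X : size (1 - 'X : {poly L}) = 2%N.
  by rewrite -opprB size_polyN -polyC1 size_XsubC.
have sQ : (size (map_poly e Q) <= size (pcoprimes p N))%N.
  by rewrite size_map_poly size_comp_poly2 // -ltnS -sP ltn_modp.
have E : (map_poly e q).[z] = (map_poly e Q).[1 - z].
  rewrite qr /Q map_comp_poly horner_comp.
  have -> : map_poly e (1 - 'X) = 1 - 'X by rewrite rmorphB rmorph1 /= map_polyX.
  by rewrite !hornerE /= subKr.
exists (fun j => (map_poly e Q)`_j); split.
  by move=> j; rewrite coef_map tower0; exists Q`_j.
by rewrite -/z E (horner_coef_wide _ sQ).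
Qed.

Lemma tower_residue N (i : emb C) x : T N x -> V (i x) -> rc (i x) ^+ (p ^ f) = rc (i x).
Proof.
have unram0 : ~ ramified (T 0) p by rewrite tower0.
case: N => [|N] Tx Vx.
  exact: (frob_K (tower_gal 0) frob phif Tx Vx).
have [c [Tc xE]] := tower_expansion Tx.
have [u uu uE] := uniformizer (zetap N.+1) i.
have iE : i x = \sum_j i (c j) * (1 - i (zeta (p ^ N.+1))) ^+ j.
  rewrite xE rmorph_sum; apply: eq_bigr => j _.
  by rewrite rmorphM rmorphXn rmorphB rmorph1.
rewrite iE in Vx *.
exact: (ramified_residue (tower_gal 0) unram0 frob f0 phif uu uE (pcoprimes_gt0 p N) Tc Vx).
Qed.

Lemma kalg_approx1 (F : set algC) (sF : is_subfield F) (i : emb C) a (c : padic_num p) : F a ->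
  exists2 x, F x & mm (i a * qbar_emb C c - i x).
Proof.
move=> Fa; have [m [u uE]] := Qp_fracP c; have [t Vt] := qbar_clear (i a).
have [n [c' cE]] := Zp_approx u (m + t).+1.
exists (a * n%:R / p%:R ^+ m).
  apply: (sfM sF); first by apply: (sfM sF) => //; apply: (sfnat sF).
  by apply/(sfV sF)/(sfX sF)/(sfnat sF).
apply: (@pV_mm _ _ 0); exists (p%:R ^+ t * i a * Zp_qbar C c').
  by apply: VM => //; apply: V_Zp.
have pm : (p%:R ^+ m : C) != 0 by rewrite expf_neq0 // cp_neq0.
apply: (mulIf pm).
have -> : qbar_emb C c = Zp_qbar C u / p%:R ^+ m.
  by rewrite uE fmorph_div rmorphXn rmorph_nat.
rewrite cE rmorphD rmorphM rmorphXn !rmorph_nat /= fmorph_div rmorphM rmorphXn !rmorph_nat expr1.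
have -> : p%:R ^+ (m + t).+1 = p%:R * p%:R ^+ t * p%:R ^+ m :> C by rewrite exprS addnC exprD mulrA.
by field.
Qed.

(** The p-adic coefficients are replaced by rational ones close enough to keep the residue at the
    given embedding. *)
Lemma kalg_approx (F : set algC) (sF : is_subfield F) (i : emb C) a : kalg F a -> V (a i) ->
  exists x, [/\ F x, V (i x) & rc (a i) = rc (i x)].
Proof.
move=> [n [b [c [Fb ->]]]] Va.
have /choice[x xP] (k : 'I_n) : exists y, F y /\ mm (i (b k) * qbar_emb C (c k) - i y).
  by have [y Fy my] := kalg_approx1 sF i (c k) (Fb k); exists y.
have m : mm (\sum_k i (b k) * qbar_emb C (c k) - i (\sum_k x k)).
  by rewrite rmorph_sum -sumrB; apply: mmsum => k _; have [] := xP k.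
have Vx : V (i (\sum_k x k)).
  by rewrite -[i _](subKr (\sum_k i (b k) * qbar_emb C (c k))); apply: VB => //; apply: mmV.
exists (\sum_k x k); split=> //; last exact/rc_eq.
by apply: (sfsum sF) => k _; have [] := xP k.
Qed.

Lemma kalg_residue N (i : emb C) a : kalg (T N) a -> V (a i) -> rc (a i) ^+ (p ^ f) = rc (a i).
Proof.
move=> ka Va; have [x [Tx Vx ->]] := kalg_approx (gf_sub (tower_gal N)) ka Va.
exact: tower_residue Tx Vx.
Qed.

Variables (W : weierstrass) (iota : emb C).
Hypotheses (p_odd : odd p) (good : ~~ (p%:Z %| wdisc W)%Z).

Lemma kpoints_frob N (P : emb C -> wpoint C) i : kpoints W (T N) P -> frob_point f (red (P i)).
Proof.
move=> /(kpoints_affine iota W (tower_gal N))[iP [x [y [z [kx ky kz eP]]]]].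
have := iP i; rewrite eP /affine_form; case: eqP => //= _ c; case: asboolP => //= Vx.
have Vy := V_ycoord c Vx.
by rewrite !(kalg_residue (N := N)) // !eqxx.
Qed.

Hypothesis ndvd : ~~ (p%:Z %| wtrace W p ^+ f - 1)%Z.

(** The reductions of P have coordinates in the field of p^f elements and are killed by M; so M P
    lies in the kernel of reduction at every embedding. *)
Lemma kpoints_multiple : exists M, coprime p M /\ forall N P, kpoints W (T N) P ->
  exists2 x, krad (T N) x & fg_point W x = iter M (kadd W P) (@kzero p C).
Proof.
have [M [cM MP]] := frob_lagrange C p_odd good f0 ndvd; exists M; split=> // N P kP.
have kM n : kpoints W (T N) (iter n (kadd W P) (@kzero p C)).
  elim: n => [|n IHn]; first exact: (kpoints0 iota W (tower_gal N)).
  exact: (kpoints_add iota (tower_gal N) good).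
apply: (nintegral_fg_point iota (tower_gal N) (kM M)) => i.
have [iP _] := kP; pose Q : ecpoint (curveC C good) := exist _ (P i) (iP i).
have E n : iter n (kadd W P) (@kzero p C) i = val (Q *+ n).
  by elim: n => [|n IHn] //; rewrite iterS /kadd IHn mulrS val_ptD.
rewrite E; apply/red_None.
have redM n : redp p_odd (Q *+ n) = redp p_odd Q *+ n.
  elim: n => [|n IHn]; first by apply: val_inj.
  by rewrite !mulrS redpD IHn.
have /(congr1 val) : redp p_odd (Q *+ M) = 0.
  by rewrite redM; apply: MP; apply: kpoints_frob kP.
by [].
Qed.

End TowerResidue.

(** * Freeness over the group ring *)

Lemma fsum_gal_set (F : set algC) (gF : galfield F) (Y : nmodType) (A : set (galQ F))
    (h : galQ F -> Y) :
  \sum_(s \in A) h s = \sum_(s <- gal_seq gF | s \in A) h s.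
Proof.
transitivity (\sum_(s \in [set: galQ F]) (if s \in A then h s else 0)).
  by rewrite fsbig_mkcond; apply: eq_fsbigr => s _; rewrite /patch.
by rewrite (fsum_gal gF) -big_mkcond.
Qed.

Section Freeness.
Variables (p : primeNat) (C : Qp_closure p) (D : fgdata C).
Local Notation V := (@qbar_int p C).
Local Notation mm := (@qbar_max p C).
Local Notation Zp := (padic_int p).
Local Notation M := (fgm D).
Let iota := fd_iota D.
Let gF := fd_gal D.
Local Notation n := (gal_n gF).
Implicit Types x y : M.

(** The quadratic part of the group law is divisible by p^(2J) on [near J], where scaling is thus
    linear to that precision. *)
Lemma fgvZ_approx J (a : Zp) x i : near J x -> pV J.*2 (fgv (a *: x) i - Zp_qbar C a * fgv x i).
Proof.
move=> nx; have [k nk] := near_pexp x J.*2.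
have nk' : near J.*2 (x *+ p ^ (k + J.*2)) by apply: near_pexp_le nk; apply: leq_addr.
have [m [c aE]] := Zp_approx a (k + J.*2).
have h1 : pV J.*2 (fgv (a *: x) i - fgv (x *+ m) i) by apply/near_sub: i; apply: nearZ_cong nk' aE.
have [b Vb bE] := fgvMn_approx x m i.
have -> : fgv (a *: x) i - Zp_qbar C a * fgv x i = (fgv (a *: x) i - fgv (x *+ m) i)
   + fgv x i ^+ 2 * b - p%:R ^+ (k + J.*2) * (Zp_qbar C c * fgv x i).
  rewrite bE aE rmorphD rmorphM rmorphXn !rmorph_nat; ring.
have Vx := fgvV x i.
apply: pVB; first apply: pVD => //.
  by rewrite mulrC; apply: pVMl => //; rewrite -addnn expr2; apply: pVM; apply: nx.
apply: (@pVW _ _ (k + J.*2)); first exact: leq_addl.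
by exists (Zp_qbar C c * fgv x i) => //; apply: VM => //; apply: V_Zp.
Qed.

Lemma near_sum J I (r : seq I) (P : pred I) (G : I -> M) : (forall j, P j -> near J (G j)) ->
  near J (\sum_(j <- r | P j) G j).
Proof. by move=> nG; apply: (big_ind (near J)) => //; [exact: near0|exact: nearD]. Qed.

Lemma nearZ J (a : Zp) x : near J x -> near J (a *: x).
Proof.
move=> nx i; rewrite -[fgv _ i](subrK (Zp_qbar C a * fgv x i)); apply: pVD.
  by apply: (@pVW _ _ J.*2); [rewrite -addnn leq_addr|exact: fgvZ_approx].
by apply: pVMl; [exact: V_Zp|exact: nx].
Qed.

Lemma fgv_sum_approx J I (r : seq I) (G : I -> M) i : (forall j, near J (G j)) ->
  pV J.*2 (fgv (\sum_(j <- r) G j) i - \sum_(j <- r) fgv (G j) i).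
Proof.
move=> nG; elim: r => [|a r IHr]; first by rewrite !big_nil fgv0 subr0; apply: pV0.
rewrite !big_cons.
have -> : fgv (G a + \sum_(j <- r) G j) i - (fgv (G a) i + \sum_(j <- r) fgv (G j) i) =
  (fgv (G a + \sum_(j <- r) G j) i - fgv (G a) i - fgv (\sum_(j <- r) G j) i)
  + (fgv (\sum_(j <- r) G j) i - \sum_(j <- r) fgv (G j) i) by ring.
by apply: pVD => //; apply: nearD_approx => //; apply: near_sum.
Qed.

Hypothesis ptf : forall x, x *+ p = 0 -> x = 0.

(** The basis of F scaled by p^(J + B) lies in [near J]. A relation among these elements is linear
    modulo p^(2J), which forces p to divide its coefficients; absence of p-torsion allows dividing
    by p and repeating. *)
Lemma independent_family : exists v : 'I_n -> M,
  forall r : 'I_n -> Zp, \sum_k r k *: v k = 0 -> forall k, r k = 0.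
Proof.
have [c cP] := kcoord_bound iota gF.
have /choice[b bP] (k : 'I_n) : exists b, forall i : emb C, V (p%:R ^+ b * i (kw k)).
  have [b bP] := kalg_bound iota gF (kalg_emb C (kwF (gF := gF) k)); exists b.
  exact: bP.
pose B := (\sum_k b k)%N.
have BP (k : 'I_n) (i : emb C) : V (p%:R ^+ B * i (kw k)).
  rewrite /B (bigD1 k) //= addnC exprD -mulrA; apply: VM; first exact/VX/Vnat.
  exact: bP.
(* B clears the denominators of the basis and c those of coordinates of integral elements; 2 J = (J
   + B) + (c + 1) then leaves one factor p to spare. *)
pose J := (B + c).+1.
have kv (k : 'I_n) : krad (fd_F D) (fun i : emb C => p%:R ^+ (J + B) * i (kw k)).
  apply/(kradP iota gF); split.
    apply: (kalg_mul gF); last exact: (kalg_emb C (kwF k)).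
    by apply: (kalg_exp gF); apply: (kalg_nat C gF).
  move=> i; apply: (@pV_mm _ _ (B + c)); exists (p%:R ^+ B * i (kw k)) => //.
  by rewrite exprD mulrA.
pose v k : M := mkfg (kv k).
have nv k : near J (v k).
  by move=> i; exists (p%:R ^+ B * i (kw k)) => //; rewrite mkfgK exprD mulrA.
exists v.
have dvd_p (r : 'I_n -> Zp) : \sum_k r k *: v k = 0 -> forall k, exists c, r k = p%:R * c.
  move=> r0.
  have h (i : emb C) : V (\sum_k i (kw k) * qbar_emb C (Zp_Qp (r k) / p%:R ^+ c.+1)).
    have h1 := @fgv_sum_approx J _ (index_enum _) (fun k => r k *: v k) i (fun k => nearZ (r k) (nv k)).
    rewrite r0 fgv0 sub0r in h1.
    have h2 : pV J.*2 (\sum_k fgv (r k *: v k) i - \sum_k Zp_qbar C (r k) * fgv (v k) i).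
      by rewrite -sumrB; apply: pVsum => k _; apply: fgvZ_approx.
    have [w Vw wE] := pVN (pVD h1 h2).
    suff -> : \sum_k i (kw k) * qbar_emb C (Zp_Qp (r k) / p%:R ^+ c.+1) = w by [].
    have pX0 t : (p%:R ^+ t : C) != 0 by rewrite expf_neq0 // cp_neq0.
    apply: (mulfI (pX0 J.*2)); rewrite -wE addKr opprK.
    rewrite mulr_sumr; apply: eq_bigr => k _.
    rewrite mkfgK fmorph_div rmorphXn rmorph_nat -/(Zp_qbar C (r k)).
    have -> : p%:R ^+ J.*2 = p%:R ^+ (J + B) * p%:R ^+ c.+1 :> C.
      by rewrite -exprD; congr (_ ^+ _); rewrite /J; lia.
    have aux (a b' g h' : C) : b' != 0 -> a * b' * (g * (h' / b')) = h' * (a * g) by move=> b0; field.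
    exact: aux.
  move=> k; have [a aE] := cP _ h k.
  have p0 : (p%:R : padic_num p) != 0 by have := Qp_p_neq0 p 1; rewrite expr1.
  exists a; apply: (@Zp_Qp_inj p).
  transitivity (p%:R * Zp_Qp a); last by rewrite rmorphM rmorph_nat.
  rewrite -aE exprSr.
  have aux (K : fieldType) (a' b' g : K) : a' != 0 -> b' != 0 -> g = b' * (a' * (g / (a' * b'))).
    by move=> a0 b0; field; rewrite a0 b0.
  exact: (aux _ _ _ _ (expf_neq0 c p0) p0).
move=> r r0 k; apply: Zp_sep => t.
elim: t r r0 k => [|t IHt] r r0 k; first by exists (r k); rewrite mul1r.
have /choice[s sE] := dvd_p r r0.
have s0 : \sum_k s k *: v k = 0.
  apply: ptf; rewrite -scaler_nat scaler_sumr -[RHS]r0; apply: eq_bigr => j _.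
  by rewrite scalerA -sE.
by have [e eE] := IHt s s0 k; exists e; rewrite sE eE exprS mulrA.
Qed.

(** An independent family is v = A g for a square matrix A, whose determinant is nonzero. A relation
    c among the g yields the relation c adj(A) among the v, whence det(A) c = 0. *)
Lemma generators_free (g : 'I_n -> M) : (forall y, exists c : 'I_n -> Zp, y = \sum_j c j *: g j) ->
  forall c : 'I_n -> Zp, \sum_j c j *: g j = 0 -> forall j, c j = 0.
Proof.
move=> gen c c0; have [v vP] := independent_family.
have /choice[a aE] k : exists c : 'I_n -> Zp, v k = \sum_j c j *: g j by apply: gen.
pose A : 'M[Zp]_n := \matrix_(k, j) a k j.
have rv (r : 'rV[Zp]_n) : \sum_k r 0 k *: v k = \sum_j (r *m A) 0 j *: g j.
  transitivity (\sum_k \sum_j (r 0 k * a k j) *: g j).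
    by apply: eq_bigr => k _; rewrite aE scaler_sumr; apply: eq_bigr => j _; rewrite scalerA.
  rewrite exchange_big; apply: eq_bigr => j _ /=; rewrite mxE scaler_suml.
  by apply: eq_bigr => k _; rewrite mxE.
have ind (r : 'rV[Zp]_n) : \sum_j (r *m A) 0 j *: g j = 0 -> r = 0.
  by rewrite -rv => /vP r0; apply/rowP => k; rewrite r0 mxE.
have dA : \det A != 0.
  apply/negP => /det0P[r r0 rA]; case/eqP: r0; apply: ind; rewrite rA.
  by apply: big1 => j _; rewrite mxE scale0r.
pose cr : 'rV[Zp]_n := \row_j c j.
have : cr *m \adj A = 0.
  apply: ind; rewrite -mulmxA mul_adj_mx.
  transitivity (\det A *: \sum_j c j *: g j); last by rewrite c0 scaler0.
  rewrite scaler_sumr; by apply: eq_bigr => j _; rewrite mul_mx_scalar !mxE scalerA.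
move=> /(congr1 (mulmx^~ A)); rewrite -mulmxA mul_adj_mx mul0mx mul_mx_scalar => h j.
have := congr1 (fun m : 'rV_n => m 0 j) h; rewrite !mxE => /eqP.
by rewrite mulf_eq0 (negPf dA) => /eqP.
Qed.

Local Notation G := (galQ (fd_F D)).
Definition fgact (s : G) x := fgm_act (gal_lift s) x.

Lemma fgactD s : {morph fgact s : x y / x + y}. Proof. exact: raddfD. Qed.
Lemma fgactZ s a x : fgact s (a *: x) = a *: fgact s x. Proof. exact: fgm_actZ. Qed.
Lemma fgact_sum s I (r : seq I) (P : pred I) (H : I -> M) :
  fgact s (\sum_(j <- r | P j) H j) = \sum_(j <- r | P j) fgact s (H j).
Proof. exact: raddf_sum. Qed.

Lemma fgv_dep x (i j : emb C) : (forall a, fd_F D a -> i a = j a) -> fgv x i = fgv x j.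
Proof. by apply: kalg_dep; have /(kradP iota gF)[] := fgvP x. Qed.

Lemma fgactM s t x : fgact (gal_mul s t) x = fgact s (fgact t x).
Proof.
apply: fgv_inj; apply/funext => i; rewrite !fgv_act /gal_act; apply: fgv_dep => a Fa.
by rewrite /emb_comp /= gal_lift_mul.
Qed.

Lemma fgact1 x : fgact (gal_one _) x = x.
Proof.
apply: fgv_inj; apply/funext => i; rewrite !fgv_act /gal_act; apply: fgv_dep => a Fa.
by rewrite /emb_comp /= gal_lift1.
Qed.

(** The finitely supported sum discards terms equal to 0, so the supports of the two families have
    to agree before the sum is transported along the additive injection [fgv]. *)
Lemma fsbig_fgv (A : set G) (h : G -> M) :
  \big[fg_add (fd_W D)/0]_(s \in A) fgv (h s) = fgv (\sum_(s \in A) h s).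
Proof.
have E : finite_support 0 A (fun s => fgv (h s)) = finite_support 0 A h.
  rewrite /finite_support !unlock; congr (finmap.enum_fset (fset_set _)).
  apply/seteqP; split=> s /= [As hs]; split=> //; apply: contra_not hs.
    by move=> ->; rewrite fgv0.
  by move=> e; apply: fgv_inj.
by rewrite E (big_morph (@fgv p C D) (id1 := 0) (op1 := fg_add (fd_W D))) //.
Qed.

End Freeness.

(** * Traces in the cyclotomic tower *)

Section GaloisSums.
Variables (F : set algC) (gF : galfield F).
Local Notation G := (galQ F).

Lemma gal_mulIg (t : G) : injective (fun s => gal_mul s t).
Proof.
move=> s s' /(congr1 (fun u => gal_mul u (gal_inv t))).
by rewrite -!(gal_mulA gF) (gal_mulgV gF) !gal_mulg1.
Qed.

Lemma sum_gal_mulr (Y : nmodType) (t : G) (f : G -> Y) :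
  \sum_(s <- gal_seq gF) f (gal_mul s t) = \sum_(s <- gal_seq gF) f s.
Proof.
have e : perm_eq [seq gal_mul s t | s <- gal_seq gF] (gal_seq gF).
  apply: uniq_perm; rewrite ?gal_seq_uniq //.
    by rewrite map_inj_uniq ?gal_seq_uniq //; apply: gal_mulIg.
  move=> s; rewrite mem_gal_seq; apply/mapP; exists (gal_mul s (gal_inv t)).
    exact: mem_gal_seq.
  by rewrite -(gal_mulA gF) (gal_mulVg gF) gal_mulg1.
by rewrite -[RHS](perm_big _ e) big_map.
Qed.

Lemma gal_powSr (s : G) k : gal_mul (gal_pow s k) s = gal_pow s k.+1.
Proof.
elim: k => [|k IHk]; first by rewrite /gal_pow /= (gal_mul1g gF) gal_mulg1.
by rewrite /gal_pow !iterS -(gal_mulA gF) -!/(gal_pow s _) IHk.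
Qed.

Lemma gal_pow_order (s : G) : exists f, [/\ (0 < f)%N, gal_pow s f = gal_one F
  & forall k, (0 < k < f)%N -> gal_pow s k != gal_one F].
Proof.
have ex : exists f, (0 < f)%N && (gal_pow s f == gal_one F).
  apply: contrapT => none.
  have inj : injective (gal_pow s).
    suff lt i j : (i < j)%N -> gal_pow s i <> gal_pow s j.
      by move=> i j; case: (ltngtP i j) => // [/lt//|/lt h /esym].
    move=> ij; rewrite -(subnKC (ltnW ij)); have : (0 < j - i)%N by rewrite subn_gt0.
    move: (j - i)%N => k k0; elim: i {ij} => [|i IHi] e.
      by apply: none; exists k; rewrite k0 -e /=.
    apply: IHi; have := congr1 (gal_mul (gal_inv s)) e.
    by rewrite addSn /gal_pow !iterS !(gal_mulKg gF).
  have := @uniq_leq_size _ [seq gal_pow s k | k <- iota 0 (size (gal_seq gF)).+1] (gal_seq gF).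
  rewrite map_inj_uniq ?iota_uniq // size_map size_iota ltnn => h.
  by have := h isT (fun x _ => mem_gal_seq gF x).
exists (ex_minn ex); case: ex_minnP => f /andP[f0 /eqP fE] fmin; split=> // k /andP[k0 kf].
by apply/negP => kE; have := fmin k; rewrite k0 kE => /(_ isT); rewrite leqNgt kf.
Qed.

Variables (F' : set algC) (gF' : galfield F').

Lemma fiber_sum (Y : nmodType) (g : galQ F' -> Y) :
  \sum_(s <- gal_seq gF) \sum_(t <- gal_seq gF' | gal_res F t == s) g t = \sum_(t <- gal_seq gF') g t.
Proof.
under eq_bigr => s _ do rewrite big_mkcond.
rewrite exchange_big /=; apply: eq_bigr => t _.
rewrite (bigD1_seq (gal_res F t)) ?mem_gal_seq ?gal_seq_uniq //= eqxx big1 ?addr0 //.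
by move=> s; rewrite eq_sym => /negPf->.
Qed.

End GaloisSums.

Section Tower.
Variables (p : primeNat) (C : Qp_closure p) (L : splittingFieldType rat).
Variable e : {rmorphism L -> algC}.
Local Notation T := (tower p (range e)).
Local Notation Zp := (padic_int p).
Variable zeta : nat -> algC.
Hypothesis zeta_prim : forall n, (0 < n)%N -> n.-primitive_root (zeta n).
Variables (W : weierstrass) (iota : emb C).
Hypothesis good : ~~ (p%:Z %| wdisc W)%Z.
Let gT N : galfield (T N) := tower_gal p e zeta_prim N.

Definition twd N : fgdata C := @FgData p C W good iota (T N) (gT N).
Local Notation m_ N := (fgm (twd N)).
Local Notation act := (@fgact p C (twd _)).

Lemma krad_mono N M (x : emb C -> C) : (N <= M)%N -> krad (T N) x -> krad (T M) x.
Proof.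
move=> le /(kradP iota (gT N))[kx mx]; apply/(kradP iota (gT M)); split=> //.
exact: kalg_mono (tower_le le) kx.
Qed.

Definition fgincl N (x : m_ N) : m_ N.+1 := @mkfg p C (twd N.+1) _ (krad_mono (leqnSn N) (fgvP x)).

Lemma fgv_incl N (x : m_ N) : fgv (fgincl x) = fgv x. Proof. by []. Qed.

Lemma fgincl_inj N : injective (@fgincl N).
Proof. by move=> x y /(congr1 (@fgv _ _ _)); rewrite !fgv_incl => /fgv_inj. Qed.

Lemma fginclD N : {morph @fgincl N : x y / x + y}.
Proof. by move=> x y; apply: fgv_inj. Qed.

Lemma fgincl_zmod N : zmod_morphism (@fgincl N).
Proof. by move=> x y; rewrite -[LHS](addrK (fgincl y)) -(fginclD (x - y) y) (subrK y x). Qed.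
HB.instance Definition _ N := GRing.isZmodMorphism.Build (m_ N) (m_ N.+1) (@fgincl N) (@fgincl_zmod N).

Lemma fginclZ N a (x : m_ N) : fgincl (a *: x) = a *: fgincl x.
Proof. by apply: fgv_inj; rewrite fgv_incl !fgvZ. Qed.

Lemma fgact_incl N (s : galQ (T N.+1)) (x : m_ N) :
  act s (fgincl x) = fgincl (act (gal_res (T N) s) x).
Proof.
apply: fgv_inj; apply/funext => i; rewrite fgv_incl !fgv_act fgv_incl /gal_act.
by apply: (fgv_dep x) => a Ta; rewrite /emb_comp /= /gal_res gal_liftK.
Qed.

Definition trace_set N := [set s : galQ (T N.+1) | fixes (T N) (gal_lift s)].

Lemma trace_setP N (s : galQ (T N.+1)) : s \in (@trace_set N) = (gal_res (T N) s == gal_one (T N)).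
Proof.
apply/idP/eqP => [/set_mem h|h].
  by apply/gal_piP => x Tx; rewrite h.
by apply/mem_set => x Tx; rewrite -(gal_liftK (gal_lift s) Tx) -/(gal_res (T N) s) h gal_lift1.
Qed.

Lemma gal_res_mul N (s t : galQ (T N.+1)) :
  gal_res (T N) (gal_mul s t) = gal_mul (gal_res (T N) s) (gal_res (T N) t).
Proof.
apply: gal_ext => x Tx; rewrite gal_lift_mul //.
have resE (u : galQ (T N.+1)) y : T N y -> gal_lift (gal_res (T N) u) y = gal_lift u y.
  exact: gal_liftK.
have Tt := gal_lift_in (gT N) (gal_res (T N) t) Tx.
rewrite (resE _ _ Tt) (resE t x Tx) (resE _ x Tx) gal_lift_mul //.
exact: tower_mono.
Qed.

Definition trace N (x : m_ N.+1) : m_ N.+1 :=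
  \sum_(s <- gal_seq (gT N.+1) | s \in (@trace_set N)) act s x.

Lemma fg_traceE N (x : m_ N.+1) : fg_trace W (T N) (T N.+1) (fgv x) = fgv (trace x).
Proof.
have := @fsbig_fgv p C (twd N.+1) (@trace_set N) (fun s => act s x).
by rewrite (fsum_gal_set (gT N.+1)) => <-.
Qed.

(** The automorphisms trivial on the lower field are the kernel of restriction, a normal
    subgroup. *)
Lemma trace_fgact N (t : galQ (T N.+1)) (x : m_ N.+1) : trace (act t x) = act t (trace x).
Proof.
rewrite /trace fgact_sum big_mkcond [RHS]big_mkcond /=.
pose g u := if gal_res (T N) u == gal_res (T N) t then act u x else 0 : m_ N.+1.
have gN : gal_mul (gal_res (T N) t) (gal_inv (gal_res (T N) t)) = gal_one _ := gal_mulgV (gT N) _.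
transitivity (\sum_(s <- gal_seq (gT N.+1)) g s).
  rewrite -(sum_gal_mulr (gT N.+1) t g); apply: eq_bigr => s _.
  rewrite /g gal_res_mul fgactM trace_setP; congr (if _ then _ else _).
  apply/eqP/eqP => [->|]; first by rewrite (gal_mul1g (gT N)).
  rewrite -{2}[gal_res (T N) t](gal_mul1g (gT N)) => /(gal_mulIg (gT N)); exact.
rewrite -(sum_gal_mul (gT N.+1) t g); apply: eq_bigr => s _.
rewrite /g gal_res_mul fgactM trace_setP; congr (if _ then _ else _).
apply/eqP/eqP => [|->]; last by rewrite gal_mulg1.
move=> /(congr1 (gal_mul (gal_inv (gal_res (T N) t)))).
by rewrite (gal_mulKg (gT N)) (gal_mulVg (gT N)).
Qed.

Lemma trace_incl N (x : m_ N) :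
  trace (fgincl x) = fgincl x *+ count (fun s => s \in (@trace_set N)) (gal_seq (gT N.+1)).
Proof.
rewrite /trace -sum1_count -[RHS]sumrMnr; apply: eq_bigr => s; rewrite trace_setP => /eqP h.
by rewrite fgact_incl h fgact1 mulr1n.
Qed.

(** An automorphism over K is determined by the image of z, one of the z^k with 0 < k < p; the count
    is therefore positive and less than p. *)
Lemma trace_count0 : coprime p (count (fun s => s \in (@trace_set 0)) (gal_seq (gT 1))).
Proof.
set c := count _ _; have pp := prime_valP p.
have z1 : (p ^ 1).-primitive_root (zeta (p ^ 1)) := zetap p zeta_prim 1.
set z := zeta (p ^ 1) in z1.
have c0 : (0 < c)%N.
  rewrite -has_count; apply/hasP; exists (gal_one (T 1)); first exact: mem_gal_seq.
  by rewrite trace_setP; apply/eqP/gal_piP => x Tx; rewrite gal_lift1 //; apply: tower_mono.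
suff lt : (c < p)%N by rewrite prime_coprime // gtnNdvd.
have Tz : T 1 z by apply: mu_tower; apply: (prim_expr_order z1).
pose R := [seq z ^+ k | k <- seq.iota 1 p.-1].
have sub : {subset [seq gal_lift s z | s <- [seq s <- gal_seq (gT 1) | s \in (@trace_set 0)]] <= R}.
  move=> _ /mapP[s _ ->].
  have : gal_lift s z ^+ (p ^ 1) = 1 by rewrite -rmorphXn (prim_expr_order z1) rmorph1.
  move=> /(prim_rootP z1)[k kE]; rewrite kE; apply/mapP; exists (k : nat) => //.
  have kp : (k < p)%N := leq_trans (ltn_ord k) (eq_leq (expn1 p)).
  suff k0 : (0 < k)%N by rewrite mem_iota; have := prime_gt0 pp; lia.
  rewrite lt0n; apply/negP => /eqP k0; move: kE; rewrite k0 expr0 -(rmorph1 (gal_lift s)) => /fmorph_inj zE.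
  have := prim_order_dvd z1 1; rewrite expr1 zE eqxx expn1 dvdn1 => /eqP p1.
  by rewrite p1 in pp.
have un : uniq [seq gal_lift s z | s <- [seq s <- gal_seq (gT 1) | s \in (@trace_set 0)]].
  rewrite map_inj_in_uniq ?filter_uniq ?gal_seq_uniq // => s t.
  rewrite !mem_filter => /andP[/set_mem fs _] /andP[/set_mem ft _] st.
  apply: gal_ext => x /(towerP e z1)[q ->].
  rewrite !horner_coef !rmorph_sum; apply: eq_bigr => j _.
  rewrite !rmorphM !rmorphXn /= st; congr (_ * _).
  have T0q : T 0 (map_poly e q)`_j by rewrite coef_map tower0; exists q`_j.
  by rewrite fs // ft.
have := uniq_leq_size un sub; rewrite !size_map size_filter size_iota -/c => le.
by rewrite (leq_ltn_trans le) // ltn_predL prime_gt0.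
Qed.

Variable d : forall N, m_ N.
Hypothesis gen : forall N (y : m_ N), exists c : galQ (T N) -> Zp,
  y = \sum_(s <- gal_seq (gT N)) c s *: act s (d N).
Hypothesis ptf : forall N (x : m_ N), x *+ p = 0 -> x = 0.

Lemma tower_free N (c : galQ (T N) -> Zp) :
  \sum_(s <- gal_seq (gT N)) c s *: act s (d N) = 0 -> forall s, c s = 0.
Proof.
rewrite (sum_gal_nth (gT N)) => c0 s; have [j ->] := gal_nthP (gT N) s.
have := @generators_free p C (twd N) (@ptf N) (fun j => act (gal_nth (gF := gT N) j) (d N)).
move=> /(_ _ (fun j => c (gal_nth (gF := gT N) j)) c0 j); apply=> y.
have [c' ->] := gen y; rewrite (sum_gal_nth (gT N)).
by exists (fun j => c' (gal_nth (gF := gT N) j)).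
Qed.

Lemma tower_free_eq N (c c' : galQ (T N) -> Zp) :
  \sum_(s <- gal_seq (gT N)) c s *: act s (d N) = \sum_(s <- gal_seq (gT N)) c' s *: act s (d N) ->
  c = c'.
Proof.
move=> E; apply/funext => s; apply/eqP; rewrite -subr_eq0; apply/eqP.
apply: (@tower_free N (fun s => c s - c' s)).
under eq_bigr => t _ do rewrite scalerBl.
by rewrite sumrB E subrr.
Qed.

Variables (alpha : Zp) (phi : galQ (T 0)).
Hypothesis ua : alpha \is a GRing.unit.
Hypothesis tr0 : trace (d 1) = fgincl (alpha *: d 0 - act (gal_inv phi) (d 0)).

Lemma frobenius_recursion : exists (b : galQ (T 0) -> Zp) (h : Zp), h \is a GRing.unit /\
  forall s, b (gal_mul s phi) = alpha * b s - h *+ (s == gal_one (T 0)).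
Proof.
pose w := alpha *: d 0 - act (gal_inv phi) (d 0).
have trw : trace (d 1) = fgincl w := tr0; have [c cE] := gen (fgincl (d 0)).
pose n := count (fun s => s \in (@trace_set 0)) (gal_seq (gT 1)).
pose b s := \sum_(t <- gal_seq (gT 1) | gal_res (T 0) t == s) c t.
exists b, n%:R; split; first exact/Zp_coprime_unit/trace_count0.
have E1 : n%:R *: d 0 = \sum_(s <- gal_seq (gT 0)) b s *: act s w.
  apply: fgincl_inj; rewrite scaler_nat raddfMn -trace_incl {1}cE.
  have -> : trace (\sum_(s <- gal_seq (gT 1)) c s *: act s (d 1)) =
      \sum_(s <- gal_seq (gT 1)) c s *: act s (trace (d 1)).
    rewrite /trace; under eq_bigr => t _ do rewrite fgact_sum.
    rewrite exchange_big; apply: eq_bigr => s _ /=.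
    rewrite -trace_fgact /trace scaler_sumr; apply: eq_bigr => t _.
    by rewrite fgactZ.
  rewrite trw -(fiber_sum (gT 0)) raddf_sum /=; apply: eq_bigr => s _.
  rewrite fginclZ /b scaler_suml; apply: eq_bigr => t /eqP <-.
  by rewrite fgact_incl.
have E2 : \sum_(s <- gal_seq (gT 0)) b s *: act s w =
    \sum_(s <- gal_seq (gT 0)) (alpha * b s - b (gal_mul s phi)) *: act s (d 0).
  have wE s : act s w = alpha *: act s (d 0) - act (gal_mul s (gal_inv phi)) (d 0).
    have -> : act s w = act s (alpha *: d 0) - act s (act (gal_inv phi) (d 0)) by exact: raddfB.
    by rewrite fgactZ -fgactM.
  under eq_bigr => s _ do rewrite wE scalerBr.
  rewrite sumrB -[X in _ - X](sum_gal_mulr (gT 0) phi) -sumrB; apply: eq_bigr => s _.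
  by rewrite -(gal_mulA (gT 0)) (gal_mulgV (gT 0)) gal_mulg1 scalerA scalerBl mulrC.
have E3 : n%:R *: d 0 = \sum_(s <- gal_seq (gT 0)) (n%:R *+ (s == gal_one (T 0))) *: act s (d 0).
  rewrite (bigD1_seq (gal_one (T 0))) ?mem_gal_seq ?gal_seq_uniq //= eqxx fgact1 big1 ?addr0 //.
  by move=> s /negPf ->; rewrite scale0r.
have := tower_free_eq (etrans (esym E3) (etrans E1 E2)).
by move=> E s; have /= -> := congr1 (@^~ s) E; rewrite subKr.
Qed.

(** Once around the cycle of phi, the recursion yields (alpha^f - 1) b(1) = alpha^(f-1) h, a
    unit. *)
Lemma frobenius_unit f : (0 < f)%N -> gal_pow phi f = gal_one (T 0) ->
  (forall k, (0 < k < f)%N -> gal_pow phi k != gal_one (T 0)) ->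
  alpha ^+ f - 1 \is a GRing.unit.
Proof.
move=> f0 fE fmin; have [b [h [uh bE]]] := frobenius_recursion.
have b1 : b (gal_pow phi 1) = alpha * b (gal_one (T 0)) - h.
  by rewrite -(gal_powSr (gT 0)) bE eqxx.
have bk k : (k < f)%N -> b (gal_pow phi k.+1) = alpha ^+ k * b (gal_pow phi 1).
  elim: k => [|k IHk] lt; first by rewrite mul1r.
  rewrite -(gal_powSr (gT 0)) bE (negPf (fmin k.+1 _)) ?lt // subr0 IHk ?exprS ?mulrA //.
  exact: ltnW.
have := bk f.-1; rewrite !prednK // leqnn fE b1 => /(_ isT).
have -> : alpha ^+ f.-1 * (alpha * b (gal_one (T 0)) - h) =
    alpha ^+ f * b (gal_one (T 0)) - alpha ^+ f.-1 * h.
  by rewrite mulrBr mulrA -exprSr prednK.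
move=> E; have : (alpha ^+ f - 1) * b (gal_one (T 0)) = alpha ^+ f.-1 * h.
  by rewrite mulrBl mul1r {2}E opprB addrC subrK.
move=> E'; have : (alpha ^+ f - 1) * b (gal_one (T 0)) \is a GRing.unit.
  by rewrite E' unitrM unitrX.
by rewrite unitrM => /andP[].
Qed.

(** alpha = a_p - p / alpha, so alpha^f and a_p^f agree modulo p. *)
Lemma ordinary_ndvd f : alpha ^+ 2 - (wtrace W p)%:~R * alpha + p%:R = 0 ->
  alpha ^+ f - 1 \is a GRing.unit -> ~~ (p%:Z %| wtrace W p ^+ f - 1)%Z.
Proof.
move=> root uf; apply/negP => /dvdzP[q qE].
have aE : alpha = (wtrace W p)%:~R - p%:R * alpha^-1.
  apply: (mulrI ua); rewrite mulrBr mulrCA divrr // mulr1 -expr2.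
  by apply/eqP; rewrite -subr_eq0 opprB addrA addrAC -[X in _ == X]root mulrC eqxx.
have [c cE] : exists c, alpha ^+ f - 1 = p%:R * c.
  have -> : alpha ^+ f - 1 = (alpha ^+ f - (wtrace W p)%:~R ^+ f) + (wtrace W p ^+ f - 1)%:~R.
    have -> : (wtrace W p ^+ f - 1)%:~R = (wtrace W p)%:~R ^+ f - 1 :> Zp.
      by rewrite mulrzBr; congr (_ - _); elim: f {uf qE} => // k IHk; rewrite !exprS intrM IHk.
    by rewrite addrA subrK.
  rewrite subrXX qE rmorphM /= {1}aE addrAC subrr sub0r.
  set S0 := \sum_(i < f) _; exists (- (alpha^-1 * S0) + q%:~R).
  by rewrite -pmulrn; ring.
by move: uf; rewrite cE unitrM (negPf (p_nunit p)).
Qed.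

End Tower.

(** * Homomorphisms out of a tensor product *)

Section TensorHom.
Variables (T : choiceType) (X : set T) (add : T -> T -> T) (Y Z : zmodType).
Local Notation tns := (tens X add Y).
Local Notation pure := (pure_tens X add).

Lemma pure_tensE x (y : Y) (hx : X x) :
  pure x y = \pi_tns [:: (exist _ x (mem_set hx) : X, y)].
Proof.
rewrite /pure_tens; case: insubP => [u _ ux|]; last by rewrite mem_set.
by congr (\pi_tns [:: (_, y)]); apply: val_inj.
Qed.

Lemma tens_piD (s t : seq (X * Y)) : \pi_tns (s ++ t) = \pi_tns s + \pi_tns t.
Proof. by apply/tens_piP/tens_sym; apply: tens_cat2; apply: tens_repr. Qed.

Lemma pure_tensDl x x' (y : Y) : X x -> X x' -> X (add x x') ->
  pure (add x x') y = pure x y + pure x' y.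
Proof.
move=> hx hx' hxx; rewrite !pure_tensE -tens_piD; apply/tens_piP.
exact: tens_addl.
Qed.

Lemma pure_tensDr x (y y' : Y) : pure x (y + y') = pure x y + pure x y'.
Proof.
have [hx|hx] := pselect (X x).
  by rewrite !(pure_tensE _ hx) -tens_piD; apply/tens_piP/tens_addr.
have E t : pure x t = 0 by rewrite /pure_tens insubF //; apply/negP => /set_mem.
by rewrite !E addr0.
Qed.

Lemma tens_pi_sum (s : seq (X * Y)) : \pi_tns s = \sum_(a <- s) pure (val a.1) a.2.
Proof.
elim: s => [|[x y] s IHs]; first by rewrite big_nil.
rewrite big_cons -IHs -cat1s tens_piD; congr (_ + _).
by rewrite (pure_tensE y (set_valP x)); congr (\pi_tns [:: (_, y)]); apply: val_inj.
Qed.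

Lemma tens_hom_eq (g h : {additive tns -> Z}) :
  (forall x y, X x -> g (pure x y) = h (pure x y)) -> g =1 h.
Proof.
move=> gh a; rewrite -[a]reprK tens_pi_sum !raddf_sum; apply: eq_bigr => b _.
exact/gh/set_valP.
Qed.

Lemma tens_hom_exists (phi : T -> Y -> Z) :
  (forall x x' y, X x -> X x' -> X (add x x') -> phi (add x x') y = phi x y + phi x' y) ->
  (forall x y y', X x -> phi x (y + y') = phi x y + phi x y') ->
  exists g : {additive tns -> Z}, forall x y, X x -> g (pure x y) = phi x y.
Proof.
move=> phil phir; pose S (s : seq (X * Y)) := \sum_(a <- s) phi (val a.1) a.2.
have phi0 (x : X) : phi (val x) 0 = 0.
  by apply: (addrI (phi (val x) 0)); rewrite -phir ?addr0 //; apply: set_valP.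
have SP s t : tens_eq add s t -> S s = S t.
  elim=> {s t} [//|s t _ -> //|s t u _ -> _ -> //|s t st|s t u _ E|x x' x'' y E|x y y'|x].
  - exact: perm_big.
  - by rewrite /S !big_cat -!/(S _) E.
  - rewrite /S !big_cons !big_nil !addr0 /= E phil -?E //; exact: set_valP.
  - by rewrite /S !big_cons !big_nil !addr0 /= phir //; apply: set_valP.
  - by rewrite /S big_cons !big_nil addr0 /= phi0.
pose g (a : tns) := S (repr a).
have gpi s : g (\pi_tns s) = S s by apply/SP/tens_repr.
have gD a b : g (a + b) = g a + g b.
  by rewrite -[a]reprK -[b]reprK -tens_piD !gpi /S big_cat.
have gB : zmod_morphism g.
  by move=> a b; apply: (addIr (g b)); rewrite -gD !subrK.
pose g' : {additive tns -> Z} := HB.pack g (GRing.isZmodMorphism.Build _ _ g gB).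
exists g' => x y hx; rewrite (pure_tensE y hx); rewrite [LHS]gpi.
by rewrite /S big_cons big_nil addr0.
Qed.

End TensorHom.

(** * The Pontryagin dual of the points *)

Lemma inj_surj_bijective (A B : Type) (f : A -> B) :
  injective f -> (forall b, exists a, f a = b) -> bijective f.
Proof.
move=> fi /choice[g gP]; exists g => [a|b]; last exact: gP.
by apply: fi; rewrite gP.
Qed.

Section Theta.
Variables (p : primeNat) (C : Qp_closure p) (L : splittingFieldType rat).
Variable e : {rmorphism L -> algC}.
Local Notation T := (tower p (range e)).
Local Notation Zp := (padic_int p).
Variable zeta : nat -> algC.
Hypothesis zeta_prim : forall n, (0 < n)%N -> n.-primitive_root (zeta n).
Variables (W : weierstrass) (iota : emb C).
Hypothesis good : ~~ (p%:Z %| wdisc W)%Z.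
Let gT N : galfield (T N) := tower_gal p e zeta_prim N.
Local Notation tw N := (@twd p C L e zeta zeta_prim W iota good N).
Local Notation m_ N := (fgm (tw N)).
Local Notation E := (@Epts_oo p C W (range e)).
Local Notation pt := (@ptens p C W (range e)).
Local Notation dual := (EQpZp_dual C W (range e)).
Local Notation flim := (fg_dual_lim C W (range e)).
Local Notation kz := (@kzero p C).

Lemma Epts_common P Q : E P -> E Q -> exists N, kpoints W (T N) P /\ kpoints W (T N) Q.
Proof.
move=> [N kP] [N' kQ]; exists (maxn N N'); split.
  by apply: kpoints_mono kP; apply: tower_le; apply: leq_maxl.
by apply: kpoints_mono kQ; apply: tower_le; apply: leq_maxr.
Qed.

Lemma Epts_add P Q : E P -> E Q -> E (kadd W P Q).
Proof.
move=> eP eQ; have [N [kP kQ]] := Epts_common eP eQ; exists N.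
exact: (kpoints_add iota (gT N) good).
Qed.

Lemma Epts_fg N (x : m_ N) : E (fg_point W (fgv x)).
Proof. by exists N; apply: (fg_point_kpoints iota W (gT N) (fgvP x)). Qed.

Lemma ptensDl P Q t : E P -> E Q -> pt (kadd W P Q) t = pt P t + pt Q t.
Proof. by move=> eP eQ; apply: pure_tensDl => //; apply: Epts_add. Qed.

Lemma ptensDr P t u : pt P (t + u) = pt P t + pt P u.
Proof. exact: pure_tensDr. Qed.

Lemma fg_point_fgvD N (x y : m_ N) :
  fg_point W (fgv (x + y)) = kadd W (fg_point W (fgv x)) (fg_point W (fgv y)).
Proof. exact: (fg_add_point iota W (gT N) (fgvP x) (fgvP y)). Qed.

(** For a fixed point P, the map t |-> g(P (x) t) is an endomorphism of Q_p/Z_p, hence a scalar. *)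
Lemma theta_ex (g : dual) N (x : m_ N) :
  exists a, forall t, g (pt (fg_point W (fgv x)) t) = QpZp_scale a t.
Proof. by apply: qz_endP => t u; rewrite ptensDr raddfD. Qed.

Definition theta_val (g : dual) N (x : m_ N) : Zp := sval (cid (theta_ex g x)).

Lemma theta_valP (g : dual) N (x : m_ N) t :
  g (pt (fg_point W (fgv x)) t) = QpZp_scale (theta_val g x) t.
Proof. by rewrite /theta_val; case: cid. Qed.

Lemma theta_valD (g : dual) N (x y : m_ N) : theta_val g (x + y) = theta_val g x + theta_val g y.
Proof.
apply: qz_scale_inj => t; rewrite qz_scaleDl -!theta_valP fg_point_fgvD ptensDl ?raddfD //;
  exact: Epts_fg.
Qed.

(** Modulo p^n a scalar is a natural number, for which linearity is additivity; Z_p is p-adically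
    separated. *)
Lemma additive_Zp_linear N (l : m_ N -> Zp) : {morph l : x y / x + y} ->
  forall a x, l (a *: x) = a * l x.
Proof.
move=> lD a x.
have l0 : l 0 = 0 by apply: (addrI (l 0)); rewrite -lD !addr0.
have lMn y k : l (y *+ k) = l y *+ k.
  by elim: k => [|k IHk]; rewrite ?l0 // !mulrS lD IHk.
apply/eqP; rewrite -subr_eq0; apply/eqP/Zp_sep => n; have [m [c aE]] := Zp_approx a n.
exists (l (c *: x) - c * l x).
have -> : a *: x = x *+ m + (c *: x) *+ (p ^ n).
  by rewrite -!scaler_nat scalerA -scalerDl natrX -aE.
rewrite lD !lMn aE -[l x *+ m]mulr_natl -[l (c *: x) *+ _]mulr_natl natrX; ring.
Qed.

Lemma theta_valZ (g : dual) N a (x : m_ N) : theta_val g (a *: x) = a * theta_val g x.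
Proof. by apply: additive_Zp_linear => y z; apply: theta_valD. Qed.

Lemma theta_fd_add (g : dual) N (x y z : krad (T N)) : val z = fg_add W (val x) (val y) ->
  theta_val g (z : m_ N) = theta_val g (x : m_ N) + theta_val g (y : m_ N).
Proof.
move=> zE; rewrite -theta_valD; congr theta_val; exact: (@fgv_inj p C (tw N)).
Qed.

Lemma theta_fd_scale (g : dual) N a (x z : krad (T N)) : val z = fg_scale W a (val x) ->
  theta_val g (z : m_ N) = a * theta_val g (x : m_ N).
Proof.
move=> zE; rewrite -theta_valZ; congr theta_val; apply: (@fgv_inj p C (tw N)).
by rewrite fgvZ.
Qed.

Lemma theta_fd_compat (g : dual) N (x : krad (T N)) (y : krad (T N.+1)) : val y = val x ->
  theta_val g (y : m_ N.+1) = theta_val g (x : m_ N).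
Proof.
move=> yx; apply: qz_scale_inj => t; rewrite -!theta_valP.
by congr (g (pt (fg_point W _) t)).
Qed.

Definition theta (g : dual) : flim :=
  FgDualLim (@theta_fd_add g) (@theta_fd_scale g) (@theta_fd_compat g).

Lemma theta_corr (g : dual) : natural_corr (theta g) g.
Proof. by move=> N x t; apply: (@theta_valP g N x t). Qed.

Lemma flimD (f : flim) N (x y : m_ N) : f N (x + y) = f N x + f N y.
Proof. exact: fd_add. Qed.

Lemma flimZ (f : flim) N a (x : m_ N) : f N (a *: x) = a * f N x.
Proof. by apply: fd_scale; apply: fgvZ. Qed.

Lemma flim0 (f : flim) N : f N (0 : m_ N) = 0.
Proof. by apply: (addrI (f N (0 : m_ N))); rewrite -flimD !addr0. Qed.

Lemma flim_sum (f : flim) N I (r : seq I) (P : pred I) (G : I -> m_ N) :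
  f N (\sum_(i <- r | P i) G i) = \sum_(i <- r | P i) f N (G i).
Proof. by apply: (big_morph (fun y : m_ N => f N y)); [exact: flimD|exact: flim0]. Qed.

Lemma flimMn (f : flim) N (x : m_ N) n : f N (x *+ n) = f N x *+ n.
Proof. by rewrite -scaler_nat flimZ mulr_natl. Qed.

(** Compatibility is given between consecutive levels; iterated, it makes the value at a point
    independent of the level. *)
Lemma flim_level (f : flim) N N' (x : m_ N) (y : m_ N') : fgv x = fgv y -> f N x = f N' y.
Proof.
have up k N0 (u : m_ N0) (v : m_ (k + N0)%N) : fgv v = fgv u -> f _ v = f _ u.
  elim: k v => [|k IHk] v vu; first exact: (congr1 (fun w => f N0 w) (@fgv_inj p C (tw N0) v u vu)).
  pose v' : m_ (k + N0)%N := @mkfg p C (tw (k + N0)) _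
    (@krad_mono p C L e zeta zeta_prim iota _ _ _ (leq_addl k N0) (fgvP u)).
  by rewrite -(IHk v') //; apply: fd_compat; rewrite [val v]vu.
move=> xy; case/orP: (leq_total N N') => le.
  by move: y xy; rewrite -(subnK le) => y xy; apply/esym/up.
by move: x xy; rewrite -(subnK le) => x xy; apply: up.
Qed.

Lemma fg_point_level N N' (x : m_ N) (y : m_ N') :
  fg_point W (fgv x) = fg_point W (fgv y) -> fgv x = fgv y.
Proof.
apply: (@fg_point_inj p C iota W _ (gT (maxn N N'))).
  exact: (@krad_mono p C L e zeta zeta_prim iota _ _ _ (leq_maxl N N') (fgvP x)).
exact: (@krad_mono p C L e zeta zeta_prim iota _ _ _ (leq_maxr N N') (fgvP y)).
Qed.

Lemma in_wcurve_Epts P i : E P -> in_wcurve W (P i).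
Proof. by move=> [N []]. Qed.

Lemma iter_kadd_add P Q n : E P -> E Q ->
  iter n (kadd W (kadd W P Q)) kz = kadd W (iter n (kadd W P) kz) (iter n (kadd W Q) kz).
Proof.
move=> eP eQ; apply/funext => i.
pose a : ecpoint (curveC C good) := exist _ (P i) (in_wcurve_Epts i eP).
pose b : ecpoint (curveC C good) := exist _ (Q i) (in_wcurve_Epts i eQ).
have itE (R : emb C -> wpoint C) (c : ecpoint (curveC C good)) k :
    R i = val c -> iter k (kadd W R) kz i = val (c *+ k).
  by move=> Rc; elim: k => [|k IHk] //; rewrite iterS /kadd IHk mulrS val_ptD Rc.
rewrite (itE _ (a + b)) /kadd ?(itE P a) ?(itE Q b) ?val_ptD //.
by rewrite mulrnDl val_ptD.
Qed.

Variable M : nat.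
Hypothesis cM : coprime p M.
Hypothesis kM : forall N P, kpoints W (T N) P ->
  exists2 x, krad (T N) x & fg_point W x = iter M (kadd W P) kz.

Lemma Epts_multiple N P : kpoints W (T N) P ->
  exists x : m_ N, fg_point W (fgv x) = iter M (kadd W P) kz.
Proof. by move=> /kM[x kx xE]; exists (@mkfg p C (tw N) x kx). Qed.

Let uM : (M%:R : Zp) \is a GRing.unit := Zp_coprime_unit cM.

Lemma ptens_iter P n t : E P -> E (iter n (kadd W P) kz) /\ pt (iter n (kadd W P) kz) t = pt P t *+ n.
Proof.
move=> eP; have e0 : E kz by exists 0%N; apply: (kpoints0 iota W (gT 0)).
have p0 : pt kz t = 0.
  by apply: (addrI (pt kz t)); rewrite -ptensDl // addr0; congr (pt _ t); apply/funext.
elim: n => [|n [en IHn]]; first by split.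
by rewrite iterS; split; [exact: Epts_add|rewrite ptensDl // IHn mulrS].
Qed.

(** M is invertible on Q_p/Z_p, so P (x) t = M P (x) (t / M), and M P comes from the formal
    group. *)
Lemma dual_multiple (g : dual) N P (x : m_ N) t : E P ->
  fg_point W (fgv x) = iter M (kadd W P) kz ->
  g (pt P t) = QpZp_scale (theta_val g x) (QpZp_scale M%:R^-1 t).
Proof.
move=> eP xE; rewrite -theta_valP xE (ptens_iter M _ eP).2 -{1}(qz_div t uM) qz_scale_nat.
set u := QpZp_scale _ t; elim: M => [|n IHn].
  by apply: (addrI (g (pt P (u *+ 0)))); rewrite -raddfD -ptensDr mulr0n addr0 raddf0 addr0.
by rewrite !mulrS ptensDr !raddfD IHn.
Qed.

Lemma theta_inj : injective theta.
Proof.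
move=> g h gh; have E' : g =1 h.
  apply: tens_hom_eq => P t eP; have [N kP] := eP; have [x xE] := Epts_multiple kP.
  rewrite !(dual_multiple _ _ eP xE); congr QpZp_scale.
  exact: (congr1 (fun f : flim => f N x) gh).
case: g h E' {gh} => [g [[gm]]] [h [[hm]]] /= E'.
have gE : g = h by apply/funext.
by subst h; congr GRing.Additive.Pack; do 2! congr (_ _); apply: Prop_irrelevance.
Qed.

Lemma flim_ext (f f' : flim) : (forall N (x : m_ N), f N x = f' N x) -> f = f'.
Proof.
case: f f' => f f1 f2 f3 [f' f1' f2' f3'] /= E'.
have fE : f = f' by apply: functional_extensionality_dep => N; apply/funext => x; apply: E'.
by subst f'; congr FgDualLim; apply: Prop_irrelevance.
Qed.

(** The character attached to f sends P (x) t to f(M P) t / M. *)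
Lemma theta_surj (f : flim) : exists g, theta g = f.
Proof.
(* [a P] is the value of f at M P, at whatever level, and 0 when M P does not come from the formal
   group. *)
have /choice[a aP] (P : emb C -> wpoint C) : exists a, forall N (x : m_ N),
    fg_point W (fgv x) = iter M (kadd W P) kz -> f N x = a.
  have [[N [x xE]]|none] := pselect (exists N (x : m_ N), fg_point W (fgv x) = iter M (kadd W P) kz).
    exists (f N x) => N' y yE; apply: flim_level; apply: fg_point_level.
    by rewrite xE.
  by exists 0 => N x xE; case: none; exists N, x.
pose phi P t := QpZp_scale (a P) (QpZp_scale M%:R^-1 t).
have phiD P Q t : E P -> E Q -> E (kadd W P Q) -> phi (kadd W P Q) t = phi P t + phi Q t.
  move=> eP eQ _; have [N [kP kQ]] := Epts_common eP eQ.
  have [x xE] := Epts_multiple kP; have [y yE] := Epts_multiple kQ.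
  rewrite /phi -(aP _ _ _ xE) -(aP _ _ _ yE) -qz_scaleDl -flimD; congr QpZp_scale.
  by apply/esym/aP; rewrite fg_point_fgvD xE yE iter_kadd_add.
have phiDr P t u : E P -> phi P (t + u) = phi P t + phi P u.
  by move=> _; rewrite /phi !qz_scaleDr.
have [g gP] := tens_hom_exists phiD phiDr.
exists g; apply: flim_ext => N x; apply: qz_scale_inj => t.
rewrite -[theta g N x]/(theta_val g (x : m_ N)) -theta_valP [LHS]gP; last exact: Epts_fg.
have xE : fg_point W (fgv (x *+ M)) = iter M (kadd W (fg_point W (fgv x))) kz.
  exact: fg_point_sum.
rewrite /phi -(aP _ _ _ xE).
have -> : f N (x *+ M : m_ N) = f N x * M%:R by rewrite flimMn mulr_natr.
by rewrite qz_scaleA qz_div.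
Qed.

Lemma theta_bij : bijective theta.
Proof. exact: inj_surj_bijective theta_inj theta_surj. Qed.

End Theta.

(** * The Coleman map *)

Section Coleman.
Variables (p : primeNat) (C : Qp_closure p) (L : splittingFieldType rat).
Variable e : {rmorphism L -> algC}.
Local Notation T := (tower p (range e)).
Local Notation Zp := (padic_int p).
Variable zeta : nat -> algC.
Hypothesis zeta_prim : forall n, (0 < n)%N -> n.-primitive_root (zeta n).
Variables (W : weierstrass) (iota : emb C).
Hypothesis good : ~~ (p%:Z %| wdisc W)%Z.
Let gT N : galfield (T N) := tower_gal p e zeta_prim N.
Local Notation tw N := (@twd p C L e zeta zeta_prim W iota good N).
Local Notation m_ N := (fgm (tw N)).
Local Notation act := (@fgact p C (tw _)).
Local Notation pt := (@ptens p C W (range e)).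
Local Notation dual := (EQpZp_dual C W (range e)).
Local Notation flim := (fg_dual_lim C W (range e)).
Local Notation iw := (iwasawa p (range e)).
Local Notation kz := (@kzero p C).
Local Notation incl := (@fgincl p C L e zeta zeta_prim W iota good _).
Local Notation trc := (@trace p C L e zeta zeta_prim W iota good _).

Variables (alpha : Zp) (d : forall N, m_ N).
Hypothesis ua : alpha \is a GRing.unit.
Hypothesis gen : forall N (y : m_ N), exists c : galQ (T N) -> Zp,
  y = \sum_(s <- gal_seq (gT N)) c s *: act s (d N).
Hypothesis ptf : forall N (x : m_ N), x *+ p = 0 -> x = 0.
Hypothesis tr : forall N, (0 < N)%N -> trc (d N.+1) = incl (alpha *: d N).

Definition dnorm N : m_ N := alpha ^- N *: d N.

Lemma dnorm_gen N (y : m_ N) : exists c : galQ (T N) -> Zp,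
  y = \sum_(s <- gal_seq (gT N)) c s *: act s (dnorm N).
Proof.
have [c ->] := gen y; exists (fun s => c s * alpha ^+ N); apply: eq_bigr => s _.
by rewrite fgactZ scalerA -mulrA mulrV ?unitrX // mulr1.
Qed.

Lemma dnorm_free N (c c' : galQ (T N) -> Zp) :
  \sum_(s <- gal_seq (gT N)) c s *: act s (dnorm N) =
  \sum_(s <- gal_seq (gT N)) c' s *: act s (dnorm N) -> c = c'.
Proof. exact: (tower_free_eq dnorm_gen ptf). Qed.

Lemma in_fiber N (t : galQ (T N)) (s : galQ (T N.+1)) :
  (s \in [set s | gal_res (T N) s = t]) = (gal_res (T N) s == t).
Proof. by apply/idP/eqP => [/set_mem|/mem_set]. Qed.

Lemma fiber_fsum (Y : nmodType) N (t : galQ (T N)) (h : galQ (T N.+1) -> Y) :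
  \sum_(s \in [set s | gal_res (T N) s = t]) h s =
  \sum_(s <- gal_seq (gT N.+1) | gal_res (T N) s == t) h s.
Proof. by rewrite (fsum_gal_set (gT N.+1)); apply: eq_bigl => s; apply: in_fiber. Qed.

Lemma gal_res1 N : gal_res (T N) (gal_one (T N.+1)) = gal_one (T N).
Proof. by apply/gal_piP => x Tx; rewrite gal_lift1 //; apply: tower_mono. Qed.

Lemma gal_res_inv N (s : galQ (T N.+1)) : gal_res (T N) (gal_inv s) = gal_inv (gal_res (T N) s).
Proof.
apply: (gal_mulIg (gT N) (t := gal_res (T N) s)).
by rewrite -(gal_res_mul zeta_prim) (gal_mulVg (gT N.+1)) gal_res1 (gal_mulVg (gT N)).
Qed.

Lemma gal_res_surj N (t : galQ (T N)) : exists s : galQ (T N.+1), gal_res (T N) s = t.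
Proof.
exists (\pi_(galQ (T N.+1)) (gal_lift t)); rewrite -[RHS]gal_lift_pi; apply/gal_piP => x Tx.
by rewrite gal_liftK //; apply: tower_mono.
Qed.

Lemma fiber_mul (Y : nmodType) N (t : galQ (T N)) (s : galQ (T N.+1)) (h : galQ (T N.+1) -> Y) :
  \sum_(u <- gal_seq (gT N.+1) | gal_res (T N) u == gal_mul (gal_res (T N) s) t) h u =
  \sum_(u <- gal_seq (gT N.+1) | gal_res (T N) u == t) h (gal_mul s u).
Proof.
rewrite big_mkcond [RHS]big_mkcond -(sum_gal_mul (gT N.+1) s); apply: eq_bigr => u _.
rewrite (gal_res_mul zeta_prim); congr (if _ then _ else _).
apply/eqP/eqP => [/(congr1 (gal_mul (gal_inv (gal_res (T N) s))))|->//].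
by rewrite !(gal_mulKg (gT N)).
Qed.

(** The power of alpha in d' absorbs the factor alpha of the trace relation, so the conjugates of d'
    over a fibre add up to the conjugate one level down. *)
Lemma fiber_act N (t : galQ (T N)) : (0 < N)%N -> incl (act t (dnorm N)) =
  \sum_(s <- gal_seq (gT N.+1) | gal_res (T N) s == t) act s (dnorm N.+1).
Proof.
move=> N0; have [s0 <-] := gal_res_surj t.
have fibE := fiber_mul (gal_one (T N)) s0 (fun s => act s (dnorm N.+1)).
rewrite gal_mulg1 in fibE; rewrite {}fibE.
have -> : \sum_(u <- gal_seq (gT N.+1) | gal_res (T N) u == gal_one (T N)) act (gal_mul s0 u) (dnorm N.+1)
    = act s0 (trc (dnorm N.+1)).
  rewrite /trace fgact_sum; apply: eq_big => [s|s _]; last by rewrite fgactM.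
  by rewrite trace_setP.
have -> : trc (dnorm N.+1) = incl (dnorm N).
  have -> : trc (dnorm N.+1) = alpha ^- N.+1 *: trc (d N.+1).
    by rewrite /trace scaler_sumr; apply: eq_bigr => s _; rewrite fgactZ.
  rewrite tr // -fginclZ scalerA /dnorm; congr (incl (_ *: _)).
  by rewrite exprS invrM ?unitrX // -mulrA mulVr // mulr1.
by rewrite fgact_incl.
Qed.

Local Notation clev := (coleman_level W alpha (fun N => fgv (d N))).

Lemma coleman_levelE (f : flim) N s : clev (f N) s = f N (act s (dnorm N)).
Proof.
rewrite /coleman_level.
have -> : gal_act (gal_lift s) (fg_scale W (alpha ^- N) (fgv (d N))) =
    val (act s (dnorm N) : krad (T N)).
  by rewrite -[val _]/(fgv (act s (dnorm N))) fgv_act fgvZ.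
by rewrite valK.
Qed.

(** Level 0 is the image of level 1 in the group ring below, since the trace relation there involves
    alpha - phi^-1. *)
Definition col_val (f : flim) N : galQ (T N) -> Zp :=
  if N is N'.+1 then clev (f N'.+1)
  else fun t => \sum_(s <- gal_seq (gT 1) | gal_res (T 0) s == t) clev (f 1%N) s.

Lemma flim_incl (f : flim) N (x : m_ N) : f N.+1 (incl x) = f N x.
Proof. exact: fd_compat. Qed.

Lemma col_compat (f : flim) N (t : galQ (T N)) : col_val f t =
  \sum_(s \in [set s : galQ (T N.+1) | gal_res (T N) s = t]) col_val f s.
Proof.
rewrite fiber_fsum; case: N t => [//|N] t; rewrite /col_val coleman_levelE -flim_incl fiber_act //.
rewrite flim_sum; apply: eq_bigr => s _.
by rewrite coleman_levelE.
Qed.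

Definition coleman_map (f : flim) : iw := Iwasawa (@col_compat f).

Lemma col_pos (f : flim) N u : coleman_map f N.+1 u = f N.+1 (act u (dnorm N.+1)).
Proof. exact: coleman_levelE. Qed.

(** At positive levels the conjugates of d' generate; level 0 is recovered by restriction from level
    1. *)
Lemma col_inj : injective coleman_map.
Proof.
move=> f f' E; apply: (flim_ext (zeta_prim := zeta_prim) (iota := iota) (good := good)).
have pos N (x : m_ N.+1) : f N.+1 x = f' N.+1 x.
  have [c ->] := dnorm_gen x; rewrite !flim_sum; apply: eq_bigr => s _.
  rewrite !flimZ -!coleman_levelE; congr (_ * _).
  exact: (congr1 (fun r : iw => r N.+1 s) E).
by case=> [|N] x //; rewrite -!(flim_incl _ x).
Qed.

Lemma iw_ext (r r' : iw) : (forall N (s : galQ (T N)), r N s = r' N s) -> r = r'.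
Proof.
case: r r' => r r1 [r' r1'] /= E.
have rE : r = r' by apply: functional_extensionality_dep => N; apply/funext => s; apply: E.
by subst r'; congr Iwasawa; apply: Prop_irrelevance.
Qed.

Section Inverse.
Variable r : iw.

(** The linear functional with value r(s) at the generator s d'. Coordinates are chosen, and
    freeness makes the choice harmless. *)
Definition lam N (y : m_ N) : Zp :=
  \sum_(s <- gal_seq (gT N)) sval (cid (dnorm_gen y)) s * r N s.

Lemma lamE N (c : galQ (T N) -> Zp) :
  lam (\sum_(s <- gal_seq (gT N)) c s *: act s (dnorm N)) = \sum_(s <- gal_seq (gT N)) c s * r N s.
Proof. by rewrite /lam; case: cid => c' /= /dnorm_free <-. Qed.

Lemma lamD N : {morph @lam N : x y / x + y}.
Proof.
move=> x y; have [a ->] := dnorm_gen x; have [b ->] := dnorm_gen y.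
rewrite -big_split /=; under eq_bigr => s _ do rewrite -scalerDl.
rewrite !lamE -big_split; apply: eq_bigr => s _; exact: mulrDl.
Qed.

Lemma lam_incl N (x : m_ N) : (0 < N)%N -> lam (incl x) = lam x.
Proof.
move=> N0; have [c ->] := dnorm_gen x.
have -> : incl (\sum_(s <- gal_seq (gT N)) c s *: act s (dnorm N)) =
    \sum_(s <- gal_seq (gT N.+1)) c (gal_res (T N) s) *: act s (dnorm N.+1).
  rewrite raddf_sum -[RHS](fiber_sum (gT N)) /=; apply: eq_bigr => t _.
  by rewrite fginclZ fiber_act // scaler_sumr; apply: eq_bigr => s /eqP ->.
rewrite !lamE -[LHS](fiber_sum (gT N)); apply: eq_bigr => t _.
rewrite (iw_compat r t) fiber_fsum mulr_sumr; by apply: eq_bigr => s /eqP ->.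
Qed.

(** Evaluated one level up, because [lam] is compatible with restriction between positive levels. *)
Definition inv_val N (x : m_ N) : Zp := lam (incl x).

Lemma inv_valD N : {morph @inv_val N : x y / x + y}.
Proof. by move=> x y; rewrite /inv_val (fginclD x y) lamD. Qed.

Lemma inv_add N (x y z : krad (T N)) : val z = fg_add W (val x) (val y) ->
  inv_val (z : m_ N) = inv_val (x : m_ N) + inv_val (y : m_ N).
Proof. by move=> zE; rewrite -inv_valD; congr inv_val; exact: (@fgv_inj p C (tw N)). Qed.

Lemma inv_scale N a (x z : krad (T N)) : val z = fg_scale W a (val x) ->
  inv_val (z : m_ N) = a * inv_val (x : m_ N).
Proof.
move=> zE; rewrite -(additive_Zp_linear (@inv_valD N)); congr inv_val.
by apply: (@fgv_inj p C (tw N)); rewrite fgvZ.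
Qed.

Lemma inv_compat N (x : krad (T N)) (y : krad (T N.+1)) : val y = val x ->
  inv_val (y : m_ N.+1) = inv_val (x : m_ N).
Proof.
move=> yx; have -> : (y : m_ N.+1) = incl (x : m_ N) by exact: (@fgv_inj p C (tw N.+1)).
exact: lam_incl.
Qed.

Definition col_inv : flim := FgDualLim inv_add inv_scale inv_compat.

Lemma col_invK : coleman_map col_inv = r.
Proof.
have lam_act N s : lam (act s (dnorm N)) = r N s.
  have -> : act s (dnorm N) = \sum_(u <- gal_seq (gT N)) (u == s)%:R *: act u (dnorm N).
    rewrite (bigD1_seq s) ?mem_gal_seq ?gal_seq_uniq //= eqxx scale1r big1 ?addr0 //.
    by move=> u /negPf ->; rewrite scale0r.
  rewrite lamE (bigD1_seq s) ?mem_gal_seq ?gal_seq_uniq //= eqxx mul1r big1 ?addr0 //.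
  by move=> u /negPf ->; rewrite mul0r.
have pos N s : clev (col_inv N.+1) s = r N.+1 s.
  by rewrite coleman_levelE -lam_act -[RHS]lam_incl.
apply: iw_ext => -[|N] s; last exact: pos.
by rewrite (iw_compat r s) fiber_fsum; apply: eq_bigr => t _; apply: pos.
Qed.

End Inverse.

Lemma col_bij : bijective coleman_map.
Proof. by apply: inj_surj_bijective col_inj _ => r; exists (col_inv r); apply: col_invK. Qed.

Variable M : nat.
Hypothesis cM : coprime p M.
Hypothesis kM : forall N P, kpoints W (T N) P ->
  exists2 x, krad (T N) x & fg_point W x = iter M (kadd W P) kz.

Local Notation th := (@theta p C L e zeta zeta_prim W iota good).
Local Notation thv g x := (@theta_val p C L e zeta zeta_prim W iota good g _ x).

Lemma theta_val_add (g h : dual) N (x : m_ N) :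
  thv (g \+ h : {additive EQpZp C W (range e) -> QpZp p}) x = thv g x + thv h x.
Proof. by apply: qz_scale_inj => t; rewrite qz_scaleDl -!theta_valP. Qed.

Lemma theta_val_incl (g : dual) N (x : m_ N) : thv g (incl x) = thv g x.
Proof. exact: (flim_incl (th g)). Qed.

Section Action.
Variables (r : iw) (g : dual).

(** The functional of r g at level N, according to (s g)(x) = g(s^-1 x). *)
Definition tw_val N (x : m_ N) : Zp :=
  \sum_(s <- gal_seq (gT N)) r N s * thv g (act (gal_inv s) x).

Lemma tw_valD N : {morph @tw_val N : x y / x + y}.
Proof.
move=> x y; rewrite /tw_val -big_split; apply: eq_bigr => s _ /=.
by rewrite fgactD theta_valD mulrDr.
Qed.

Lemma tw_add N (x y z : krad (T N)) : val z = fg_add W (val x) (val y) ->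
  tw_val (z : m_ N) = tw_val (x : m_ N) + tw_val (y : m_ N).
Proof. by move=> zE; rewrite -tw_valD; congr tw_val; exact: (@fgv_inj p C (tw N)). Qed.

Lemma tw_scale N a (x z : krad (T N)) : val z = fg_scale W a (val x) ->
  tw_val (z : m_ N) = a * tw_val (x : m_ N).
Proof.
move=> zE; rewrite -(additive_Zp_linear (@tw_valD N)); congr tw_val.
by apply: (@fgv_inj p C (tw N)); rewrite fgvZ.
Qed.

Lemma tw_compat N (x : krad (T N)) (y : krad (T N.+1)) : val y = val x ->
  tw_val (y : m_ N.+1) = tw_val (x : m_ N).
Proof.
move=> yx; have -> : (y : m_ N.+1) = incl (x : m_ N) by exact: (@fgv_inj p C (tw N.+1)).
rewrite /tw_val -[LHS](fiber_sum (gT N)); apply: eq_bigr => t _.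
rewrite (iw_compat r t) fiber_fsum mulr_suml; apply: eq_bigr => s /eqP <-.
by rewrite fgact_incl theta_val_incl gal_res_inv.
Qed.

Definition tw_flim : flim := FgDualLim tw_add tw_scale tw_compat.

Lemma iter_kadd_act (s : absGal) P n :
  gal_act s (iter n (kadd W P) kz) = iter n (kadd W (gal_act s P)) kz.
Proof. by elim: n => [|n IHn] //; rewrite !iterS -IHn. Qed.

(** The functionals of r g form a compatible system, so surjectivity of [theta] provides h; its
    formula at an arbitrary P follows from the one at M P. *)
Lemma action_exists : exists2 h, is_iw_action r g h & th h = tw_flim.
Proof.
have [h hE] := @theta_surj p C L e zeta zeta_prim W iota good M cM kM tw_flim; exists h => // N P t kP.
have [x xE] := @Epts_multiple p C L e zeta zeta_prim W iota good M kM N P kP.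
have eP : Epts_oo W (range e) P by exists N.
rewrite (@dual_multiple p C L e zeta zeta_prim W iota good M cM _ _ _ _ t eP xE).
have -> : thv h x = tw_val x by exact: (congr1 (fun f : flim => f N x) hE).
rewrite (fsum_gal (gT N)) /tw_val qz_scale_suml; apply: eq_bigr => s _.
have eP' : Epts_oo W (range e) (gal_act (gal_lift (gal_inv s)) P).
  by exists N; apply: (@kpoints_act p C iota W _ (gT N)).
have xE' : fg_point W (fgv (act (gal_inv s) x)) =
    iter M (kadd W (gal_act (gal_lift (gal_inv s)) P)) kz.
  rewrite -iter_kadd_act -xE fgv_act.
  exact: (fg_point_act iota W (gT N) _ (fgvP x)).
by rewrite (@dual_multiple p C L e zeta zeta_prim W iota good M cM _ _ _ _ t eP' xE') qz_scaleA.
Qed.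

Lemma action_pos (h : dual) N : th h = tw_flim ->
  coleman_map (th h) N.+1 = gr_mul (r N.+1) (coleman_map (th g) N.+1).
Proof.
move=> hE; apply/funext => u; rewrite hE /gr_mul (fsum_gal (gT N.+1)) col_pos.
transitivity (tw_val (act u (dnorm N.+1))); first by [].
by apply: eq_bigr => s _; rewrite col_pos fgactM.
Qed.

(** At level 0 both sides are projections from level 1, and the projection of group rings is
    multiplicative. *)
Lemma action_col (h : dual) : th h = tw_flim ->
  forall N, coleman_map (th h) N = gr_mul (r N) (coleman_map (th g) N).
Proof.
move=> hE [|N]; last exact: action_pos.
apply/funext => t; rewrite (iw_compat (coleman_map (th h)) t) (action_pos 0 hE) fiber_fsum.
rewrite /gr_mul (fsum_gal (gT 0)).
under eq_bigr => u _ do rewrite (fsum_gal (gT 1)).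
rewrite exchange_big -[LHS](fiber_sum (gT 0)); apply: eq_bigr => s' _.
rewrite (iw_compat r s') fiber_fsum mulr_suml; apply: eq_bigr => s /eqP <- /=.
rewrite -mulr_sumr; congr (_ * _).
have fibE := fiber_mul (gal_mul (gal_inv (gal_res (T 0) s)) t) s
  (fun u => coleman_map (th g) 1%N (gal_mul (gal_inv s) u)).
rewrite (gal_mulKVg (gT 0)) in fibE; apply: (etrans fibE).
by apply: eq_bigr => u _; rewrite (gal_mulKg (gT 1)).
Qed.

End Action.

Lemma coleman_linear : iw_linear (coleman_map \o th).
Proof.
split=> [g h N s|r g]; last first.
  by have [h hact hE] := action_exists r g; exists h => //; apply: action_col.
have pos N' (u : galQ (T N'.+1)) : clev ((th (g \+ h : {additive EQpZp C W (range e) -> QpZp p})) N'.+1) u =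
    clev (th g N'.+1) u + clev (th h N'.+1) u.
  by rewrite !coleman_levelE; apply: theta_val_add.
case: N s => [|N] s /=; last exact: pos.
by rewrite -big_split; apply: eq_bigr => u _; apply: pos.
Qed.

End Coleman.

Theorem theorem4p7
  (p : primeNat) (p_odd : odd p)
  (W : weierstrass) (W_min : minimal_model W)
  (good : ~~ (p%:Z %| wdisc W)%Z)
  (ordinary : ~~ (p%:Z %| wtrace W p)%Z)
  (alpha beta : padic_int p)
  (alpha_root : alpha ^+ 2 - (wtrace W p)%:~R * alpha + p%:R = 0)
  (beta_root : beta ^+ 2 - (wtrace W p)%:~R * beta + p%:R = 0)
  (alpha_unit : ~ (exists c : padic_int p, alpha = p%:R * c))
  (beta_nonunit : exists c : padic_int p, beta = p%:R * c)
  (L : splittingFieldType rat) (L_abelian : abelian 'Gal({: L} / 1))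
  (e : {rmorphism L -> algC}) (K : set algC) (K_def : K = range e)
  (K_unram : ~ ramified K p)
  (S : seq nat) (S_prime : all prime S) (S_p : (p : nat) \notin S)
  (S_ram : forall l, prime l -> ramified K l -> l \in S)
  (m : nat) (m_cond : field_conductor K m)
  (C : Qp_closure p) (iota : emb C)
  (zeta : nat -> algC)
  (zeta_prim : forall n, (0 < n)%N -> n.-primitive_root (zeta n))
  (phi : galQ (tower p K 0)) (phi_frob : is_frobenius p phi)
  (d : nat -> emb C -> C)
  (d_sys : is_coleman_system W alpha beta phi iota zeta S d)
  (torsfree : ptorsion_free C W (cyclotomic_oo m p)) :
  exists (theta : EQpZp_dual C W K -> fg_dual_lim C W K)
         (Col : fg_dual_lim C W K -> iwasawa p K),
    [/\ bijective theta,
        forall g, natural_corr (theta g) g,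
        forall (f : fg_dual_lim C W K) N, (0 < N)%N ->
          Col f N = coleman_level W alpha d (f N),
        bijective (Col \o theta)
      & iw_linear (Col \o theta)].
Proof.
subst K; have ua := Zp_unit_ndvd alpha_unit.
pose tw N := @twd p C L e zeta zeta_prim W iota good N.
pose dd N : fgm (tw N) := @mkfg p C (tw N) (d N) (cs_mem d_sys N).
pose gT N := tower_gal p e zeta_prim N.
have gen N (y : fgm (tw N)) : exists c : galQ (tower p (range e) N) -> padic_int p,
    y = \sum_(s <- gal_seq (gT N)) c s *: @fgact p C (tw N) s (dd N).
  have : krad (tower p (range e) N) (fgv y) := fgvP y.
  rewrite (cs_gen d_sys N) => -[c _ cE]; exists c; apply: (@fgv_inj p C (tw N)).
  rewrite -cE -(fsum_gal (gT N)).
  have /esym-> := @fsbig_fgv p C (tw N) setT (fun s => c s *: @fgact p C (tw N) s (dd N)).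
  have aux (G H : galQ (tower p (range e) N) -> emb C -> C) : G = H ->
      \big[fg_add W/0]_(s \in setT) G s = \big[fg_add W/0]_(s \in setT) H s by move=> ->.
  by apply: aux; apply/funext => s; rewrite fgvZ.
have [m0 Km _] := m_cond.
(* K lies in Q(mu_m), so the tower lies in Q(mu_{m p^oo}) and inherits the absence of p-torsion. *)
have ptf N (x : fgm (tw N)) : x *+ p = 0 -> x = 0.
  apply: fgm_ptorsion => P kP; apply: torsfree; apply: kpoints_mono kP.
  exact: (tower_cyclotomic_oo Km m0).
have tr N : (0 < N)%N -> @trace p C L e zeta zeta_prim W iota good N (dd N.+1) =
    @fgincl p C L e zeta zeta_prim W iota good N (alpha *: dd N).
  move=> N0; apply: (@fgv_inj p C (tw N.+1)); rewrite -fg_traceE fgv_incl fgvZ.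
  exact: (cs_trace d_sys N0).
have tr0 : @trace p C L e zeta zeta_prim W iota good 0 (dd 1%N) =
    @fgincl p C L e zeta zeta_prim W iota good 0
      (alpha *: dd 0%N - @fgact p C (tw 0%N) (gal_inv phi) (dd 0%N)).
  (* The given relation expresses the difference as addition of a multiple by -1. *)
  apply: (@fgv_inj p C (tw 1%N)); rewrite -fg_traceE fgv_incl -scaleN1r fgvD !fgvZ.
  exact: (cs_trace0 d_sys).
have [f [f0 fE fmin]] := gal_pow_order (gT 0%N) phi.
have uf := frobenius_unit gen ptf ua tr0 f0 fE fmin.
have ndvd := ordinary_ndvd ua alpha_root uf.
have [M [cM kM]] := kpoints_multiple zeta_prim K_unram phi_frob f0 fE iota p_odd good ndvd.
exists (@theta p C L e zeta zeta_prim W iota good), (coleman_map ua tr).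
split.
- exact: (theta_bij zeta_prim iota good cM kM).
- exact: theta_corr.
(* For N > 0 the two sides are the same by definition. *)
- by move=> h [].
- by apply: bij_comp; [exact: (col_bij ua gen ptf)|exact: (theta_bij zeta_prim iota good cM kM)].
- exact: (coleman_linear ua tr cM kM).
Qed.
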